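(* Let $b:(0,T)\times\mathbb{R}^N\to\mathbb{R}^N$ be a vector field satisfying assumptions (R1), (R2) and (R3), and fix $t\in[0,T)$. Then the regular Lagrangian flow associated to $b$ starting at time $t$, if it exists, is unique (i.e. if $X,\bar X$ are two such flows, then for every $s\in[t,T]$, $X(s,x)=\bar X(s,x)$ for a.e. $x\in\mathbb{R}^N$).
   Context: $\mathscr{L}^N$ is Lebesgue measure; $B_R$ is the ball of radius $R$ centered at the origin; $L^p_{\rm loc}([0,T]\times\mathbb{R}^N)$ means $L^p((0,T)\times B_R)$ for all $R>0$. Singular integral operators of fundamental type: a singular kernel of fundamental type is $K\in\mathscr{S}'(\mathbb{R}^N)$ with $\widehat K\in L^\infty$, $K|_{\mathbb{R}^N\setminus\{0\}}\in C^1(\mathbb{R}^N\setminus\{0\})$, and constants $C_0,C_1,A_2\ge0$ with $|K(x)|\le C_0|x|^{-N}$, $|\nabla K(x)|\le C_1|x|^{-N-1}$ for $x\ne0$, and $|\int_{R_1<|x|<R_2}K\,dx|\le A_2$ for all $0<R_1<R_2<\infty$. The associated operator $S$ is $\widehat{Su}=\widehat K\widehat u$ (Fourier transform normalized so that $\widehat{K*u}=\widehat K\widehat u$), which for $u\in L^1$ is a tempered distribution. Assumptions on a (measurable) vector field $b:(0,T)\times\mathbb{R}^N\to\mathbb{R}^N$: (R1) $\frac{b(s,x)}{1+|x|}=\tilde b_1(s,x)+\tilde b_2(s,x)$ with $\tilde b_1\in L^1((0,T);L^1(\mathbb{R}^N))$, $\tilde b_2\in L^1((0,T);L^\infty(\mathbb{R}^N))$.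 (R2) For every $i,j=1,\dots,N$, $\partial_jb^i=\sum_{k=1}^mS^i_{jk}g^i_{jk}$ in $\mathcal{D}'((0,T)\times\mathbb{R}^N)$, where $S^i_{jk}$ are singular integral operators of fundamental type in $\mathbb{R}^N$ (acting in $x$ only, independently of time) and $g^i_{jk}\in L^1((0,T)\times\mathbb{R}^N)$. (R3) $b\in L^p_{\rm loc}([0,T]\times\mathbb{R}^N)$ for some $p>1$. Function spaces: $L^0_{\rm loc}(\mathbb{R}^N)$ is the space of measurable functions (mod a.e. equality; here possibly $\mathbb{R}^N$-valued) with local convergence in measure ($u_n\to u$ iff $\mathscr{L}^N(\{x\in B_r:|u_n-u|>\gamma\})\to0$ for all $\gamma,r>0$); $\log L_{\rm loc}$ is the space of measurable $u$ with $\int_{B_r}\log(1+|u|)\,dx<\infty$ for all $r$; $\mathcal{B}(E,F)$ denotes bounded functions from $E$ to $F$ (for $F=\log L_{\rm loc}$: $\int_{B_r}\log(1+|u|)\,dx$ bounded uniformly on $E$ for each $r$). Regular Lagrangian flow relative to $b$ starting at time $t\in[0,T)$ ($b$ satisfying (R1)): a map $X\in C([t,T]_s;L^0_{\rm loc}(\mathbb{R}^N_x))\cap\mathcal{B}([t,T]_s;\log L_{\rm loc}(\mathbb{R}^N_x))$, $\mathbb{R}^N$-valued, such that (i) $\partial_s(\beta(X(s,x)))=\beta'(X(s,x))\,b(s,X(s,x))$ in $\mathcal{D}'((t,T)\times\mathbb{R}^N)$ for every $\beta\in C^1(\mathbb{R}^N;\mathbb{R})$ with $|\beta(z)|\le C(1+\log(1+|z|))$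 and $|\beta'(z)|\le\frac{C}{1+|z|}$ for all $z$, for some constant $C$; (ii) $X(t,x)=x$ for a.e. $x$; (iii) there is $L\ge0$ (a compression constant of $X$) such that for every $s\in[t,T]$, $\mathscr{L}^N(\{x:X(s,x)\in B\})\le L\,\mathscr{L}^N(B)$ for every Borel $B\subset\mathbb{R}^N$. *)

(* Defs.v *)
From HB Require Import structures.
From mathcomp Require Import all_boot all_order all_algebra.
From mathcomp Require Import all_classical all_reals all_analysis.
From mathcomp Require Import complex.

Set Implicit Arguments.
Unset Strict Implicit.
Unset Printing Implicit Defensive.
Import Order.TTheory GRing.Theory Num.Theory.
Import numFieldNormedType.Exports.

Local Open Scope classical_set_scope.
Local Open Scope ring_scope.

(* The sigma-algebra on [R^n] generated by the coordinates, which is the Borel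
   one *)
Definition measure_rV_display : measure_display.
Proof. exact: default_measure_display. Qed.

Section measurable_rV.
Variables (R : realType) (n : nat).

Let coors : 'I_n -> 'rV[R]_n -> measurableTypeR R := fun i x => x ord0 i.

Let rV_set0 : g_sigma_preimage coors set0.
Proof. exact: sigma_algebra0. Qed.

Let rV_setC A : g_sigma_preimage coors A -> g_sigma_preimage coors (~` A).
Proof. exact: sigma_algebraC. Qed.

Let rV_bigcup (F : _^nat) : (forall i, g_sigma_preimage coors (F i)) ->
  g_sigma_preimage coors (\bigcup_i (F i)).
Proof. exact: sigma_algebra_bigcup. Qed.

HB.instance Definition _ := @isMeasurable.Build measure_rV_display
  'rV[R]_n (g_sigma_preimage coors) rV_set0 rV_setC rV_bigcup.

End measurable_rV.

Lemma measurable_coord (R : realType) n (i : 'I_n) :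
  measurable_fun [set: 'rV[R]_n] (fun x : 'rV[R]_n => x ord0 i).
Proof.
move=> _ Y mY; rewrite setTI; apply: sub_sigma_algebra => /=.
rewrite -bigcup_seq/=; exists i => /=; first by rewrite mem_index_enum.
by exists Y => //; rewrite setTI.
Qed.

Lemma measurable_fun_rVP (R : realType) d (T : measurableType d) n
    (f : T -> 'rV[R]_n) :
  (forall i, measurable_fun [set: T] (fun x => f x ord0 i)) ->
  measurable_fun [set: T] f.
Proof.
move=> mf; have fS : g_sigma_preimage
    (fun i => (fun x : 'rV[R]_n => x ord0 i : measurableTypeR R) \o f)
    `<=` measurable.
  apply: smallest_sub; first exact: sigma_algebra_measurable.
  case: n => [|n] in f mf *; first by rewrite big_ord0.
  rewrite -bigcup_mkord_ord; apply: bigcup_sub => i Ii.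
  by move=> A [B mB <-]; exact: mf.
move=> _ A mA; apply: fS.
by rewrite (g_sigma_preimage_comp
  (fun i (x : 'rV[R]_n) => x ord0 i : measurableTypeR R) f); exists A.
Qed.

(* Lebesgue measure on [R^n], by recursion on [n] as the image of a product
   measure *)
Section lebesgue_rV.
Variable R : realType.

Definition cons_rV n (z : measurableTypeR R * 'rV[R]_n) : 'rV[R]_n.+1 :=
  \row_(i < n.+1) if unlift ord0 i is Some j then z.2 ord0 j else z.1.

Lemma measurable_cons_rV n : measurable_fun [set: _] (@cons_rV n).
Proof.
apply: measurable_fun_rVP => i; rewrite /cons_rV.
have [j ->|->] := unliftP ord0 i.
  rewrite (_ : (fun x => _) = (fun y : 'rV[R]_n => y ord0 j) \o snd); last first.
    by apply/funext => z /=; rewrite mxE liftK.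
  by apply: measurableT_comp => //; exact: measurable_coord.
rewrite (_ : (fun x => _) = fst) //.
by apply/funext => z /=; rewrite mxE unlift_none.
Qed.

Section step.
Variables (n : nat) (mu : {sigma_finite_measure set 'rV[R]_n -> \bar R}).

Definition lebesgue_rV_step : set 'rV[R]_n.+1 -> \bar R :=
  pushforward (@lebesgue_measure R \x mu)%E (@cons_rV n).

Let step0 : lebesgue_rV_step set0 = 0%E.
Proof. by rewrite /lebesgue_rV_step /pushforward preimage_set0 measure0. Qed.

Let step_ge0 A : (0 <= lebesgue_rV_step A)%E.
Proof. by rewrite /lebesgue_rV_step /pushforward; exact: measure_ge0. Qed.

Let step_sigma_additive : semi_sigma_additive lebesgue_rV_step.
Proof.
move=> F mF tF mUF; rewrite /lebesgue_rV_step /pushforward preimage_bigcup.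
have mpre A : measurable A -> measurable (@cons_rV n @^-1` A).
  by move=> mA; rewrite -[X in measurable X]setTI; exact: measurable_cons_rV.
apply: measure_semi_sigma_additive.
- by move=> k; exact: mpre.
- apply/trivIsetP => /= i j _ _ ij; rewrite -preimage_setI.
  by move/trivIsetP : tF => /(_ i j Logic.I Logic.I ij) ->; rewrite preimage_set0.
- by rewrite -preimage_bigcup; exact: mpre.
Qed.

HB.instance Definition _ := isMeasure.Build _ _ _ lebesgue_rV_step
  step0 step_ge0 step_sigma_additive.

Let step_sigma_finite : sigma_finite setT lebesgue_rV_step.
Proof.
pose split (x : 'rV[R]_n.+1) : measurableTypeR R * 'rV[R]_n :=
  (x ord0 ord0, \row_j x ord0 (lift ord0 j)).
have msplit : measurable_fun [set: _] split.
  apply/measurable_fun_pairP; split; first exact: measurable_coord.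
  apply: measurable_fun_rVP => i.
  rewrite (_ : (fun x => _) = fun x : 'rV[R]_n.+1 => x ord0 (lift ord0 i)).
    exact: measurable_coord.
  by apply/funext => x /=; rewrite mxE.
have splitK : cancel (@cons_rV n) split.
  move=> [a v]; rewrite /split /cons_rV mxE unlift_none; congr pair.
  by apply/rowP => j; rewrite !mxE liftK.
have /sigma_finiteP[F [TF ndF Foo]] := sigma_finiteT (@lebesgue_measure R).
have /sigma_finiteP[G [TG ndG Goo]] := sigma_finiteT mu.
have [H HT mH] : sigma_finite setT (@lebesgue_measure R \x mu)%E.
  exists (fun k => F k `*` G k).
    rewrite -setXTT TF TG predeqE => -[x y]; split; last first.
      by move=> [k _ []/= ? ?]; split; exists k.
    move=> [/= [k _ Fkx] [l _ Gly]]; exists (maxn k l) => //; split.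
    - by move: x Fkx; exact/subsetPset/ndF/leq_maxl.
    - by move: y Gly; exact/subsetPset/ndG/leq_maxr.
  move=> k; have [? ?] := Foo k; have [? ?] := Goo k; split.
    exact: measurableX.
  by rewrite product_measure1E// lte_mul_pinfty// ge0_fin_numE.
exists (fun i => split @^-1` H i).
  by rewrite -preimage_bigcup -HT preimage_setT.
move=> i; have [mHi Hoo] := mH i; split.
  by rewrite -[X in measurable X]setTI; exact: msplit.
rewrite /lebesgue_rV_step /pushforward (_ : _ @^-1` _ = H i) //.
by apply/seteqP; split => z /=; rewrite splitK.
Qed.

HB.instance Definition _ := Measure_isSigmaFinite.Build _ _ _
  lebesgue_rV_step step_sigma_finite.

End step.

Fixpoint lebesgue_rV n : {sigma_finite_measure set 'rV[R]_n -> \bar R} :=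
  if n is n'.+1 then lebesgue_rV_step (lebesgue_rV n') else \d_(0 : 'rV[R]_0).

Lemma lebesgue_rV_box n (A : 'I_n -> set R) : (forall i, measurable (A i)) ->
  lebesgue_rV n [set x | forall i, A i (x ord0 i)] =
  (\prod_(i < n) lebesgue_measure (A i))%E.
Proof.
elim: n A => [A mA|n IH A mA] /=.
  by rewrite big_ord0 /dirac indicE mem_set // => -[].
rewrite /lebesgue_rV_step /pushforward big_ord_recl -IH => [|i]; last exact: mA.
have mB : measurable [set x : 'rV[R]_n | forall i, A (lift ord0 i) (x ord0 i)].
  rewrite (_ : [set x | _] = \bigcap_(i in [set: 'I_n])
    ((fun x : 'rV[R]_n => x ord0 i) @^-1` A (lift ord0 i))).
    apply: fin_bigcap_measurable => // i _.
    by rewrite -[X in measurable X]setTI; exact: measurable_coord.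
  by apply/seteqP; split => x /= h i; [move=> _; exact: (h i)|exact: (h i Logic.I)].
have E := product_measure1E (@lebesgue_measure R) (lebesgue_rV n) (mA ord0) mB.
apply: etrans E.
congr (_ _); apply/seteqP; split => -[a v] /=.
  move=> h; split; first by have := h ord0; rewrite mxE unlift_none.
  by move=> i; have := h (lift ord0 i); rewrite mxE liftK.
move=> [Aa Av] i; rewrite mxE.
by case: unliftP => [j ->|->]; [exact: Av|].
Qed.

End lebesgue_rV.

Section euclidean.
Variables (R : realType) (n : nat).
Implicit Types x y : 'rV[R]_n.

Definition dotv x y : R := \sum_(i < n) x ord0 i * y ord0 i.

(* The library norm on matrices is the sup norm *)
Definition enorm x : R := Num.sqrt (dotv x x).

Definition eball (r : R) : set 'rV[R]_n := [set x | enorm x < r].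

Definition basis_rV (j : 'I_n) : 'rV[R]_n := delta_mx ord0 j.

Definition gradient (f : 'rV[R]_n -> R) x : 'rV[R]_n :=
  \row_j 'D_(basis_rV j) f x.

End euclidean.

Section regularity.
Variables (R : realType) (V : normedModType R).
Implicit Types (A : set V) (f : V -> R).

(* meant for open [A] *)
Definition C1_on A f := forall x, A x ->
  differentiable f x /\ forall v, {for x, continuous ('D_v f)}.

Definition iter_derive (vs : seq V) f : V -> R :=
  foldr (fun v g => 'D_v g) f vs.

Definition smooth f := forall vs x, differentiable (iter_derive vs f) x.

Definition support_of f : set V := closure [set x | f x != 0].

Definition test_function A f :=
  [/\ smooth f, compact (support_of f) & support_of f `<=` A].

End regularity.

Local Notation normc := ComplexField.Normc.normc.

Section complex_valued.
Variable R : realType.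
Local Notation C := R[i].

Definition cis (t : R) : C := Complex (cos t) (sin t).

Definition re_im (T : Type) (P : (T -> R) -> Prop) (f : T -> C) : Prop :=
  P (fun x => complex.Re (f x)) /\ P (fun x => complex.Im (f x)).

Definition Cintegral d (T : measurableType d) (mu : {measure set T -> \bar R})
    (D : set T) (f : T -> C) : C :=
  Complex (\int[mu]_(x in D) complex.Re (f x)) (\int[mu]_(x in D) complex.Im (f x)).

End complex_valued.

Section fourier.
Variables (R : realType) (n : nat).
Local Notation C := R[i].
Local Notation leb := (lebesgue_rV R n).
Implicit Types (u phi psi : 'rV[R]_n -> C).

(* The factor 2 pi in the exponent makes the transform of [K * u] the product
   of the transforms, and [inv_fourier] its inverse, without any constant. *)
Definition fourier u : 'rV[R]_n -> C := fun xi =>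
  Cintegral leb setT (fun x => cis (- (2 * pi * dotv x xi)) * u x).

Definition inv_fourier u : 'rV[R]_n -> C := fun x =>
  Cintegral leb setT (fun xi => cis (2 * pi * dotv x xi) * u xi).

Definition Cpartial (s : seq 'I_n) phi (x : 'rV[R]_n) : C :=
  let d f := iter_derive [seq basis_rV R j | j <- s] f x in
  Complex (d (fun y => complex.Re (phi y))) (d (fun y => complex.Im (phi y))).

Definition schwartz_seminorm (k : nat) phi : \bar R :=
  ereal_sup [set y | exists (s : seq 'I_n) (x : 'rV[R]_n),
    (size s <= k)%N /\ y = ((1 + enorm x) ^+ k * normc (Cpartial s phi x))%:E].

Definition schwartz phi : Prop :=
  re_im (@smooth R 'rV[R]_n) phi /\
  forall k, (schwartz_seminorm k phi < +oo)%E.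

(* [S'(R^n)]; the values of [F] outside the Schwartz space are irrelevant *)
Definition tempered (F : ('rV[R]_n -> C) -> C) : Prop :=
  (forall a phi psi, schwartz phi -> schwartz psi ->
     F (fun x => a * phi x + psi x) = a * F phi + F psi) /\
  (exists (k : nat) (c : R), forall phi, schwartz phi ->
     ((normc (F phi))%:E <= c%:E * schwartz_seminorm k phi)%E).

Record fundamental_kernel := FundamentalKernel {
  fk_dist : ('rV[R]_n -> C) -> C ;
  (* the bounded function representing the Fourier transform *)
  fk_hat : 'rV[R]_n -> C ;
  (* the function representing the kernel away from the origin *)
  fk_fun : 'rV[R]_n -> C ;
  fk_tempered : tempered fk_dist ;
  fk_hat_measurable : re_im (measurable_fun setT) fk_hat ;
  fk_hat_bounded : (Lnorm leb +oo (fun xi => (normc (fk_hat xi))%:E) < +oo)%E ;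
  fk_hatE : forall phi, schwartz phi ->
    fk_dist (fourier phi) =
    Cintegral leb setT (fun xi => fk_hat xi * phi xi) ;
  fk_C1 : re_im (C1_on (~` [set (0 : 'rV[R]_n)])) fk_fun ;
  fk_funE : forall phi, re_im (test_function (~` [set (0 : 'rV[R]_n)])) phi ->
    fk_dist phi = Cintegral leb setT (fun x => fk_fun x * phi x) ;
  fk_size : exists2 C0 : R, 0 <= C0 & forall x, x != 0 ->
    normc (fk_fun x) <= C0 * enorm x ^- n ;
  fk_gradient : exists2 C1 : R, 0 <= C1 & forall x, x != 0 ->
    Num.sqrt (\sum_(j < n) normc (Cpartial [:: j] fk_fun x) ^+ 2)
      <= C1 * enorm x ^- n.+1 ;
  fk_cancel : exists2 A2 : R, 0 <= A2 & forall R1 R2 : R, 0 < R1 -> R1 < R2 ->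
    normc (Cintegral leb [set x | R1 < enorm x < R2] fk_fun) <= A2 }.

(* [<S u, phi> = <F(S u), F^-1 phi>] where [F(S u)] is the bounded function
   [F K * F u] *)
Definition singular_op (K : fundamental_kernel) (u : 'rV[R]_n -> R) phi : C :=
  Cintegral leb setT (fun xi =>
    fk_hat K xi * fourier (fun x => Complex (u x) 0) xi * inv_fourier phi xi).

End fourier.

(* Functions defined almost everywhere are represented by Borel functions. *)
Section vector_field.
Variables (R : realType) (N : nat) (T : R).
Local Notation leb1 := (@lebesgue_measure R).
Local Notation leb := (lebesgue_rV R N).
Local Notation leb2 := (@lebesgue_measure R \x lebesgue_rV R N)%E.
Implicit Types (b : R -> 'rV[R]_N -> 'rV[R]_N).

Definition strip (a c : R) : set (measurableTypeR R * 'rV[R]_N) :=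
  `]a, c[%classic `*` setT.

Definition measurable_field b :=
  measurable_fun (strip 0 T) (fun z => b z.1 z.2).

(* [f] in [L^1((0,T); L^q(R^N))] *)
Definition L1_Lq (q : \bar R) (f : R -> 'rV[R]_N -> 'rV[R]_N) : Prop :=
  measurable_field f /\
  (\int[leb1]_(s in `]0%R, T[) Lnorm leb q (fun x => (enorm (f s x))%:E) < +oo)%E.

Definition R1 b : Prop :=
  exists b1 b2 : R -> 'rV[R]_N -> 'rV[R]_N,
    [/\ L1_Lq 1 b1, L1_Lq +oo b2 &
      {ae leb2, forall z, strip 0 T z ->
        (1 + enorm z.2)^-1 *: b z.1 z.2 = b1 z.1 z.2 + b2 z.1 z.2}].

Definition R2 b : Prop :=
  exists (m : nat) (K : 'I_N -> 'I_N -> 'I_m -> fundamental_kernel R N)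
    (g : 'I_N -> 'I_N -> 'I_m -> R -> 'rV[R]_N -> R),
    (forall i j k,
      leb2.-integrable (strip 0 T) (fun z => (g i j k z.1 z.2)%:E)) /\
    (forall i j (phi : R * 'rV[R]_N -> R), test_function (strip 0 T) phi ->
      Complex
        (- \int[leb2]_(z in strip 0 T)
             (b z.1 z.2 ord0 i * 'D_(0, basis_rV R j) phi z)) 0 =
      \sum_(k < m) Cintegral leb1 `]0, T[%classic (fun s =>
        singular_op (K i j k) (g i j k s)
          (fun x => Complex (phi (s, x)) 0))).

Definition R3 b : Prop :=
  exists2 p : \bar R, (1 < p)%E & forall r : R, 0 < r ->
    (Lnorm leb2 p ((fun z => (enorm (b z.1 z.2))%:E)
                  \_ (`]0%R, T[%classic `*` eball r)) < +oo)%E.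

(* local convergence in measure *)
Definition cvg_L0loc (I : Type) (F : set_system I)
    (u : I -> 'rV[R]_N -> 'rV[R]_N) (v : 'rV[R]_N -> 'rV[R]_N) : Prop :=
  forall gamma r : R, 0 < gamma -> 0 < r ->
    leb [set x | eball r x /\ gamma < enorm (u i x - v x)] @[i --> F] --> 0%E.

(* the admissible renormalizations *)
Definition log_C1 (beta : 'rV[R]_N -> R) : Prop :=
  C1_on setT beta /\
  exists C : R, forall z,
    `|beta z| <= C * (1 + ln (1 + enorm z)) /\
    enorm (gradient beta z) <= C / (1 + enorm z).

Record regular_lagrangian_flow b (t : R) (X : R -> 'rV[R]_N -> 'rV[R]_N) := {
  (* [X s] is only an element of [L^0_loc] for each [s]; by continuity in [s]
     these classes have representatives measurable in both variables *)
  rlf_measurable : measurable_fun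
    (`[t, T]%classic `*` setT : set (measurableTypeR R * 'rV[R]_N))
    (fun z => X z.1 z.2) ;
  rlf_continuous : forall s, `[t, T]%classic s ->
    cvg_L0loc (within `[t, T]%classic (nbhs s)) X (X s) ;
  rlf_bounded : forall r : R, 0 < r -> exists M : R,
    forall s, `[t, T]%classic s ->
      (\int[leb]_(x in eball r) (ln (1 + enorm (X s x)))%:E <= M%:E)%E ;
  rlf_equation : forall beta, log_C1 beta ->
    forall phi : R * 'rV[R]_N -> R, test_function (strip t T) phi ->
      - (\int[leb2]_(z in strip t T)
           (beta (X z.1 z.2) * 'D_(1, 0) phi z)) =
      \int[leb2]_(z in strip t T)
        (dotv (gradient beta (X z.1 z.2)) (b z.1 (X z.1 z.2)) * phi z) ;
  rlf_initial : {ae leb, forall x, X t x = x} ;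
  rlf_compression : exists2 L : R, 0 <= L &
    forall s, `[t, T]%classic s -> forall B : set 'rV[R]_N, measurable B ->
      (leb (X s @^-1` B) <= L%:E * leb B)%E }.

End vector_field.

(* Main.v *)
(* For almost every x both flows are absolutely continuous trajectories
   X(s,x) = x + int_t^s b(u, X(u,x)) du: test the equation with a truncation of
   log(1+|z|^2)/2, which bounds |X(s,x)| uniformly in s because b/(1+|x|) is
   integrable along a flow of bounded compression, then with truncations of the
   coordinates. Let D be the l^1 distance of the two trajectories and
   a = 2^-m; then log(1 + D(s)/a) is at most the time integral of
   |b(X) - b(Xbar)| / (a + D).

   No maximal function is used. Telescoping dyadic mollifications gives
   |b(y) - b(z)| <= (a + |y - z|) (W_m(y) + W_m(z)), where W_m is a sum over
   k <= m of 2^k |b - b_k|, b_k being b mollified at scale 2^-k, and of local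
   averages of 2^k |b_k - b_(k-1)|. Writing rho_q - rho_2q as a divergence and
   using (R2), 2^k (b_k - b_(k-1)) is a sum of S g paired with dilates of a
   mean-zero smooth product, that is, g convolved with dilates of an
   integrable kernel of mean zero; by continuity of translations in L^1 its
   local L^1 norm tends to 0, and so does that of 2^k (b - b_k). Hence the
   local L^1 norm of W_m is o(m) by a Cesaro argument, and compression
   transfers this bound to both flows. On {D >= 2^-p} the left-hand side
   exceeds (m - p) log 2, so letting m tend to infinity D vanishes a.e. *)
Require Import Defs.
From HB Require Import structures.
From mathcomp Require Import all_boot all_order all_algebra.
From mathcomp Require Import all_classical all_reals all_analysis.
From mathcomp Require Import measurable_realfun.
From mathcomp Require Import complex ring lra.

Set Implicit Arguments.
Unset Strict Implicit.
Unset Printing Implicit Defensive.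
Import Order.TTheory GRing.Theory Num.Theory.
Import numFieldNormedType.Exports.

Local Open Scope classical_set_scope.
Local Open Scope ring_scope.

Import HBNNSimple.

Local Notation mu := (@lebesgue_measure _).
Local Notation leb2 := (lebesgue_measure \x lebesgue_rV _ _)%E.
Local Notation spacetime R n := (measurableTypeR R * 'rV[R]_n)%type.
Local Notation mfunT := (measurable_fun setT).
Local Notation integrableT m f := (m.-integrable setT (EFin \o f)).

(** With [g] only in L^1, [S g] need not be an integrable function, so no bound by its size is
    available along the flow. What is available is [S g] tested on smooth profiles at scale 2^-k. A
    bound of order one for each scale would add up to order m, the very size of log(1 + D/a) on {D
    >= 2^-p}, and prove nothing: each scale has to contribute o(1). The vanishing mean of the
    kernels [kap] provides this, replacing the norm of [g] by an L^1 modulus of continuity at scale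
    2^-k. A majorant of [kap] valid for all scales comes from the bounded Fourier transform of K
    near the origin and from the gradient of K far from it; the mean vanishes because the transform
    of the profile does so at frequency zero. Profiles are products of functions of one variable, so
    that Fourier inversion, test functions and Schwartz functions reduce to dimension one and rho_q
    - rho_2q telescopes over the coordinates. Mollifying twice makes the increment between
    consecutive scales a mollified block, whose Lipschitz constant is governed by the local mass of
    the block. *)

Lemma measurable_L1 d (T : measurableType d) (R : realType) (m : {measure set T -> \bar R}) (f : T -> R) :
  integrableT m f -> mfunT f.
Proof. by move=> fI; apply/measurable_EFinP; exact: measurable_int fI. Qed.

(** * Lebesgue measure and integration on R^n *)

Lemma lebesgue_itv_lty (R : realType) (a b : R) : (@lebesgue_measure R `[a, b]%classic < +oo)%E.
Proof. by rewrite lebesgue_measure_itv/=; case: ifP => _; rewrite -?EFinB ltry. Qed.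

(** * Affine changes of variables on the line *)

Section affine1.
Variable R : realType.

Lemma measurable_affine (a c : R) :
  measurable_fun [set: measurableTypeR R]
    (fun z : measurableTypeR R => a * z + c : measurableTypeR R).
Proof.
apply: measurable_funD => //; apply: measurable_funM => //.
Qed.

(** Lebesgue measure is determined by the length of half-open intervals, and [|a|] times the image
    measure has the same values there. For [a < 0] the preimage of []l, r]] is closed on the left
    instead, with the same length. *)
Lemma lebesgue_affine (a c : R) (A : set R) : a != 0 -> measurable A ->
  (`|a|%:E * mu ((fun z => a * z + c)%R @^-1` A) = mu A)%E.
Proof.
move=> a0 mA.
have an : 0 <= `|a| by [].
pose f : measurableTypeR R -> measurableTypeR R := fun z => a * z + c.
have mf : mfunT f by exact: measurable_affine.
pose nu : {measure set (measurableTypeR R) -> \bar R} :=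
  mscale (NngNum an) (measure_function_pushforward__canonical__measure_function_Measure mu mf).
rewrite -[LHS]/(nu A); apply/esym/lebesgue_measure_unique => // _ [[l r]] _ <-.
rewrite /nu/= /mscale/= /pushforward/=.
have na : `|a| != 0 by rewrite normr_eq0.
move: a0; rewrite neq_lt => /orP[a0|a0].
  rewrite (_ : _ @^-1` _ = `[(r - c) / a, (l - c) / a[%classic); last first.
    apply/seteqP; split => z /=; rewrite !in_itv/= => /andP[h1 h2].
    - by rewrite ler_ndivrMr// ltr_ndivlMr// mulrC; apply/andP; rewrite /f in h1 h2; split; lra.
    - move: h1 h2; rewrite ler_ndivrMr// ltr_ndivlMr// mulrC => h1 h2.
      by apply/andP; rewrite /f; split; lra.
  rewrite !lebesgue_measure_itv/= !lte_fin ltr_ndivlMr// divfK ?lt_eqF//.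
  have -> : (l - c < r - c) = (l < r) by rewrite ltrD2r.
  case: ifPn => _; last by rewrite mule0.
  rewrite -!EFinB -EFinM; congr EFin; rewrite ltr0_norm//; field.
  by rewrite lt_eqF.
rewrite (_ : _ @^-1` _ = `](l - c) / a, (r - c) / a]%classic); last first.
  apply/seteqP; split => z /=; rewrite !in_itv/= => /andP[h1 h2].
  - by rewrite ltr_pdivrMr// ler_pdivlMr// mulrC; apply/andP; rewrite /f in h1 h2; split; lra.
  - move: h1 h2; rewrite ltr_pdivrMr// ler_pdivlMr// mulrC => h1 h2.
    by apply/andP; rewrite /f; split; lra.
rewrite !lebesgue_measure_itv/= !lte_fin ltr_pdivlMr// divfK ?gt_eqF//.
have -> : (l - c < r - c) = (l < r) by rewrite ltrD2r.
case: ifPn => _; last by rewrite mule0.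
rewrite -!EFinB -EFinM; congr EFin; rewrite gtr0_norm//; field.
by rewrite gt_eqF.
Qed.

Lemma ge0_integral_affine1 (a c : R) (f : R -> \bar R) : a != 0 ->
  mfunT f -> (forall x, 0 <= f x)%E ->
  (`|a|%:E * \int[mu]_z f (a * z + c)%R = \int[mu]_z f z)%E.
Proof.
move=> a0 mf f0.
pose h : measurableTypeR R -> measurableTypeR R := fun z => a * z + c.
have mh : mfunT h by exact: measurable_affine.
have := @ge0_integral_pushforward _ _ _ _ R h mh mu setT f measurableT mf
  (fun x _ => f0 x).
rewrite preimage_setT => <-; have an : 0 <= `|a| by [].
have := @ge0_integral_mscale _ _ _ (measure_function_pushforward__canonical__measure_function_Measure mu mh)
  setT measurableT (NngNum an) f mf (fun x _ => f0 x).
move=> /= <-; apply: eq_measure_integral => //= A mA _.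
by rewrite -(lebesgue_affine c a0 mA).
Qed.

End affine1.

Lemma measurable_patch d d' (T1 : measurableType d) (T2 : measurableType d') (D : set T1)
  (f : T1 -> T2) : measurable D -> mfunT f -> mfunT (f \_ D).
Proof.
by move=> mD mf; apply/(measurable_restrictT _ mD).1; exact: measurable_funS mf.
Qed.

Lemma integrable_indic_lty d (T : measurableType d) (R : realType)
  (mu : {measure set T -> \bar R}) (A : set T) : measurable A -> (mu A < +oo)%E ->
  mu.-integrable setT (fun x => (\1_A x)%:E : \bar R).
Proof.
move=> mA Aoo; apply/integrableP; split; first exact/measurable_EFinP.
under eq_integral do rewrite gee0_abs ?lee_fin//.
by rewrite integral_indic// setIT.
Qed.

Lemma ae_imply d (T : measurableType d) (R : realType) (mu : {measure set T -> \bar R})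
  (P Q : T -> Prop) : (forall x, P x -> Q x) ->
  {ae mu, forall x, P x} -> {ae mu, forall x, Q x}.
Proof. by move=> PQ; apply: filterS. Qed.

Lemma ae_imply2 d (T : measurableType d) (R : realType) (mu : {measure set T -> \bar R})
  (P P' Q : T -> Prop) : (forall x, P x -> P' x -> Q x) ->
  {ae mu, forall x, P x} -> {ae mu, forall x, P' x} -> {ae mu, forall x, Q x}.
Proof. by move=> PQ; apply: filterS2. Qed.

(** * Measurability of integrals depending on a parameter *)

Section parameter_integral.
Context d1 d2 (T1 : measurableType d1) (T2 : measurableType d2) (R : realType).
Variable m2 : {sigma_finite_measure set T2 -> \bar R}.

Lemma ge0_measurable_integral (f : T1 * T2 -> \bar R) :
  mfunT f -> (forall z, 0 <= f z)%E ->
  mfunT (fun x => \int[m2]_y f (x, y))%E.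
Proof. exact: measurable_fun_fubini_tonelli_F. Qed.

Lemma measurable_integral (f : T1 * T2 -> \bar R) :
  mfunT f -> mfunT (fun x => \int[m2]_y f (x, y))%E.
Proof.
move=> mf.
rewrite (_ : (fun x => _) = (fun x => (\int[m2]_y f^\+ (x, y) - \int[m2]_y f^\- (x, y))%E)).
  apply: emeasurable_funB; apply: ge0_measurable_integral => //.
    exact: measurable_funepos.
  exact: measurable_funeneg.
apply/funext => x; rewrite integralE; congr (_ - _)%E; apply: eq_integral => y _.
  by rewrite !funeposE.
by rewrite !funenegE.
Qed.

Lemma measurable_Rintegral (f : T1 * T2 -> R) :
  mfunT f -> mfunT (fun x => \int[m2]_y f (x, y)).
Proof.
move=> mf; rewrite /Rintegral; apply: measurableT_comp => //.
by apply: (@measurable_integral (EFin \o f)); exact/measurable_EFinP.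
Qed.

Lemma ge0_fubini (m1 : {sigma_finite_measure set T1 -> \bar R}) (f : T1 * T2 -> \bar R) :
  mfunT f -> (forall z, 0 <= f z)%E ->
  (\int[m1]_x \int[m2]_y f (x, y) = \int[m2]_y \int[m1]_x f (x, y))%E.
Proof. by move=> mf f0; exact: fubini_tonelli. Qed.

End parameter_integral.

(** * Affine changes of variables and product integrands on R^n *)

Section rV_toolkit.
Variable R : realType.
Local Notation leb n := (lebesgue_rV R n).
Implicit Types n : nat.

Lemma ge0_integral_rV0 (f : 'rV[R]_0 -> \bar R) :
  mfunT f -> (\int[leb 0]_x f x)%E = f 0.
Proof.
by move=> mf; rewrite /= integral_dirac// diracT mul1e.
Qed.

(** The measure in dimension [n.+1] is the image of a product measure, so Tonelli splits off the
    first coordinate; the inductions on the dimension rest on this. *)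
Lemma ge0_integral_rVS n (f : 'rV[R]_n.+1 -> \bar R) :
  mfunT f -> (forall x, 0 <= f x)%E ->
  (\int[leb n.+1]_x f x = \int[mu]_z \int[leb n]_v f (cons_rV (z, v)))%E.
Proof.
move=> mf f0.
have := @ge0_integral_pushforward _ _ _ _ R _ (@measurable_cons_rV R n) (mu \x leb n)%E
   setT f measurableT mf (fun x _ => f0 x).
rewrite preimage_setT => E.
transitivity (\int[(mu \x leb n)%E]_x (f \o cons_rV (n:=n)) x)%E.
  exact: E.
rewrite fubini_tonelli1//.
- by apply: measurableT_comp => //; exact: measurable_cons_rV.
- by move=> x; exact: f0.
Qed.

Definition tail_rV n (x : 'rV[R]_n.+1) : 'rV[R]_n := \row_j x ord0 (lift ord0 j).

Lemma measurable_tail_rV n : mfunT (@tail_rV n).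
Proof.
apply: measurable_fun_rVP => i.
rewrite (_ : (fun x => _) = fun x : 'rV[R]_n.+1 => x ord0 (lift ord0 i)).
  exact: measurable_coord.
by apply/funext => x; rewrite mxE.
Qed.

Lemma cons_rV_head n (z : R) (v : 'rV[R]_n) : cons_rV (z, v) ord0 ord0 = z.
Proof. by rewrite mxE unlift_none. Qed.

Lemma cons_rV_lift n (z : R) (v : 'rV[R]_n) j : cons_rV (z, v) ord0 (lift ord0 j) = v ord0 j.
Proof. by rewrite mxE liftK. Qed.

Lemma cons_rVK n (x : 'rV[R]_n.+1) : cons_rV (x ord0 ord0, tail_rV x) = x.
Proof.
apply/rowP => j; rewrite mxE; case: unliftP => [k ->|->] //=.
by rewrite mxE.
Qed.

Lemma cons_rVD n (z z' : R) (v v' : 'rV[R]_n) :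
  cons_rV (z, v) + cons_rV (z', v') = cons_rV (z + z', v + v').
Proof.
apply/rowP => j; rewrite !mxE; case: (unliftP ord0 j) => [k _|_] //=.
by rewrite !mxE.
Qed.

Lemma cons_rVZ n a (z : R) (v : 'rV[R]_n) : a *: cons_rV (z, v) = cons_rV (a * z, a *: v).
Proof.
apply/rowP => j; rewrite !mxE; case: (unliftP ord0 j) => [k _|_] //=.
by rewrite !mxE.
Qed.

Lemma measurable_rV_affine n a (c : 'rV[R]_n) : mfunT (fun x : 'rV[R]_n => a *: x + c).
Proof.
apply: measurable_fun_rVP => i.
rewrite (_ : (fun x => _) = (fun x : 'rV[R]_n => a * x ord0 i + c ord0 i)); last first.
  by apply/funext => x; rewrite !mxE.
apply: measurable_funD => //; apply: measurable_funM => //.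
exact: measurable_coord.
Qed.

Lemma measurable_pair_cons n z : mfunT (fun v : 'rV[R]_n => cons_rV (z, v)).
Proof. by apply: measurableT_comp => //; exact: measurable_cons_rV. Qed.

(** The first coordinate is changed by the one-dimensional formula, the others by induction. The
    Jacobian stays on the left, so that infinite integrals need no separate case. *)
Lemma ge0_integral_affine n a (c : 'rV[R]_n) (f : 'rV[R]_n -> \bar R) :
  a != 0 -> mfunT f -> (forall x, 0 <= f x)%E ->
  ((`|a| ^+ n)%:E * \int[leb n]_x f (a *: x + c)%R = \int[leb n]_x f x)%E.
Proof.
move=> a0; elim: n c f => [c f mf f0|n IH c f mf f0].
  rewrite expr0 mul1e !ge0_integral_rV0//; first by rewrite (_ : _ + _ = 0) //; apply/rowP => -[].
  by apply: measurableT_comp => //; exact: measurable_rV_affine.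
have mfc : mfunT (f \o @cons_rV R n).
  by apply: measurableT_comp => //; exact: measurable_cons_rV.
rewrite !ge0_integral_rVS//; last first.
  by apply: measurableT_comp => //; exact: measurable_rV_affine.
pose F (z : R) := (\int[leb n]_v f (cons_rV (z, v)))%E.
have F0 z : (0 <= F z)%E by exact: integral_ge0.
have mF : mfunT F.
  exact: (ge0_measurable_integral (leb n) mfc (fun z => f0 _)).
rewrite -(ge0_integral_affine1 (c ord0 ord0) a0 mF F0).
rewrite exprS EFinM -muleA; congr (_ * _)%E.
rewrite -ge0_integralZl_EFin//; last 2 first.
- by move=> z _; exact: integral_ge0.
- apply: (@ge0_measurable_integral _ _ _ _ R (leb n) (f \o (fun y => a *: y + c) \o @cons_rV R n)) => //.
  - apply: measurableT_comp; last exact: measurable_cons_rV.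
    by apply: measurableT_comp => //; exact: measurable_rV_affine.
  - by move=> z; exact: f0.
apply: eq_integral => z _; rewrite /F -[in RHS](IH (tail_rV c))//.
  congr (_ * _)%E; apply: eq_integral => v _.
  by rewrite cons_rVZ -[in LHS](cons_rVK c) cons_rVD.
by apply: measurableT_comp => //; exact: measurable_pair_cons.
Qed.

(** Multiplication by a positive real respects the convention for [+oo - +oo]. Changes of variables
    therefore pass to signed functions without any integrability assumption. *)
Lemma gt0_muleBr (r : R) (x y : \bar R) : 0 < r ->
  (r%:E * (x - y) = r%:E * x - r%:E * y)%E.
Proof.
move=> r0; case: x => [x||]; case: y => [y||] /=;
  rewrite ?gt0_muley ?gt0_muleNy ?lte_fin//= ?addye ?addNye ?gt0_muley ?gt0_muleNy ?lte_fin//.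
by rewrite -!EFinM -!EFinB mulrBr.
Qed.

Lemma integral_affine n a (c : 'rV[R]_n) (f : 'rV[R]_n -> \bar R) :
  a != 0 -> mfunT f ->
  ((`|a| ^+ n)%:E * \int[leb n]_x f (a *: x + c)%R = \int[leb n]_x f x)%E.
Proof.
move=> a0 mf; rewrite integralE [RHS]integralE.
rewrite -(ge0_integral_affine c a0 (measurable_funepos mf))//.
rewrite -(ge0_integral_affine c a0 (measurable_funeneg mf))//.
rewrite gt0_muleBr; last by rewrite exprn_gt0// normr_gt0.
by congr (_ * _ - _ * _)%E; apply: eq_integral => x _; rewrite ?funeposE ?funenegE.
Qed.

Lemma Rintegral_reflect n (c : 'rV[R]_n) (f : 'rV[R]_n -> R) :
  mfunT f ->
  \int[leb n]_x f (c - x) = \int[leb n]_x f x.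
Proof.
move=> mf; rewrite /Rintegral.
have N1 : (-1 : R) != 0 by rewrite oppr_eq0 oner_eq0.
rewrite -[in RHS](integral_affine c N1); last exact/measurable_EFinP.
rewrite normrN1 expr1n mul1e; congr fine; apply: eq_integral => x _.
by rewrite scaleN1r addrC.
Qed.

Lemma ge0_integral_shift n (c : 'rV[R]_n) (f : 'rV[R]_n -> \bar R) :
  mfunT f -> (forall x, 0 <= f x)%E ->
  (\int[leb n]_x f (x + c)%R = \int[leb n]_x f x)%E.
Proof.
move=> mf f0.
rewrite -[in RHS](ge0_integral_affine c (oner_neq0 R))//.
rewrite normr1 expr1n mul1e; apply: eq_integral => x _.
by rewrite scale1r.
Qed.

Lemma ge0_integral_scale n a (f : 'rV[R]_n -> \bar R) :
  a != 0 -> mfunT f -> (forall x, 0 <= f x)%E ->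
  ((`|a| ^+ n)%:E * \int[leb n]_x f (a *: x)%R = \int[leb n]_x f x)%E.
Proof.
move=> a0 mf f0.
rewrite -[in RHS](ge0_integral_affine 0 a0 mf f0); congr (_ * _)%E.
by apply: eq_integral => x _; rewrite addr0.
Qed.

Lemma ge0_integral_prod n (f : 'I_n -> R -> \bar R) :
  (forall i, mfunT (f i)) -> (forall i x, 0 <= f i x)%E ->
  (\int[leb n]_x \prod_(i < n) f i (x ord0 i) = \prod_(i < n) \int[mu]_z f i z)%E.
Proof.
have mprod m (g : 'I_m -> R -> \bar R) : (forall i, mfunT (g i)) ->
   mfunT (fun x : 'rV[R]_m => \prod_(i < m) g i (x ord0 i))%E.
  elim: m g => [g _|m IHm g mg].
    rewrite (_ : (fun x => _) = cst 1%E) //.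
    by apply/funext => x; rewrite big_ord0.
  rewrite (_ : (fun x => _) = fun x : 'rV[R]_m.+1 => (g ord0 (x ord0 ord0) * \prod_(i < m) g (lift ord0 i) (tail_rV x ord0 i))%E); last first.
    by apply/funext => x; rewrite big_ord_recl; congr (_ * _)%E; apply: eq_bigr => i _; rewrite mxE.
  apply: emeasurable_funM; first by apply: measurableT_comp => //; exact: measurable_coord.
  apply: (@measurableT_comp _ _ _ _ _ _ (fun x : 'rV[R]_m => (\prod_(i < m) g (lift ord0 i) (x ord0 i))%E)).
    by apply: (IHm (fun i => g (lift ord0 i))) => i; exact: mg.
  exact: measurable_tail_rV.
elim: n f => [f mf f0|n IH f mf f0].
  rewrite big_ord0 ge0_integral_rV0 ?big_ord0//; exact: mprod.
rewrite ge0_integral_rVS//; [|exact: mprod|by move=> x; exact: prode_ge0].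
rewrite big_ord_recl.
under eq_integral => z _.
  under eq_integral => v _.
    rewrite big_ord_recl cons_rV_head.
    under eq_bigr do rewrite cons_rV_lift.
    over.
  rewrite ge0_integralZl//=; last 2 first.
  - by apply: (mprod n (fun i => f (lift ord0 i))) => i; exact: mf.
  - by move=> v _; exact: prode_ge0.
  rewrite (IH (fun i => f (lift ord0 i)))//.
  over.
by rewrite ge0_integralZr//; do ?[exact: mf|by move=> *; exact: f0|by apply: prode_ge0 => i _; exact: integral_ge0].
Qed.

Lemma integrable_leb_affine n a (c : 'rV[R]_n) (f : 'rV[R]_n -> R) : a != 0 ->
  integrableT (leb n) f ->
  (leb n).-integrable setT (fun x => (f (a *: x + c)%R)%:E).
Proof.
move=> a0 /integrableP[mf foo]; apply/integrableP; split.
  apply: (measurableT_comp mf); exact: measurable_rV_affine.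
have := ge0_integral_affine c a0 (measurableT_comp (@abse_measurable R setT) mf) (fun x => abse_ge0 _).
move=> /= E; rewrite -E in foo.
rewrite ltNge leye_eq; apply/eqP => I; move: foo; rewrite I.
by rewrite gt0_muley// lte_fin exprn_gt0// normr_gt0.
Qed.

End rV_toolkit.

(** * Sequences of extended reals tending to zero *)

Section cvg_toolkit.
Variable R : realType.

Lemma ge0_cvge0 (u : nat -> \bar R) : (forall k, 0 <= u k)%E ->
  (forall e : R, 0 < e -> \forall k \near \oo, (u k <= e%:E)%E) ->
  u @ \oo --> 0%E.
Proof.
move=> u0 H; apply/fine_cvgP; split.
  near=> k; rewrite ge0_fin_numE//.
  by apply: (@le_lt_trans _ _ 1%:E); [near: k; exact: H|exact: ltry].
apply/cvgrPdist_le => e e0; near=> k.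
rewrite sub0r normrN ger0_norm ?fine_ge0//.
have uk : (u k <= e%:E)%E by near: k; exact: H.
rewrite -lee_fin fineK// ge0_fin_numE//.
by rewrite (le_lt_trans uk)// ltry.
Unshelve. all: by end_near. Qed.

Lemma cvge0_lt (u : nat -> \bar R) (e : R) : u @ \oo --> 0%E -> 0 < e ->
  \forall k \near \oo, (u k < e%:E)%E.
Proof.
move=> /fine_cvgP[uf uc] e0; near=> k.
have uk : u k \is a fin_num by near: k.
rewrite -(fineK uk) lte_fin (le_lt_trans (ler_norm _))//.
near: k; exact: (@cvgr0_norm_lt _ _ _ _ _ _ uc e e0).
Unshelve. all: by end_near. Qed.

Lemma ge0_dominated_cvg0 d (T : measurableType d) (mu : {measure set T -> \bar R})
    (F : nat -> T -> \bar R) (G : T -> \bar R) :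
  (forall k, mfunT (F k)) -> (forall k x, 0 <= F k x)%E ->
  mu.-integrable setT G ->
  {ae mu, forall x, forall k, (F k x <= G x)%E} ->
  {ae mu, forall x, F ^~ x @ \oo --> 0%E} ->
  (\int[mu]_x F k x)%E @[k --> \oo] --> 0%E.
Proof.
move=> mF F0 iG FG Fc.
have [] := @dominated_convergence _ _ _ mu setT measurableT F (cst 0%E) G mF
  (@measurable_cst _ _ _ _ _ _) _ iG _.
- by apply: filterS Fc => x + _.
- by apply: filterS FG => x FGx k _; rewrite gee0_abs.
- by move=> _ _ /=; rewrite integral0.
Qed.

Lemma squeeze_cvge0 (u v : nat -> \bar R) : (forall k, 0 <= u k <= v k)%E ->
  v @ \oo --> 0%E -> u @ \oo --> 0%E.
Proof.
move=> uv v0.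
have uv' : \forall k \near \oo, (cst 0%E k <= u k <= v k)%E by near=> k; exact: uv.
exact: (squeeze_cvge uv' (cvg_cst _) v0).
Unshelve. all: by end_near. Qed.

End cvg_toolkit.

(** * Continuity of translations in L^1 *)

Section L1_shift1.
Variable R : realType.

Lemma L1_truncate (f : R -> R) : integrableT mu f ->
  (\int[mu]_x `|(f x - (f \_ `[- k%:R, k%:R]) x)%:E|)%E @[k --> \oo] --> 0%E.
Proof.
move=> fi.
have mf : mfunT f by exact: measurable_L1 fi.
have [] := @dominated_convergence _ _ _ mu setT measurableT
  (fun k x => ((f \_ `[- k%:R, k%:R]) x)%:E) (EFin \o f) (abse \o (EFin \o f)).
- move=> k; apply/measurable_EFinP; apply/(measurable_restrictT _ _).1 => //.
  exact: measurable_funS mf.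
- exact: measurable_int fi.
- apply: aeW => x _; apply: cvg_near_cst; near=> k.
  rewrite patchE mem_set//= in_itv/= -ler_norml.
  near: k; exact: nbhs_infty_ger.
- exact: integrable_abse.
- apply: aeW => x k _ /=; rewrite lee_fin patchE.
  by case: ifP => //; rewrite normr0.
- move=> _ + _; apply: squeeze_cvge0 => k.
  rewrite integral_ge0//=; apply: ge0_le_integral => //.
  + apply/measurable_EFinP; apply: measurableT_comp => //; apply: measurable_funB => //.
    exact: measurable_patch.
  + apply/measurable_EFinP; apply: measurableT_comp => //; apply: measurable_funB => //.
    exact: measurable_patch.
  + by move=> x _; rewrite distrC.
Unshelve. all: by end_near. Qed.

Let shift_norm (f : R -> R) (a : R) := (\int[mu]_x `|(f (x + a) - f x)%:E|)%E.

Let mshift (f : R -> R) (a : R) : mfunT f ->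
  mfunT (fun x : R => f (x + a)).
Proof. by move=> mf; apply: measurableT_comp => //; exact: measurable_funD. Qed.

Let mabsB (f g : R -> R) : mfunT f -> mfunT g ->
  mfunT (fun x => `|(f x - g x)%:E|%E).
Proof.
by move=> mf mg; apply/measurable_EFinP; apply: measurableT_comp => //; exact: measurable_funB.
Qed.

(** Translation invariance turns the error of [h] at [x + a] into the error at [x], which is why the
    same integral occurs twice. *)
Let shift_norm_approx (f h : R -> R) (a : R) :
  mfunT f -> mfunT h ->
  (shift_norm f a <= shift_norm h a +
     (\int[mu]_x `|(f x - h x)%:E| + \int[mu]_x `|(f x - h x)%:E|))%E.
Proof.
move=> mf mh; rewrite /shift_norm.
have {2}-> : (\int[mu]_x `|(f x - h x)%:E| = \int[mu]_x `|(f (x + a) - h (x + a))%:E|)%E.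
  rewrite -[LHS](@ge0_integral_affine1 R 1 a) ?oner_eq0//; last exact: mabsB.
  by rewrite normr1 mul1e; apply: eq_integral => x _; rewrite mul1r.
rewrite -!ge0_integralD//.
- apply: ge0_le_integral => //.
  + by apply: mabsB => //; exact: mshift.
  + by apply: emeasurable_funD; [|apply: emeasurable_funD]; apply: mabsB => //; exact: mshift.
  + move=> x _; rewrite !abse_EFin -!EFinD lee_fin.
    have -> : f (x + a) - f x = (h (x + a) - h x) + ((f (x + a) - h (x + a)) - (f x - h x)) by ring.
    rewrite (le_trans (ler_normD _ _))// lerD2l addrC.
    by rewrite (le_trans (ler_normB _ _))// addrC.
- by apply: mabsB => //; exact: mshift.
- by move=> x _; exact: adde_ge0.
- by apply: emeasurable_funD; apply: mabsB => //; exact: mshift.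
- by apply: mabsB => //; exact: mshift.
- by apply: mabsB => //; exact: mshift.
Qed.

(** [f] is cut to [[-m, m]] and approximated there by a continuous function. The result [h] is
    bounded, supported in that interval and continuous except at its two end points, so its
    translates converge by dominated convergence. *)
Lemma L1_shift_cvg1 (f : R -> R) (a : nat -> R) : integrableT mu f ->
  a @ \oo --> 0 ->
  (\int[mu]_x `|(f (x + a k) - f x)%:E|)%E @[k --> \oo] --> 0%E.
Proof.
move=> fi a0; apply: ge0_cvge0 => [k|e e0]; first exact: integral_ge0.
have mf : mfunT f by exact: measurable_L1 fi.
(* Cutting and approximating cost [e6] each, and [shift_norm_approx] counts their sum twice; the
   remaining two [e6] are for the translates of [h]. *)
pose e6 := e / 6; have e60 : 0 < e6 by rewrite divr_gt0.
have [m _ Hm] := cvge0_lt (L1_truncate fi) e60.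
have {Hm} := Hm m (leqnn m) => /= Hm.
pose I := `[- m%:R, m%:R]%classic : set R.
have fiI : mu.-integrable I (EFin \o f) by apply: (integrableS measurableT) => //; exact: measurable_itv.
have mI : measurable I by exact: measurable_itv.
have Ioo : (mu I < +oo)%E.
  by rewrite lebesgue_measure_itv/=; case: ifP => _; rewrite -?EFinB ltry.
have [g [cg gi gc]] := @approximation_continuous_integrable R I f (measurable_itv _) Ioo fiI.
have [p _ Hp] := cvge0_lt gc e60.
have {Hp} := Hp p (leqnn p) => /= Hp.
pose h := g p \_ I.
have mg : mfunT (g p) by exact: continuous_measurable_fun.
have mh : mfunT h.
  exact: measurable_patch.
have fh : (\int[mu]_x `|(f x - h x)%:E| <= (e6 + e6)%:E)%E.
  have mfI : mfunT (f \_ I) by exact: measurable_patch.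
  apply: (@le_trans _ _ (\int[mu]_x (`|(f x - (f \_ I) x)%:E| + `|((f \_ I) x - h x)%:E|)))%E.
    apply: ge0_le_integral => //; [exact: mabsB|by apply: emeasurable_funD; exact: mabsB|].
    by move=> x _; rewrite !abse_EFin -EFinD lee_fin; exact: ler_distD.
  rewrite ge0_integralD//; [|exact: mabsB|exact: mabsB].
  rewrite EFinD; apply: leeD; first exact: ltW.
  apply: le_trans (ltW Hp).
  rewrite [leRHS]integral_mkcond; apply: ge0_le_integral => //.
  + exact: mabsB.
  + by apply: measurable_patch => //; exact: mabsB.
  + move=> x _; rewrite /h !patchE; case: ifP => // _; by rewrite subrr abse0.
have [M [M0 gM]] : exists M : R, 0 <= M /\ forall x, `|h x| <= M.
  have cI : compact (g p @` I).
    apply: continuous_compact; last exact: segment_compact.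
    by apply: continuous_subspaceT => x; exact: cg.
  have [M [Mr MH]] := compact_bounded cI.
  exists (`|M| + 1); split; first by rewrite addr_ge0.
  move=> x; rewrite /h patchE; case: ifPn => [xI|_]; last by rewrite normr0 addr_ge0.
  by apply: MH; [rewrite (le_lt_trans (ler_norm _))// ltrDl|exists x => //; rewrite inE in xI].
have hc : (shift_norm h (a k) @[k --> \oo] --> 0)%E.
  (* The support of [h] enlarged by 1: outside it both [h x] and [h (x + a)] vanish once
     [|a| <= 1]. *)
  pose J := `[- (m%:R + 1), m%:R + 1]%classic : set R.
  have [K _ HK] : \forall k \near \oo, `|a k| <= 1 by apply: (cvgr0_norm_le _ a0).
  rewrite -(cvg_shiftn K) /=.
  apply: (@ge0_dominated_cvg0 _ _ _ mu _ (fun x => (2 * M * \1_J x)%:E)) => //.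
  - by move=> k; apply: mabsB => //; exact: mshift.
  - rewrite (_ : (fun x => _) = fun x => ((2 * M)%:E * (\1_J x)%:E)%E) //.
    apply: integrableZl => //; apply: integrable_indic_lty; first exact: measurable_itv.
    exact: lebesgue_itv_lty.
  - apply: aeW => x k; rewrite abse_EFin lee_fin indicE.
    case: (boolP (x \in J)) => xJ.
      rewrite mulr1 (le_trans (ler_normB _ _))// mulr_natl mulr2n lerD//.
    rewrite mulr0.
    have := HK (k + K)%N (leq_addl _ _) => /=; rewrite ler_norml => /andP[ak1 ak2].
    have xNI y : `|y - x| <= 1 -> h y = 0.
      move=> yx; rewrite /h patchE ifN//; apply: contra xJ.
      rewrite !inE /I /J /= !in_itv/= => /andP[h1 h2].
      by move: yx; rewrite ler_norml => /andP[h3 h4]; apply/andP; split; lra.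
    rewrite !xNI ?subrr ?normr0 ?normr_le0//.
    by rewrite addrC addKr ler_norml ak1 ak2.
  (* [h] may jump at the end points of the interval; these form a null set. *)
  - have : {ae mu, forall x : R, x != - m%:R /\ x != m%:R}.
      exists [set - m%:R; m%:R]; split.
      + exact: measurableU.
      + by apply: countable_lebesgue_measure0; apply: finite_set_countable; exact: finite_set2.
      + move=> x /=; case: (eqVneq x (- m%:R)) => [->|h1]; first by left.
        by case: (eqVneq x m%:R) => [->|h2 []]; [right|].
    apply: ae_imply => x [x1 x2].
    apply/fine_cvgP; split; first by near=> k.
    apply/cvgrPdist_lt => d d0.
    have : h (x + a (k + K)%N) @[k --> \oo] --> h x.
      have aK0 : a (k + K)%N @[k --> \oo] --> 0 by rewrite cvg_shiftn.
      have [xm|] := ltP `|x| m%:R.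
        have hE y : `|y| < m%:R -> h y = g p y.
          move=> ym; rewrite /h patchE ifT//; apply/mem_set; rewrite /I/= in_itv/=.
          by rewrite -ler_norml ltW.
        rewrite (hE x xm).
        have : g p (x + a (k + K)%N) @[k --> \oo] --> g p x.
          apply: (@cvg_comp _ _ _ (fun k => x + a (k + K)%N) (g p) _ (nbhs x)); last exact: cg.
          have : x + a (k + K)%N @[k --> \oo] --> x + 0 by apply: cvgD => //; exact: cvg_cst.
          by rewrite addr0.
        apply: cvg_trans; apply: near_eq_cvg; near=> k.
        rewrite hE// (le_lt_trans (ler_normD _ _))// -ltrBrDl.
        by near: k; apply: (@cvgr0_norm_lt _ _ _ _ _ _ aK0); rewrite subr_gt0.
      move=> mx; have {}mx : m%:R < `|x|.
        rewrite lt_neqAle mx andbT; apply/eqP => E.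
        have [x0|x0] := leP 0 x; first by move: x2; rewrite E ger0_norm// eqxx.
        by move: x1; rewrite E ltr0_norm// opprK eqxx.
      have hE y : m%:R < `|y| -> h y = 0.
        move=> ym; rewrite /h patchE ifN//; apply/negP; rewrite inE /I/= in_itv/=.
        by rewrite -ler_norml leNgt ym.
      rewrite (hE x mx).
      have : (fun _ : nat => 0 : R) k @[k --> \oo] --> (0 : R) by exact: cvg_cst.
      apply: cvg_trans; apply: near_eq_cvg; near=> k.
      rewrite hE//.
      have : `|a (k + K)%N| < `|x| - m%:R.
        by near: k; apply: (@cvgr0_norm_lt _ _ _ _ _ _ aK0); rewrite subr_gt0.
      have := lerB_normD x (a (k + K)%N); lra.
    move=> /cvgrPdist_lt/(_ d d0); apply: filterS => k /=.
    by rewrite sub0r normrN normr_id distrC.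
near=> k.
apply: (le_trans (shift_norm_approx (a k) mf mh)).
have -> : e = (e6 + e6) + ((e6 + e6) + (e6 + e6)) by rewrite /e6; field.
rewrite EFinD; apply: leeD.
  by apply: ltW; near: k; apply: cvge0_lt => //; exact: addr_gt0.
by rewrite EFinD; apply: leeD.
Unshelve. all: by end_near. Qed.

End L1_shift1.

Section L1_shift.
Variable R : realType.
Local Notation leb n := (lebesgue_rV R n).

Lemma measurable_rV_shift n (c : 'rV[R]_n) : mfunT (fun x : 'rV[R]_n => x + c).
Proof.
rewrite (_ : (fun x => _) = fun x => 1 *: x + c); first exact: measurable_rV_affine.
by apply/funext => x; rewrite scale1r.
Qed.

Lemma integrable_rVS n (f : 'rV[R]_n.+1 -> R) : integrableT (leb n.+1) f ->
  (mu \x leb n)%E.-integrable setT (fun z => (f (cons_rV z))%:E).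
Proof.
move=> /integrableP[mf foo]; apply/integrableP; split.
  exact: (measurableT_comp mf (@measurable_cons_rV R n)).
move: foo; rewrite ge0_integral_rVS//; last exact: measurableT_comp.
rewrite fubini_tonelli1//; apply: measurableT_comp => //.
exact: (measurableT_comp mf (@measurable_cons_rV R n)).
Qed.

Lemma measurable_normB d (T : measurableType d) (f g : T -> R) :
  mfunT f -> mfunT g ->
  mfunT (fun x => `|(f x - g x)%:E|%E).
Proof.
by move=> mf mg; apply/measurable_EFinP; apply: measurableT_comp => //; exact: measurable_funB.
Qed.

Lemma ge0_le_integralD d (T : measurableType d) (m : {measure set T -> \bar R})
    (f g h : T -> \bar R) :
  mfunT f -> mfunT g -> mfunT h ->
  (forall x, 0 <= f x)%E -> (forall x, 0 <= g x)%E -> (forall x, 0 <= h x)%E ->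
  (forall x, f x <= g x + h x)%E ->
  (\int[m]_x f x <= \int[m]_x g x + \int[m]_x h x)%E.
Proof.
move=> mf mg mh f0 g0 h0 fgh; rewrite -ge0_integralD//.
by apply: ge0_le_integral => //; exact: emeasurable_funD.
Qed.

(* Induction on the dimension: a translation is the composition of a translation
   along the first coordinate and of one along the others; Tonelli's theorem
   and dominated convergence on the remaining variables conclude. *)
Lemma L1_shift_cvg n (f : 'rV[R]_n -> R) (h : nat -> 'rV[R]_n) :
  integrableT (leb n) f ->
  (forall i, h k ord0 i @[k --> \oo] --> (0 : R)) ->
  (\int[leb n]_x `|(f (x + h k) - f x)%:E|)%E @[k --> \oo] --> 0%E.
Proof.
elim: n f h => [f h fi h0|n IH f h fi h0].
  rewrite (_ : (fun k => _) = cst 0%E); first exact: cvg_cst.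
  apply/funext => k; apply: integral0_eq => x _.
  rewrite (_ : x + h k = x) ?subrr ?abse0//; by apply/rowP => -[].
have mf : mfunT f by exact: measurable_L1 fi.
have fi2 := integrable_rVS fi.
pose a k := h k ord0 ord0; pose w k := tail_rV (h k).
have hE k z v : cons_rV (z, v) + h k = cons_rV (z + a k, v + w k).
  by rewrite -[in LHS](cons_rVK (h k)) cons_rVD.
pose F (z : R) (v : 'rV[R]_n) := f (cons_rV (z, v)).
pose TT : measurableType _ := (spacetime R n)%type.
have mF : mfunT (fun z : TT => F z.1 z.2).
  rewrite (_ : (fun z => _) = f \o @cons_rV R n); last by apply/funext => -[].
  exact: (measurableT_comp mf (@measurable_cons_rV R n)).
have msh (c : R) (u : 'rV[R]_n) : mfunT (fun z : TT => (z.1 + c, z.2 + u) : TT).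
  apply/measurable_fun_pairP; split => /=.
    by apply: measurable_funD => //; exact: measurable_fst.
  exact: (measurableT_comp (measurable_rV_shift u) measurable_snd).
have mFs (c : R) (u : 'rV[R]_n) : mfunT (fun z : TT => F (z.1 + c) (z.2 + u)).
  exact: (measurableT_comp mF (msh c u)).
have mFv (u : 'rV[R]_n) : mfunT (fun z : TT => F z.1 (z.2 + u)).
  by have := mFs 0 u; rewrite (_ : (fun z : TT => _) = fun z : TT => F z.1 (z.2 + u))//; apply/funext => z; rewrite addr0.
have mFz (c : R) : mfunT (fun z : TT => F (z.1 + c) z.2).
  by have := mFs c 0; rewrite (_ : (fun z : TT => _) = fun z : TT => F (z.1 + c) z.2)//; apply/funext => z; rewrite addr0.
have m1 z : mfunT (F z).
  exact: (measurableT_comp mf (measurable_pair_cons z)).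
have m2 v : mfunT (F ^~ v).
  exact: (measurableT_comp mF (measurable_pair2 v)).
pose A k := (\int[mu]_z \int[leb n]_v `|(F z (v + w k) - F z v)%:E|)%E.
pose B k := (\int[leb n]_v \int[mu]_z `|(F (z + a k)%R v - F z v)%:E|)%E.
have mA k : mfunT (fun z : measurableTypeR R => \int[leb n]_v `|(F z (v + w k) - F z v)%:E|)%E.
  exact: (ge0_measurable_integral (leb n) (measurable_normB (mFv (w k)) mF) (fun _ => abse_ge0 _)).
have swap (G : TT -> TT) : mfunT G ->
    mfunT (fun z : 'rV[R]_n * measurableTypeR R => G (z.2, z.1)).
  move=> mG; apply: (measurableT_comp mG).
  by apply/measurable_fun_pairP; split; [exact: measurable_snd|exact: measurable_fst].
have mswap : mfunT (fun z : 'rV[R]_n * measurableTypeR R => (z.2, z.1) : TT).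
  by apply/measurable_fun_pairP; split; [exact: measurable_snd|exact: measurable_fst].
have mB k : mfunT (fun v => \int[mu]_z `|(F (z + a k)%R v - F z v)%:E|)%E.
  have := ge0_measurable_integral mu (measurableT_comp (measurable_normB (mFz (a k)) mF) mswap) (fun _ => abse_ge0 _).
  exact.
have bound k : (\int[leb n.+1]_x `|(f (x + h k) - f x)%:E| <= A k + B k)%E.
  have mfs : mfunT (fun x : 'rV[R]_n.+1 => `|(f (x + h k) - f x)%:E|%E).
    by apply: measurable_normB => //; exact: (measurableT_comp mf (measurable_rV_shift (h k))).
  rewrite ge0_integral_rVS//.
  (* The shift of the first coordinate is undone by invariance, so the increment in the other
     coordinates may be taken at the shifted first coordinate. *)
  have -> : A k = (\int[mu]_z \int[leb n]_v `|(F (z + a k)%R (v + w k) - F (z + a k)%R v)%:E|)%E.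
    rewrite /A -[LHS](@ge0_integral_affine1 R 1 (a k)) ?oner_eq0//.
    - by rewrite normr1 mul1e; apply: eq_integral => z _; rewrite mul1r.
    - exact: mA.
    - by move=> x; exact: integral_ge0.
  have -> : B k = (\int[mu]_z \int[leb n]_v `|(F (z + a k)%R v - F z v)%:E|)%E.
    exact/esym/(ge0_fubini (leb n) mu (measurable_normB (mFz (a k)) mF) (fun _ => abse_ge0 _)).
  apply: ge0_le_integralD.
  - exact: (ge0_measurable_integral (leb n) (measurableT_comp mfs (@measurable_cons_rV R n)) (fun _ => abse_ge0 _)).
  - exact: (ge0_measurable_integral (leb n) (measurable_normB (mFs (a k) (w k)) (mFz (a k))) (fun _ => abse_ge0 _)).
  - exact: (ge0_measurable_integral (leb n) (measurable_normB (mFz (a k)) mF) (fun _ => abse_ge0 _)).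
  - by move=> z; exact: integral_ge0.
  - by move=> z; exact: integral_ge0.
  - by move=> z; exact: integral_ge0.
  move=> z; apply: ge0_le_integralD => //.
  - exact: (measurableT_comp mfs (measurable_pair_cons z)).
  - by apply: measurable_normB => //; exact: (measurableT_comp (m1 _) (measurable_rV_shift (w k))).
  - exact: measurable_normB.
  - by move=> v; rewrite hE /F !abse_EFin -EFinD lee_fin ler_distD.
have /integrable12ltyP foo12 := fi2; have /integrable21ltyP foo21 := fi2.
have mF2 : mfunT (fun z : TT => (f (cons_rV z))%:E) by exact: measurable_int fi2.
have {}foo12 := foo12 mF2; have {}foo21 := foo21 mF2.
have A0 : A k @[k --> \oo] --> 0%E.
  apply: (@ge0_dominated_cvg0 R _ _ mu _ (fun z => \int[leb n]_v `|(F z v)%:E| + \int[leb n]_v `|(F z v)%:E|)%E).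
  - exact: mA.
  - by move=> k x; exact: integral_ge0.
  - have I : mu.-integrable setT (fun z => \int[leb n]_v `|(F z v)%:E|)%E.
      apply/integrableP; split.
        exact: (ge0_measurable_integral (leb n) (measurableT_comp (@abse_measurable R setT) mF2) (fun _ => abse_ge0 _)).
      by under eq_integral do rewrite gee0_abs ?integral_ge0//.
    exact: integrableD.
  - apply: aeW => z k.
    have -> : (\int[leb n]_v `|(F z v)%:E| + \int[leb n]_v `|(F z v)%:E| =
       \int[leb n]_v `|(F z (v + w k))%:E| + \int[leb n]_v `|(F z v)%:E|)%E.
      congr (_ + _)%E; rewrite -[LHS](ge0_integral_shift (w k)) //.
      by apply/measurable_EFinP; exact: measurableT_comp.
    apply: ge0_le_integralD => //.
    + by apply: measurable_normB => //; exact: (measurableT_comp (m1 _) (measurable_rV_shift (w k))).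
    + apply/measurable_EFinP; apply: measurableT_comp => //; exact: (measurableT_comp (m1 _) (measurable_rV_shift (w k))).
    + by apply/measurable_EFinP; apply: measurableT_comp.
    + by move=> v; rewrite !abse_EFin -EFinD lee_fin ler_normB.
  - apply: ae_imply (ae_integrable1 fi2) => z Iz; apply: (IH (F z)) => //.
    by move=> i; rewrite (_ : (fun k => _) = fun k => h k ord0 (lift ord0 i)) //; apply/funext => k; rewrite mxE.
have B0 : B k @[k --> \oo] --> 0%E.
  apply: (@ge0_dominated_cvg0 R _ _ (leb n) _ (fun v => \int[mu]_z `|(F z v)%:E| + \int[mu]_z `|(F z v)%:E|)%E).
  - exact: mB.
  - by move=> k x; exact: integral_ge0.
  - have I : (leb n).-integrable setT (fun v => \int[mu]_z `|(F z v)%:E|)%E.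
      apply/integrableP; split.
        exact: (ge0_measurable_integral mu (measurableT_comp (measurableT_comp (@abse_measurable R setT) mF2) mswap) (fun _ => abse_ge0 _)).
      by under eq_integral do rewrite gee0_abs ?integral_ge0//.
    exact: integrableD.
  - apply: aeW => v k.
    have -> : (\int[mu]_z `|(F z v)%:E| + \int[mu]_z `|(F z v)%:E| =
       \int[mu]_z `|(F (z + a k)%R v)%:E| + \int[mu]_z `|(F z v)%:E|)%E.
      congr (_ + _)%E; rewrite -[LHS](@ge0_integral_affine1 R 1 (a k)) ?oner_eq0//.
      + by rewrite normr1 mul1e; apply: eq_integral => z _; rewrite mul1r.
      + by apply/measurable_EFinP; exact: measurableT_comp.
    have ms : mfunT (fun z : R => F (z + a k) v).
      apply: (measurableT_comp (m2 v)); exact: measurable_funD.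
    apply: ge0_le_integralD => //.
    + exact: (measurable_normB ms (m2 v)).
    + by apply/measurable_EFinP; apply: measurableT_comp.
    + by apply/measurable_EFinP; exact: (measurableT_comp (@normr_measurable R setT) (m2 v)).
    + by move=> z; rewrite !abse_EFin -EFinD lee_fin ler_normB.
  - apply: ae_imply (ae_integrable2 fi2) => v Iv; exact: (@L1_shift_cvg1 R (F ^~ v) a Iv (h0 ord0)).
apply: (@squeeze_cvge0 R _ (fun k => A k + B k)%E).
  by move=> k; rewrite bound integral_ge0.
by rewrite -[0%E]adde0; apply: cvgeD.
Qed.

End L1_shift.

(** * Fubini for real-valued integrals *)

Section real_fubini.
Context d1 d2 (T1 : measurableType d1) (T2 : measurableType d2) (R : realType).
Variables (m1 : {sigma_finite_measure set T1 -> \bar R}) (m2 : {sigma_finite_measure set T2 -> \bar R}).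
Local Notation m12 := (m1 \x m2)%E.
Implicit Types f : T1 * T2 -> R.

Lemma abse_fine_le (e : \bar R) : (`|(fine e)%:E| <= `|e|)%E.
Proof. by case: e => [r| |] //=; rewrite normr0 ?leey. Qed.

Lemma measurable_Rintegral2 f : mfunT f ->
  mfunT (fun y => \int[m1]_x f (x, y)).
Proof.
move=> mf; apply: (@measurable_Rintegral _ _ T2 T1 R m1 (fun z => f (z.2, z.1))).
by apply: (measurableT_comp mf); apply: measurable_fun_pair => //=; exact: measurable_snd.
Qed.

Lemma integrable_inner1 f : integrableT m12 f ->
  m1.-integrable setT (fun x => (\int[m2]_y f (x, y))%:E).
Proof.
move=> fI; have /measurable_EFinP mf := measurable_int _ fI.
apply: (le_integrable _ _ _ (integrable_fubini_F fI)) => //.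
- by apply/measurable_EFinP; exact: (measurable_Rintegral m2 mf).
- by move=> x _; exact: abse_fine_le.
Qed.

Lemma integrable_inner2 f : integrableT m12 f ->
  m2.-integrable setT (fun y => (\int[m1]_x f (x, y))%:E).
Proof.
move=> fI; have /measurable_EFinP mf := measurable_int _ fI.
have mF := measurable_Rintegral2 mf.
apply/integrableP; split; first exact/measurable_EFinP.
have mE := measurable_int _ fI.
apply: le_lt_trans (proj1 (integrable21ltyP m1 m2 mE) fI).
apply: ge0_le_integral => //.
- by apply: measurableT_comp => //; exact/measurable_EFinP.
- by apply: (@measurable_fun_fubini_tonelli_G _ _ _ _ _ m1 (abse \o (EFin \o f))) => [|x]; [exact: (measurableT_comp (@abse_measurable R setT) mE)|exact: abse_ge0].
- move=> y _; apply: (le_trans (abse_fine_le _)); apply: le_abse_integral => //.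
  by apply/measurable_EFinP; apply: (measurableT_comp mf); exact: measurable_pair2.
Qed.

(** Taking [fine] of the inner integrals can change them only where the section is not integrable,
    and this happens on a null set. *)
Lemma Rfubini1 f : integrableT m12 f ->
  \int[m1]_x \int[m2]_y f (x, y) = \int[m12]_z f z.
Proof.
move=> fI; rewrite /Rintegral -(integral12_prod_meas1 fI); congr fine.
apply: ae_eq_integral => //.
- exact: measurable_int (integrable_inner1 fI).
- exact: measurable_int (integrable_fubini_F fI).
- move: (ae_integrable1 fI); apply: ae_imply => x /integrable_fin_num h _.
  by rewrite fineK//; exact: (h measurableT).
Qed.

Lemma Rfubini2 f : integrableT m12 f ->
  \int[m2]_y \int[m1]_x f (x, y) = \int[m12]_z f z.
Proof.
move=> fI; rewrite /Rintegral -(integral21_prod_meas1 fI); congr fine.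
apply: ae_eq_integral => //.
- exact: measurable_int (integrable_inner2 fI).
- exact: measurable_fubini_G fI.
- move: (ae_integrable2 fI); apply: ae_imply => x /integrable_fin_num h _.
  by rewrite fineK//; exact: (h measurableT).
Qed.

Lemma Rfubini f : integrableT m12 f ->
  \int[m1]_x \int[m2]_y f (x, y) = \int[m2]_y \int[m1]_x f (x, y).
Proof. by move=> fI; rewrite Rfubini1// Rfubini2. Qed.

Lemma integrable_prod (a : T1 -> R) (c : T2 -> R) :
  integrableT m1 a -> integrableT m2 c ->
  m12.-integrable setT (fun z => (a z.1 * c z.2)%:E).
Proof.
move=> aI cI.
have /measurable_EFinP ma := measurable_int _ aI; have /measurable_EFinP mc := measurable_int _ cI.
have mac : mfunT (fun z : T1 * T2 => a z.1 * c z.2).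
  by apply: measurable_funM; [exact: (measurableT_comp ma measurable_fst)|exact: (measurableT_comp mc measurable_snd)].
apply/integrable12ltyP; first exact/measurable_EFinP.
under eq_integral => x _.
  under eq_integral => y _ do rewrite /= normrM EFinM.
  rewrite ge0_integralZl//; last by apply/measurable_EFinP; exact: measurableT_comp mc.
  over.
rewrite ge0_integralZr//; last 2 first.
- by apply/measurable_EFinP; exact: measurableT_comp ma.
- by apply: integral_ge0 => y _; rewrite lee_fin.
by rewrite lte_mul_pinfty//; [exact: integral_ge0|rewrite ge0_fin_numE//; [case/integrableP : aI|exact: integral_ge0]|case/integrableP : cI].
Qed.

Lemma le_integrable_prod f (a : T1 -> R) (c : T2 -> R) : mfunT f ->
  integrableT m1 a -> integrableT m2 c ->
  (forall x y, `|f (x, y)| <= a x * c y) ->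
  integrableT m12 f.
Proof.
move=> mf aI cI fac; apply: (le_integrable _ _ _ (integrable_prod aI cI)) => //.
  exact/measurable_EFinP.
by move=> [x y] _; rewrite /= lee_fin (le_trans (fac x y))// ler_norm.
Qed.

End real_fubini.

Section Rdominated.
Context d (T : measurableType d) (R : realType) (mu : {measure set T -> \bar R}).

Lemma Rdominated_cvg (F : nat -> T -> R) (f g : T -> R) :
  (forall k, mfunT (F k)) -> mfunT f ->
  integrableT mu g ->
  (forall k x, `|F k x| <= g x) ->
  {ae mu, forall x, F ^~ x @ \oo --> f x} ->
  (\int[mu]_x F k x) @[k --> \oo] --> \int[mu]_x f x.
Proof.
move=> mF mf gI Fg Ff.
have Ff' : {ae mu, forall x, setT x -> (F k x)%:E @[k --> \oo] --> (f x)%:E}.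
  by apply: ae_imply Ff => x h _; apply/fine_cvgP; split=> //; exact: nearW.
have [fI _ H] := @dominated_convergence _ T R mu setT measurableT (fun k x => (F k x)%:E) (EFin \o f) (EFin \o g)
  (fun k => (measurable_EFinP _ _).2 (mF k)) ((measurable_EFinP _ _).2 mf)
  Ff' gI (ae_imply (fun x _ k _ => Fg k x) Ff').
apply: fine_cvg; rewrite fineK//; exact: integrable_fin_num.
Qed.

End Rdominated.

(** * Smooth functions of one variable and their tensor products *)

Section smooth1.
Variable R : realType.
Implicit Types (f g : R -> R) (x a c : R) (p : {poly R}).

Lemma isdM f g x a c : is_derive x 1 f a -> is_derive x 1 g c ->
  is_derive x 1 (fun y => f y * g y) (f x * c + g x * a).
Proof. by move=> ? ?; exact: is_deriveM. Qed.

Lemma isdD f g x a c : is_derive x 1 f a -> is_derive x 1 g c ->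
  is_derive x 1 (fun y => f y + g y) (a + c).
Proof. by move=> ? ?; exact: is_deriveD. Qed.

Lemma isdV f x a : f x != 0 -> is_derive x 1 f a ->
  is_derive x 1 (fun y => (f y)^-1) (- f x ^- 2 * a).
Proof. by move=> ? ?; exact: is_deriveV. Qed.

Lemma isd_comp f g x a c : is_derive (g x) 1 f a -> is_derive x 1 g c ->
  is_derive x 1 (fun y => f (g y)) (a * c).
Proof. by move=> ? ?; exact: is_derive1_comp. Qed.

Lemma isd_affine a c x : is_derive x 1 (fun y => a * y + c) a.
Proof.
have h := isdD (isdM (is_derive_cst a x 1) (is_derive_id x (1 : R))) (is_derive_cst c x 1).
by move: h; rewrite mulr0 !addr0 mulr1.
Qed.

Lemma isd_derive1 f x a : is_derive x 1 f a -> (derive1 f) x = a.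
Proof. by move=> [fd fa]; rewrite derive1E. Qed.

Lemma isd_near f g x a : (\forall y \near x, f y = g y) ->
  is_derive x 1 f a -> is_derive x 1 g a.
Proof. exact: near_eq_is_derive. Qed.

(* the functions [p(1/x) exp(-1/x)], extended by [0] to the left of [0] *)
Definition flat_exp p x := if 0 < x then p.[x^-1] * expR (- x^-1) else 0.

Lemma poly_growth p : exists C (m : nat), 0 <= C /\ forall y, 1 <= y -> `|p.[y]| <= C * y ^+ m.
Proof.
elim/poly_ind: p => [|p c [C [m [C0 H]]]].
  by exists 0, 0%N; split => // y _; rewrite horner0 normr0 mul0r.
exists (C + `|c|), m.+1; split; first by rewrite addr_ge0.
move=> y y1; rewrite hornerMXaddC (le_trans (ler_normD _ _))// mulrDl lerD//.
  rewrite normrM exprSr mulrA (ger0_norm (le_trans ler01 y1)) ler_wpM2r ?H//.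
  exact: le_trans ler01 y1.
by rewrite ler_peMr// exprn_ege1.
Qed.

(** The Taylor term of order [m.+2] of exp(1/x) beats a polynomial of growth [m] in 1/x by two
    powers of x. The quadratic bound is what makes the difference quotient at 0 vanish. *)
Lemma flat_exp_bound p : exists C, 0 <= C /\ forall x, 0 < x -> x <= 1 -> `|flat_exp p x| <= C * x ^+ 2.
Proof.
have [C [m [C0 H]]] := poly_growth p.
exists (C * (m.+2)`!%:R); split; first by rewrite mulr_ge0.
move=> x x0 x1; rewrite /flat_exp x0 normrM (ger0_norm (expR_ge0 _)).
have xi1 : 1 <= x^-1 by rewrite invf_ge1.
have xi0 : 0 < x^-1 by rewrite invr_gt0.
rewrite (le_trans (ler_wpM2r (expR_ge0 _) (H _ xi1)))//.
rewrite -!mulrA ler_wpM2l// expRN.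
have := expR_ge1Dxn m.+1 (ltW xi0) => He.
have e0 := expR_gt0 x^-1.
rewrite ler_pdivrMr// exprVn.
have {}He : x^-1 ^+ m.+2 / (m.+2)`!%:R <= expR x^-1 by lra.
have -> : x ^- m = (m.+2)`!%:R * x ^+ 2 * (x^-1 ^+ m.+2 / (m.+2)`!%:R).
  have f0 : (m.+2)`!%:R != 0 :> R by rewrite pnatr_eq0 -lt0n fact_gt0.
  have x0' : x != 0 by rewrite gt_eqF.
  rewrite exprVn -[in X in _ ^- X]addn2 exprD; field.
  by rewrite f0 x0' expf_neq0.
by rewrite ler_wpM2l// mulr_ge0// exprn_ge0// ltW.
Qed.

(** With y = 1/x, the derivative of p(y) exp(-y) with respect to x is y^2 (p(y) - p'(y)) exp(-y),
    again of the same form. Only the point 0 needs the flatness estimate. *)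
Lemma flat_exp_derive p x : is_derive x 1 (flat_exp p) (flat_exp ('X ^+ 2 * (p - p^`())) x).
Proof.
have [x0|x0|->] := ltgtP x 0.
- rewrite /flat_exp ltNge (ltW x0)/=.
  apply: (isd_near (f := cst 0)).
  near=> y; rewrite ifF//; apply/negbTE; rewrite -leNgt ltW//.
  by near: y; apply: lt_nbhsl.
- apply: (isd_near (f := fun y => p.[y^-1] * expR (- y^-1))).
    near=> y; rewrite /flat_exp ifT//; near: y; exact: lt_nbhsr.
  rewrite /flat_exp x0.
  have xn0 : x != 0 by rewrite gt_eqF.
  have dV : is_derive x 1 (fun y => y^-1) (- x ^- 2).
    by have := isdV xn0 (is_derive_id x 1); rewrite mulr1.
  have d1 := isd_comp (is_derive_poly p x^-1) dV.
  have dN : is_derive x 1 (fun y => - y^-1) (x ^- 2).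
    by rewrite -[x ^- 2]opprK; exact: is_deriveN.
  have d2 := isd_comp (g := fun y => - y^-1) (is_derive_expR (- x^-1)) dN.
  have := isdM d1 d2.
  rewrite (_ : _ + _ = ('X ^+ 2 * (p - p^`())).[x^-1] * expR (- x^-1)) //.
  rewrite hornerM hornerXn hornerD hornerN exprVn; ring.
- have E0 : flat_exp p 0 = 0 by rewrite /flat_exp ltxx.
  rewrite [X in is_derive _ _ _ X](_ : _ = 0); last by rewrite /flat_exp ltxx.
  have [C [C0 H]] := flat_exp_bound p.
  have L : (fun h : R => h^-1 *: ((flat_exp p \o shift 0) (h *: 1) - flat_exp p 0)) @ 0^' --> (0 : R).
    apply/cvgrPdist_le => e e0; near=> h.
    rewrite sub0r normrN /= addr0 E0 subr0 [h *: 1]mulr1 normrZ.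
    have h0 : h != 0 by near: h; exact: nbhs_dnbhs_neq.
    have [hp|hn] := ltP 0 h; last by rewrite /flat_exp ltNge hn/= normr0 mulr0 ltW.
    have h1 : h <= 1.
      rewrite (le_trans (ler_norm _))//; near: h.
      apply: dnbhs0_le; exact: ltr01.
    rewrite normfV gtr0_norm// (le_trans (ler_wpM2l _ (H _ hp h1))) ?invr_ge0 ?ltW//.
    rewrite mulrC -mulrA expr2 mulfK//.
    have : `|h| <= e / (C + 1).
      by near: h; apply: dnbhs0_le; rewrite divr_gt0// ltr_wpDl.
    rewrite gtr0_norm// ler_pdivlMr ?ltr_wpDl// => hh.
    by rewrite (lt_le_trans _ hh)// mulrDr mulr1 mulrC ltrDl.
  by apply: DeriveDef; [apply/cvg_ex; exists 0|exact/cvg_lim].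
Unshelve. all: by end_near. Qed.

(* A class of smooth functions that is closed under differentiation. *)
Inductive SM : (R -> R) -> Prop :=
| SM_flat p : SM (flat_exp p)
| SM_cst c : SM (cst c)
| SM_id : SM id
| SM_cos : SM cos
| SM_sin : SM sin
| SM_atan : SM atan
| SM_add f g : SM f -> SM g -> SM (fun x => f x + g x)
| SM_mul f g : SM f -> SM g -> SM (fun x => f x * g x)
| SM_inv f : SM f -> (forall x, f x != 0) -> SM (fun x => (f x)^-1)
| SM_comp f a c : SM f -> SM (fun x => f (a * x + c)).

Lemma SM_is_derive f : SM f -> exists2 g, SM g & forall x, is_derive x 1 f (g x).
Proof.
elim => {f}.
- by move=> p; exists (flat_exp ('X ^+ 2 * (p - p^`()))); [exact: SM_flat|exact: flat_exp_derive].
- by move=> c; exists (cst 0); [exact: SM_cst|move=> x; exact: is_derive_cst].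
- by exists (cst 1); [exact: SM_cst|move=> x; exact: is_derive_id].
- exists (fun x => -1 * sin x); first by apply: SM_mul; [exact: SM_cst|exact: SM_sin].
  by move=> x; rewrite mulN1r; exact: is_derive_cos.
- by exists cos; [exact: SM_cos|move=> x; exact: is_derive_sin].
- exists (fun x => (1 + x * x)^-1); last by move=> x; exact: is_derive1_atan.
  apply: SM_inv => [|x]; last by rewrite gt_eqF// ltr_pwDl// -expr2 sqr_ge0.
  by apply: SM_add; [exact: SM_cst|apply: SM_mul; exact: SM_id].
- move=> f g fS [f' f'S df] gS [g' g'S dg].
  by exists (fun x => f' x + g' x); [exact: SM_add|move=> x; exact: isdD].
- move=> f g fS [f' f'S df] gS [g' g'S dg].
  exists (fun x => f x * g' x + g x * f' x); last by move=> x; exact: isdM.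
  by apply: SM_add; exact: SM_mul.
- move=> f fS [f' f'S df] f0.
  exists (fun x => (-1 * ((f x)^-1 * (f x)^-1)) * f' x).
    by do ![apply: SM_mul|apply: SM_inv|exact: SM_cst|by []].
  move=> x; have := isdV (f0 x) (df x).
  by rewrite -exprVn expr2 mulN1r.
- move=> f a c fS [f' f'S df].
  exists (fun x => f' (a * x + c) * a).
    by apply: SM_mul; [exact: SM_comp|exact: SM_cst].
  move=> x; exact: (isd_comp (df _) (isd_affine a c x)).
Qed.

Lemma SM_derive1 f : SM f -> SM (derive1 f).
Proof.
move=> /SM_is_derive[g gS df]; rewrite (_ : (derive1 f) = g)//.
by apply/funext => x; exact: isd_derive1.
Qed.

Lemma SM_isd f x : SM f -> is_derive x 1 f ((derive1 f) x).
Proof. by move=> /SM_is_derive[g gS df]; rewrite (isd_derive1 (df x)). Qed.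

Lemma SM_derivable f x : SM f -> derivable f x 1.
Proof. by move=> /(SM_isd x)[]. Qed.

Lemma SM_continuous f : SM f -> continuous f.
Proof.
by move=> fS x; apply: differentiable_continuous; apply/derivable1_diffP; exact: SM_derivable.
Qed.

Lemma SM_measurable f : SM f -> mfunT f.
Proof. by move=> fS; apply: continuous_measurable_fun; exact: SM_continuous. Qed.

(** A smooth passage from 0 to 1 over [[-1, 1]], symmetric about (0, 1/2). The symmetry makes [bell]
    even and [theta] odd. *)
Definition smoothstep x := flat_exp 1 (1 + x) / (flat_exp 1 (1 + x) + flat_exp 1 (1 - x)).

Lemma flat_exp1_ge0 x : 0 <= flat_exp 1 x.
Proof. by rewrite /flat_exp; case: ifP => // _; rewrite hornerC mul1r expR_ge0. Qed.

Lemma flat_exp1_gt0 x : 0 < x -> 0 < flat_exp 1 x.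
Proof. by rewrite /flat_exp => ->; rewrite hornerC mul1r expR_gt0. Qed.

Lemma flat_exp_le0 p x : x <= 0 -> flat_exp p x = 0.
Proof. by rewrite /flat_exp leNgt => /negbTE ->. Qed.

Lemma smoothstep_den x : 0 < flat_exp 1 (1 + x) + flat_exp 1 (1 - x).
Proof.
have [x0|x0] := leP 0 x.
  by rewrite ltr_pwDl ?flat_exp1_ge0// flat_exp1_gt0//; lra.
by rewrite ltr_wpDl ?flat_exp1_ge0// flat_exp1_gt0//; lra.
Qed.

Lemma SM_smoothstep : SM smoothstep.
Proof.
rewrite (_ : smoothstep = fun x => flat_exp 1 (1 * x + 1) *
  (flat_exp 1 (1 * x + 1) + flat_exp 1 (-1 * x + 1))^-1); last first.
  by apply/funext => x; rewrite /smoothstep mul1r mulN1r ![_ + 1]addrC.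
apply: SM_mul; first by apply: SM_comp; exact: SM_flat.
apply: SM_inv.
  by apply: SM_add; apply: SM_comp; exact: SM_flat.
by move=> x; rewrite mul1r mulN1r ![_ + 1]addrC gt_eqF// smoothstep_den.
Qed.

Lemma smoothstep0 x : x <= -1 -> smoothstep x = 0.
Proof. by move=> x1; rewrite /smoothstep flat_exp_le0 ?mul0r//; lra. Qed.

Lemma smoothstep1 x : 1 <= x -> smoothstep x = 1.
Proof.
move=> x1; rewrite /smoothstep [flat_exp 1 (1 - x)]flat_exp_le0 ?addr0; last by lra.
by rewrite divff// gt_eqF// flat_exp1_gt0//; lra.
Qed.

Lemma smoothstepN x : smoothstep (- x) = 1 - smoothstep x.
Proof.
rewrite /smoothstep opprK [flat_exp 1 (1 - x) + _]addrC; field.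
by rewrite gt_eqF// smoothstep_den.
Qed.

Lemma smoothstep_ge0 x : 0 <= smoothstep x.
Proof. by rewrite /smoothstep divr_ge0 ?flat_exp1_ge0// ltW// smoothstep_den. Qed.

Lemma smoothstep_le1 x : smoothstep x <= 1.
Proof. by have := smoothstep_ge0 (- x); rewrite smoothstepN subr_ge0. Qed.

Definition Cc (M : R) f := SM f /\ forall x, M < `|x| -> f x = 0.

Lemma Cc_derive1 M f : Cc M f -> Cc M (derive1 f).
Proof.
move=> [fS f0]; split; first exact: SM_derive1.
move=> x xM; apply: isd_derive1; apply: (isd_near (f := cst 0)).
near=> y; rewrite f0//; near: y.
by apply: (@cvgr_norm_gt R R R (nbhs x)); [exact: cvg_id|].
Unshelve. all: by end_near. Qed.

Lemma Cc_bounded M f : Cc M f -> exists2 C, 0 <= C & forall x, `|f x| <= C.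
Proof.
move=> [fS f0].
have cI : compact (f @` `[- M, M]).
  apply: continuous_compact; last exact: segment_compact.
  by apply: continuous_subspaceT => x; exact: SM_continuous.
have [C [Cr CH]] := compact_bounded cI.
exists (`|C| + 1); first by rewrite addr_ge0.
move=> x; have [xM|xM] := leP `|x| M; last by rewrite f0// normr0 addr_ge0.
apply: CH; first by rewrite (le_lt_trans (ler_norm _))// ltrDl.
by exists x => //=; rewrite in_itv/= -ler_norml.
Qed.

Lemma Cc_integrable M f : Cc M f -> integrableT (@lebesgue_measure R) f.
Proof.
move=> fC; have [C C0 fb] := Cc_bounded fC.
have fm := SM_measurable fC.1.
apply: (@le_integrable _ (measurableTypeR R) _ (@lebesgue_measure R) _ measurableT (EFin \o f)
  (fun x => C%:E * (\1_(`[- M, M]%classic : set R) x)%:E)%E).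
- exact/measurable_EFinP.
- move=> x _; rewrite -EFinM !abse_EFin lee_fin normrM (ger0_norm C0) indicE.
  have [xM|xM] := leP `|x| M; last by rewrite (fC.2 _ xM) normr0 mulr_ge0.
  by rewrite mem_set ?normr1 ?mulr1//= in_itv/= -ler_norml.
- apply: integrableZl => //; apply: integrable_indic_lty; first exact: measurable_itv.
  exact: lebesgue_itv_lty.
Qed.

Lemma Cc_le M M' f : M <= M' -> Cc M f -> Cc M' f.
Proof. by move=> MM [fS f0]; split => // x xM; apply: f0; exact: le_lt_trans xM. Qed.

Lemma Cc_Rintegral M M' f : M <= M' -> Cc M f ->
  \int[@lebesgue_measure R]_x f x = \int[@lebesgue_measure R]_(x in `[- M', M']) f x.
Proof.
move=> MM fC; rewrite [RHS]Rintegral_mkcond; apply: eq_Rintegral => x _.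
rewrite patchE; case: ifPn => //; rewrite notin_setE/= in_itv/= -ler_norml => /negP.
by rewrite -ltNge => xM; rewrite (Cc_le MM fC).2.
Qed.

Lemma SM_Rintegral_derive1 f (a c : R) : a < c -> SM f ->
  \int[@lebesgue_measure R]_(x in `[a, c]) (derive1 f) x = f c - f a.
Proof.
move=> ac fS; rewrite /Rintegral (@continuous_FTC2 _ _ f)//.
- by apply: continuous_subspaceT => x; exact/SM_continuous/SM_derive1.
- split.
  + by move=> x _; exact: SM_derivable.
  + by apply: cvg_at_right_filter; exact: SM_continuous.
  + by apply: cvg_at_left_filter; exact: SM_continuous.
Qed.

Lemma Rintegral_affine1 (a c : R) f : a != 0 -> mfunT f ->
  `|a| * \int[@lebesgue_measure R]_x f (a * x + c) = \int[@lebesgue_measure R]_x f x.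
Proof.
move=> a0 mf; have mf' : mfunT (EFin \o f) by exact/measurable_EFinP.
rewrite /Rintegral -[in RHS]/(fine (\int[@lebesgue_measure R]_x (EFin \o f) x)%E).
have a0' : 0 < `|a| by rewrite normr_gt0.
have fineM e : fine (`|a|%:E * e)%E = `|a| * fine e.
  by case: e => [r||] //=; rewrite ?gt0_muley ?gt0_muleNy ?lte_fin// mulr0.
rewrite [in RHS]integralE.
rewrite -(ge0_integral_affine1 c a0 (measurable_funepos mf'))//.
rewrite -(ge0_integral_affine1 c a0 (measurable_funeneg mf'))//.
rewrite -gt0_muleBr// fineM [in LHS]integralE; congr (_ * fine _).
by congr (_ - _)%E; apply: eq_integral => x _; rewrite ?funeposE ?funenegE.
Qed.

Definition bell := derive1 smoothstep.
(** A primitive of [bell x - bell (x / 2) / 2], the difference of two mollifiers at scales 1 and 2.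
    It is compactly supported because both have mass one, and odd, hence of mean zero. *)
Definition theta x := smoothstep x - smoothstep (x / 2).

Lemma bell_Cc : Cc 1 bell.
Proof.
split; first exact/SM_derive1/SM_smoothstep.
move=> x x1; apply: isd_derive1.
have [x0|x0] := leP 0 x.
  rewrite ger0_norm// in x1.
  apply: (isd_near (f := cst 1)).
  near=> y; rewrite smoothstep1//; apply: ltW; near: y; exact: lt_nbhsr.
rewrite ltr0_norm// ltrNr in x1.
apply: (isd_near (f := cst 0)).
near=> y; rewrite smoothstep0//; apply: ltW; near: y; exact: lt_nbhsl.
Unshelve. all: by end_near. Qed.

Lemma bellN x : bell (- x) = bell x.
Proof.
have dS (y : R) : is_derive y 1 smoothstep (bell y) by exact/SM_isd/SM_smoothstep.
have d1 : is_derive x 1 (fun y => smoothstep (-1 * y + 0)) (bell (-1 * x + 0) * -1).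
  exact: (isd_comp (dS _) (isd_affine _ _ x)).
have d2 : is_derive x 1 (fun y => (-1) * smoothstep y + 1) (-1 * bell x).
  have := isd_comp (isd_affine (-1) 1 (smoothstep x)) (dS x); exact.
have E : (fun y => smoothstep (-1 * y + 0)) = fun y => (-1) * smoothstep y + 1.
  by apply/funext => y; rewrite mulN1r addr0 smoothstepN mulN1r addrC.
have := isd_derive1 d1; rewrite E (isd_derive1 d2) mulN1r addr0 mulrN1 mulN1r.
by move=> /oppr_inj ->.
Qed.

Lemma Rintegral_bell : \int[@lebesgue_measure R]_x bell x = 1.
Proof.
rewrite (Cc_Rintegral (lexx 1) bell_Cc) SM_Rintegral_derive1; last exact: SM_smoothstep.
  by rewrite smoothstep1// smoothstep0// subr0.
by rewrite ltrNl (lt_trans _ ltr01)// ltrN10.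
Qed.

Lemma theta_Cc : Cc 2 theta.
Proof.
split.
  rewrite (_ : theta = fun x => smoothstep x + (cst (-1) x) * smoothstep (2^-1 * x + 0)).
    apply: SM_add; first exact: SM_smoothstep.
    by apply: SM_mul; [exact: SM_cst|apply: SM_comp; exact: SM_smoothstep].
  by apply/funext => x; rewrite /theta/= mulN1r addr0 [x / 2]mulrC.
move=> x x2; rewrite /theta; have [x0|x0] := leP 0 x.
  by rewrite ger0_norm// in x2; rewrite !smoothstep1 ?subrr//; lra.
by rewrite ltr0_norm// in x2; rewrite !smoothstep0 ?subrr//; lra.
Qed.

Lemma thetaN x : theta (- x) = - theta x.
Proof. by rewrite /theta mulNr !smoothstepN; ring. Qed.

Lemma Rintegral_theta : \int[@lebesgue_measure R]_x theta x = 0.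
Proof.
have mt : mfunT theta by apply: SM_measurable; case: theta_Cc.
have E : \int[@lebesgue_measure R]_x theta x = - \int[@lebesgue_measure R]_x theta x.
  have N1 : (-1 : R) != 0 by rewrite oppr_eq0 oner_eq0.
  rewrite -{1}(Rintegral_affine1 0 N1 mt) normrN1 mul1r -[RHS]mulN1r.
  rewrite -RintegralZl//; last exact: (Cc_integrable theta_Cc).
  by apply: eq_Rintegral => x _; rewrite addr0 !mulN1r thetaN.
lra.
Qed.

Lemma theta_derive1 x : derive1 theta x = bell x - bell (x / 2) / 2.
Proof.
have dS (y : R) : is_derive y 1 smoothstep (bell y) by exact/SM_isd/SM_smoothstep.
apply: isd_derive1.
have d2 : is_derive x 1 (fun y => smoothstep (2^-1 * y + 0)) (bell (2^-1 * x + 0) * 2^-1).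
  exact: (isd_comp (dS _) (isd_affine _ _ x)).
rewrite (_ : theta = fun x => smoothstep x + (-1) * smoothstep (2^-1 * x + 0)); last first.
  by apply/funext => y; rewrite /theta/= mulN1r addr0 [y / 2]mulrC.
rewrite (_ : _ - _ = bell x + (-1) * (bell (2^-1 * x + 0) * 2^-1)); last first.
  by rewrite addr0 [x / 2]mulrC mulN1r.
have := isdD (dS x) (isdM (is_derive_cst (-1 : R) x 1) d2).
by rewrite mulr0 addr0.
Qed.

End smooth1.

(** * Smooth products of functions of linear forms *)

Section smoothV.
Variables (R : realType) (V : normedModType R).

Definition deriv_closed (F : (R -> R) -> Prop) :=
  (forall f, F f -> exists2 g, F g & forall x : R, is_derive x 1 f (g x)) /\
  (forall a f, F f -> F (fun x => a * f x)).

Definition linform (l : V -> R) :=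
  (forall x, differentiable l x) /\ (forall v x, 'D_v l x = l v).

(** Linear combinations of products with exactly one factor for each form in the list. The list is
    an index of the family because every term of the Leibniz rule has the same forms. *)
Inductive tens (F : (R -> R) -> Prop) : seq (V -> R) -> (V -> R) -> Prop :=
| tens_nil : tens F [::] (cst 1)
| tens_cons c l ls f : F c -> tens F ls f -> tens F (l :: ls) (fun x => c (l x) * f x)
| tens_add ls f g : tens F ls f -> tens F ls g -> tens F ls (fun x => f x + g x)
| tens_scale a ls f : tens F ls f -> tens F ls (fun x => a * f x).

Lemma tens_derive F ls f : deriv_closed F -> (forall l, List.In l ls -> linform l) ->
  tens F ls f -> (forall x, differentiable f x) /\ (forall v, tens F ls ('D_v f)).
Proof.
move=> [Fd Fs] + ft; elim: ft => {ls f}.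
- move=> _; split; first by move=> x; exact: differentiable_cst.
  move=> v; rewrite (_ : 'D_v _ = (fun x : V => (0 : R) * cst (1 : R) x)); first by apply: tens_scale; exact: tens_nil.
  by apply/funext => x; rewrite derive_cst mul0r.
- move=> c l ls f Fc ft IH lin.
  have [df tf] := IH (fun l' h => lin l' (or_intror h)).
  have [dl Dl] := lin l (or_introl erefl).
  have [c' Fc' dc] := Fd c Fc.
  have dcl x : differentiable (fun x => c (l x)) x.
    apply: (@differentiable_comp _ _ _ _ l c); first exact: dl.
    by apply/derivable1_diffP; case: (dc (l x)).
  have Dcl v x : 'D_v (fun x => c (l x)) x = l v * c' (l x).
    rewrite deriveE//.
    have dcx : differentiable c (l x) by apply/derivable1_diffP; case: (dc (l x)).
    have -> : 'd (fun x0 => c (l x0)) x = 'd c (l x) \o 'd l x :> (V -> R).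
      exact: (diff_comp (dl x) dcx).
    have E : 'd l x v = l v by rewrite -(deriveE v (dl x)) Dl.
    rewrite /= E.
    rewrite (_ : l v = l v *: (1 : R)); last by rewrite /GRing.scale/= mulr1.
    by rewrite linearZ/= -deriveE//; case: (dc (l x)) => _ ->; rewrite /GRing.scale/= mulr1.
  split; first by move=> x; exact: differentiableM.
  move=> v.
  rewrite (_ : 'D_v _ = fun x : V => (l v * c' (l x)) * f x + c (l x) * 'D_v f x).
    apply: tens_add; last by apply: tens_cons => //; exact: tf.
    by apply: (tens_cons l (Fs (l v) c' Fc')).
  apply/funext => x; have := deriveM (diff_derivable (v := v) (dcl x)) (diff_derivable (v := v) (df x)).
  move=> E; apply: etrans E _; rewrite Dcl /GRing.scale/= addrC mulrC; congr (_ + _).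
- move=> ls f g ft IHf gt IHg lin.
  have [df tf] := IHf lin; have [dg tg] := IHg lin.
  split; first by move=> x; exact: differentiableD.
  move=> v; rewrite (_ : 'D_v _ = fun x : V => 'D_v f x + 'D_v g x); first exact: tens_add.
  by apply/funext => x; exact: (deriveD (diff_derivable (df x)) (diff_derivable (dg x))).
- move=> a ls f ft IHf lin.
  have [df tf] := IHf lin.
  split; first by move=> x; apply: (@differentiableZ _ _ _ f a x).
  move=> v; rewrite (_ : 'D_v _ = fun x : V => a * 'D_v f x); first exact: tens_scale.
  by apply/funext => x; exact: (deriveZ a (diff_derivable (df x))).
Qed.

Lemma tens_smooth F ls f : deriv_closed F -> (forall l, List.In l ls -> linform l) ->
  tens F ls f -> smooth f.
Proof.
move=> FC lin ft vs; suff : tens F ls (iter_derive vs f).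
  by move=> /(tens_derive FC lin)[].
elim: vs => //= v vs /(tens_derive FC lin)[_]; exact.
Qed.

Lemma tens_prod F (I : Type) (s : seq I) (u : I -> R -> R) (l : I -> V -> R) :
  (forall i, F (u i)) -> tens F [seq l i | i <- s] (fun x => \prod_(i <- s) u i (l i x)).
Proof.
move=> Fu; elim: s => [|i s IH] /=.
  rewrite (_ : (fun x => _) = cst 1); first exact: tens_nil.
  by apply/funext => x; rewrite big_nil.
rewrite (_ : (fun x => _) = fun x => u i (l i x) * \prod_(i <- s) u i (l i x)).
  exact: tens_cons.
by apply/funext => x; rewrite big_cons.
Qed.

(* A directional derivative is the derivative of a function of one variable. *)
Lemma derive_line (f : V -> R) v x d :
  is_derive (0 : R) 1 (fun h : R => f (h *: v + x)) d -> 'D_v f x = d.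
Proof.
move=> [_ <-]; rewrite /derive.
suff -> : (fun h : R => h^-1 *: ((f \o shift x) (h *: v) - f x)) =
  (fun h : R => h^-1 *: (((fun h0 : R => f (h0 *: v + x)) \o shift 0) (h *: (1 : R)) - f (0 *: v + x))) by [].
apply/funext => h /=; rewrite scale0r add0r addr0.
by rewrite (_ : h *: (1 : R) = h) // /GRing.scale/= mulr1.
Qed.

End smoothV.

Section forms.
Variables (R : realType) (n : nat).

Lemma linform_coord (i : 'I_n) : linform (fun x : 'rV[R]_n => x ord0 i).
Proof.
split=> [x|v x]; first exact: differentiable_coord.
apply: derive_line.
rewrite (_ : (fun h => _) = fun h : R => v ord0 i * h + x ord0 i); first exact: isd_affine.
by apply/funext => h; rewrite !mxE mulrC.
Qed.

Let lin_cont (l : {linear (R * 'rV[R]_n)%type -> R}) : continuous l ->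
  linform l.
Proof.
move=> lc; have dl x : differentiable l x by exact: linear_differentiable.
by split=> // v x; rewrite deriveE// diff_lin.
Qed.

Lemma linform_fst : linform (fun z : R * 'rV[R]_n => z.1).
Proof.
have @f : {linear (R * 'rV[R]_n)%type -> R}.
  by exists (fun z : R * 'rV[R]_n => z.1); do 2![eexists]; do ?[constructor].
rewrite (_ : (fun _ => _) = f)//; apply: lin_cont; by move=> z; exact: cvg_fst.
Qed.

Lemma linform_snd (i : 'I_n) : linform (fun z : R * 'rV[R]_n => z.2 ord0 i).
Proof.
have @f : {linear (R * 'rV[R]_n)%type -> R}.
  by exists (fun z : R * 'rV[R]_n => z.2 ord0 i); do 2![eexists]; do ?[constructor];
     rewrite ?mxE// => ? *; rewrite ?mxE//; move=> ?; rewrite !mxE.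
rewrite (_ : (fun _ => _) = f)//; apply: lin_cont => z.
apply: (@continuous_comp _ _ _ snd (fun x : 'rV[R]_n => x ord0 i)); first exact: cvg_snd.
exact: coord_continuous.
Qed.

Lemma SM_closed : deriv_closed (@SM R).
Proof.
split; first exact: SM_is_derive.
by move=> a f fS; apply: SM_mul => //; exact: SM_cst.
Qed.

Lemma compact_support_sub (V : normedModType R) (f : V -> R) (K : set V) :
  closed K -> compact K -> (forall x, f x != 0 -> K x) ->
  compact (support_of f) /\ support_of f `<=` K.
Proof.
move=> cK kK fK; have sK : support_of f `<=` K.
  by rewrite /support_of closureE; apply: smallest_sub.
split => //; apply: (subclosed_compact _ kK sK); exact: closed_closure.
Qed.

Definition cube (r : R) : set 'rV[R]_n := [set x | forall i, `|x ord0 i| <= r].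

Lemma cube_compact r : compact (cube r).
Proof.
rewrite (_ : cube r = [set v : 'rV[R]_n | forall i, `[- r, r]%classic (v ord0 i)]).
  by apply: (rV_compact (A := fun=> `[- r, r]%classic)) => i; exact: segment_compact.
by apply/seteqP; split => x /= h i; have := h i; rewrite in_itv/= -ler_norml.
Qed.

Lemma cube_shift_compact r (c : 'rV[R]_n) : compact [set x | cube r (x - c)].
Proof.
rewrite (_ : [set x | _] = (fun x => x + c) @` cube r).
  apply: continuous_compact; last exact: cube_compact.
  apply: continuous_subspaceT => x.
  by apply: (@continuousD _ _ _ (fun y : 'rV[R]_n => y) (cst c) x); [move=> A|exact: cst_continuous].
apply/seteqP; split => [x h|_ [x h <-]] /=; last by rewrite addrK.
by exists (x - c) => //; rewrite subrK.
Qed.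

Lemma rV_hausdorff : hausdorff_space 'rV[R]_n.
Proof. exact: norm_hausdorff. Qed.

(* Products of functions of one variable give all the test functions needed. *)
Lemma test_prod (u : 'I_n -> R -> R) (r : R) (c : 'rV[R]_n) (A : set 'rV[R]_n) :
  (forall i, SM (u i)) -> (forall i x, r < `|x - c ord0 i| -> u i x = 0) ->
  (forall x, cube r (x - c) -> A x) ->
  test_function A (fun x : 'rV[R]_n => \prod_(i < n) u i (x ord0 i)).
Proof.
move=> uS u0 cA.
have [|||sc sK] := @compact_support_sub _ (fun x : 'rV[R]_n => \prod_(i < n) u i (x ord0 i)) [set x | cube r (x - c)].
- apply: compact_closed; [exact: rV_hausdorff|exact: cube_shift_compact].
- exact: cube_shift_compact.
- move=> x; apply: contraNP => xc; apply/eqP.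
  have [i xi] : exists i, r < `|x ord0 i - c ord0 i|.
    apply: contrapT => /forallNP H; apply: xc => i; rewrite !mxE leNgt; exact/negP/H.
  by rewrite (bigD1 i)//= u0// mul0r.
split => //; last by move=> x /sK/cA.
have := @tens_prod R _ (@SM R) _ (index_enum 'I_n) u (fun i (x : 'rV[R]_n) => x ord0 i) uS.
apply: tens_smooth; first exact: SM_closed.
elim: (index_enum _) => //= i s IH l [<-|]; [exact: linform_coord|exact: IH].
Qed.

Lemma test_prod_time (al : R -> R) (a a' : R) (u : 'I_n -> R -> R) (r : R) (c : 'rV[R]_n) (t0 t1 : R) :
  SM al -> (forall s, ~~ (a <= s <= a') -> al s = 0) -> t0 < a -> a' < t1 ->
  (forall i, SM (u i)) -> (forall i x, r < `|x - c ord0 i| -> u i x = 0) ->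
  test_function (strip t0 t1) (fun z : R * 'rV[R]_n => al z.1 * \prod_(i < n) u i (z.2 ord0 i)).
Proof.
move=> aS a0 ta ta' uS u0.
pose K : set (R * 'rV[R]_n) := `[a, a']%classic `*` [set x | cube r (x - c)].
have cK : compact K by apply: compact_setX; [exact: segment_compact|exact: cube_shift_compact].
have [|||sc sK] := @compact_support_sub _ (fun z : R * 'rV[R]_n => al z.1 * \prod_(i < n) u i (z.2 ord0 i)) K.
- apply: compact_closed => //; exact: norm_hausdorff.
- done.
- move=> z z0; split => /=.
    rewrite in_itv/=; apply: contraNT z0 => /a0 ->; by rewrite mul0r.
  move: z0; apply: contraNP => xc; apply/eqP.
  have [i xi] : exists i, r < `|z.2 ord0 i - c ord0 i|.
    apply: contrapT => /forallNP H; apply: xc => i; rewrite !mxE leNgt; exact/negP/H.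
  by rewrite (bigD1 i)//= u0// mul0r mulr0.
split => //; last first.
  move=> z /sK[/=]; rewrite in_itv/= => /andP[h1 h2] _; split => //=.
  by rewrite in_itv/= (lt_le_trans ta h1) (le_lt_trans h2 ta').
have tp := @tens_prod R _ (@SM R) _ (index_enum 'I_n) u (fun i (z : R * 'rV[R]_n) => z.2 ord0 i) uS.
have := tens_cons (fun z : R * 'rV[R]_n => z.1) aS tp.
apply: tens_smooth; first exact: SM_closed.
move=> l /= [<-|]; first exact: linform_fst.
elim: (index_enum _) => //= i s IH [<-|]; [exact: linform_snd|exact: IH].
Qed.

Lemma isd_shift (f : R -> R) x : SM f -> is_derive (0 : R) 1 (fun h => f (1 * h + x)) (derive1 f x).
Proof.
move=> fS; have d := SM_isd (1 * 0 + x) fS.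
have := @isd_comp R f (fun h => 1 * h + x) 0 _ _ d (isd_affine 1 x 0).
by rewrite mulr0 add0r mulr1.
Qed.

Lemma derive_time (al : R -> R) (P : 'rV[R]_n -> R) z : SM al ->
  'D_(1, 0) (fun z : R * 'rV[R]_n => al z.1 * P z.2) z = derive1 al z.1 * P z.2.
Proof.
move=> aS; apply: derive_line.
have := isdM (isd_shift z.1 aS) (is_derive_cst (P z.2) (0 : R) (1 : R)).
rewrite mulr0 add0r [P _ * _]mulrC.
congr (is_derive _ _ _ _); apply/funext => h /=.
by rewrite scaler0 add0r [h *: 1]mulr1 mul1r.
Qed.

Lemma derive_space (a : R -> R) (u : 'I_n -> R -> R) (j : 'I_n) z : (forall i, SM (u i)) ->
  'D_(0, basis_rV R j) (fun z : R * 'rV[R]_n => a z.1 * \prod_(i < n) u i (z.2 ord0 i)) z =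
  a z.1 * \prod_(i < n) (if i == j then derive1 (u i) else u i) (z.2 ord0 i).
Proof.
move=> uS; apply: derive_line.
pose C := a z.1 * \prod_(i < n | i != j) u i (z.2 ord0 i).
have := isdM (isd_shift (z.2 ord0 j) (uS j)) (is_derive_cst C (0 : R) (1 : R)).
rewrite mulr0 add0r.
rewrite (_ : C * _ = a z.1 * \prod_(i < n) (if i == j then derive1 (u i) else u i) (z.2 ord0 i)); last first.
  rewrite [in RHS](bigD1 j)//= eqxx /C mulrC mulrCA; congr (_ * (_ * _)).
  by apply: eq_bigr => i /negbTE ->.
congr (is_derive _ _ _ _); apply/funext => h /=.
rewrite scaler0 add0r [in RHS](bigD1 j)//= /C mulrCA.
rewrite /basis_rV !mxE !eqxx mulr1 mul1r; congr (_ * (_ * _)).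
apply: eq_bigr => i /negbTE ij; by rewrite !mxE ij /= mulr0 add0r.
Qed.

End forms.

(** * The Fourier transform in one variable *)

Section fourier1.
Variable R : realType.
Implicit Types (u v : R -> R) (M xi x : R).

(** [Fc] and [Fs] are the real and imaginary parts of the transform with the positive sign in the
    exponent, the convention of [inv_fourier]. Keeping them real gives access to real calculus. *)
Definition Fc u xi := \int[mu]_x (cos (2 * pi * (x * xi)) * u x).
Definition Fs u xi := \int[mu]_x (sin (2 * pi * (x * xi)) * u x).

Lemma SM_cosl xi : SM (fun x : R => cos (2 * pi * (x * xi))).
Proof.
rewrite (_ : (fun x => _) = fun x : R => cos ((2 * pi * xi) * x + 0)).
  by apply: SM_comp; exact: SM_cos.
by apply/funext => x; congr cos; ring.
Qed.

Lemma SM_sinl xi : SM (fun x : R => sin (2 * pi * (x * xi))).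
Proof.
rewrite (_ : (fun x => _) = fun x : R => sin ((2 * pi * xi) * x + 0)).
  by apply: SM_comp; exact: SM_sin.
by apply/funext => x; congr sin; ring.
Qed.

Lemma Cc_mul M (f u : R -> R) : SM f -> Cc M u -> Cc M (fun x => f x * u x).
Proof.
move=> fS [uS u0]; split; first exact: SM_mul.
by move=> x /u0 ->; rewrite mulr0.
Qed.

Lemma Cc_scale M a u : Cc M u -> Cc M (fun x => a * u x).
Proof. by apply: Cc_mul; exact: SM_cst. Qed.

Lemma Cc_Rintegral_derive1 M u : Cc M u -> \int[mu]_x derive1 u x = 0.
Proof.
move=> uC; pose M' := `|M| + 1.
have MM : M <= M' by rewrite (le_trans (ler_norm _))// lerDl.
have M0 : 0 < M' by rewrite ltr_wpDl.
have MM1 : M < M' by rewrite (le_lt_trans (ler_norm _))// ltrDl.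
rewrite (Cc_Rintegral MM (Cc_derive1 uC)) SM_Rintegral_derive1 ?(proj1 uC)//; last 2 first.
- by rewrite gtrN.
- exact: (proj1 uC).
by rewrite !(proj2 uC) ?subrr// ?normrN gtr0_norm//.
Qed.

Lemma Cc_integrable_norm M u : Cc M u -> integrableT mu (fun x => `|u x|).
Proof. by move=> /Cc_integrable; exact: integrable_norm. Qed.

Lemma Rint_cos_le M u xi (c : R -> R) : Cc M u -> SM c -> (forall x, `|c x| <= 1) ->
  `|\int[mu]_x (c x * u x)| <= \int[mu]_x `|u x|.
Proof.
move=> uC cS c1; have cuC := Cc_mul cS uC.
rewrite (le_trans (le_normr_Rintegral _ (Cc_integrable cuC)))//.
apply: le_Rintegral => //.
- exact: (Cc_integrable_norm cuC).
- exact: (Cc_integrable_norm uC).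
- by move=> x _; rewrite normrM ler_piMl.
Qed.

Lemma cos_norm1 x : `|cos x| <= 1.
Proof. by rewrite ler_norml cos_geN1 cos_le1. Qed.

Lemma sin_norm1 x : `|sin x| <= 1.
Proof. by rewrite ler_norml sin_geN1 sin_le1. Qed.

Lemma Fc_bound M u : Cc M u -> exists2 C, 0 <= C & forall xi, `|Fc u xi| <= C /\ `|Fs u xi| <= C.
Proof.
move=> uC; exists (\int[mu]_x `|u x|); first exact: Rintegral_ge0.
move=> xi; split; apply: (Rint_cos_le xi uC).
- exact: SM_cosl.
- by move=> x; exact: cos_norm1.
- exact: SM_sinl.
- by move=> x; exact: sin_norm1.
Qed.

Lemma isd_cosl xi x : is_derive x 1 (fun x : R => cos (2 * pi * (x * xi)))
  (- (2 * pi * xi) * sin (2 * pi * (x * xi))).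
Proof.
have := @isd_comp R cos (fun y => 2 * pi * xi * y + 0) x _ _ (is_derive_cos (2 * pi * xi * x + 0)) (isd_affine (2 * pi * xi) 0 x).
rewrite (_ : 2 * pi * xi * x + 0 = 2 * pi * (x * xi)); last by ring.
rewrite (_ : - sin _ * _ = - (2 * pi * xi) * sin (2 * pi * (x * xi))); last by ring.
congr (is_derive _ _ _ _); apply/funext => y; congr cos; ring.
Qed.

Lemma isd_sinl xi x : is_derive x 1 (fun x : R => sin (2 * pi * (x * xi)))
  ((2 * pi * xi) * cos (2 * pi * (x * xi))).
Proof.
have := @isd_comp R sin (fun y => 2 * pi * xi * y + 0) x _ _ (is_derive_sin (2 * pi * xi * x + 0)) (isd_affine (2 * pi * xi) 0 x).
rewrite (_ : 2 * pi * xi * x + 0 = 2 * pi * (x * xi)); last by ring.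
rewrite (_ : cos _ * _ = (2 * pi * xi) * cos (2 * pi * (x * xi))); last by ring.
congr (is_derive _ _ _ _); apply/funext => y; congr sin; ring.
Qed.

Lemma RintD_Cc M u v : Cc M u -> Cc M v ->
  \int[mu]_x (u x + v x) = \int[mu]_x u x + \int[mu]_x v x.
Proof. by move=> uC vC; apply: RintegralD => //; [exact: (Cc_integrable uC)|exact: (Cc_integrable vC)]. Qed.

Lemma RintZ_Cc M a u : Cc M u -> \int[mu]_x (a * u x) = a * \int[mu]_x u x.
Proof. by move=> uC; apply: RintegralZl => //; exact: (Cc_integrable uC). Qed.

Lemma Fc_derive1 M u xi : Cc M u -> Fc (derive1 u) xi = 2 * pi * xi * Fs u xi.
Proof.
move=> uC; have uC' := Cc_derive1 uC.
have := Cc_Rintegral_derive1 (Cc_mul (SM_cosl xi) uC).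
rewrite (_ : derive1 _ = fun x => cos (2 * pi * (x * xi)) * derive1 u x +
    (- (2 * pi * xi)) * (sin (2 * pi * (x * xi)) * u x)); last first.
  apply/funext => x; have := isdM (isd_cosl xi x) (SM_isd x uC.1).
  by move=> /isd_derive1 ->; congr (_ + _); ring.
rewrite (RintD_Cc (Cc_mul (SM_cosl xi) uC') (Cc_scale _ (Cc_mul (SM_sinl xi) uC))).
rewrite (RintZ_Cc _ (Cc_mul (SM_sinl xi) uC)) -/(Fc _ _) -/(Fs _ _); lra.
Qed.

Lemma Fs_derive1 M u xi : Cc M u -> Fs (derive1 u) xi = - (2 * pi * xi * Fc u xi).
Proof.
move=> uC; have uC' := Cc_derive1 uC.
have := Cc_Rintegral_derive1 (Cc_mul (SM_sinl xi) uC).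
rewrite (_ : derive1 _ = fun x => sin (2 * pi * (x * xi)) * derive1 u x +
    (2 * pi * xi) * (cos (2 * pi * (x * xi)) * u x)); last first.
  apply/funext => x; have := isdM (isd_sinl xi x) (SM_isd x uC.1).
  by move=> /isd_derive1 ->; congr (_ + _); ring.
rewrite (RintD_Cc (Cc_mul (SM_sinl xi) uC') (Cc_scale _ (Cc_mul (SM_cosl xi) uC))).
rewrite (RintZ_Cc _ (Cc_mul (SM_cosl xi) uC)) -/(Fc _ _) -/(Fs _ _); lra.
Qed.

(** Each derivative of [u] yields a factor [2 * pi * xi] and exchanges the cosine and sine
    transforms, so both have to be carried through the induction. *)
Lemma Fc_decay M u k : Cc M u -> exists2 C, 0 <= C &
  forall xi, `|xi| ^+ k * `|Fc u xi| <= C /\ `|xi| ^+ k * `|Fs u xi| <= C.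
Proof.
elim: k u => [u uC|k IH u uC].
  have [C C0 H] := Fc_bound uC; exists C => // xi; rewrite expr0 !mul1r; exact: H.
have [C C0 H] := IH _ (Cc_derive1 uC).
have pi0 : 0 < 2 * pi :> R by rewrite mulr_gt0// pi_gt0.
exists (C / (2 * pi)); first by rewrite divr_ge0// ltW.
move=> xi; have [H1 H2] := H xi.
rewrite (Fc_derive1 _ uC) in H1; rewrite (Fs_derive1 _ uC) in H2.
by split; rewrite ler_pdivlMr// exprS;
  [move: H2; rewrite normrN|move: H1]; rewrite !normrM (gtr0_norm (pi_gt0 R)) (gtr0_norm (ltr0n R 2))
    => h; apply: le_trans h; rewrite le_eqVlt; apply/orP; left; apply/eqP; ring.
Qed.

Let ae_dom M u : Cc M u -> integrableT mu (fun x => `|2 * pi * x * u x|).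
Proof.
move=> uC; have lC : SM (fun x : R => 2 * pi * x).
  by apply: SM_mul; [exact: SM_cst|exact: SM_id].
exact: (Cc_integrable_norm (Cc_mul lC uC)).
Qed.

Lemma Fc_isd M u xi : Cc M u -> is_derive xi 1 (Fc u) (Fs (fun x => (- (2 * pi)) * x * u x) xi).
Proof.
move=> uC.
have d (x z : R) : is_derive z 1 (fun z : R => cos (2 * pi * (x * z)) * u x) (sin (2 * pi * (x * z)) * (- (2 * pi) * x * u x)).
  have := isdM (isd_cosl x z) (is_derive_cst (u x) z (1 : R)).
  rewrite mulr0 add0r (_ : u x * _ = sin (2 * pi * (x * z)) * (- (2 * pi) * x * u x)); last by rewrite [z * x]mulrC; ring.
  by congr (is_derive _ _ _ _); apply/funext => y; rewrite [y * x]mulrC.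
pose f (z x : R) := cos (2 * pi * (x * z)) * u x.
have If z : `]xi - 1, xi + 1[%classic z -> integrableT mu (f z).
  by move=> _; exact: (Cc_integrable (Cc_mul (SM_cosl z) uC)).
have Df z x : `]xi - 1, xi + 1[%classic z -> [set: R] x -> derivable (f ^~ x) z 1.
  by move=> _ _; case: (d x z).
have Gf z x : `]xi - 1, xi + 1[%classic z -> [set: R] x -> `|partial1of2 f z x| <= `|2 * pi * x * u x|.
  move=> _ _; rewrite /partial1of2 (isd_derive1 (d x z)) normrM.
  by rewrite !mulNr normrN ler_piMl// sin_norm1.
have Ix : `]xi - 1, xi + 1[%classic xi by rewrite /= in_itv/=; apply/andP; split; lra.
apply: DeriveDef.
  by apply: (derivable_under_integral measurableT Ix If Df _ (ae_dom uC) Gf).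
rewrite -derive1E (differentiation_under_integral measurableT Ix If Df _ (ae_dom uC) Gf)//.
by apply: eq_Rintegral => x _; rewrite /partial1of2 (isd_derive1 (d x xi)).
Qed.

Lemma Fs_isd M u xi : Cc M u -> is_derive xi 1 (Fs u) (Fc (fun x => 2 * pi * x * u x) xi).
Proof.
move=> uC.
have d (x z : R) : is_derive z 1 (fun z : R => sin (2 * pi * (x * z)) * u x) (cos (2 * pi * (x * z)) * (2 * pi * x * u x)).
  have := isdM (isd_sinl x z) (is_derive_cst (u x) z (1 : R)).
  rewrite mulr0 add0r (_ : u x * _ = cos (2 * pi * (x * z)) * (2 * pi * x * u x)); last by rewrite [z * x]mulrC; ring.
  by congr (is_derive _ _ _ _); apply/funext => y; rewrite [y * x]mulrC.
pose f (z x : R) := sin (2 * pi * (x * z)) * u x.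
have If z : `]xi - 1, xi + 1[%classic z -> integrableT mu (f z).
  by move=> _; exact: (Cc_integrable (Cc_mul (SM_sinl z) uC)).
have Df z x : `]xi - 1, xi + 1[%classic z -> [set: R] x -> derivable (f ^~ x) z 1.
  by move=> _ _; case: (d x z).
have Gf z x : `]xi - 1, xi + 1[%classic z -> [set: R] x -> `|partial1of2 f z x| <= `|2 * pi * x * u x|.
  move=> _ _; rewrite /partial1of2 (isd_derive1 (d x z)).
  by rewrite normrM ler_piMl// cos_norm1.
have Ix : `]xi - 1, xi + 1[%classic xi by rewrite /= in_itv/=; apply/andP; split; lra.
apply: DeriveDef.
  by apply: (derivable_under_integral measurableT Ix If Df _ (ae_dom uC) Gf).
rewrite -derive1E (differentiation_under_integral measurableT Ix If Df _ (ae_dom uC) Gf)//.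
by apply: eq_Rintegral => x _; rewrite /partial1of2 (isd_derive1 (d x xi)).
Qed.

(** Transforms of compactly supported smooth functions. Differentiating multiplies [u] by a multiple
    of x, which preserves the support; hence the class is closed and all its members decay
    rapidly. *)
Definition FT (f : R -> R) := exists M u, Cc M u /\ (f = Fc u \/ f = Fs u).

Lemma FT_closed : deriv_closed FT.
Proof.
have lS a : SM (fun x : R => a * x) by apply: SM_mul; [exact: SM_cst|exact: SM_id].
split.
- move=> f [M [u [uC [->|->]]]].
  + exists (Fs (fun x => (- (2 * pi)) * x * u x)); last by move=> x; exact: Fc_isd uC.
    by exists M, (fun x => - (2 * pi) * x * u x); split; [exact: Cc_mul|right].
  + exists (Fc (fun x => 2 * pi * x * u x)); last by move=> x; exact: Fs_isd uC.
    by exists M, (fun x => 2 * pi * x * u x); split; [exact: Cc_mul|left].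
- move=> a f [M [u [uC [->|->]]]]; exists M, (fun x => a * u x); split; try exact: Cc_scale; [left|right].
  + apply/funext => xi; rewrite -(RintZ_Cc _ (Cc_mul (SM_cosl xi) uC)).
    by apply: eq_Rintegral => x _; rewrite mulrCA.
  + apply/funext => xi; rewrite -(RintZ_Cc _ (Cc_mul (SM_sinl xi) uC)).
    by apply: eq_Rintegral => x _; rewrite mulrCA.
Qed.

Lemma FT_decay f k : FT f -> exists2 C, 0 <= C & forall xi, (1 + `|xi|) ^+ k * `|f xi| <= C.
Proof.
move=> [M [u [uC fE]]].
have [C C0 H] := Fc_bound uC; have [C' C0' H'] := Fc_decay k uC.
exists (2 ^+ k * (C + C')); first by rewrite mulr_ge0 ?addr_ge0.
move=> xi; have [h h'] : `|f xi| <= C /\ `|xi| ^+ k * `|f xi| <= C'.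
  by have [h1 h2] := H xi; have [h3 h4] := H' xi; case: fE => ->.
have [x1|x1] := leP `|xi| 1.
  apply: (@le_trans _ _ (2 ^+ k * `|f xi|)).
    by rewrite ler_wpM2r// lerXn2r ?nnegrE ?addr_ge0//; lra.
  by rewrite ler_wpM2l// ?exprn_ge0// (le_trans h)// lerDl.
apply: (@le_trans _ _ (2 ^+ k * (`|xi| ^+ k * `|f xi|))).
  rewrite mulrA -exprMn ler_wpM2r// lerXn2r ?nnegrE ?addr_ge0//.
  by lra.
by rewrite ler_wpM2l// ?exprn_ge0// (le_trans h')// lerDr.
Qed.

Lemma FT_continuous f : FT f -> continuous f.
Proof.
move=> fF x; apply: differentiable_continuous; apply/derivable1_diffP.
by have [Fd _] := FT_closed; have [g _ d] := Fd f fF; case: (d x).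
Qed.

Lemma FT_measurable f : FT f -> mfunT f.
Proof. by move=> fF; apply: continuous_measurable_fun; exact: FT_continuous. Qed.

Lemma integrable_oneDsqrV : mu.-integrable setT (fun x => ((1 + x ^+ 2)^-1)%:E).
Proof.
have p0 x : 0 <= (1 + x ^+ 2)^-1 :> R by rewrite invr_ge0 addr_ge0 ?sqr_ge0.
have cont : continuous (fun x : R => (1 + x ^+ 2)^-1).
  by move=> x; exact: (@continuous_oneDsqrV R x).
apply/integrableP; split.
  by apply/measurable_EFinP; exact: continuous_measurable_fun.
under eq_integral do rewrite gee0_abs ?lee_fin//.
rewrite ge0_symfun_integralT//; last by move=> x; rewrite /= sqrrN.
rewrite (_ : [set x | 0 <= x] = `[0, +oo[%classic); last first.
  by apply/seteqP; split => x /=; rewrite in_itv/= andbT.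
rewrite (@ge0_continuous_FTC2y _ _ (@atan R) 0 (pi / 2)).
- by rewrite -EFinB -EFinM ltry.
- by move=> x _.
- by apply: continuous_subspaceT => x; exact: cont.
- exact: cvgy_atan.
- by move=> x _; exact: derivable_atan.
- by apply: cvg_at_right_filter; exact: continuous_atan.
- by move=> x _; rewrite derive1_atan.
Qed.

Lemma FT_integrable f : FT f -> integrableT mu f.
Proof.
move=> fF; have [C C0 H] := FT_decay 2 fF.
apply: (@le_integrable _ (measurableTypeR R) _ mu _ measurableT (EFin \o f) (fun x => C%:E * ((1 + x ^+ 2)^-1)%:E)%E).
- by apply/measurable_EFinP; exact: FT_measurable.
- move=> x _; rewrite -EFinM !abse_EFin lee_fin.
  have x1 : 0 < 1 + x ^+ 2 by rewrite ltr_pwDl// sqr_ge0.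
  rewrite [leRHS]ger0_norm ?mulr_ge0 ?invr_ge0 ?(ltW x1)//.
  rewrite ler_pdivlMr// mulrC (le_trans _ (H x))// ler_wpM2r//.
  by rewrite sqrrD expr1n mul1r -normrX [`|x ^+ 2|]ger0_norm ?sqr_ge0// lerD2r lerDl mulrn_wge0.
- by apply: integrableZl => //; exact: integrable_oneDsqrV.
Qed.

(** The primitive is explicit, but the fundamental theorem on a half-line is applied to nonnegative
    integrands. So exp(-e x) (1 + cos(a x)) is integrated with primitive [F1 + F2], and the integral
    of exp(-e x) is subtracted. *)
Lemma damped_cos (e a : R) : 0 < e ->
  mu.-integrable `[0, +oo[ (EFin \o (fun x => expR (- (e * x)))) /\
  \int[mu]_(x in `[0, +oo[) (expR (- (e * x)) * cos (a * x)) = e / (e ^+ 2 + a ^+ 2).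
Proof.
move=> e0.
pose w x := expR (- (e * x)).
have dw (x : R) : is_derive x 1 w (- e * w x).
  have := @isd_comp R expR (fun x => - e * x + 0) x _ _ (is_derive_expR (- e * x + 0)) (isd_affine (- e) 0 x).
  rewrite addr0 [_ * - e]mulrC /w mulNr.
  rewrite -mulNr -/(w x) mulNr => h; rewrite mulNr; move: h.
  congr (is_derive _ _ _ _); [by apply/funext => y; rewrite addr0 mulNr|by rewrite mulNr].
pose den := e ^+ 2 + a ^+ 2.
have den0 : 0 < den by rewrite ltr_pwDl// ?exprn_gt0// sqr_ge0.
have dc x : is_derive x 1 (fun x => cos (a * x)) (- a * sin (a * x)).
  have := @isd_comp R cos (fun x => a * x + 0) x _ _ (is_derive_cos (a * x + 0)) (isd_affine a 0 x).
  rewrite addr0 (_ : - sin (a * x) * a = - a * sin (a * x)); last by ring.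
  by congr (is_derive _ _ _ _); apply/funext => y; rewrite addr0.
have ds x : is_derive x 1 (fun x => sin (a * x)) (a * cos (a * x)).
  have := @isd_comp R sin (fun x => a * x + 0) x _ _ (is_derive_sin (a * x + 0)) (isd_affine a 0 x).
  rewrite addr0 (_ : cos (a * x) * a = a * cos (a * x)); last by ring.
  by congr (is_derive _ _ _ _); apply/funext => y; rewrite addr0.
pose F1 x := w x * (- e^-1).
pose F2 x := w x * (a / den * sin (a * x) + - e / den * cos (a * x)).
have dF1 x : is_derive x 1 F1 (w x).
  have := isdM (dw x) (is_derive_cst (- e^-1) x (1 : R)).
  rewrite mulr0 add0r (_ : _ * (- e * w x) = w x)//.
  by rewrite /cst; field; rewrite gt_eqF.
have dF2 x : is_derive x 1 F2 (w x * cos (a * x)).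
  have d1 := isdM (is_derive_cst (a / den) x (1 : R)) (ds x).
  have d2 := isdM (is_derive_cst (- e / den) x (1 : R)) (dc x).
  have := isdM (dw x) (isdD d1 d2).
  rewrite (_ : _ + _ = w x * cos (a * x))//.
  by rewrite /cst /den; field; rewrite gt_eqF.
have wc : continuous w.
  by move=> x; apply: differentiable_continuous; apply/derivable1_diffP; case: (dw x).
have cc : continuous (fun x => cos (a * x)).
  by move=> x; apply: differentiable_continuous; apply/derivable1_diffP; case: (dc x).
have w0 : w x @[x --> +oo] --> 0.
  apply/cvgrPdist_le => d d0; near=> x.
  have x0 : 0 < x by near: x; exact: nbhs_pinfty_gt.
  rewrite sub0r normrN ger0_norm ?expR_ge0// /w expRN.
  have ex : (e * d)^-1 <= x by near: x; apply: nbhs_pinfty_ge; exact: num_real.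
  have := expR_ge1Dx (e * x) => h.
  rewrite -[d]invrK lef_pV2 ?posrE ?expR_gt0 ?invr_gt0// (le_trans _ h)//.
  apply: (@le_trans _ _ (e * x)); last by rewrite lerDr.
  by move: ex; rewrite invfM mulrC ler_pdivrMr// mulrC.
have F1l : F1 x @[x --> +oo] --> 0.
  by rewrite -[0](mul0r (- e^-1)); apply: cvgM => //; exact: cvg_cst.
have F2l : F2 x @[x --> +oo] --> 0.
  pose C := `|a / den| + `|- e / den|.
  have C0 : 0 <= C by rewrite addr_ge0.
  apply/cvgrPdist_le => d d0; near=> x.
  rewrite sub0r normrN /F2 normrM.
  have : `|w x| <= d / (C + 1).
    by near: x; apply: (cvgr0_norm_le _ w0); rewrite divr_gt0// ltr_wpDl.
  rewrite ler_pdivlMr ?ltr_wpDl// => h; rewrite (le_trans _ h)// ler_wpM2l//.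
  rewrite (le_trans (ler_normD _ _))// !normrM -/C.
  have h1 := cos_norm1 (a * x); have h2 := sin_norm1 (a * x).
  rewrite (@le_trans _ _ C)// ?lerDl//; apply: lerD; first by rewrite -!normrM normrM ler_piMr.
  by rewrite -!normrM normrM ler_piMr.
have fge0 x : 0 <= x -> 0 <= w x * (1 + cos (a * x)).
  by move=> _; rewrite mulr_ge0 ?expR_ge0//; have := cos_geN1 (a * x); lra.
have F1r : F1 x @[x --> 0^'+] --> F1 0.
  by apply: cvg_at_right_filter; apply: differentiable_continuous; apply/derivable1_diffP; case: (dF1 0).
have F2r : F2 x @[x --> 0^'+] --> F2 0.
  by apply: cvg_at_right_filter; apply: differentiable_continuous; apply/derivable1_diffP; case: (dF2 0).
have dd1 x : 0 < x -> derivable F1 x 1 by case: (dF1 x).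
have dd2 x : 0 < x -> derivable (fun x => F1 x + F2 x) x 1.
  by move=> _; have := isdD (dF1 x) (dF2 x); case.
have wcx : {within `[0, +oo[, continuous w} by apply: continuous_subspaceT => x; exact: wc.
have w0x x : 0 <= x -> 0 <= w x by move=> _; exact: expR_ge0.
have dE1 : {in `]0, +oo[, derive1 F1 =1 w} by move=> x _; exact: isd_derive1.
have I1 : \int[mu]_(x in `[0, +oo[) w x = 0 - F1 0.
  exact: (Rintegral_ge0_continuous_FTC2y w0x wcx F1l dd1 F1r dE1).
have I2 : \int[mu]_(x in `[0, +oo[) (w x * (1 + cos (a * x))) = 0 - (F1 0 + F2 0).
  apply: (@Rintegral_ge0_continuous_FTC2y _ _ (fun x => F1 x + F2 x) 0 0 fge0 _ _ dd2).
  - apply: continuous_subspaceT => x; apply: cvgM; first exact: wc.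
    by apply: cvgD; [exact: cvg_cst|exact: cc].
  - by rewrite -[0](addr0 0); exact: cvgD.
  - exact: cvgD.
  - move=> x _; have := isdD (dF1 x) (dF2 x) => /isd_derive1 ->.
    by rewrite mulrDr mulr1.
have intw : mu.-integrable `[0, +oo[ (EFin \o w).
  apply/integrableP; split.
    by apply: measurable_funTS; apply/measurable_EFinP; exact: continuous_measurable_fun.
  under eq_integral do rewrite gee0_abs ?lee_fin ?expR_ge0//.
  by rewrite (ge0_continuous_FTC2y w0x wcx F1l dd1 F1r dE1) -EFinB ltry.
have intwc : mu.-integrable `[0, +oo[ (EFin \o (fun x => w x * cos (a * x))).
  apply: (le_integrable _ _ _ intw) => //.
    by apply: measurable_funTS; apply/measurable_EFinP; apply: continuous_measurable_fun => x; apply: cvgM; [exact: wc|exact: cc].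
  by move=> x _ /=; rewrite lee_fin normrM ler_piMr// cos_norm1.
have : \int[mu]_(x in `[0, +oo[) (w x * (1 + cos (a * x))) =
  \int[mu]_(x in `[0, +oo[) w x + \int[mu]_(x in `[0, +oo[) (w x * cos (a * x)).
  rewrite -RintegralD//.
  by apply: eq_Rintegral => x _; rewrite mulrDr mulr1.
rewrite I1 I2 => H.
have -> : \int[mu]_(x in `[0, +oo[) (w x * cos (a * x)) = - F2 0 by lra.
split; first exact: intw.
rewrite /F2 /w mulr0 oppr0 expR0 mul1r mulr0 sin0 cos0 mulr0 add0r mulr1; ring.
Unshelve. all: by end_near. Qed.

End fourier1.

(** * Fourier inversion on the line by Abel summation *)

Section inversion1.
Variable R : realType.
Implicit Types (u v : R -> R) (M xi x : R).

Let expRN_cont (e : R) : continuous (fun x : R => expR (- (e * `|x|))).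
Proof.
move=> x; apply: (@continuous_comp _ _ _ (fun x : R => - (e * `|x|)) expR); last exact: continuous_expR.
by apply: cvgN; apply: cvgM; [exact: cvg_cst|exact: norm_continuous].
Qed.

Let cos_cont (a : R) : continuous (fun x : R => cos (a * x)).
Proof.
move=> x; apply: (@continuous_comp _ _ _ (fun x : R => a * x) cos); last exact: continuous_cos.
by apply: cvgM; [exact: cvg_cst|exact: cvg_id].
Qed.

Lemma fineM_gt0 (r : R) (x : \bar R) : 0 < r -> fine (r%:E * x) = r * fine x.
Proof.
move=> r0; case: x => [x| |] //=; first by rewrite gt0_muley ?lte_fin//= mulr0.
by rewrite gt0_muleNy ?lte_fin//= mulr0.
Qed.

Let half : [set x : R | 0 <= x] = `[0, +oo[%classic.
Proof. by apply/seteqP; split => x /=; rewrite in_itv/= andbT. Qed.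

Lemma damped_integrable (e : R) : 0 < e -> integrableT mu (fun x => expR (- (e * `|x|))).
Proof.
move=> e0; have [I _] := damped_cos 0 e0.
apply/integrableP; split.
  by apply/measurable_EFinP; apply: continuous_measurable_fun; exact: expRN_cont.
under eq_integral do rewrite gee0_abs ?lee_fin ?expR_ge0//.
rewrite ge0_symfun_integralT; last 3 first.
- by move=> x; exact: expR_ge0.
- exact: expRN_cont.
- by move=> x /=; rewrite normrN.
rewrite half lte_mul_pinfty ?lee_fin//.
move/integrableP : I => [_]; apply: le_lt_trans; rewrite le_eqVlt; apply/orP; left; apply/eqP.
apply: eq_integral => x; rewrite inE/= in_itv/= andbT => x0.
by rewrite (ger0_norm x0) ger0_norm ?expR_ge0.
Qed.

Lemma damped_cos_integrable (e a : R) : 0 < e ->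
  integrableT mu (fun x => expR (- (e * `|x|)) * cos (a * x)).
Proof.
move=> e0; apply: (@le_integrable _ (measurableTypeR R) _ mu _ measurableT _ _ _ _ (damped_integrable e0)).
  apply/measurable_EFinP; apply: measurable_funM; apply: continuous_measurable_fun.
    exact: expRN_cont.
  exact: cos_cont.
by move=> x _ /=; rewrite lee_fin normrM ler_piMr// cos_norm1.
Qed.

Lemma damped_cosT (e a : R) : 0 < e ->
  \int[mu]_x (expR (- (e * `|x|)) * cos (a * x)) = 2 * e / (e ^+ 2 + a ^+ 2).
Proof.
move=> e0; have [I H0] := damped_cos 0 e0.
(* Folding an even integrand onto the half-line is done for nonnegative functions, hence [1 + cos].
   The case [c = 0] then gives the integral of the exponential alone. *)
have G c : \int[mu]_x (expR (- (e * `|x|)) * (1 + cos (c * x))) = 2 * (e^-1 + e / (e ^+ 2 + c ^+ 2)).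
  have [_ H] := damped_cos c e0.
  have Ic : mu.-integrable `[0, +oo[ (EFin \o (fun x => expR (- (e * x)) * cos (c * x))).
    apply: (@le_integrable _ (measurableTypeR R) _ mu _ _ _ _ _ _ I) => //.
      apply: measurable_funTS; apply/measurable_EFinP; apply: measurable_funM; apply: continuous_measurable_fun.
        move=> x; apply: (@continuous_comp _ _ _ (fun x : R => - (e * x)) expR); last exact: continuous_expR.
        by apply: cvgN; apply: cvgM; [exact: cvg_cst|exact: cvg_id].
      exact: cos_cont.
    by move=> x _ /=; rewrite lee_fin normrM ler_piMr// cos_norm1.
  rewrite {1}/Rintegral ge0_symfun_integralT; last 3 first.
  - by move=> x; rewrite mulr_ge0 ?expR_ge0//; have := cos_geN1 (c * x); lra.
  - by move=> x; apply: cvgM; [exact: expRN_cont|apply: cvgD; [exact: cvg_cst|exact: cos_cont]].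
  - by move=> x /=; rewrite normrN mulrN cosN.
  rewrite half fineM_gt0//; congr (2 * _).
  rewrite (_ : e^-1 = \int[mu]_(x in `[0, +oo[) expR (- (e * x))); last first.
    move: H0; under eq_Rintegral do rewrite mul0r cos0 mulr1.
    by move=> ->; rewrite expr0n addr0; field; rewrite gt_eqF.
  rewrite -H -RintegralD//; apply: eq_Rintegral => x; rewrite inE/= in_itv/= andbT => x0.
  by rewrite (ger0_norm x0) mulrDr mulr1.
have Iw := damped_integrable e0.
have Iwc := damped_cos_integrable a e0.
have E0 : \int[mu]_x expR (- (e * `|x|)) = 2 / e.
  have := G 0; under eq_Rintegral do rewrite mul0r cos0.
  rewrite RintegralZr// expr0n/= addr0 (_ : e / e ^+ 2 = e^-1); first by lra.
  by field; rewrite gt_eqF.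
have := G a.
under eq_Rintegral do rewrite mulrDr mulr1.
by rewrite RintegralD// E0 mulrDr -[2 * e / _]mulrA => /addrI.
Qed.

Lemma poisson_kernelE (p e x : R) : 0 < p -> 0 < e ->
  p^-1 * ((1 + (2 * p / e * x) ^+ 2)^-1 * (2 * p / e)) = 2 * e / (e ^+ 2 + (2 * p * x) ^+ 2).
Proof.
move=> p0 e0; have en : e != 0 by rewrite gt_eqF.
have pn : p != 0 by rewrite gt_eqF.
have d0 : e ^+ 2 + (2 * p * x) ^+ 2 != 0 by rewrite gt_eqF// ltr_pwDl ?exprn_gt0// sqr_ge0.
have -> : 1 + (2 * p / e * x) ^+ 2 = (e ^+ 2 + (2 * p * x) ^+ 2) / e ^+ 2 by field.
by rewrite invf_div; field; rewrite pn d0 en.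
Qed.

(** The primitive of the Poisson kernel tends to the Heaviside step away from 0. *)
Lemma poisson_cvg (x : R) : x != 0 ->
  (atan (2 * pi * x / k.+1%:R^-1) / pi + 2^-1) @[k --> \oo] --> ((0 < x)%R%:R : R).
Proof.
move=> x0; have [pi0 pi0'] : 0 < pi :> R /\ pi != 0 :> R by rewrite pi_gt0 gt_eqF ?pi_gt0.
have hp : pi / 2 / pi = 2^-1 :> R by rewrite mulrAC divff// mul1r.
have H (y : R) : 0 < y -> (atan (2 * pi * y / k.+1%:R^-1)) @[k --> \oo] --> (pi / 2 : R).
  move=> y0; apply: (cvg_comp _ (@atan R)); last exact: cvgy_atan.
  apply/cvgryPge => B; near=> k; rewrite invrK.
  have : B / (2 * pi * y) <= k%:R by near: k; exact: nbhs_infty_ger.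
  rewrite ler_pdivrMr ?mulr_gt0// => h; apply: (le_trans h).
  by rewrite mulrC ler_wpM2l ?mulr_ge0// ?ltW// ?ltr_nat ?mulr_gt0.
have [x1|x1] := ltP 0 x.
  rewrite (_ : true%:R = pi / 2 / pi + 2^-1 :> R); last by rewrite hp mulr1n; lra.
  by apply: cvgD; [apply: cvgM; [exact: H|exact: cvg_cst]|exact: cvg_cst].
have xN : 0 < - x by rewrite oppr_gt0 lt_neqAle x0.
rewrite (_ : false%:R = - (pi / 2) / pi + 2^-1 :> R); last by rewrite mulNr hp mulr0n; lra.
apply: cvgD; last exact: cvg_cst.
apply: cvgM; last exact: cvg_cst.
have := cvgN (H _ xN).
suff -> : (fun k : nat => atan (2 * pi * x / k.+1%:R^-1)) = - (fun k : nat => atan (2 * pi * - x / k.+1%:R^-1)) by apply.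
by apply/funext => k; rewrite fctE -atanN; congr atan; ring.
Unshelve. all: by end_near. Qed.

(** The integral is damped by exp(-e |xi|). Fubini turns it into [v] tested on the Poisson kernel,
    and an integration by parts into minus the integral of [A k] times the derivative of [v]. Since
    [A k] is bounded and tends to the Heaviside step, the limit is minus the integral of that
    derivative over the positive axis, that is, [v 0]. *)
Lemma Fc_inv0 M v : Cc M v -> \int[mu]_xi Fc v xi = v 0.
Proof.
move=> vC; pose e (k : nat) : R := k.+1%:R^-1.
have e0 k : 0 < e k by rewrite invr_gt0.
have FI : integrableT mu (Fc v) by apply: FT_integrable; exists M, v; split => //; left.
have mFc := measurable_int _ FI; move/measurable_EFinP in mFc.
have mw k : mfunT (fun x : R => expR (- (e k * `|x|))).
  by apply: continuous_measurable_fun; exact: expRN_cont.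
have w1 k x : expR (- (e k * `|x|)) <= 1 by rewrite -expR0 ler_expR oppr_le0 mulr_ge0// ltW.
have ecvg : e @ \oo --> 0 by exact: cvg_harmonic.
have lim1 : \int[mu]_xi (expR (- (e k * `|xi|)) * Fc v xi) @[k --> \oo] --> \int[mu]_xi Fc v xi.
  apply: (@Rdominated_cvg _ _ _ mu _ _ (fun x => `|Fc v x|)) => //.
  - by move=> k; exact: (measurable_funM (mw k) mFc).
  - exact: integrable_norm.
  - by move=> k x; rewrite normrM ler_piMl// ger0_norm ?expR_ge0.
  - apply: aeW => x.
    rewrite -[X in _ --> X]mul1r; apply: cvgM; last exact: cvg_cst.
    rewrite -[1]expR0 -oppr0 -(mul0r `|x|).
    apply: (cvg_comp _ expR); last exact: continuous_expR.
    by apply: cvgN; apply: cvgM => //; exact: cvg_cst.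
have dv := Cc_derive1 vC.
have [pi0 pi0'] : 0 < pi :> R /\ pi != 0 :> R by rewrite pi_gt0 gt_eqF ?pi_gt0.
(* The primitive of the Poisson kernel of width [e k] that takes the value 1/2 at 0. *)
pose A k x := atan (2 * pi * x / e k) / pi + 2^-1.
have AS k : SM (A k).
  rewrite (_ : A k = fun x => (fun x => atan ((2 * pi / e k) * x + 0)) x * cst pi^-1 x + cst 2^-1 x).
    apply: SM_add; last exact: SM_cst.
    by apply: SM_mul; [apply: (SM_comp (f := @atan R)); exact: SM_atan|exact: SM_cst].
  by apply/funext => x; rewrite /A addr0 mulrAC.
have A1 k x : `|A k x| <= 1.
  have := atan_gtNpi2 (2 * pi * x / e k); have := atan_ltpi2 (2 * pi * x / e k).
  rewrite /A; set t := atan _ => h1 h2.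
  have : t / pi <= 2^-1 by rewrite ler_pdivrMr// mulrC ltW.
  have : - 2^-1 <= t / pi by rewrite ler_pdivlMr// mulNr mulrC ltW.
  rewrite ler_norml; lra.
have lim2 : (- \int[mu]_x (A k x * derive1 v x)) @[k --> \oo] --> v 0.
  pose M' : R := `|M| + 1.
  have M0 : 0 < M' by rewrite ltr_wpDl.
  have MM1 : M < M' by rewrite (le_lt_trans (ler_norm _))// ltrDl.
  have v0 : v 0 = - \int[mu]_(x in `[0, M']) derive1 v x.
    by rewrite (SM_Rintegral_derive1 M0 vC.1) (vC.2 M') ?sub0r ?opprK// (gtr0_norm M0) MM1.
  rewrite v0 Rintegral_mkcond; apply: cvgN.
  apply: (@Rdominated_cvg _ _ _ mu _ _ (fun x => `|derive1 v x|)).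
  - by move=> k; exact: (measurable_funM (SM_measurable (AS k)) (SM_measurable dv.1)).
  - by apply: (measurable_patch (measurable_itv _) (SM_measurable dv.1)).
  - exact: (Cc_integrable_norm dv).
  - by move=> k x; rewrite normrM ler_piMl.
  - exists [set 0]; split => //; first exact: lebesgue_measure_set1.
    move=> x /= H; apply: contrapT => x0; apply: H.
    rewrite patchE; case: ifPn => xM.
      rewrite -[X in _ --> X]mul1r; apply: cvgM; last exact: cvg_cst.
      have x1 : 0 < x by move: xM; rewrite inE/= in_itv/= lt_neqAle => /andP[-> _]; rewrite andbT eq_sym; exact/eqP.
      by have := poisson_cvg (x := x); rewrite x1; apply; exact/eqP.
    have [x1|x1] := ltP 0 x.
      rewrite dv.2 ?mulr0; first by under eq_fun do rewrite mulr0; exact: cvg_cst.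
      rewrite (lt_trans MM1)// gtr0_norm// ltNge; apply/negP => xM'.
      by move: xM; rewrite notin_setE/= in_itv/= (ltW x1) xM'.
    rewrite -[X in _ --> X](mul0r (derive1 v x)); apply: cvgM; last exact: cvg_cst.
    by have := poisson_cvg (x := x); rewrite ltNge x1; apply; exact/eqP.
apply: (cvg_unique (@norm_hausdorff _ _) lim1).
suff <- : (fun k => - \int[mu]_x (A k x * derive1 v x)) = (fun k => \int[mu]_xi (expR (- (e k * `|xi|)) * Fc v xi)) by [].
apply/funext => k.
have [C C0 vb] := Cc_bounded vC.
transitivity (\int[mu]_x (v x * (2 * e k / (e k ^+ 2 + (2 * pi * x) ^+ 2)))).
  have := Cc_Rintegral_derive1 (Cc_mul (AS k) vC).
  have dA x : derive1 (A k) x = 2 * e k / (e k ^+ 2 + (2 * pi * x) ^+ 2).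
    have d1 := @isd_comp R (@atan R) (fun x => (2 * pi / e k) * x + 0) x _ _ (is_derive1_atan _) (isd_affine (2 * pi / e k) 0 x).
    have d2 := isdD (isdM d1 (is_derive_cst (pi^-1 : R) x (1 : R))) (is_derive_cst (2^-1 : R) x (1 : R)).
    rewrite (_ : A k = (fun x => atan (2 * pi / e k * x + 0) * cst pi^-1 x + cst 2^-1 x)); last first.
      by apply/funext => y; rewrite /A addr0 mulrAC.
    rewrite (isd_derive1 d2) /cst addr0.
    by rewrite mulr0 add0r !addr0 poisson_kernelE.
  have vd : Cc M (fun x => derive1 (A k) x * v x) := Cc_mul (SM_derive1 (AS k)) vC.
  under eq_Rintegral => x _ do rewrite (isd_derive1 (isdM (SM_isd x (AS k)) (SM_isd x vC.1))).
  rewrite (RintD_Cc (Cc_mul (AS k) dv) (_ : Cc M (fun x => v x * derive1 (A k) x))); last first.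
    by under eq_fun do rewrite mulrC.
  move=> h; apply/eqP; rewrite eq_sym -addr_eq0; apply/eqP; rewrite -[RHS]h addrC; congr (_ + _).
  by apply: eq_Rintegral => x _; rewrite dA.
under eq_Rintegral => x _ do rewrite -(damped_cosT (2 * pi * x) (e0 k)).
pose f (z : measurableTypeR R * measurableTypeR R) := expR (- (e k * `|z.2|)) * (cos (2 * pi * (z.1 * z.2)) * v z.1).
have fI : integrableT (mu \x mu)%E f.
  apply: (@le_integrable_prod _ _ _ _ R mu mu f (fun x => `|v x|) (fun y => expR (- (e k * `|y|)))).
  - apply: measurable_funM; first exact: (measurableT_comp (mw k) measurable_snd).
    apply: measurable_funM; last exact: (measurableT_comp (SM_measurable vC.1) measurable_fst).
    have mc : mfunT (@cos R) by apply: continuous_measurable_fun => x; exact: continuous_cos.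
    apply: (measurableT_comp mc); apply: measurable_funM => //.
    by apply: measurable_funM; [exact: measurable_fst|exact: measurable_snd].
  - exact: (Cc_integrable_norm vC).
  - exact: (damped_integrable (e0 k)).
  - move=> x y; rewrite /f/= mulrC normrM [`|expR _|]ger0_norm ?expR_ge0// ler_wpM2r ?expR_ge0//.
    by rewrite normrM ler_piMl// cos_norm1.
transitivity (\int[mu]_x \int[mu]_y f (x, y)).
  apply: eq_Rintegral => x _; rewrite -RintegralZl//; last exact: damped_cos_integrable.
  by apply: eq_Rintegral => y _; rewrite /f/= -[2 * pi * x * y]mulrA; ring.
rewrite Rfubini//; apply: eq_Rintegral => y _; rewrite /Fc -RintegralZl//.
exact: (Cc_integrable (Cc_mul (SM_cosl y) vC)).
Qed.
End inversion1.

(** * Complex-valued integrals and products of one-variable transforms *)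

Local Notation normc := ComplexField.Normc.normc.
Local Notation Re := complex.Re.
Local Notation Im := complex.Im.

Section complex_integral.
Variable R : realType.
Local Notation C := R[i].

Definition Cintegrable d (T : measurableType d) (m : {measure set T -> \bar R}) (f : T -> C) :=
  re_im (fun g => integrableT m g) f.

Lemma Cext (x y : C) : Re x = Re y -> Im x = Im y -> x = y.
Proof. by case: x => a c; case: y => a' c' /= -> ->. Qed.

Lemma cReM (x y : C) : Re (x * y) = Re x * Re y - Im x * Im y.
Proof. by case: x => a c; case: y. Qed.

Lemma cImM (x y : C) : Im (x * y) = Re x * Im y + Im x * Re y.
Proof. by case: x => a c; case: y. Qed.

Lemma cReD (x y : C) : Re (x + y) = Re x + Re y.
Proof. by case: x => a c; case: y. Qed.

Lemma Re_le_normc (x : C) : `|Re x| <= normc x.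
Proof.
by case: x => a c /=; rewrite -sqrtr_sqr ler_wsqrtr// lerDl sqr_ge0.
Qed.

Lemma Im_le_normc (x : C) : `|Im x| <= normc x.
Proof.
by case: x => a c /=; rewrite -sqrtr_sqr ler_wsqrtr// lerDr sqr_ge0.
Qed.

Lemma normc_ge0 (x : C) : 0 <= normc x.
Proof. by case: x => a c; exact: sqrtr_ge0. Qed.

Lemma normc_le (x : C) : normc x <= `|Re x| + `|Im x|.
Proof.
case: x => a c /=; rewrite -[leRHS](@ger0_norm _ (`|a| + `|c|)) ?addr_ge0//.
rewrite -sqrtr_sqr ler_wsqrtr// sqrrD !real_normK ?num_real// -addrA [_ *+ 2 + _]addrC addrA lerDl.
by rewrite mulrn_wge0// mulr_ge0.
Qed.

Lemma normc_prod n (z : 'I_n -> C) : normc (\prod_(i < n) z i) = \prod_(i < n) normc (z i).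
Proof.
elim/big_ind2: _ => //; first exact: ComplexField.Normc.normc1.
by move=> x a y c <- <-; rewrite ComplexField.Normc.normcM.
Qed.

Lemma normc_cis (t : R) : normc (cis t) = 1.
Proof. by rewrite /= cos2Dsin2 sqrtr1. Qed.

Lemma cisD (s t : R) : cis (s + t) = cis s * cis t.
Proof. by apply: Cext; rewrite ?cReM ?cImM/= ?cosD ?sinD//; ring. Qed.

Lemma cis0 : cis 0 = 1 :> C.
Proof. by apply: Cext; rewrite /= ?cos0 ?sin0. Qed.

Lemma cis_sum n (t : 'I_n -> R) : cis (\sum_(i < n) t i) = \prod_(i < n) cis (t i).
Proof. by elim/big_rec2: _ => [|i x y _ <-]; rewrite ?cis0// cisD. Qed.

Section one_space.
Context d (T : measurableType d) (m : {measure set T -> \bar R}).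
Implicit Types f g : T -> C.

Lemma measurable_normc f : re_im (mfunT) f -> mfunT (fun x => normc (f x)).
Proof.
move=> [mr mi].
rewrite (_ : (fun x => _) = fun x => Num.sqrt (Re (f x) ^+ 2 + Im (f x) ^+ 2)); last first.
  by apply/funext => x; case: (f x).
apply: (measurableT_comp (f := @Num.sqrt R)).
  by apply: continuous_measurable_fun; exact: sqrt_continuous.
by apply: measurable_funD; exact: measurable_funX.
Qed.

Lemma Cintegrable_measurable f : Cintegrable m f -> re_im (mfunT) f.
Proof. by move=> [fr fi]; split; apply/measurable_EFinP; [exact: measurable_int fr|exact: measurable_int fi]. Qed.

Lemma Cintegrable_normc f : Cintegrable m f -> integrableT m (fun x => normc (f x)).
Proof.
move=> fI; have mf := Cintegrable_measurable fI; case: fI => fr fi.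
have := integrableD measurableT (integrable_norm fr) (integrable_norm fi).
apply: le_integrable => //; first by apply/measurable_EFinP; exact: measurable_normc.
by move=> x _ /=; rewrite lee_fin (ger0_norm (normc_ge0 _)) (le_trans (normc_le _))// ler_norm.
Qed.

Lemma le_Cintegrable f (g : T -> R) : re_im (mfunT) f ->
  integrableT m g -> (forall x, normc (f x) <= g x) -> Cintegrable m f.
Proof.
move=> [mr mi] gI fg; split; apply: (le_integrable _ _ _ gI) => //; try exact/measurable_EFinP;
  move=> x _ /=; rewrite lee_fin; apply: (le_trans (le_trans _ (fg x)) (ler_norm _)).
- exact: Re_le_normc.
- exact: Im_le_normc.
Qed.

Lemma Cintegral_scale (c : C) f : Cintegrable m f ->
  Cintegral m setT (fun x => c * f x) = c * Cintegral m setT f.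
Proof.
move=> [fr fi]; apply: Cext; rewrite ?cReM ?cImM/=.
  under eq_Rintegral do rewrite cReM.
  by rewrite RintegralB//; [rewrite !RintegralZl|exact: (integrableZl measurableT (Re c) fr)|exact: (integrableZl measurableT (Im c) fi)].
under eq_Rintegral do rewrite cImM.
by rewrite RintegralD//; [rewrite !RintegralZl|exact: (integrableZl measurableT (Re c) fi)|exact: (integrableZl measurableT (Im c) fr)].
Qed.

(** The factor 2 comes from bounding the real and the imaginary part separately; only the finiteness
    of the resulting constants matters. *)
Lemma normc_Cintegral f : Cintegrable m f ->
  normc (Cintegral m setT f) <= 2 * \int[m]_x normc (f x).
Proof.
move=> fI; have nI := Cintegrable_normc fI; case: fI => fr fi.
rewrite (le_trans (normc_le _))// mulr_natl mulr2n lerD//=.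
  rewrite (le_trans (le_normr_Rintegral _ fr))// le_Rintegral//; last by move=> x _; exact: Re_le_normc.
  exact: integrable_norm fr.
rewrite (le_trans (le_normr_Rintegral _ fi))// le_Rintegral//; last by move=> x _; exact: Im_le_normc.
exact: integrable_norm fi.
Qed.

Lemma re_im_measurableM f g : re_im (mfunT) f -> re_im (mfunT) g ->
  re_im (mfunT) (fun x => f x * g x).
Proof.
move=> [mf mf'] [mg mg']; split.
  by under eq_fun do rewrite cReM; apply: measurable_funB; apply: measurable_funM.
by under eq_fun do rewrite cImM; apply: measurable_funD; apply: measurable_funM.
Qed.

Lemma re_im_measurable_comp d' (T' : measurableType d') (f : T -> C) (h : T' -> T) :
  re_im (mfunT) f -> mfunT h -> re_im (mfunT) (fun x => f (h x)).
Proof. by move=> [mf mf'] mh; split; [exact: (measurableT_comp mf mh)|exact: (measurableT_comp mf' mh)]. Qed.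

Lemma re_im_measurable_cis (h : T -> R) : mfunT h -> re_im (mfunT) (fun x => cis (h x)).
Proof.
move=> mh; split.
  by apply: (measurableT_comp (f := @cos R)) => //; apply: continuous_measurable_fun => x; exact: continuous_cos.
by apply: (measurableT_comp (f := @sin R)) => //; apply: continuous_measurable_fun => x; exact: continuous_sin.
Qed.

Lemma re_im_measurable_cst (c : C) : re_im (mfunT) (fun _ : T => c).
Proof. by split; exact: measurable_cst. Qed.

Lemma re_im_measurable_prod n (h : 'I_n -> T -> C) : (forall i, re_im (mfunT) (h i)) ->
  re_im (mfunT) (fun x => \prod_(i < n) h i x).
Proof.
move=> mh; elim: (index_enum _) => [|i s IH].
  by under eq_fun do rewrite big_nil; exact: re_im_measurable_cst.
by under eq_fun do rewrite big_cons; exact: re_im_measurableM.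
Qed.

End one_space.

Lemma Cfubini d1 d2 (T1 : measurableType d1) (T2 : measurableType d2)
    (m1 : {sigma_finite_measure set T1 -> \bar R}) (m2 : {sigma_finite_measure set T2 -> \bar R})
    (f : T1 * T2 -> C) : Cintegrable (m1 \x m2)%E f ->
  Cintegral m1 setT (fun x => Cintegral m2 setT (fun y => f (x, y))) =
  Cintegral m2 setT (fun y => Cintegral m1 setT (fun x => f (x, y))).
Proof.
move=> [fr fi]; apply: Cext => /=.
  exact: (Rfubini (f := fun z => Re (f z))).
exact: (Rfubini (f := fun z => Im (f z))).
Qed.

Local Notation leb := (@lebesgue_rV R).

Lemma Rintegral_rVS n (f : 'rV[R]_n.+1 -> R) : integrableT (leb n.+1) f ->
  \int[leb n.+1]_x f x = \int[mu]_z \int[leb n]_v f (cons_rV (z, v)).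
Proof.
move=> fI; have gI := integrable_rVS fI.
rewrite (Rfubini1 (f := fun z => f (cons_rV z)) gI) /Rintegral; congr fine.
have mf := measurable_int _ fI.
rewrite /=/lebesgue_rV_step integral_pushforward//; exact: measurable_cons_rV.
Qed.

Lemma Cintegral_rVS n (f : 'rV[R]_n.+1 -> C) : Cintegrable (leb n.+1) f ->
  Cintegral (leb n.+1) setT f = Cintegral mu setT (fun z => Cintegral (leb n) setT (fun v => f (cons_rV (z, v)))).
Proof.
move=> [fr fi]; apply: Cext.
  exact: (Rintegral_rVS fr).
exact: (Rintegral_rVS fi).
Qed.

Lemma integrable_prod_normc n (h : 'I_n -> R -> C) : (forall i, Cintegrable mu (h i)) ->
  integrableT (leb n) (fun x => \prod_(i < n) normc (h i (x ord0 i))).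
Proof.
move=> hI; have mh i := Cintegrable_measurable (hI i).
have mp : mfunT (fun x : 'rV[R]_n => \prod_(i < n) normc (h i (x ord0 i))).
  by apply: measurable_prod => i _; apply: (measurableT_comp (measurable_normc (mh i))); exact: measurable_coord.
apply/integrableP; split; first exact/measurable_EFinP.
have n0 i x : (0 <= (normc (h i x))%:E)%E by rewrite lee_fin normc_ge0.
have mn i : mfunT (EFin \o (fun x : R => normc (h i x))).
  by apply/measurable_EFinP; exact: measurable_normc.
under eq_integral => x _.
  rewrite /= ger0_norm ?prodr_ge0// -?prodEFin; last by move=> i _; exact: normc_ge0.
  over.
rewrite (ge0_integral_prod mn n0).
suff /andP[] : (0 <= \prod_(i < n) \int[mu]_z (normc (h i z))%:E < +oo)%E by [].
elim/big_ind: _ => [|x y /andP[x0 xy] /andP[y0 yy]|i _].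
- by rewrite lee_fin ler01 ltry.
- by rewrite mule_ge0//= lte_mul_pinfty// ge0_fin_numE.
- rewrite integral_ge0//; have /integrableP[_] := Cintegrable_normc (hI i).
  by under eq_integral do rewrite gee0_abs ?lee_fin ?normc_ge0//.
Qed.

Lemma Cintegrable_prod n (h : 'I_n -> R -> C) : (forall i, Cintegrable mu (h i)) ->
  Cintegrable (leb n) (fun x => \prod_(i < n) h i (x ord0 i)).
Proof.
move=> hI; apply: (le_Cintegrable _ (integrable_prod_normc hI)).
  apply: re_im_measurable_prod => i; apply: (re_im_measurable_comp (Cintegrable_measurable (hI i))).
  exact: measurable_coord.
by move=> x; rewrite normc_prod.
Qed.

Lemma Cintegral_prod n (h : 'I_n -> R -> C) : (forall i, Cintegrable mu (h i)) ->
  Cintegral (leb n) setT (fun x => \prod_(i < n) h i (x ord0 i)) = \prod_(i < n) Cintegral mu setT (h i).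
Proof.
elim: n h => [|n IH] h hI.
  rewrite big_ord0 (_ : (fun x => _) = fun=> 1); last by apply/funext => x; rewrite big_ord0.
  rewrite /Cintegral /Rintegral (@ge0_integral_rV0 R (fun=> 1%:E)) ?lee_fin//.
  by rewrite (@ge0_integral_rV0 R (fun=> 0%:E)).
rewrite (Cintegral_rVS (Cintegrable_prod hI)) big_ord_recl -IH//.
transitivity (Cintegral mu setT (fun z => Cintegral (leb n) setT (fun x => \prod_(i < n) h (lift ord0 i) (x ord0 i)) * h ord0 z)).
  congr (Cintegral _ _); apply/funext => z; rewrite mulrC.
  have hI' : Cintegrable (leb n) (fun x => \prod_(i < n) h (lift ord0 i) (x ord0 i)) by exact: (Cintegrable_prod (fun i => hI (lift ord0 i))).
  rewrite -(Cintegral_scale _ hI'); congr (Cintegral _ _); apply/funext => v.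
  rewrite big_ord_recl cons_rV_head; congr (_ * _).
  by apply: eq_bigr => i _; rewrite cons_rV_lift.
by rewrite (Cintegral_scale _ (hI ord0)) mulrC.
Qed.

End complex_integral.

(** * Transforms of translated and dilated functions *)

Section cFT.
Variable R : realType.
Local Notation C := R[i].
Implicit Types (u v : R -> R) (M q xi x y : R).

Definition cFT u xi : C := Complex (Fc u xi) (Fs u xi).

(** The dilation includes a reflection: as a function of [x] it is the convolution kernel of scale
    [q] evaluated at [y - x]. In particular [dil 1 0 v] is [v] reflected. *)
Definition dil q y v x := q^-1 * v ((y - x) / q).

Lemma dil_Cc M q y v : 0 < q -> Cc M v -> Cc (`|y| + q * M) (dil q y v).
Proof.
move=> q0 [vS v0]; split.
  rewrite (_ : dil q y v = fun x => cst q^-1 x * v (- q^-1 * x + y / q)).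
    by apply: SM_mul; [exact: SM_cst|exact: SM_comp].
  by apply/funext => x; rewrite /dil/=; congr (_ * v _); field; rewrite gt_eqF.
move=> x xM; rewrite /dil v0 ?mulr0// normrM normfV (gtr0_norm q0) ltr_pdivlMr// mulrC.
have := ler_normD (y - x) (- y); rewrite (_ : y - x - y = - x); last by ring.
rewrite !normrN; lra.
Qed.

Lemma cFTE M u xi : Cc M u ->
  Cintegral mu setT (fun x => cis (2 * pi * (x * xi)) * Complex (u x) 0) = cFT u xi.
Proof.
move=> uC; apply: Cext => /=; apply: eq_Rintegral => x _; rewrite ?cReM ?cImM/= mulr0; ring.
Qed.

Lemma Cintegrable_cis_Cc M u xi : Cc M u -> Cintegrable mu (fun x => cis (2 * pi * (x * xi)) * Complex (u x) 0).
Proof.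
move=> uC; apply: (@le_Cintegrable R _ (measurableTypeR R) mu _ (fun x => `|u x|)).
- apply: re_im_measurableM.
    apply: re_im_measurable_cis; apply: measurable_funM => //; exact: measurable_funM.
  by split; [exact: (SM_measurable uC.1)|exact: measurable_cst].
- exact: (Cc_integrable_norm uC).
- by move=> x; rewrite ComplexField.Normc.normcM normc_cis mul1r /= expr0n addr0 sqrtr_sqr.
Qed.

Lemma cFT_FT M u : Cc M u -> FT (Fc u) /\ FT (Fs u).
Proof. by move=> uC; split; exists M, u; split => //; [left|right]. Qed.

Lemma cFT_Cintegrable M u : Cc M u -> Cintegrable mu (cFT u).
Proof. by move=> /cFT_FT[? ?]; split; exact: FT_integrable. Qed.

Lemma Cc_shift M u y : Cc M u -> Cc (M + `|y|) (fun x => u (x + y)).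
Proof.
move=> [uS u0]; split.
  rewrite (_ : (fun _ => _) = fun x => u (1 * x + y)); first exact: SM_comp.
  by apply/funext => x; rewrite mul1r.
move=> x xM; apply: u0; have := ler_normD (x + y) (- y); rewrite addrK normrN; lra.
Qed.

Lemma Fs_int0 M u : Cc M u -> \int[mu]_xi Fs u xi = 0.
Proof.
move=> uC; have [_ FsF] := cFT_FT uC.
have N1 : (-1 : R) != 0 by rewrite oppr_eq0 oner_eq0.
have := Rintegral_affine1 0 N1 (FT_measurable FsF); rewrite normrN1 mul1r.
rewrite (_ : (fun x => _) = fun x => (-1) * Fs u x); last first.
  apply/funext => xi; rewrite addr0 /Fs -(RintZ_Cc (-1) (Cc_mul (SM_sinl xi) uC)).
  by apply: eq_Rintegral => x _; rewrite mulN1r !mulrN sinN; ring.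
rewrite RintegralZl//; last exact: FT_integrable.
lra.
Qed.

Lemma cFT_shift M u x xi : Cc M u ->
  cis (- (2 * pi * (x * xi))) * cFT u xi = cFT (fun y => u (y + x)) xi.
Proof.
move=> uC; have uCx := Cc_shift x uC.
have mS (c : R -> R) : SM c -> mfunT (fun y => c y * u y).
  by move=> cS; exact: (SM_measurable (SM_mul cS uC.1)).
have scos : SM (fun y : R => cos (2 * pi * ((y - x) * xi))).
  rewrite (_ : (fun _ => _) = fun y : R => cos ((2 * pi * xi) * y + - (2 * pi * x * xi))).
    by apply: SM_comp; exact: SM_cos.
  by apply/funext => y; congr cos; ring.
have ssin : SM (fun y : R => sin (2 * pi * ((y - x) * xi))).
  rewrite (_ : (fun _ => _) = fun y : R => sin ((2 * pi * xi) * y + - (2 * pi * x * xi))).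
    by apply: SM_comp; exact: SM_sin.
  by apply/funext => y; congr sin; ring.
have n1 : (1 : R) != 0 by exact: oner_neq0.
apply: Cext; rewrite ?cReM ?cImM/= cosN sinN.
- have := Rintegral_affine1 x n1 (mS _ scos); rewrite normr1 mul1r => E.
  rewrite [RHS](_ : _ = \int[mu]_y (cos (2 * pi * ((y - x) * xi)) * u y)); last first.
    by rewrite -E; apply: eq_Rintegral => y _; rewrite mul1r addrK.
  rewrite -(RintZ_Cc _ (Cc_mul (SM_cosl xi) uC)) -[X in _ - X](RintZ_Cc _ (Cc_mul (SM_sinl xi) uC)).
  rewrite -RintegralB//; first last.
  + exact: (Cc_integrable (Cc_scale _ (Cc_mul (SM_sinl xi) uC))).
  + exact: (Cc_integrable (Cc_scale _ (Cc_mul (SM_cosl xi) uC))).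
  apply: eq_Rintegral => y _; rewrite mulrBl mulrBr cosB; ring.
- have := Rintegral_affine1 x n1 (mS _ ssin); rewrite normr1 mul1r => E.
  rewrite [RHS](_ : _ = \int[mu]_y (sin (2 * pi * ((y - x) * xi)) * u y)); last first.
    by rewrite -E; apply: eq_Rintegral => y _; rewrite mul1r addrK.
  rewrite -(RintZ_Cc _ (Cc_mul (SM_sinl xi) uC)) -[X in _ + X](RintZ_Cc _ (Cc_mul (SM_cosl xi) uC)).
  rewrite -RintegralD//; first last.
  + exact: (Cc_integrable (Cc_scale _ (Cc_mul (SM_cosl xi) uC))).
  + exact: (Cc_integrable (Cc_scale _ (Cc_mul (SM_sinl xi) uC))).
  apply: eq_Rintegral => y _; rewrite mulrBl mulrBr sinB; ring.
Qed.

(** A modulation of the transform is a translation of [u], so inversion at [x] is inversion at 0;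
    the imaginary part is the integral of an odd function. *)
Lemma cFT_inv M u x : Cc M u ->
  Cintegral mu setT (fun xi => cis (- (2 * pi * (x * xi))) * cFT u xi) = Complex (u x) 0.
Proof.
move=> uC; have uCx := Cc_shift x uC.
rewrite (_ : (fun _ => _) = cFT (fun y => u (y + x))); last first.
  by apply/funext => xi; exact: cFT_shift uC.
by apply: Cext; rewrite /= ?(Fc_inv0 uCx) ?add0r// (Fs_int0 uCx).
Qed.

Lemma cFT_dil M q y v xi : 0 < q -> Cc M v ->
  cFT (dil q y v) xi = cis (2 * pi * (y * xi)) * cFT (dil 1 0 v) (q * xi).
Proof.
move=> q0 vC; have qn : q != 0 by rewrite gt_eqF.
have qi : q^-1 != 0 by rewrite invr_eq0.
have d := dil_Cc 0 ltr01 vC.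
rewrite (_ : cFT (dil 1 0 v) (q * xi) = cis (- (2 * pi * (y * xi))) * cFT (dil q y v) xi).
  by rewrite mulrA -cisD subrr cis0 mul1r.
rewrite (cFT_shift _ _ (dil_Cc y q0 vC)).
have H (c : R -> R) : SM (fun x => c (x * (q * xi))) -> SM (fun x => c (x * xi)) ->
  \int[mu]_x (c (x * (q * xi)) * dil 1 0 v x) = \int[mu]_x (c (x * xi) * dil q y v (x + y)).
  move=> c1 c2; have := Rintegral_affine1 0 qi (SM_measurable (SM_mul c1 d.1)) => <-.
  rewrite normfV (gtr0_norm q0).
  have dC : Cc (`|y| + q * M + `|y|) (fun x => c (x * xi) * (q * dil q y v (x + y))).
    by apply: Cc_mul => //; apply: Cc_scale; exact: (Cc_shift _ (dil_Cc y q0 vC)).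
  rewrite -(RintZ_Cc _ (M := `|y| + q * M + `|y|)); last first.
    move: dC; congr (Cc _ _); apply/funext => x; congr (c _ * _); first by field.
    rewrite /dil invr1 mulr1 mul1r mulrA mulfV// mul1r; congr v; by field.
  apply: eq_Rintegral => x _; rewrite addr0 (_ : q^-1 * x * (q * xi) = x * xi); last by field.
  rewrite mulrCA; congr (_ * _); rewrite /dil invr1 mulr1 mul1r; congr (_ * v _).
  by field.
by apply: Cext => /=; [apply: (H (fun t => cos (2 * pi * t)))|apply: (H (fun t => sin (2 * pi * t)))];
  rewrite ?(SM_cosl, SM_sinl)//; (exact: SM_cosl || exact: SM_sinl).
Qed.

End cFT.

(** * Products of one-variable functions: transforms and Schwartz bounds *)

Section product_transform.
Variables (R : realType) (n : nat).
Local Notation C := R[i].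
Local Notation leb := (@lebesgue_rV R n).
Implicit Types (u : 'I_n -> R -> R) (x y xi : 'rV[R]_n).

Lemma Complex_prod m (a : 'I_m -> R) : Complex (\prod_(i < m) a i) 0 = \prod_(i < m) Complex (a i) 0.
Proof.
elim/big_rec2: _ => // i x y _ <-.
by apply: Cext; rewrite ?cReM ?cImM/=; ring.
Qed.

Lemma cis_dotv x xi : cis (2 * pi * dotv x xi) = \prod_(i < n) cis (2 * pi * (x ord0 i * xi ord0 i)).
Proof. by rewrite /dotv mulr_sumr cis_sum. Qed.

Lemma cisN_dotv x xi : cis (- (2 * pi * dotv x xi)) = \prod_(i < n) cis (- (2 * pi * (x ord0 i * xi ord0 i))).
Proof. by rewrite /dotv mulr_sumr -sumrN cis_sum. Qed.

Lemma inv_fourier_prod M u xi : (forall i, Cc M (u i)) ->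
  inv_fourier (fun x => Complex (\prod_(i < n) u i (x ord0 i)) 0) xi = \prod_(i < n) cFT (u i) (xi ord0 i).
Proof.
move=> uC; rewrite /inv_fourier.
under eq_bigr => i _ do rewrite -(cFTE _ (uC i)).
rewrite -(Cintegral_prod (h := fun i (x : R) => cis (2 * pi * (x * xi ord0 i)) * Complex (u i x) 0)); last first.
  by move=> i; exact: Cintegrable_cis_Cc (uC i).
congr (Cintegral _ _ _); apply/funext => x.
rewrite cis_dotv Complex_prod -big_split/=.
by apply: eq_bigr => i _; rewrite [_ * xi _ _]mulrC.
Qed.

Lemma fourier_prod M u x : (forall i, Cc M (u i)) ->
  fourier (fun xi => \prod_(i < n) cFT (u i) (xi ord0 i)) x = Complex (\prod_(i < n) u i (x ord0 i)) 0.
Proof.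
move=> uC; rewrite /fourier Complex_prod.
under eq_bigr => i _ do rewrite -(cFT_inv (x ord0 i) (uC i)).
rewrite -(Cintegral_prod (h := fun i (xi : R) => cis (- (2 * pi * (x ord0 i * xi))) * cFT (u i) xi)); last first.
  move=> i; have [I1 I2] := cFT_Cintegrable (uC i).
  apply: (@le_Cintegrable R _ (measurableTypeR R) mu _ (fun xi : R => normc (cFT (u i) xi))).
  - apply: re_im_measurableM; last exact: Cintegrable_measurable (cFT_Cintegrable (uC i)).
    apply: re_im_measurable_cis; apply: measurableT_comp => //; apply: measurable_funM => //; exact: measurable_funM.
  - exact: Cintegrable_normc (cFT_Cintegrable (uC i)).
  - by move=> xi; rewrite ComplexField.Normc.normcM normc_cis mul1r.
congr (Cintegral _ _ _); apply/funext => xi.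
rewrite cisN_dotv -big_split/=.
by apply: eq_bigr => i _; rewrite [_ * x _ _]mulrC.
Qed.

(** A weight that is itself a product over the forms splits along the factors, which [1 + enorm x]
    would not do; [enorm_le_prod] compares the two. *)
Lemma tens_bound (ls : seq ('rV[R]_n -> R)) f k : tens (@FT R) ls f ->
  exists2 B, 0 <= B & forall x, (\prod_(l <- ls) (1 + `|l x|)) ^+ k * `|f x| <= B.
Proof.
elim => {ls f} [|c l ls f cF _ [B B0 H]|ls f g _ [B B0 H] _ [B' B0' H']|a ls f _ [B B0 H]].
- by exists 1 => // x; rewrite big_nil expr1n mul1r normr1.
- have [A A0 cA] := FT_decay k cF; exists (A * B); first exact: mulr_ge0.
  move=> x; rewrite big_cons exprMn normrM mulrACA ler_pM// ?mulr_ge0 ?exprn_ge0 ?addr_ge0//.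
  by rewrite prodr_ge0// => i _; rewrite addr_ge0.
- exists (B + B'); first exact: addr_ge0.
  move=> x; rewrite (le_trans _ (lerD (H x) (H' x)))// -mulrDr ler_wpM2l ?ler_normD//.
  by rewrite exprn_ge0// prodr_ge0// => i _; rewrite addr_ge0.
- exists (`|a| * B); first exact: mulr_ge0.
  by move=> x; rewrite normrM mulrCA ler_wpM2l.
Qed.

Lemma dotvv_ge0 x : 0 <= dotv x x.
Proof. by apply: sumr_ge0 => i _; rewrite -expr2 sqr_ge0. Qed.

Lemma enorm_ge0 x : 0 <= enorm x.
Proof. exact: sqrtr_ge0. Qed.

Lemma coord_le_enorm x i : `|x ord0 i| <= enorm x.
Proof.
rewrite -sqrtr_sqr ler_wsqrtr// /dotv (bigD1 i)//= -expr2 lerDl.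
by apply: sumr_ge0 => j _; rewrite -expr2 sqr_ge0.
Qed.

Lemma enorm_le_sum x : enorm x <= \sum_(i < n) `|x ord0 i|.
Proof.
have s0 : 0 <= \sum_(i < n) `|x ord0 i| by apply: sumr_ge0.
rewrite -[leRHS](ger0_norm s0) -sqrtr_sqr ler_wsqrtr//.
rewrite expr2 mulr_suml; apply: ler_sum => i _.
rewrite (le_trans (ler_norm _))// normrM ler_wpM2l// (bigD1 i)//= lerDl sumr_ge0//.
Qed.

Lemma enorm_le_prod x : 1 + enorm x <= \prod_(i < n) (1 + `|x ord0 i|).
Proof.
rewrite (le_trans (_ : _ <= 1 + \sum_(i < n) `|x ord0 i|)) ?lerD2l ?enorm_le_sum//.
suff [] : 1 + \sum_(i < n) `|x ord0 i| <= \prod_(i < n) (1 + `|x ord0 i|) /\ 0 <= \sum_(i < n) `|x ord0 i| by [].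
elim/big_rec2: _ => [|i p s _ [h s0]]; first by rewrite addr0.
split; last by rewrite addr_ge0.
rewrite (le_trans _ (ler_wpM2l _ h)) ?addr_ge0//.
by rewrite mulrDr mulr1 mulrDl mul1r addrA [leRHS]addrA lerDl mulr_ge0.
Qed.

Definition coords : seq ('rV[R]_n -> R) := [seq (fun x : 'rV[R]_n => x ord0 i) | i <- index_enum 'I_n].

Lemma coords_linform l : List.In l coords -> linform l.
Proof.
rewrite /coords; elim: (index_enum _) => //= i s IH [<-|//]; exact: linform_coord.
Qed.

Lemma tens_schwartz_bound f k : tens (@FT R) coords f ->
  exists2 B, 0 <= B & forall (s : seq 'I_n) x, (size s <= k)%N ->
    (1 + enorm x) ^+ k * `|iter_derive [seq basis_rV R j | j <- s] f x| <= B.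
Proof.
move=> ft; have FTc := @FT_closed R.
suff : forall m g, tens (@FT R) coords g -> exists2 B, 0 <= B & forall (s : seq 'I_n) x, (size s <= m)%N ->
    (1 + enorm x) ^+ k * `|iter_derive [seq basis_rV R j | j <- s] g x| <= B by apply.
have base g : tens (@FT R) coords g -> exists2 B, 0 <= B & forall x, (1 + enorm x) ^+ k * `|g x| <= B.
  move=> gt; have [B B0 H] := tens_bound k gt; exists B => // x.
  rewrite (le_trans _ (H x))// ler_wpM2r// lerXn2r ?nnegrE ?addr_ge0 ?enorm_ge0//.
    by rewrite big_map prodr_ge0// => i _; rewrite addr_ge0.
  by rewrite big_map enorm_le_prod.
elim => [|m IH] g gt.
  have [B B0 H] := base g gt; exists B => // s x; rewrite leqn0 size_eq0 => /eqP ->; exact: H.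
have [B B0 H] := base g gt.
have gd j : tens (@FT R) coords ('D_(basis_rV R j) g).
  by have [_] := tens_derive FTc coords_linform gt; exact.
have /choice[D HD] : forall j, exists B, 0 <= B /\ forall (s : seq 'I_n) x, (size s <= m)%N ->
    (1 + enorm x) ^+ k * `|iter_derive [seq basis_rV R j | j <- s] ('D_(basis_rV R j) g) x| <= B.
  by move=> j; have [B' B0' H'] := IH _ (gd j); exists B'.
have D0 : 0 <= \sum_j D j by apply: sumr_ge0 => j _; case: (HD j).
exists (B + \sum_j D j); first exact: addr_ge0.
(* [iter_derive] is a right fold, so the last direction of the list is the first one to be applied
   to [g]. *)
move=> s x; case/lastP : s => [_|s j]; first by rewrite (le_trans (H x))// lerDl.
rewrite size_rcons ltnS map_rcons => sm.
have -> : iter_derive (rcons [seq basis_rV R j | j <- s] (basis_rV R j)) g =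
  iter_derive [seq basis_rV R j | j <- s] ('D_(basis_rV R j) g) by rewrite /iter_derive -cats1 foldr_cat.
have [_ HDj] := HD j; rewrite (le_trans (HDj s x sm))// (bigD1 j)//= addrCA lerDl addr_ge0//.
by apply: sumr_ge0 => i _; case: (HD i).
Qed.

Lemma tens_schwartz (phi : 'rV[R]_n -> C) : re_im (tens (@FT R) coords) phi -> schwartz phi.
Proof.
move=> [tr ti]; have FTc := @FT_closed R; split.
  by split; apply: (tens_smooth FTc coords_linform).
move=> k; have [B B0 H] := tens_schwartz_bound k tr; have [B' B0' H'] := tens_schwartz_bound k ti.
apply: (@le_lt_trans _ _ (B + B')%:E); last exact: ltry.
apply: ge_ereal_sup => _ [s [x [sk ->]]]; rewrite lee_fin.
rewrite (le_trans _ (lerD (H s x sk) (H' s x sk)))// -mulrDr ler_wpM2l ?exprn_ge0 ?addr_ge0 ?enorm_ge0//.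
exact: normc_le.
Qed.

Lemma prod_cFT_schwartz M u : (forall i, Cc M (u i)) ->
  schwartz (fun xi => \prod_(i < n) cFT (u i) (xi ord0 i)).
Proof.
move=> uC; apply: tens_schwartz; rewrite /coords.
elim: (index_enum _) => [|i s [IHr IHi]] /=.
  split.
    rewrite (_ : (fun x => _) = cst 1); first exact: tens_nil.
    by apply/funext => x; rewrite big_nil.
  rewrite (_ : (fun x => _) = fun x : 'rV[R]_n => 0 * cst 1 x); first by apply: tens_scale; exact: tens_nil.
  by apply/funext => x; rewrite big_nil mul0r.
have [cF sF] := cFT_FT (uC i).
split.
- rewrite [X in tens _ _ X](_ : _ = fun x : 'rV[R]_n => Fc (u i) (x ord0 i) * Re (\prod_(j <- s) cFT (u j) (x ord0 j)) +
    (-1) * (Fs (u i) (x ord0 i) * Im (\prod_(j <- s) cFT (u j) (x ord0 j)))); last first.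
    by apply/funext => x; rewrite big_cons cReM mulN1r.
  by apply: tens_add; [|apply: tens_scale]; apply: (@tens_cons R _ (@FT R) _ (fun x : 'rV[R]_n => x ord0 i)).
- rewrite [X in tens _ _ X](_ : _ = fun x : 'rV[R]_n => Fc (u i) (x ord0 i) * Im (\prod_(j <- s) cFT (u j) (x ord0 j)) +
    (Fs (u i) (x ord0 i) * Re (\prod_(j <- s) cFT (u j) (x ord0 j)))); last first.
    by apply/funext => x; rewrite big_cons cImM.
  by apply: tens_add; apply: (@tens_cons R _ (@FT R) _ (fun x : 'rV[R]_n => x ord0 i)).
Qed.

End product_transform.

(** * Singular integral operators tested on dilated products *)

Lemma ae_le_Lnormy d (T : measurableType d) (R : realType) (m : {measure set T -> \bar R}) (f : T -> \bar R) :
  {ae m, forall x, (`|f x| <= Lnorm m +oo f)%E}.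
Proof.
rewrite unlock; case: ifPn => [_|]; first exact: ess_sup_inf.ess_sup_ge.
(* The norm is set to zero when the whole space is null; in that case every set is null. *)
rewrite -leNgt => m0; exists setT; split => //.
by apply/eqP; rewrite eq_le m0 measure_ge0.
Qed.

Section kernel_toolkit.
Variables (R : realType) (n : nat).
Local Notation C := R[i].
Local Notation leb := (@lebesgue_rV R n).

(** [fk_hat] is bounded only almost everywhere. Replacing it by 0 where it exceeds its essential
    supremum gives a function bounded at every point that defines the same operator. *)
Lemma bounded_representative (K : fundamental_kernel R n) : exists (H : 'rV[R]_n -> C) (B : R),
  [/\ 0 <= B, re_im (mfunT) H, forall x, normc (H x) <= B &
    {ae leb, forall x, H x = fk_hat K x}].
Proof.
have mh := fk_hat_measurable K; have := fk_hat_bounded K; set L := Lnorm _ _ _ => Ly.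
have L0 : (0 <= L)%E by exact: Lnorm_ge0.
have Lf : L \is a fin_num by rewrite ge0_fin_numE.
pose A := [set x | normc (fk_hat K x) <= fine L].
have mA : measurable A.
  have := measurable_normc mh => /(_ measurableT `]-oo, fine L]%classic (measurable_itv _)).
  by rewrite setTI; congr measurable; apply/seteqP; split => x /=; rewrite in_itv.
exists (fun x => fk_hat K x * Complex (\1_A x) 0), (fine L); split.
- exact: fine_ge0.
- apply: re_im_measurableM => //; split; [exact: measurable_indic|exact: measurable_cst].
- move=> x; rewrite indicE; case: (boolP (x \in A)) => [|_].
    by rewrite inE /A/= ComplexField.Normc.normcM ComplexField.Normc.normc1 mulr1.
  by rewrite ComplexField.Normc.normcM ComplexField.Normc.normc0 mulr0 fine_ge0.
- apply: ae_imply (ae_le_Lnormy leb (fun xi => (normc (fk_hat K xi))%:E)) => x.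
  rewrite -/L -(fineK Lf) abse_EFin lee_fin ger0_norm ?normc_ge0// => xL.
  by rewrite indicE mem_set ?mulr1.
Qed.

Lemma Cintegral_ae (f g : 'rV[R]_n -> C) : re_im (mfunT) f -> re_im (mfunT) g ->
  {ae leb, forall x, f x = g x} -> Cintegral leb setT f = Cintegral leb setT g.
Proof.
move=> [mf mf'] [mg mg'] fg; apply: Cext; rewrite /= /Rintegral; congr fine; apply: ae_eq_integral => //;
  try exact/measurable_EFinP; by apply: ae_imply fg => x -> _.
Qed.

Lemma Rintegral_prod m (g : 'I_m -> R -> R) : (forall i, integrableT mu (g i)) ->
  integrableT (lebesgue_rV R m) (fun x : 'rV[R]_m => \prod_(i < m) g i (x ord0 i)) /\
  \int[lebesgue_rV R m]_x (\prod_(i < m) g i (x ord0 i)) = \prod_(i < m) \int[mu]_z g i z.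
Proof.
move=> gI; have gC i : Cintegrable mu (fun x => Complex (g i x) 0).
  by split; [exact: gI|exact: integrable0].
have P (x : 'rV[R]_m) : \prod_(i < m) Complex (g i (x ord0 i)) 0 = Complex (\prod_(i < m) g i (x ord0 i)) 0.
  by rewrite Complex_prod.
split.
  by have [I _] := Cintegrable_prod gC; move: I; congr (integrable _ _ _); apply/funext => x; rewrite /= P.
have E := congr1 (@complex.Re R) (Cintegral_prod gC).
transitivity (Re (Cintegral (lebesgue_rV R m) setT (fun x : 'rV[R]_m => \prod_(i < m) Complex (g i (x ord0 i)) 0))).
  by apply: eq_Rintegral => x _; rewrite P.
rewrite E (_ : \prod_(i < m) _ = \prod_(i < m) Complex (\int[mu]_x g i x) 0).
  by rewrite -Complex_prod.
by apply: eq_bigr => i _; apply: Cext => //=; rewrite /Rintegral integral0.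
Qed.

Lemma measurable_dotv d (T : measurableType d) (f g : T -> 'rV[R]_n) :
  mfunT f -> mfunT g -> mfunT (fun x => dotv (f x) (g x)).
Proof.
move=> mf mg; rewrite /dotv; apply: measurable_sum => i.
apply: measurable_funM; [exact: (measurableT_comp (measurable_coord i) mf)|exact: (measurableT_comp (measurable_coord i) mg)].
Qed.

Lemma dotvBl (x y z : 'rV[R]_n) : dotv (x - y) z = dotv x z - dotv y z.
Proof. by rewrite /dotv -sumrB; apply: eq_bigr => i _; rewrite !mxE mulrBl. Qed.

End kernel_toolkit.

(** * Singular operators tested on a dilated profile *)

Section kernel.
Variables (R : realType) (n : nat).
Local Notation C := R[i].
Local Notation leb := (@lebesgue_rV R n).
Variables (H : 'rV[R]_n -> C) (B : R) (v : 'I_n -> R -> R) (M : R).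
Hypotheses (B0 : 0 <= B) (mH : re_im (mfunT) H) (H_le : forall x, normc (H x) <= B).
Hypothesis vC : forall i, Cc M (v i).
Implicit Types (x y w xi : 'rV[R]_n).

(** The transform of the product profile of scale [q] centred at the origin; a centre [w]
    contributes only the phase in [prod_cFT_dil]. *)
Definition PP q xi := \prod_(i < n) cFT (dil 1 0 (v i)) (q * xi ord0 i).

(** K convolved with the dilated profile, written on the Fourier side. Its real part [kap] is the
    kernel that represents [S g] tested on the profile centred at [y] as a convolution with [g]. *)
Definition ckap q w := Cintegral leb setT (fun xi => H xi * (cis (2 * pi * dotv w xi) * PP q xi)).

Definition kap q w : R := Re (ckap q w).

Lemma prod_cFT_dil q w xi : 0 < q ->
  \prod_(i < n) cFT (dil q (w ord0 i) (v i)) (xi ord0 i) = cis (2 * pi * dotv w xi) * PP q xi.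
Proof.
move=> q0; rewrite cis_dotv /PP -big_split/=; apply: eq_bigr => i _.
by rewrite (cFT_dil _ _ q0 (vC i)).
Qed.

Definition AA := \prod_(i < n) \int[mu]_z normc (cFT (dil 1 0 (v i)) z).

Let dC i := dil_Cc 0 ltr01 (vC i).

Lemma AA_ge0 : 0 <= AA.
Proof. by apply: prodr_ge0 => i _; apply: Rintegral_ge0 => x _; exact: normc_ge0. Qed.

Lemma Rintegral_scale1 q (g : R -> R) : 0 < q -> mfunT g ->
  \int[mu]_z g (q * z) = q^-1 * \int[mu]_z g z.
Proof.
move=> q0 mg; have qn : q != 0 by rewrite gt_eqF.
rewrite -(Rintegral_affine1 0 qn mg) (gtr0_norm q0) mulKf//.
by apply: eq_Rintegral => z _; rewrite addr0.
Qed.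

Lemma integrable_scale1 q (g : R -> R) : q != 0 -> integrableT mu g ->
  integrableT mu (fun z => g (q * z)).
Proof.
move=> q0 /integrableP[/measurable_EFinP mg gy]; apply/integrableP; split.
  by apply/measurable_EFinP; apply: (measurableT_comp mg); exact: measurable_funM.
have mg' : mfunT (fun x : R => `|(g x)%:E|%E : \bar R) by apply: measurableT_comp => //; exact/measurable_EFinP.
have := ge0_integral_affine1 0 q0 mg' (fun x : R => abse_ge0 _).
under eq_integral do rewrite addr0.
move=> E; move: gy; rewrite /= -E; have := @integral_ge0 _ _ R mu setT (fun x : R => `|(g (q * x))%:E|%E) (fun (x : R) _ => abse_ge0 _).
case: (\int[mu]_x _)%E => //; first by move=> r _ _; exact: ltry.
by move=> _; rewrite gt0_muley ?lte_fin ?normr_gt0.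
Qed.

Lemma PP_integrable q : 0 < q -> Cintegrable leb (PP q) /\ \int[leb]_xi normc (PP q xi) = q ^- n * AA.
Proof.
move=> q0; have qn : q != 0 by rewrite gt_eqF.
have cI i := cFT_Cintegrable (dC i).
have hI i : Cintegrable mu (fun z => cFT (dil 1 0 (v i)) (q * z)).
  by have [h1 h2] := cI i; split; [exact: (integrable_scale1 qn h1)|exact: (integrable_scale1 qn h2)].
split; first exact: (Cintegrable_prod hI).
rewrite /PP; under eq_Rintegral do rewrite normc_prod.
have [_ ->] := Rintegral_prod (g := fun i z => normc (cFT (dil 1 0 (v i)) (q * z))) (fun i => Cintegrable_normc (hI i)).
have W i : \int[mu]_z normc (cFT (dil 1 0 (v i)) (q * z)) = q^-1 * \int[mu]_z normc (cFT (dil 1 0 (v i)) z).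
  exact: (Rintegral_scale1 q0 (measurable_normc (Cintegrable_measurable (cI i)))).
by rewrite (eq_bigr _ (fun i _ => W i)) big_split prodr_const card_ord exprVn.
Qed.

Lemma measurable_PP q : re_im (mfunT) (PP q).
Proof.
apply: re_im_measurable_prod => i; apply: (re_im_measurable_comp (Cintegrable_measurable (cFT_Cintegrable (dC i)))).
by apply: measurable_funM => //; exact: measurable_coord.
Qed.

Let HPm d (T : measurableType d) (f g : T -> 'rV[R]_n) q : mfunT f -> mfunT g ->
  re_im (mfunT) (fun z => H (f z) * (cis (2 * pi * dotv (g z) (f z)) * PP q (f z))).
Proof.
move=> mf mg; apply: re_im_measurableM; first exact: re_im_measurable_comp.
apply: re_im_measurableM; last exact: (re_im_measurable_comp (measurable_PP q)).
by apply: re_im_measurable_cis; apply: measurable_funM => //; exact: measurable_dotv.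
Qed.

Lemma ckap_integrable q w : 0 < q -> Cintegrable leb (fun xi => H xi * (cis (2 * pi * dotv w xi) * PP q xi)).
Proof.
move=> q0; have [PI _] := PP_integrable q0.
apply: (le_Cintegrable (g := fun xi => B * normc (PP q xi))).
- by apply: HPm => //; exact: measurable_cst.
- exact: (integrableZl measurableT B (Cintegrable_normc PI)).
- by move=> xi; rewrite !ComplexField.Normc.normcM normc_cis mul1r ler_wpM2r ?normc_ge0.
Qed.

Lemma kap_le q w : 0 < q -> `|kap q w| <= 2 * B * AA * q ^- n.
Proof.
move=> q0; have [PI PE] := PP_integrable q0.
rewrite (le_trans (Re_le_normc _))// (le_trans (normc_Cintegral (ckap_integrable w q0)))//.
rewrite -!mulrA ler_pM2l// [AA * _]mulrC -PE -RintegralZl//; last exact: Cintegrable_normc.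
apply: le_Rintegral => //.
- exact: (Cintegrable_normc (ckap_integrable w q0)).
- exact: (integrableZl measurableT B (Cintegrable_normc PI)).
- by move=> xi _; rewrite !ComplexField.Normc.normcM normc_cis mul1r ler_wpM2r ?normc_ge0.
Qed.

Lemma measurable_kap q : mfunT (kap q).
Proof.
apply: (measurable_Rintegral leb (f := fun z : 'rV[R]_n * 'rV[R]_n => Re (H z.2 * (cis (2 * pi * dotv z.1 z.2) * PP q z.2)))).
by have [] := HPm q (@measurable_snd _ _ 'rV[R]_n 'rV[R]_n) (@measurable_fst _ _ 'rV[R]_n 'rV[R]_n).
Qed.

(** Fubini in frequency and position: the integrand is dominated by [B], the integrable [PP q] and
    [g]. The two phases combine into the one of [ckap] at [y - x]. *)
Lemma singular_op_kap (K : fundamental_kernel R n) (g : 'rV[R]_n -> R) q y :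
  {ae leb, forall x, H x = fk_hat K x} -> 0 < q -> integrableT leb g ->
  Re (singular_op K g (fun x => Complex (\prod_(i < n) dil q (y ord0 i) (v i) (x ord0 i)) 0)) =
  \int[leb]_x (kap q (y - x) * g x).
Proof.
move=> HK q0 gI; have [PI PE] := PP_integrable q0.
pose M' := \sum_(i < n) `|y ord0 i| + q * M.
have uC i : Cc M' (dil q (y ord0 i) (v i)).
  apply: Cc_le (dil_Cc (y ord0 i) q0 (vC i)); rewrite lerD2r (bigD1 i)//= lerDl.
  by apply: sumr_ge0.
have mg : mfunT g by exact: measurable_L1 gI.
have mgc : re_im (mfunT) (fun x => Complex (g x) 0 : C) by split; [exact: mg|exact: measurable_cst].
have gn : integrableT leb (fun x => `|g x|) by exact: integrable_norm.
have fI xi : Cintegrable leb (fun x => cis (- (2 * pi * dotv x xi)) * Complex (g x) 0).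
  apply: (le_Cintegrable _ gn).
    apply: re_im_measurableM mgc; apply: re_im_measurable_cis; apply: measurableT_comp => //.
    by apply: measurable_funM => //; apply: measurable_dotv => //; exact: measurable_cst.
  by move=> x; rewrite ComplexField.Normc.normcM normc_cis mul1r /= expr0n addr0 sqrtr_sqr.
pose F (z : 'rV[R]_n * 'rV[R]_n) : C := H z.1 * (cis (2 * pi * dotv y z.1) * PP q z.1) *
  (cis (- (2 * pi * dotv z.2 z.1)) * Complex (g z.2) 0).
have mF : re_im (mfunT) F.
  apply: re_im_measurableM; first by apply: HPm; [exact: measurable_fst|exact: measurable_cst].
  apply: re_im_measurableM; last exact: (re_im_measurable_comp mgc measurable_snd).
  apply: re_im_measurable_cis; apply: measurableT_comp => //.
  apply: measurable_funM => //; apply: measurable_dotv; [exact: measurable_snd|exact: measurable_fst].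
have FI : Cintegrable (leb \x leb)%E F.
  apply: (le_Cintegrable mF (integrable_prod (integrableZl measurableT B (Cintegrable_normc PI)) gn)).
  move=> [xi x]; rewrite /F/= !ComplexField.Normc.normcM !normc_cis !mul1r.
  rewrite [X in _ * _ * X](_ : _ = `|g x|); last by rewrite /= expr0n addr0 sqrtr_sqr.
  by rewrite ler_wpM2r// ler_wpM2r ?normc_ge0.
rewrite /singular_op.
have mfou : re_im (mfunT) (fourier (fun x => Complex (g x) 0 : C)).
  pose G (z : 'rV[R]_n * 'rV[R]_n) : C := cis (- (2 * pi * dotv z.2 z.1)) * Complex (g z.2) 0.
  have [mG1 mG2] : re_im (mfunT) G.
    apply: re_im_measurableM; last exact: (re_im_measurable_comp mgc measurable_snd).
    apply: re_im_measurable_cis; apply: measurableT_comp => //.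
    apply: measurable_funM => //; apply: measurable_dotv; [exact: measurable_snd|exact: measurable_fst].
  by split; [exact: (measurable_Rintegral leb mG1)|exact: (measurable_Rintegral leb mG2)].
have minv : re_im (mfunT) (inv_fourier (fun x : 'rV[R]_n => Complex (\prod_(i < n) dil q (y ord0 i) (v i) (x ord0 i)) 0)).
  rewrite (_ : inv_fourier _ = fun xi => cis (2 * pi * dotv y xi) * PP q xi); last first.
    by apply/funext => xi; rewrite (inv_fourier_prod _ uC) prod_cFT_dil.
  apply: re_im_measurableM; last exact: measurable_PP.
  by apply: re_im_measurable_cis; apply: measurable_funM => //; apply: measurable_dotv => //; exact: measurable_cst.
rewrite (@Cintegral_ae R n _ (fun xi => H xi * fourier (fun x => Complex (g x) 0 : C) xi *
    inv_fourier (fun x : 'rV[R]_n => Complex (\prod_(i < n) dil q (y ord0 i) (v i) (x ord0 i)) 0) xi)); last first.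
- by apply: ae_imply HK => xi ->.
- by apply: re_im_measurableM => //; exact: re_im_measurableM.
- by apply: re_im_measurableM => //; apply: re_im_measurableM => //; exact: fk_hat_measurable.
rewrite (_ : Cintegral _ _ _ = Cintegral leb setT (fun xi => Cintegral leb setT (fun x => F (xi, x)))); last first.
  congr (Cintegral _ _ _); apply/funext => xi.
  rewrite (inv_fourier_prod _ uC) prod_cFT_dil// /F /fourier/= (Cintegral_scale _ (fI xi)).
  by rewrite -!mulrA; congr (_ * _); rewrite mulrC -!mulrA.
rewrite Cfubini// (_ : Cintegral _ _ _ = Cintegral leb setT (fun x => Complex (g x) 0 * ckap q (y - x))); last first.
  congr (Cintegral _ _ _); apply/funext => x.
  rewrite -(Cintegral_scale _ (ckap_integrable (y - x) q0)).
  congr (Cintegral _ _ _); apply/funext => xi.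
  rewrite /F/= dotvBl mulrBr cisD; ring.
by apply: eq_Rintegral => x _; rewrite cReM/= mul0r subr0 mulrC.
Qed.

End kernel.

(** * Discretisation, measurability and mean value inequality on R^n *)

Section rV_topology.
Variables (R : realType) (n : nat).
Local Notation V := 'rV[R]_n.

Lemma rV_norm_le (x : V) e : 0 <= e -> (forall i, `|x ord0 i| <= e) -> `|x| <= e.
Proof.
move=> e0 H; rewrite [`|x|]mx_normrE; apply: bigmax_le => //= -[i j] _ /=.
by rewrite (ord1 i).
Qed.

(** Rounding the coordinates down to multiples of 1/(k+1) leaves countably many values, so any
    function composed with [grid] is measurable. Continuous functions are then limits of measurable
    ones. *)
Definition grid (k : nat) (x : V) : V := \row_i ((Num.floor (k.+1%:R * x ord0 i))%:~R / k.+1%:R).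

Lemma grid_cvg x : grid k x @[k --> \oo] --> x.
Proof.
apply/cvgrPdist_le => e e0; near=> k; apply: rV_norm_le; first exact: ltW.
move=> i; rewrite !mxE; set y := x ord0 i.
have p0 : 0 < k.+1%:R :> R by [].
have /andP[h1 h2] := floor_itv (k.+1%:R * y).
have ke : (k.+1%:R)^-1 <= e.
  by apply: ltW; near: k; exact: near_infty_natSinv_lt (PosNum e0).
rewrite (le_trans _ ke)// -[y in y - _](mulKf (lt0r_neq0 p0)) [_^-1 * _]mulrC -mulrBl normrM normfV (gtr0_norm p0) ler_piMl ?invr_ge0 ?ltW//.
rewrite ger0_norm ?subr_ge0//.
by rewrite ltrBlDl; move: h2; rewrite intrD.
Unshelve. all: by end_near. Qed.

Lemma measurable_grid (f : V -> R) k : mfunT (f \o grid k).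
Proof.
move=> _ B mB; rewrite setTI.
have p0 : 0 < k.+1%:R :> R by [].
pose Q (z : 'rV[int]_n) : V := \row_i ((z ord0 i)%:~R / k.+1%:R).
pose A (z : 'rV[int]_n) : set V := \bigcap_(i in [set: 'I_n])
   ((fun x : V => x ord0 i) @^-1` [set y : R | Num.floor (k.+1%:R * y) = z ord0 i]).
have mA z : measurable (A z).
  apply: fin_bigcap_measurable => // i _.
  rewrite -[X in measurable X]setTI; apply: measurable_coord => //.
  rewrite (_ : [set y | _] = `[(z ord0 i)%:~R / k.+1%:R, ((z ord0 i)%:~R + 1) / k.+1%:R[%classic)//.
  apply/seteqP; split => y /=; rewrite in_itv/= ler_pdivrMr// ltr_pdivlMr// [y * _]mulrC.
    by move=> <-; have := floor_itv (k.+1%:R * y); rewrite intrD.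
  by move=> H; apply: floor_def; rewrite intrD.
rewrite (_ : _ @^-1` _ = \bigcup_(z in [set: 'rV[int]_n]) (A z `&` [set x | B (f (Q z))])).
  apply: (@countable_bigcupT_measurable _ _ 'rV[int]_n); first exact: countableP.
  move=> z; apply: measurableI => //; have [h|h] := pselect (B (f (Q z))).
    by rewrite (_ : [set x | _] = setT)//; apply/seteqP; split.
  by rewrite (_ : [set x | _] = set0)//; apply/seteqP; split.
apply/seteqP; split => [x /= Bx|x [z _ [Az /= Bz]]] /=.
  exists (\row_i Num.floor (k.+1%:R * x ord0 i)) => //; split.
    by move=> i _ /=; rewrite mxE.
  rewrite /= (_ : Q _ = grid k x)//; by apply/rowP => i; rewrite !mxE.
rewrite (_ : grid k x = Q z)//; apply/rowP => i; rewrite !mxE.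
by have /= -> := Az i Logic.I.
Qed.

Lemma measurable_set1_rV (c : V) : measurable [set c].
Proof.
rewrite (_ : [set c] = \bigcap_(i in [set: 'I_n]) ((fun x : V => x ord0 i) @^-1` [set c ord0 i])).
  apply: fin_bigcap_measurable => // i _.
  by rewrite -[X in measurable X]setTI; apply: measurable_coord => //; exact: measurable_set1.
apply/seteqP; split => [_ -> i _ //|x /= H]; apply/rowP => i; exact: (H i Logic.I).
Qed.

Lemma punctured_continuous_measurable (f : V -> R) (c : V) :
  (forall x, x != c -> {for x, continuous f}) -> mfunT (fun x => f x * \1_(~` [set c]) x).
Proof.
move=> fc; apply: (measurable_realfun.measurable_fun_cvg (h := fun k x => f (grid k x) * \1_(~` [set c]) x)).
  move=> k; apply: measurable_funM; first exact: measurable_grid.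
  by apply: measurable_indic; apply: measurableC; exact: measurable_set1_rV.
move=> x _; rewrite indicE; case: (boolP (x \in ~` [set c])) => [|_].
  rewrite inE/= => /eqP xc; apply: cvgM; last exact: cvg_cst.
  by move=> A fA; exact: (grid_cvg (fc x xc A fA)).
by rewrite mulr0; under eq_fun do rewrite mulr0; exact: cvg_cst.
Qed.

Lemma derive_basis (f : V -> R) (u p : V) : differentiable f p ->
  'D_u f p = \sum_(j < n) u ord0 j * 'D_(basis_rV R j) f p.
Proof.
move=> fd; rewrite deriveE// {1}[u]row_sum_delta linear_sum.
by apply: eq_bigr => j _; rewrite linearZ/= deriveE.
Qed.

Lemma rV_MVT (f : V -> R) (w x : V) (B : R) :
  (forall h : R, 0 <= h <= 1 -> differentiable f (w + h *: (x - w)) /\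
     `|'D_(x - w) f (w + h *: (x - w))| <= B) ->
  `|f x - f w| <= B.
Proof.
move=> H; pose g (h : R) := f (w + h *: (x - w)).
have gd (h : R) : 0 <= h <= 1 -> is_derive h 1 g ('D_(x - w) f (w + h *: (x - w))).
  move=> h01; have [fd _] := H h h01.
  have fdv : derivable f (w + h *: (x - w)) (x - w) by exact: diff_derivable.
  have E : (fun k : R => k^-1 *: ((g \o shift h) (k *: (1 : R)) - g h)) =
    (fun k : R => k^-1 *: ((f \o shift (w + h *: (x - w))) (k *: (x - w)) - f (w + h *: (x - w)))).
    apply/funext => k /=; congr (_ *: (f _ - _)).
    by rewrite -[k%:A]/(k * 1) mulr1 scalerDl addrCA.
  by apply: DeriveDef; [rewrite /derivable E|rewrite /derive E].
have [||c c01] := @MVT_segment R g (fun h => 'D_(x - w) f (w + h *: (x - w))) 0 1 ler01.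
- by move=> h; rewrite in_itv/= => /andP[h0 h1]; apply: gd; rewrite !ltW.
- apply: derivable_within_continuous => h; rewrite in_itv/= => h01; by have [] := gd h h01.
- rewrite subr0 mulr1 /g scale0r addr0 scale1r addrCA subrr addr0 => ->.
  by have [_] := H c c01.
Qed.

End rV_topology.

(** * Decay of the rescaled kernels *)

Section kernel_decay.
Variables (R : realType) (n : nat).
Local Notation C := R[i].
Local Notation leb := (@lebesgue_rV R n).
Variables (K : fundamental_kernel R n) (H : 'rV[R]_n -> C) (B : R) (v : 'I_n -> R -> R) (M : R).
Hypotheses (B0 : 0 <= B) (mH : re_im (mfunT) H) (H_le : forall x, normc (H x) <= B).
Hypothesis HK : {ae leb, forall x, H x = fk_hat K x}.
Hypotheses (M0 : 0 < M) (vC : forall i, Cc M (v i)).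
Implicit Types (x w xi : 'rV[R]_n).

Definition prof q w x : R := \prod_(i < n) dil q (w ord0 i) (v i) (x ord0 i).

Let uC q w i : 0 < q -> Cc (\sum_(i < n) `|w ord0 i| + q * M) (dil q (w ord0 i) (v i)).
Proof.
move=> q0; apply: Cc_le (dil_Cc (w ord0 i) q0 (vC i)); rewrite lerD2r (bigD1 i)//= lerDl.
by apply: sumr_ge0.
Qed.

Lemma dil_supp q (y : R) i (x : R) : 0 < q -> q * M < `|x - y| -> dil q y (v i) x = 0.
Proof.
move=> q0 h; rewrite /dil (vC i).2 ?mulr0// normrM normfV (gtr0_norm q0) ltr_pdivlMr// mulrC.
by rewrite distrC.
Qed.

Lemma prof_supp q w x : 0 < q -> prof q w x != 0 -> forall i, `|x ord0 i - w ord0 i| <= q * M.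
Proof.
move=> q0 + i; apply: contraR; rewrite -ltNge => h.
by apply/eqP; rewrite /prof (bigD1 i)//= dil_supp// mul0r.
Qed.

Lemma dil_int q (y : R) i : 0 < q -> \int[mu]_x dil q y (v i) x = \int[mu]_x v i x /\
  \int[mu]_x `|dil q y (v i) x| = \int[mu]_x `|v i x|.
Proof.
move=> q0; have qn : - q^-1 != 0 by rewrite oppr_eq0 invr_eq0 gt_eqF.
have mv := SM_measurable (vC i).1.
have mv' : mfunT (fun x : R => `|v i x|) by exact: measurableT_comp.
have dC := dil_Cc y q0 (vC i).
have E (x : R) : (y - x) / q = - q^-1 * x + y / q by field; rewrite gt_eqF.
split.
  rewrite -(Rintegral_affine1 (y / q) qn mv) normrN normfV (gtr0_norm q0).
  rewrite -RintegralZl//; last first.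
    have := Cc_integrable (Cc_scale q dC); congr (integrable _ _ _); apply/funext => x.
    by rewrite /= /dil mulVKf ?gt_eqF// E.
  by apply: eq_Rintegral => x _; rewrite /dil E.
rewrite -(Rintegral_affine1 (y / q) qn mv') normrN normfV (gtr0_norm q0).
rewrite -RintegralZl//; last first.
  have := Cc_integrable_norm (Cc_scale q dC); congr (integrable _ _ _); apply/funext => x.
  by rewrite /= /dil mulVKf ?gt_eqF// E.
by apply: eq_Rintegral => x _; rewrite /dil E normrM ger0_norm ?invr_ge0 ?ltW.
Qed.

Lemma prof_int q w : 0 < q -> [/\ integrableT leb (prof q w),
  \int[leb]_x prof q w x = \prod_(i < n) \int[mu]_x v i x &
  \int[leb]_x `|prof q w x| = \prod_(i < n) \int[mu]_x `|v i x|].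
Proof.
move=> q0; have [I E] := Rintegral_prod (fun i => Cc_integrable (uC w i q0)).
have [I' E'] := Rintegral_prod (fun i => Cc_integrable_norm (uC w i q0)).
split => //.
  by rewrite /prof E; apply: eq_bigr => i _; have [] := dil_int (w ord0 i) i q0.
rewrite (_ : \prod_(i < n) _ = \prod_(i < n) \int[mu]_x `|dil q (w ord0 i) (v i) x|).
  by rewrite -E'; apply: eq_Rintegral => x _; rewrite /prof normr_prod.
by apply: eq_bigr => i _; have [] := dil_int (w ord0 i) i q0.
Qed.

Let far q w i x : 0 < q -> 2 * q * M <= `|w ord0 i| -> `|x ord0 i - w ord0 i| <= q * M ->
  `|w ord0 i| / 2 <= `|x ord0 i| /\ x != 0.
Proof.
move=> q0 wi xw; have qM : 0 < q * M by rewrite mulr_gt0.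
have h : `|w ord0 i| / 2 <= `|x ord0 i|.
  by have := ler_normB (x ord0 i) (x ord0 i - w ord0 i); rewrite subKr; lra.
split => //; apply: contraTneq h => ->; rewrite mxE normr0 -ltNge; lra.
Qed.

(** When [w] is far from the origin compared with [q], the profile centred at [w] is a test function
    supported away from 0. Fourier inversion identifies [kap] with K tested on it, and there K is
    the function [fk_fun]. *)
Lemma kap_ker q w i : 0 < q -> 2 * q * M <= `|w ord0 i| ->
  kap H v q w = \int[leb]_x (Re (fk_fun K x) * prof q w x).
Proof.
move=> q0 wi.
have -> : kap H v q w = Re (fk_dist K (fourier (fun xi => \prod_(i < n) cFT (dil q (w ord0 i) (v i)) (xi ord0 i)))).
  rewrite (fk_hatE K (prod_cFT_schwartz (fun i => uC w i q0))) /kap /ckap.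
  congr (Re _); apply: Cintegral_ae.
  - exact: Cintegrable_measurable (ckap_integrable mH H_le vC w q0).
  - apply: re_im_measurableM; first exact: fk_hat_measurable.
    apply: re_im_measurable_prod => k.
    apply: (re_im_measurable_comp (Cintegrable_measurable (cFT_Cintegrable (uC w k q0)))).
    exact: measurable_coord.
  - by apply: ae_imply HK => xi ->; rewrite (prod_cFT_dil vC).
rewrite (_ : fourier _ = fun x => Complex (prof q w x) 0); last first.
  by apply/funext => x; rewrite (fourier_prod _ (fun i => uC w i q0)).
rewrite fk_funE; last first.
  split => /=.
    apply: (@test_prod R n (fun i => dil q (w ord0 i) (v i)) (q * M) w).
    - by move=> k; exact: (uC w k q0).1.
    - by move=> k x; exact: dil_supp.
    - move=> x xw; have := xw i; rewrite !mxE => xwi.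
      by have [_ /eqP] := far q0 wi xwi.
  have [cs ss] := @compact_support_sub R _ (fun _ : 'rV[R]_n => 0) set0 closed0 compact0 (fun x h => False_ind _ (negP h (eqxx _))).
  split => //; last exact: subset_trans ss (@sub0set _ _).
  rewrite (_ : (fun _ => 0) = fun x : 'rV[R]_n => 0 * cst 1 x); last by apply/funext => x; rewrite mul0r.
  by apply: (tens_smooth (@SM_closed R) (ls := [::])) => //; apply: tens_scale; exact: tens_nil.
by apply: eq_Rintegral => x _; rewrite cReM/= mulr0 subr0.
Qed.

Hypothesis v0 : exists j, \int[mu]_x v j x = 0.

(** The profile has mean zero, so the value of the kernel at [w] may be subtracted from it. The mean
    value inequality and the bound on the gradient then gain a factor [q / |w|] over the size of the
    kernel. *)
Lemma kap_decay : exists2 D, 0 <= D & forall q w i, 0 < q -> 2 * q * M <= `|w ord0 i| ->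
  `|kap H v q w| <= D * q * `|w ord0 i| ^- n.+1.
Proof.
have [C1 C10 grad] := fk_gradient K.
pose V := \prod_(i < n) \int[mu]_x `|v i x|.
have V0 : 0 <= V by apply: prodr_ge0 => i _; exact: Rintegral_ge0.
(* [n%:R * M] bounds the displacement in the support, in units of [q] and summed over the
   coordinates; the power of 2 accounts for points of the segment being half as far from 0 as [w];
   [V] is the L^1 norm of the profile. *)
exists (n%:R * M * C1 * 2 ^+ n.+1 * V); first by rewrite !mulr_ge0// ?exprn_ge0// ltW.
move=> q w i q0 wi; rewrite (kap_ker q0 wi).
have qM : 0 < q * M by rewrite mulr_gt0.
have wi0 : 0 < `|w ord0 i| by lra.
have [PI P0 P1] := prof_int w q0.
pose f x := Re (fk_fun K x).
have [f1 _] := fk_C1 K.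
pose L := n%:R * (q * M) * (C1 * (`|w ord0 i| / 2) ^- n.+1).
have L0 : 0 <= L by rewrite !mulr_ge0 ?invr_ge0 ?exprn_ge0 ?divr_ge0// ltW.
have near_w x : (forall j, `|x ord0 j - w ord0 j| <= q * M) -> `|f x - f w| <= L.
  move=> xw; apply: rV_MVT => h /andP[h0 h1].
  pose p := w + h *: (x - w).
  have pw : `|p ord0 i - w ord0 i| <= q * M.
    rewrite /p !mxE addrAC subrr add0r normrM (ger0_norm h0) (le_trans _ (xw i))//.
    by rewrite ler_piMl.
  have [pi p0] := far q0 wi pw.
  have [fd _] := f1 p (fun h => negP p0 (introT eqP h)).
  split => //; rewrite -/p derive_basis// (le_trans (ler_norm_sum _ _ _))//.
  rewrite /L -mulrA -[n in n%:R]card_ord mulr_natl -sumr_const; apply: ler_sum => j _.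
  rewrite normrM ler_pM//; first by rewrite !mxE.
  have pe : `|w ord0 i| / 2 <= enorm p by rewrite (le_trans pi)// coord_le_enorm.
  have G := grad p p0.
  have : `|'D_(basis_rV R j) f p| <= C1 * enorm p ^- n.+1.
    apply: le_trans G; apply: (@le_trans _ _ (normc (Cpartial [:: j] (fk_fun K) p))).
      exact: (Re_le_normc (Cpartial [:: j] (fk_fun K) p)).
    by rewrite -[leLHS]ger0_norm ?normc_ge0// -sqrtr_sqr ler_wsqrtr// (bigD1 j)//= lerDl sumr_ge0.
  move=> h2; apply: (le_trans h2); rewrite ler_wpM2l// lef_pV2 ?posrE ?exprn_gt0 ?divr_gt0//.
    by rewrite lerXn2r ?nnegrE ?divr_ge0 ?enorm_ge0.
  by rewrite (lt_le_trans _ pe)// divr_gt0.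
have mf : mfunT (fun x => f x * prof q w x).
  have mp : mfunT (prof q w) by exact: measurable_L1 PI.
  rewrite (_ : (fun x => _) = fun x => f x * \1_(~` [set (0 : 'rV[R]_n)]) x * prof q w x).
    apply: measurable_funM => //; apply: punctured_continuous_measurable => x /eqP x0.
    by apply: differentiable_continuous; have [] := f1 x x0.
  apply/funext => x; rewrite indicE; case: (boolP (x \in _)) => [_|]; first by rewrite mulr1.
  rewrite notin_setE/= => /contrapT ->; rewrite mulr0 mul0r.
  have [->|/(prof_supp q0) h] := eqVneq (prof q w 0) 0; first by rewrite mulr0.
  by have [_ /eqP] := far q0 wi (h i).
have DI : integrableT leb (fun x => (f x - f w) * prof q w x).
  apply: (le_integrable _ _ _ (integrableZl measurableT L (integrable_norm PI))) => //.
    apply/measurable_EFinP; under eq_fun do rewrite mulrBl.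
    apply: measurable_funB => //; apply: measurable_funM => //.
    by exact: measurable_L1 PI.
  move=> x _ /=; rewrite lee_fin normrM (ger0_norm (mulr_ge0 _ _))//.
  have [->|/(prof_supp q0) h] := eqVneq (prof q w x) 0; first by rewrite normr0 !mulr0.
  by rewrite ler_wpM2r// near_w.
have -> : \int[leb]_x (f x * prof q w x) = \int[leb]_x ((f x - f w) * prof q w x).
  have PZ := integrableZl measurableT (f w) PI.
  have E0 : \int[leb]_x (f w * prof q w x) = 0.
    rewrite RintegralZl// P0; case: v0 => j vj; by rewrite (bigD1 j)//= vj mul0r mulr0.
  rewrite -[RHS]addr0 -E0 -RintegralD//; apply: eq_Rintegral => x _; ring.
rewrite (le_trans (le_normr_Rintegral _ DI))//.
apply: (@le_trans _ _ (\int[leb]_x (L * `|prof q w x|))).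
  apply: le_Rintegral => //; first exact: integrable_norm DI.
    exact: (integrableZl measurableT L (integrable_norm PI)).
  move=> x _; rewrite normrM.
  have [->|/(prof_supp q0) h] := eqVneq (prof q w x) 0; first by rewrite normr0 !mulr0.
  by rewrite ler_wpM2r// near_w.
rewrite RintegralZl ?P1 -/V//; last exact: (integrable_norm PI).
rewrite /L exprMn invfM exprVn invrK le_eqVlt; apply/orP; left; apply/eqP; ring.
Qed.

End kernel_decay.

Lemma cvg_eq0 (R : realType) (u v : nat -> R) (l : R) : u @ \oo --> l -> v @ \oo --> 0 ->
  (forall k, `|u k| <= v k) -> l = 0.
Proof.
move=> ul v0 uv; apply: (cvg_unique (@norm_hausdorff _ _) ul).
apply/cvgr0Pnorm_le => e e0; near=> k.
rewrite (le_trans (uv k))// (le_trans (ler_norm _))//; near: k.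
exact: cvgr0_norm_le v0 e e0.
Unshelve. all: by end_near. Qed.

(** * An integrable majorant common to all scales *)

Section dyadic_majorant.
Variables (R : realType) (n : nat).
Local Notation leb := (@lebesgue_rV R n).

Lemma measurable_cube (r : R) : measurable (@cube R n r).
Proof.
rewrite (_ : cube r = \bigcap_(i in [set: 'I_n]) ((fun x : 'rV[R]_n => x ord0 i) @^-1` `[- r, r]%classic)).
  apply: fin_bigcap_measurable => // i _.
  by rewrite -[X in measurable X]setTI; apply: measurable_coord.
apply/seteqP; split => [x xr i _|x xr i]; last by have := xr i Logic.I; rewrite /= in_itv/= -ler_norml.
by rewrite /= in_itv/= -ler_norml.
Qed.

Lemma lebesgue_cube (r : R) : 0 <= r -> leb (cube r) = ((2 * r) ^+ n)%:E.
Proof.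
move=> r0; rewrite (_ : cube r = [set x : 'rV[R]_n | forall i, `[- r, r]%classic (x ord0 i)]).
  have := @lebesgue_rV_box R n (fun=> `[- r, r]%classic) (fun=> measurable_itv _) => ->.
  under eq_bigr do rewrite lebesgue_measure_itv/= lte_fin.
  have E : ((if - r < r then (r%:E - (- r)%:E)%E else 0%E) = (2 * r)%:E :> \bar R).
    case: ifPn => [_|]; first by rewrite -EFinB; congr EFin; ring.
    by rewrite -leNgt => h; congr EFin; lra.
  by under eq_bigr do rewrite E; rewrite prodEFin prodr_const card_ord.
by apply/seteqP; split => x xr i; have := xr i; rewrite /= in_itv/= -ler_norml.
Qed.

(** A dyadic model of (1 + |u|)^(-n-1). The cubes have volume [16 ^+ n * 2 ^+ (m * n)], so the m-th
    term has integral [16 ^+ n * 2 ^- m], and no integration in polar coordinates is required. *)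
Definition Psi (u : 'rV[R]_n) : \bar R :=
  (\sum_(0 <= m <oo) ((2 ^- (m * n.+1))%:E * (\1_(cube (8 * 2 ^+ m)) u)%:E))%E.

Let term0 m (u : 'rV[R]_n) : (0 <= (2 ^- (m * n.+1))%:E * (\1_(cube (8 * 2 ^+ m)) u)%:E :> \bar R)%E.
Proof. by rewrite -EFinM lee_fin mulr_ge0// invr_ge0 exprn_ge0. Qed.

Let mterm m : mfunT (fun u : 'rV[R]_n => (2 ^- (m * n.+1))%:E * (\1_(cube (8 * 2 ^+ m)) u)%:E : \bar R)%E.
Proof.
apply: measurable_funeM; apply/measurable_EFinP; apply: measurable_indic.
exact: measurable_cube.
Qed.

Lemma Psi_ge0 u : (0 <= Psi u)%E.
Proof. by apply: nneseries_ge0 => m _ _; exact: term0. Qed.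

Lemma measurable_Psi : mfunT Psi.
Proof. by apply: ge0_emeasurable_sum. Qed.

Lemma Psi_integrable : leb.-integrable setT Psi.
Proof.
apply/integrableP; split; first exact: measurable_Psi.
under eq_integral do rewrite gee0_abs ?Psi_ge0//.
rewrite /Psi integral_nneseries//.
apply: (@le_lt_trans _ _ (2 * 16 ^+ n)%:E); last exact: ltry.
apply: le_trans (epsilon_trick0 xpredT _); last by rewrite mulr_ge0// exprn_ge0.
apply: lee_nneseries => [m _|m _].
  by move=> _; apply: integral_ge0 => u _; exact: term0.
have p0 : 0 <= (8 : R) * 2 ^+ m by rewrite mulr_ge0// exprn_ge0.
rewrite ge0_integralZl//; last first.
  by apply/measurable_EFinP; apply: measurable_indic; exact: measurable_cube.
rewrite integral_indic//; last exact: measurable_cube.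
rewrite setIT; apply: (@le_trans _ _ ((2 ^- (m * n.+1))%:E * ((2 * (8 * 2 ^+ m)) ^+ n)%:E)%E).
  by rewrite -(lebesgue_cube p0).
rewrite -EFinM lee_fin le_eqVlt; apply/orP; left; apply/eqP.
have -> : 2 * (8 * 2 ^+ m) = 16 * 2 ^+ m :> R by ring.
rewrite exprMn -exprM natrX exprS mulnSr exprD; field.
by rewrite !expf_neq0.
Qed.

Lemma Psi_ge1 (u : 'rV[R]_n) : cube 8 u -> (1 <= Psi u)%E.
Proof.
move=> u8; apply: le_trans (nneseries_lim_ge (P := xpredT) 1 (fun m _ _ => term0 m u)).
by rewrite big_nat1 mul0n expr0 invr1 mul1e mulr1 indicE mem_set.
Qed.

(** One term of the series suffices: if the m-th cube is the last one not to contain [u], then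
    [|u_i| > 8 * 2 ^+ m >= 2 ^+ m.+1], and the next cube contains [u] because coordinate [i] is the
    largest. *)
Lemma Psi_ge_decay (u : 'rV[R]_n) i : 8 < `|u ord0 i| -> (forall j, `|u ord0 j| <= `|u ord0 i|) ->
  ((`|u ord0 i| ^- n.+1)%:E <= Psi u)%E.
Proof.
move=> u8 umax; pose r := `|u ord0 i|.
have ex : exists m, r <= 8 * 2 ^+ m.
  exists (Num.Def.truncn r).+1.
  have h := ltW (truncnS_gt r); rewrite (le_trans h)// (@le_trans _ _ (2 ^+ (Num.Def.truncn r).+1))//.
    by rewrite -natrX ler_nat ltnW// ltn_expl.
  by rewrite ler_peMl ?exprn_ge0//; lra.
case: (ex_minnP ex) => -[|m] hm mmin.
  by move: hm; rewrite expr0 mulr1 leNgt u8.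
have mr : 8 * 2 ^+ m < r by rewrite ltNge; apply/negP => /mmin; rewrite ltnn.
apply: le_trans (nneseries_lim_ge (P := xpredT) m.+2 (fun m _ _ => term0 m u)).
rewrite big_nat_recr//= indicE mem_set ?mule1; last by move=> j; exact: le_trans (umax j) hm.
apply: (@le_trans _ _ (2 ^- (m.+1 * n.+1))%:E); last by rewrite leeDr// sume_ge0.
rewrite lee_fin exprM lef_pV2 ?posrE ?exprn_gt0//; last by rewrite (lt_trans _ u8).
rewrite lerXn2r ?nnegrE ?exprn_ge0// (le_trans _ (ltW mr))// exprS ler_wpM2r ?exprn_ge0//.
by lra.
Qed.

End dyadic_majorant.

(** * Majorant and vanishing mean of the rescaled kernels *)

Section kernel_mean.
Variables (R : realType) (n : nat).
Local Notation C := R[i].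
Local Notation leb := (@lebesgue_rV R n).
Variables (K : fundamental_kernel R n) (H : 'rV[R]_n -> C) (B : R) (v : 'I_n -> R -> R).
Hypotheses (B0 : 0 <= B) (mH : re_im (mfunT) H) (H_le : forall x, normc (H x) <= B).
Hypothesis HK : {ae leb, forall x, H x = fk_hat K x}.
Hypotheses (vC : forall i, Cc 2 (v i)) (v0 : exists j, \int[mu]_x v j x = 0).
Implicit Types (x w xi : 'rV[R]_n).

(** In the cube of radius [8 * q] the crude bound by the L^1 norm of the transform is enough, since
    [Psi >= 1] there. Outside, the largest coordinate of [w] exceeds the threshold [4 * q] at which
    [kap_decay] applies to profiles of radius 2. *)
Lemma kap_majorant : exists2 E, 0 <= E & forall q w, 0 < q ->
  (`|kap H v q w|%:E <= (E * q ^- n)%:E * Psi (q^-1 *: w))%E.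
Proof.
have [D D0 HD] := kap_decay mH H_le HK (ltr0n R 2) vC v0.
have A0 := AA_ge0 v.
have E0 : 0 <= 2 * B * AA v by rewrite !mulr_ge0.
exists (2 * B * AA v + D); first exact: addr_ge0.
move=> q w q0; have qn0 : 0 <= q ^- n by rewrite invr_ge0 exprn_ge0// ltW.
have kl := kap_le mH H_le vC w q0.
have [|] := pselect (cube 8 (q^-1 *: w)).
  move=> /Psi_ge1 P1; apply: le_trans (lee_wpmul2l _ P1); last by rewrite lee_fin mulr_ge0// addr_ge0.
  by rewrite mule1 lee_fin (le_trans kl)// ler_wpM2r// lerDl.
move=> /existsNP[k /negP]; rewrite -ltNge => k8.
have [i _ imax] := @arg_maxP _ R _ k xpredT (fun j => `|(q^-1 *: w) ord0 j|) isT.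
pose r := `|(q^-1 *: w) ord0 i|.
have r8 : 8 < r by rewrite (lt_le_trans k8)//; exact: imax.
have wE : `|w ord0 i| = q * r.
  by rewrite /r mxE normrM normfV (gtr0_norm q0) mulVKf// gt_eqF.
apply: le_trans (lee_wpmul2l _ (Psi_ge_decay r8 (fun j => imax j isT))); last first.
  by rewrite lee_fin mulr_ge0// addr_ge0.
have wi : 2 * q * 2 <= `|w ord0 i|.
  by rewrite wE; have : q * 4 <= q * r; [rewrite ler_pM2l//; lra|lra].
rewrite -EFinM lee_fin (le_trans (HD q w i q0 wi))// wE -/r.
have rp : 0 <= r ^- n.+1 by rewrite invr_ge0 exprn_ge0//; lra.
have -> : D * q * (q * r) ^- n.+1 = D * q ^- n * r ^- n.+1.
  rewrite exprMn invfM [q ^+ n.+1]exprS; field.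
  by rewrite !expf_neq0// gt_eqF//; lra.
by rewrite ler_wpM2r// ler_wpM2r// lerDr.
Qed.

Lemma integrable_scale_rV (q : R) (f : 'rV[R]_n -> \bar R) : 0 < q -> (forall x, 0 <= f x)%E ->
  leb.-integrable setT f -> leb.-integrable setT (fun x => f (q^-1 *: x)).
Proof.
move=> q0 f0 /integrableP[mf fy].
have qi : q^-1 != 0 by rewrite invr_eq0 gt_eqF.
have ms : mfunT (fun x : 'rV[R]_n => q^-1 *: x).
  have := measurable_rV_affine q^-1 (0 : 'rV[R]_n); congr (measurable_fun _ _).
  by apply/funext => x; rewrite addr0.
apply/integrableP; split; first exact: (measurableT_comp mf ms).
have E := ge0_integral_scale qi mf f0.
have qp : 0 < `|q^-1| ^+ n by rewrite exprn_gt0// normr_gt0.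
have e1 : (\int[leb]_x `|f x| = \int[leb]_x f x)%E by apply: eq_integral => x _; exact: gee0_abs.
have e2 : (\int[leb]_x `|f (q^-1 *: x)%R| = \int[leb]_x f (q^-1 *: x)%R)%E by apply: eq_integral => x _; exact: gee0_abs.
move: fy; rewrite e1 -E -e2.
have := @integral_ge0 _ _ R leb setT (fun x => `|f (q^-1 *: x)|%E) (fun x _ => abse_ge0 _).
case: (\int[_]_x _)%E => //; first by move=> r _ _; exact: ltry.
by move=> _; rewrite gt0_muley ?lte_fin.
Qed.

Lemma kap_integrable q : 0 < q -> integrableT leb (kap H v q).
Proof.
move=> q0; have [E E0 HE] := kap_majorant.
have PI := integrable_scale_rV q0 (@Psi_ge0 R n) (@Psi_integrable R n).
apply: (le_integrable _ _ _ (integrableZl measurableT (E * q ^- n) PI)) => //.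
  by apply/measurable_EFinP; exact: measurable_kap mH vC q.
move=> w _; rewrite [leRHS]gee0_abs; first exact: HE.
by rewrite mule_ge0 ?Psi_ge0// lee_fin mulr_ge0// invr_ge0 exprn_ge0// ltW.
Qed.

(** A summability factor: it equals 1 at 0, and at argument [w / k.+1] it is the transform of a bump
    of mass one and width 1/(k+1). *)
Let Fe := Fc (@bell R).

Let Fe_int k : integrableT mu (fun x : R => Fe (x / k.+1%:R)).
Proof.
have FI : integrableT mu Fe.
  by apply: FT_integrable; exists 1, (@bell R); split; [exact: bell_Cc|left].
have kn : (k.+1%:R^-1 : R) != 0 by rewrite invr_eq0.
have := integrable_scale1 kn FI; congr (integrable _ _ _); apply/funext => x /=.
by rewrite mulrC.
Qed.

Let Fs_bell (xi : R) : Fs (@bell R) xi = 0.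
Proof.
have N1 : (-1 : R) != 0 by rewrite oppr_eq0 oner_eq0.
have mC := Cc_mul (SM_sinl xi) (@bell_Cc R).
have := Rintegral_affine1 0 N1 (SM_measurable mC.1); rewrite normrN1 mul1r -/(Fs _ _).
rewrite (_ : (fun x : R => _) = fun x : R => (-1) * (sin (2 * pi * (x * xi)) * bell x)); last first.
  by apply/funext => x; rewrite addr0 !mulN1r bellN mulNr mulrN sinN mulNr.
by rewrite (RintZ_Cc _ mC) -/(Fs _ _); lra.
Qed.

Let dil_bell : dil 1 0 (@bell R) = @bell R.
Proof. by apply/funext => x; rewrite /dil invr1 mul1r mulr1 sub0r bellN. Qed.

Lemma inv_Fe k (xi : R) :
  Cintegral mu setT (fun w : R => cis (2 * pi * (w * xi)) * Complex (Fe (w / k.+1%:R)) 0) =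
  Complex (k.+1%:R * bell (k.+1%:R * xi)) 0.
Proof.
have k0 : 0 < k.+1%:R^-1 :> R by rewrite invr_gt0.
have := cFT_inv (- xi) (dil_Cc 0 k0 (@bell_Cc R)).
rewrite {2}/dil sub0r opprK invrK [xi * _]mulrC => <-.
congr (Cintegral _ _ _); apply/funext => w; rewrite (cFT_dil 0 w k0 (@bell_Cc R)) dil_bell.
rewrite mul0r mulr0 cis0 mul1r /cFT Fs_bell /Fe [_^-1 * w]mulrC; congr (cis _ * _).
ring.
Qed.

Lemma Fe0 : Fe 0 = 1.
Proof.
rewrite /Fe /Fc -[RHS](@Rintegral_bell R); apply: eq_Rintegral => x _.
by rewrite mulr0 mulr0 cos0 mul1r.
Qed.

(** Fubini moves the summability factors to the frequency side, where they become the approximate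
    identity (k+1) bell((k+1) xi) in each coordinate. Rescaling makes the transforms of the factors
    appear at frequencies of order [q / k.+1]. *)
Lemma kap_test q k : 0 < q ->
  `|\int[leb]_w (kap H v q w * \prod_(i < n) Fe (w ord0 i / k.+1%:R))| <=
  2 * B * \prod_(i < n) \int[mu]_z (normc (cFT (dil 1 0 (v i)) (q / k.+1%:R * z)) * `|bell z|).
Proof.
move=> q0; have [PI PE] := PP_integrable vC q0.
pose g (w : 'rV[R]_n) : R := \prod_(i < n) Fe (w ord0 i / k.+1%:R).
have [gI _] := Rintegral_prod (fun i : 'I_n => Fe_int k).
have mg : mfunT g by exact: measurable_L1 gI.
have mgc : re_im (mfunT) (fun x => Complex (g x) 0 : C) by split; [exact: mg|exact: measurable_cst].
pose F (z : 'rV[R]_n * 'rV[R]_n) : C := Complex (g z.1) 0 * (H z.2 * (cis (2 * pi * dotv z.1 z.2) * PP v q z.2)).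
have mF : re_im (mfunT) F.
  apply: re_im_measurableM; first exact: (re_im_measurable_comp mgc measurable_fst).
  apply: re_im_measurableM; first exact: (re_im_measurable_comp mH measurable_snd).
  apply: re_im_measurableM; last exact: (re_im_measurable_comp (measurable_PP vC q) measurable_snd).
  apply: re_im_measurable_cis.
  apply: measurable_funM => //; apply: measurable_dotv; [exact: measurable_fst|exact: measurable_snd].
have normcR (a : R) : normc (Complex a 0) = `|a| by rewrite /= expr0n addr0 sqrtr_sqr.
have FI : Cintegrable (leb \x leb)%E F.
  apply: (le_Cintegrable mF (integrable_prod (integrable_norm gI) (integrableZl measurableT B (Cintegrable_normc PI)))).
  move=> [w xi]; rewrite /F/= !ComplexField.Normc.normcM normc_cis !mul1r normcR.
  by rewrite ler_wpM2l// ler_wpM2r ?normc_ge0.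
rewrite [X in `|X|](_ : _ = Re (Cintegral leb setT (fun w => Cintegral leb setT (fun xi => F (w, xi))))); last first.
  apply: eq_Rintegral => w _.
  have -> : Cintegral leb setT (fun xi => F (w, xi)) = Complex (g w) 0 * ckap H v q w.
    by rewrite -(Cintegral_scale _ (ckap_integrable mH H_le vC w q0)).
  by rewrite cReM/= mul0r subr0 mulrC.
rewrite (Cfubini FI) (le_trans (Re_le_normc _))//.
pose h (i : 'I_n) (z : R) : C := cFT (dil 1 0 (v i)) (q * z) * Complex (k.+1%:R * bell (k.+1%:R * z)) 0.
have E xi : Cintegral leb setT (fun w => F (w, xi)) = H xi * \prod_(i < n) h i (xi ord0 i).
  have I1 : forall i, Cintegrable mu (fun w : R => cis (2 * pi * (w * xi ord0 i)) * Complex (Fe (w / k.+1%:R)) 0).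
    move=> i; apply: (@le_Cintegrable R _ (measurableTypeR R) mu _ (fun w : R => `|Fe (w / k.+1%:R)|)).
    - apply: re_im_measurableM.
        by apply: re_im_measurable_cis; apply: measurable_funM => //; exact: measurable_funM.
      by split; [exact: measurable_L1 (Fe_int k)|exact: measurable_cst].
    - exact: integrable_norm (Fe_int k).
    - by move=> w; rewrite ComplexField.Normc.normcM normc_cis mul1r normcR.
  transitivity (H xi * PP v q xi * \prod_(i < n) Complex (k.+1%:R * bell (k.+1%:R * xi ord0 i)) 0); last first.
    by rewrite /h big_split/= mulrA.
  under eq_bigr do rewrite -inv_Fe.
  rewrite -(Cintegral_prod I1) -(Cintegral_scale _ (Cintegrable_prod I1)).
  congr (Cintegral _ _ _); apply/funext => w; rewrite /F/= big_split/= -cis_dotv -Complex_prod -/(g w).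
  ring.
rewrite (_ : Cintegral leb setT _ = Cintegral leb setT (fun xi => H xi * \prod_(i < n) h i (xi ord0 i))); last first.
  by congr (Cintegral _ _ _); apply/funext => xi; exact: E.
have hI i : Cintegrable mu (h i).
  have [Cb Cb0 Hb] := Cc_bounded (@bell_Cc R).
  have I0 : Cintegrable mu (fun z => cFT (dil 1 0 (v i)) (q * z)).
    have [a c] := cFT_Cintegrable (dil_Cc 0 ltr01 (vC i)); have qn : q != 0 by rewrite gt_eqF.
    by split; [exact: (integrable_scale1 qn a)|exact: (integrable_scale1 qn c)].
  apply: (@le_Cintegrable R _ (measurableTypeR R) mu _ (fun z : R => k.+1%:R * Cb * normc (cFT (dil 1 0 (v i)) (q * z)))).
  - apply: re_im_measurableM; first exact: Cintegrable_measurable I0.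
    split; last exact: measurable_cst.
    apply: measurable_funM => //; apply: (measurableT_comp (SM_measurable (@bell_Cc R).1)).
    exact: measurable_funM.
  - exact: (integrableZl measurableT (k.+1%:R * Cb) (Cintegrable_normc I0)).
  - move=> z; rewrite ComplexField.Normc.normcM normcR mulrC ler_wpM2r ?normc_ge0//.
    by rewrite normrM ger0_norm// ler_wpM2l.
have HI : Cintegrable leb (fun xi => H xi * \prod_(i < n) h i (xi ord0 i)).
  have hp := Cintegrable_prod hI.
  apply: (le_Cintegrable _ (integrableZl measurableT B (Cintegrable_normc hp))).
    by apply: re_im_measurableM => //; exact: Cintegrable_measurable hp.
  by move=> xi; rewrite ComplexField.Normc.normcM ler_wpM2r ?normc_ge0.
rewrite (le_trans (normc_Cintegral HI))// -mulrA ler_wpM2l//.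
have [nI nE] := Rintegral_prod (fun i => Cintegrable_normc (hI i)).
apply: (@le_trans _ _ (\int[leb]_xi (B * \prod_(i < n) normc (h i (xi ord0 i))))).
  apply: le_Rintegral => //; first exact: Cintegrable_normc HI.
    exact: (integrableZl measurableT B nI).
  by move=> xi _; rewrite ComplexField.Normc.normcM normc_prod ler_wpM2r// prodr_ge0// => i _; exact: normc_ge0.
rewrite RintegralZl// ler_wpM2l// nE le_eqVlt; apply/orP; left; apply/eqP; apply: eq_bigr => i _.
pose h' (z : R) := normc (cFT (dil 1 0 (v i)) (q / k.+1%:R * z)) * `|bell z|.
have k0 : 0 < k.+1%:R :> R by [].
have mh' : mfunT h'.
  apply: measurable_funM.
    apply: measurable_normc; apply: (re_im_measurable_comp (Cintegrable_measurable (cFT_Cintegrable (dil_Cc 0 ltr01 (vC i))))).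
    exact: measurable_funM.
  by apply: measurableT_comp => //; exact: (SM_measurable (@bell_Cc R).1).
have hE (z : R) : normc (h i z) = k.+1%:R * h' (k.+1%:R * z).
  rewrite /h ComplexField.Normc.normcM normcR normrM (ger0_norm (ler0n _ _)) /h'.
  by rewrite [q / _ * _]mulrA divfK ?gt_eqF// mulrCA.
under eq_Rintegral do rewrite hE.
rewrite RintegralZl//; last first.
  have := Cintegrable_normc (hI i).
  move=> /(integrableZl measurableT k.+1%:R^-1); congr (integrable _ _ _); apply/funext => z.
  by transitivity ((k.+1%:R^-1 * normc (h i z))%:E) => //; rewrite hE mulKf ?gt_eqF.
by rewrite (Rintegral_scale1 k0 mh') mulVKf// gt_eqF.
Qed.

(** Formally the mean is the value of [H * PP q] at frequency 0. [H] has no meaningful value there,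
    but it is bounded, while the transform of a mean-zero factor is continuous and vanishes at 0; so
    the upper bounds of [kap_test] tend to 0 as the summability factors tend to 1. *)
Lemma kap_mean0 q : 0 < q -> \int[leb]_w kap H v q w = 0.
Proof.
move=> q0; have kI := kap_integrable q0.
have [Cf Cf0 Hf] := Fc_bound (@bell_Cc R).
have Fec : continuous Fe by apply: FT_continuous; exists 1, (@bell R); split; [exact: bell_Cc|left].
have cvg0 (z : R) : z / k.+1%:R @[k --> \oo] --> (0 : R).
  rewrite -[X in _ --> X](mulr0 z); apply: cvgM; [exact: cvg_cst|exact: cvg_harmonic].
have cprod (a : nat -> 'I_n -> R) (l : 'I_n -> R) : (forall i, a ^~ i @ \oo --> l i) ->
    \prod_(i < n) a k i @[k --> \oo] --> \prod_(i < n) l i.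
  move=> al; elim: (index_enum _) => [|i s IH].
    by rewrite big_nil; under eq_fun do rewrite big_nil; exact: cvg_cst.
  by rewrite big_cons; under eq_fun do rewrite big_cons; apply: cvgM.
have lim1 : \int[leb]_w (kap H v q w * \prod_(i < n) Fe (w ord0 i / k.+1%:R)) @[k --> \oo] --> \int[leb]_w kap H v q w.
  apply: (@Rdominated_cvg _ _ _ leb _ _ (fun w => `|kap H v q w| * Cf ^+ n)).
  - move=> k; apply: measurable_funM; first exact: measurable_kap mH vC q.
    have [gI _] := Rintegral_prod (fun i : 'I_n => Fe_int k).
    by exact: measurable_L1 gI.
  - exact: measurable_kap mH vC q.
  - exact: (integrableZr measurableT (Cf ^+ n) (integrable_norm kI)).
  - move=> k w; rewrite normrM ler_wpM2l// normr_prod.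
    rewrite -[n in Cf ^+ n]card_ord -prodr_const; apply: ler_prod => i _.
    by rewrite normr_ge0/=; have [] := Hf (w ord0 i / k.+1%:R).
  - apply: aeW => w; rewrite -[X in _ --> X]mulr1; apply: cvgM; first exact: cvg_cst.
    have F1 : \prod_(i < n) Fe 0 = 1 by apply: big1 => i _; exact: Fe0.
    rewrite -[X in _ --> X]F1.
    apply: (cprod (fun k i => Fe (w ord0 i / k.+1%:R))) => i.
    by apply: (cvg_comp _ Fe (cvg0 (w ord0 i))); exact: Fec.
have lim2 : 2 * B * \prod_(i < n) \int[mu]_z (normc (cFT (dil 1 0 (v i)) (q / k.+1%:R * z)) * `|bell z|) @[k --> \oo] --> 0.
  rewrite -[X in _ --> X](mulr0 (2 * B)); apply: cvgM; first exact: cvg_cst.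
  have [j vj] := v0.
  rewrite -[X in _ --> X](_ : \prod_(i < n) (\int[mu]_z (normc (cFT (dil 1 0 (v i)) 0) * `|bell z|)) = 0); last first.
    have [dE _] := dil_int vC 0 j ltr01.
    have c0 : normc (cFT (dil 1 0 (v j)) 0) = 0.
      rewrite (_ : cFT _ _ = 0) ?ComplexField.Normc.normc0//; apply: Cext => /=.
        by rewrite /Fc; under eq_Rintegral do rewrite !mulr0 cos0 mul1r; rewrite dE.
      by rewrite /Fs; under eq_Rintegral do rewrite !mulr0 sin0 mul0r; rewrite /Rintegral integral0.
    have z0 : \int[mu]_z (normc (cFT (dil 1 0 (v j)) 0) * `|bell z|) = 0.
      by rewrite c0; under eq_Rintegral do rewrite mul0r; rewrite /Rintegral integral0.
    by rewrite (bigD1 j)// z0; exact: mul0r.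
  apply: (cprod (fun k i => \int[mu]_z (normc (cFT (dil 1 0 (v i)) (q / k.+1%:R * z)) * `|bell z|))) => i.
  have dC := dil_Cc 0 ltr01 (vC i).
  have [Cv Cv0 Hv] := Fc_bound dC; have [cF sF] := cFT_FT dC.
  have nle (z : R) : normc (cFT (dil 1 0 (v i)) z) <= 2 * Cv.
    by rewrite (le_trans (normc_le _))//= mulr_natl mulr2n; have [a c] := Hv z; rewrite lerD.
  have ms k : mfunT (fun z : R => normc (cFT (dil 1 0 (v i)) (q / k.+1%:R * z)) * `|bell z|).
    apply: measurable_funM; last by apply: measurableT_comp => //; exact: (SM_measurable (@bell_Cc R).1).
    apply: measurable_normc; apply: (re_im_measurable_comp (Cintegrable_measurable (cFT_Cintegrable dC))).
    exact: measurable_funM.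
  apply: (@Rdominated_cvg _ (measurableTypeR R) _ mu _ _ (fun z => 2 * Cv * `|bell z|)).
  - exact: ms.
  - by apply: measurable_funM => //; apply: measurableT_comp => //; exact: (SM_measurable (@bell_Cc R).1).
  - exact: (integrableZl measurableT (2 * Cv) (Cc_integrable_norm (@bell_Cc R))).
  - by move=> k z; rewrite normrM normr_id (ger0_norm (normc_ge0 _)) ler_wpM2r.
  - apply: aeW => z; apply: cvgM; last exact: cvg_cst.
    have qz : q / k.+1%:R * z @[k --> \oo] --> (0 : R).
      under eq_fun => k do rewrite mulrAC; exact: cvg0.
    have nc (t : R) : normc (cFT (dil 1 0 (v i)) t) = Num.sqrt (Fc (dil 1 0 (v i)) t ^+ 2 + Fs (dil 1 0 (v i)) t ^+ 2) by [].
    rewrite nc; under eq_fun do rewrite nc.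
    apply: (cvg_comp _ (@Num.sqrt R)); last exact: sqrt_continuous.
    by apply: cvgD; rewrite expr2; under eq_fun do rewrite expr2;
      apply: cvgM; (apply: (cvg_comp _ _ qz); exact: FT_continuous).
by apply: (cvg_eq0 lim1 lim2) => k; exact: kap_test.
Qed.

End kernel_mean.

(** * Moduli of continuity in L^1 *)

Section modulus.
Variables (R : realType) (n : nat).
Local Notation leb := (@lebesgue_rV R n).
Implicit Types (h : 'rV[R]_n -> R) (q : R).
Local Open Scope ereal_scope.

Definition L1n h := \int[leb]_x `|(h x)%:E|.

Definition omega h w := \int[leb]_y `|(h (y - w)%R - h y)%:E|.

(** The L^1 modulus of continuity averaged over displacements [q *: u] with weight [Psi]; it
    controls any convolution kernel dominated by [Psi] rescaled to [q]. *)
Definition modulus h q := \int[leb]_u (Psi u * omega h (q *: u)%R).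

Lemma measurable_rV_sub : mfunT (fun z : 'rV[R]_n * 'rV[R]_n => (z.1 - z.2)%R).
Proof.
apply: measurable_fun_rVP => i.
rewrite (_ : (fun z => _) = fun z : 'rV[R]_n * 'rV[R]_n => (z.1 ord0 i - z.2 ord0 i)%R); last first.
  by apply/funext => z; rewrite !mxE.
apply: measurable_funB.
  exact: (measurableT_comp (measurable_coord i) measurable_fst).
exact: (measurableT_comp (measurable_coord i) measurable_snd).
Qed.

Lemma measurable_rV_subc (y : 'rV[R]_n) : mfunT (fun x : 'rV[R]_n => (y - x)%R).
Proof.
apply: measurable_fun_rVP => i.
rewrite (_ : (fun z => _) = fun z : 'rV[R]_n => (y ord0 i - z ord0 i)%R); last by apply/funext => z; rewrite !mxE.
by apply: measurable_funB => //; exact: measurable_coord.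
Qed.

Lemma measurable_rV_scale q : mfunT (fun x : 'rV[R]_n => q *: x).
Proof.
have := measurable_rV_affine q (0 : 'rV[R]_n); congr (measurable_fun _ _).
by apply/funext => x; rewrite addr0.
Qed.

Lemma omega_ge0 h w : 0 <= omega h w.
Proof. exact: integral_ge0. Qed.

Lemma modulus_ge0 h q : 0 <= modulus h q.
Proof. by apply: integral_ge0 => u _; rewrite mule_ge0 ?Psi_ge0 ?omega_ge0. Qed.

Lemma measurable_shiftB (h : 'rV[R]_n -> R) : mfunT h ->
  mfunT (fun z : 'rV[R]_n * 'rV[R]_n => `|(h (z.2 - z.1)%R - h z.2)%:E|).
Proof.
move=> mh; apply: measurable_normB; last exact: (measurableT_comp mh measurable_snd).
apply: (measurableT_comp mh).
have ms : mfunT (fun z : 'rV[R]_n * 'rV[R]_n => (z.2, z.1)).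
  by apply: measurable_fun_pair; [exact: measurable_snd|exact: measurable_fst].
exact: (measurableT_comp measurable_rV_sub ms).
Qed.

Lemma measurable_omega h : mfunT h -> mfunT (omega h).
Proof.
move=> mh; apply: (@ge0_measurable_integral _ _ _ _ R leb (fun z : 'rV[R]_n * 'rV[R]_n => `|(h (z.2 - z.1)%R - h z.2)%:E|)) => //.
exact: measurable_shiftB.
Qed.

Lemma omega_le h w : mfunT h -> omega h w <= 2%:E * L1n h.
Proof.
move=> mh; have mn : mfunT (fun y => `|(h y)%:E|) by apply: measurableT_comp => //; exact/measurable_EFinP.
have ms : mfunT (fun y : 'rV[R]_n => (y - w)%R) by exact: measurable_rV_shift.
rewrite (_ : 2%:E * L1n h = \int[leb]_y `|(h (y - w)%R)%:E| + L1n h); last first.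
  rewrite mule_natl mule2n; congr (_ + _).
  by rewrite (ge0_integral_shift (- w)%R mn).
apply: ge0_le_integralD => //.
- by apply: measurable_normB => //; exact: (measurableT_comp mh ms).
- exact: (measurableT_comp mn ms).
- by move=> y; rewrite -EFinD lee_fin ler_normB.
Qed.

Lemma measurable_Psi_omega h q : mfunT h ->
  mfunT (fun u => Psi u * omega h (q *: u)%R).
Proof.
move=> mh; apply: emeasurable_funM; first exact: measurable_Psi.
exact: (measurableT_comp (measurable_omega mh) (measurable_rV_scale q)).
Qed.

Lemma modulus_le h q : mfunT h ->
  modulus h q <= 2%:E * L1n h * \int[leb]_u Psi u.
Proof.
move=> mh; rewrite -ge0_integralZl//.
- apply: ge0_le_integral => //.
  + by move=> u _; rewrite mule_ge0 ?Psi_ge0 ?omega_ge0.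
  + exact: measurable_Psi_omega.
  + by apply: emeasurable_funM => //; exact: measurable_Psi.
  + by move=> u _; rewrite muleC lee_wpmul2r ?Psi_ge0 ?omega_le.
- exact: measurable_Psi.
- by move=> u _; exact: Psi_ge0.
- by rewrite mule_ge0// integral_ge0.
Qed.

Lemma omega_cvg h (u : 'rV[R]_n) : integrableT leb h ->
  omega h (2 ^- l *: u)%R @[l --> \oo] --> 0.
Proof.
move=> hI; have := @L1_shift_cvg R n h (fun l => - (2 ^- l *: u))%R hI; apply.
move=> i; under eq_fun do rewrite !mxE.
have c0 : (2 ^- l * u ord0 i)%R @[l --> \oo] --> (0%R : R).
  rewrite -[X in _ --> X](mul0r (u ord0 i)); apply: cvgM; last exact: cvg_cst.
  under eq_fun do rewrite -exprVn.
  by apply: cvg_expr; rewrite ger0_norm// invf_lt1//; lra.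
by have := cvgN c0; rewrite oppr0; apply.
Qed.

(** Dominated convergence with majorant [2 * L1n h * Psi], the pointwise limit being continuity of
    translations. [Psi] is only almost everywhere known to be finite, which suffices. *)
Lemma modulus_cvg h : integrableT leb h -> modulus h (2 ^- l)%R @[l --> \oo] --> 0.
Proof.
move=> hI; have mh : mfunT h by exact: measurable_L1 hI.
have L1f : L1n h \is a fin_num.
  by rewrite ge0_fin_numE; [case/integrableP : hI|exact: integral_ge0].
have := @ge0_dominated_cvg0 R _ _ leb (fun l u => Psi u * omega h (2 ^- l *: u)%R) (fun u => (2 * fine (L1n h))%:E * Psi u); apply.
- by move=> l; exact: measurable_Psi_omega.
- by move=> l u; rewrite mule_ge0 ?Psi_ge0 ?omega_ge0.
- exact: (integrableZl measurableT _ (@Psi_integrable R n)).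
- apply: aeW => u l; rewrite muleC lee_wpmul2r ?Psi_ge0//.
  by rewrite EFinM fineK// omega_le.
- have := integrable_ae measurableT (@Psi_integrable R n); apply: ae_imply => u /(_ Logic.I) Pf.
  by have := cvgeZl Pf (omega_cvg u hI); rewrite mule0.
Qed.

Lemma conv_modulus (k h : 'rV[R]_n -> R) (E Bk m q : R) : (0 < q)%R -> (0 <= E)%R ->
  mfunT k -> (forall w, (`|k w| <= Bk)%R) ->
  (forall w, `|k w|%:E <= (E * q ^- n)%:E * Psi (q^-1 *: w)%R) ->
  integrableT leb k -> (\int[leb]_w k w)%R = m ->
  integrableT leb h ->
  \int[leb]_y `|(\int[leb]_x (k (y - x) * h x) - m * h y)%R%:E| <= E%:E * modulus h q.
Proof.
move=> q0 E0 mk kB kP kI km hI.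
have mh : mfunT h by exact: measurable_L1 hI.
pose F (z : 'rV[R]_n * 'rV[R]_n) : \bar R := `|k z.1|%:E * `|(h (z.2 - z.1)%R - h z.2)%:E|.
have mF : mfunT F.
  apply: emeasurable_funM; last exact: measurable_shiftB.
  by apply/measurable_EFinP; apply: measurableT_comp => //; exact: (measurableT_comp mk measurable_fst).
have F0 z : 0 <= F z by rewrite /F -EFinM lee_fin mulr_ge0.
have mJ : mfunT (fun z : 'rV[R]_n * 'rV[R]_n => (k (z.1 - z.2) * h z.2)%R).
  apply: measurable_funM; last exact: (measurableT_comp mh measurable_snd).
  exact: (measurableT_comp mk measurable_rV_sub).
apply: (@le_trans _ _ (\int[leb]_y \int[leb]_w F (w, y))).
  apply: ge0_le_integral => //.
  - apply: measurable_normB; first exact: (measurable_Rintegral leb mJ).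
    exact: measurable_funM.
  - apply: (@ge0_measurable_integral _ _ _ _ R leb (fun z : 'rV[R]_n * 'rV[R]_n => F (z.2, z.1))) => //.
    by apply: (measurableT_comp mF); apply: measurable_fun_pair; [exact: measurable_snd|exact: measurable_fst].
  - move=> y _.
    have hyI : leb.-integrable setT (fun w => (h (y - w)%R)%:E).
      have N1 : ((-1)%R : R) != 0%R by rewrite oppr_eq0 oner_eq0.
      have := integrable_leb_affine y N1 hI; congr (integrable _ _ _).
      by apply/funext => w; rewrite scaleN1r addrC.
    have khI : integrableT leb ((fun w => k w * h (y - w))%R).
      apply: (le_integrable _ _ _ (integrableZl measurableT Bk (integrable_norm hyI))) => //.
        apply/measurable_EFinP; apply: measurable_funM => //.
        exact: (measurableT_comp mh (measurable_rV_subc y)).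
      move=> w _ /=; rewrite lee_fin normrM (ger0_norm (mulr_ge0 _ _))//.
        by rewrite ler_wpM2r.
      exact: le_trans (normr_ge0 _) (kB w).
    have kyI := integrableZr measurableT (h y) kI.
    have mkh : mfunT (fun w => k w * h (y - w))%R by exact: measurable_L1 khI.
    have E1 : (\int[leb]_x (k (y - x) * h x) = \int[leb]_w (k w * h (y - w)))%R.
      rewrite -(Rintegral_reflect y mkh); apply: eq_Rintegral => x _.
      by rewrite subKr.
    have E2 : (\int[leb]_x (k (y - x) * h x) - m * h y = \int[leb]_w (k w * (h (y - w) - h y)))%R.
      rewrite E1 -km -RintegralZr// -RintegralB//.
      by apply: eq_Rintegral => w _; rewrite mulrBr.
    have DI : integrableT leb ((fun w => k w * (h (y - w) - h y))%R).
      have := integrableB measurableT khI kyI; congr (integrable _ _ _).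
      by apply/funext => w; rewrite /= mulrBr EFinB.
    rewrite E2 abse_EFin EFin_normr_Rintegral//.
    apply: le_trans (le_abse_integral _ _ (measurable_int _ DI)) _ => //.
    apply: ge0_le_integral => //.
    + by apply: measurableT_comp => //; exact: measurable_int DI.
    + by apply: (measurableT_comp mF); exact: measurable_pair2.
    + by move=> w _; rewrite /F /= -EFinM lee_fin normrM.
rewrite -(ge0_fubini leb leb mF F0).
apply: (@le_trans _ _ (\int[leb]_w ((E * q ^- n)%:E * (Psi (q^-1 *: w)%R * omega h w)))).
  have mo := measurable_omega mh.
  apply: ge0_le_integral => //.
  - by move=> w _; apply: integral_ge0.
  - exact: ge0_measurable_integral.
  - apply: emeasurable_funM => //; apply: emeasurable_funM => //.
    exact: (measurableT_comp (@measurable_Psi R n) (measurable_rV_scale _)).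
  - move=> w _; rewrite /F /= ge0_integralZl//; last first.
      exact: (measurable_normB (measurableT_comp mh (measurable_rV_shift (- w)%R)) mh).
    by rewrite -/(omega h w) muleA lee_wpmul2r ?omega_ge0.
pose G (u : 'rV[R]_n) := Psi u * omega h (q *: u)%R.
have mG : mfunT G by exact: measurable_Psi_omega.
have G0 u : 0 <= G u by rewrite mule_ge0 ?Psi_ge0 ?omega_ge0.
have qi : (q^-1)%R != 0%R by rewrite invr_eq0 gt_eqF.
have := ge0_integral_scale qi mG G0.
rewrite -[\int[leb]_u G u]/(modulus h q) => <-.
rewrite normfV (gtr0_norm q0) exprVn ge0_integralZl//; last 3 first.
- apply: emeasurable_funM; last exact: measurable_omega.
  exact: (measurableT_comp (@measurable_Psi R n) (measurable_rV_scale _)).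
- by move=> w _; rewrite mule_ge0 ?Psi_ge0 ?omega_ge0.
- by rewrite lee_fin mulr_ge0// invr_ge0 exprn_ge0// ltW.
have -> : \int[leb]_x (Psi (q^-1 *: x)%R * omega h x) = \int[leb]_x G (q^-1 *: x)%R.
  by apply: eq_integral => w _; rewrite /G scalerA divff ?gt_eqF// scale1r.
by rewrite EFinM -muleA.
Qed.

End modulus.

(** * Mollifiers *)

Section window.
Variable R : realType.
Implicit Types (a c s : R) (n : nat).

(** A smooth approximation of the indicator of []a, c[]. The steps have width 2/n and are centred at
    a + 2/n and c - 2/n, so that the support stays in [a + 1/n, c - 1/n] as soon as the two centres
    are in order. *)
Definition window n a c s := smoothstep (n%:R * (s - a) - 2) - smoothstep (n%:R * (s - c) + 2).

Lemma SM_window n a c : SM (window n a c).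
Proof.
rewrite (_ : window n a c = fun s => smoothstep (n%:R * s + (- (n%:R * a) - 2)) +
  cst (-1) s * smoothstep (n%:R * s + (- (n%:R * c) + 2))).
  apply: SM_add; first by apply: SM_comp; exact: SM_smoothstep.
  by apply: SM_mul; [exact: SM_cst|apply: SM_comp; exact: SM_smoothstep].
by apply/funext => s; rewrite /window /cst mulN1r; congr (smoothstep _ - smoothstep _); ring.
Qed.

Lemma window_norm n a c s : `|window n a c s| <= 1.
Proof.
rewrite /window ler_norml.
have := smoothstep_ge0 (n%:R * (s - a) - 2); have := smoothstep_le1 (n%:R * (s - a) - 2).
have := smoothstep_ge0 (n%:R * (s - c) + 2); have := smoothstep_le1 (n%:R * (s - c) + 2).
by move=> ? ? ? ?; apply/andP; split; lra.
Qed.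

Lemma window_supp n a c s : (0 < n)%N -> 4 <= n%:R * (c - a) ->
  ~~ (a + n%:R^-1 <= s <= c - n%:R^-1) -> window n a c s = 0.
Proof.
move=> n0 nac; have np : 0 < n%:R :> R by rewrite ltr0n.
have nn : n%:R * n%:R^-1 = 1 :> R by rewrite divff// gt_eqF.
have h1 : a + n%:R^-1 <= s = (1 <= n%:R * (s - a)).
  by rewrite -lerBrDl -(ler_pM2l np) nn.
have h2 : s <= c - n%:R^-1 = (n%:R * (s - c) <= -1).
  by rewrite -lerBlDl -(ler_pM2l np) mulrN nn.
have E : n%:R * (s - c) = n%:R * (s - a) - n%:R * (c - a) by ring.
rewrite h1 h2 negb_and -!ltNge /window => /orP[h|h].
- by rewrite !smoothstep0 ?subrr//; lra.
- by rewrite !smoothstep1 ?subrr//; lra.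
Qed.

Lemma nmul_cvg (y : R) (A : R) : 0 < y -> \forall n \near \oo, A <= n%:R * y.
Proof.
move=> y0; near=> n.
have : A / y <= n%:R by near: n; exact: nbhs_infty_ger.
by rewrite ler_pdivrMr.
Unshelve. all: by end_near. Qed.

Lemma near_window a c s : a < c -> \forall n \near \oo, window n a c s = (a < s < c)%R%:R.
Proof.
move=> ac.
have E n : n%:R * (s - c) = n%:R * (s - a) - n%:R * (c - a) by ring.
have [sa|sa] := leP s a.
  near=> n; have nac : 6 <= n%:R * (c - a) by near: n; apply: nmul_cvg; lra.
  have h : n%:R * (s - a) <= 0 by rewrite mulr_ge0_le0// subr_le0.
  by have := E n; rewrite /window !smoothstep0 ?subrr//; lra.
have [sc|sc] := ltP s c; last first.
  near=> n; have nac : 6 <= n%:R * (c - a) by near: n; apply: nmul_cvg; lra.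
  have h : 0 <= n%:R * (s - c) by rewrite mulr_ge0// subr_ge0.
  by have := E n; rewrite /window !smoothstep1 ?subrr//; lra.
near=> n; have h1 : 3 <= n%:R * (s - a) by near: n; apply: nmul_cvg; lra.
have h2 : 3 <= n%:R * (c - s) by near: n; apply: nmul_cvg; lra.
have h3 : n%:R * (s - c) = - (n%:R * (c - s)) by ring.
by rewrite /window smoothstep1 ?smoothstep0 ?subr0//; lra.
Unshelve. all: by end_near. Qed.

Lemma near_window_supp a c : a < c -> \forall n \near \oo, (0 < n)%N /\ 4 <= n%:R * (c - a).
Proof.
move=> ac; near=> n; split; first by near: n; exact: nbhs_infty_gt.
by near: n; apply: nmul_cvg; lra.
Unshelve. all: by end_near. Qed.

Lemma window_itv (h : R -> R) t0 t1 a c : integrableT mu h ->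
  (forall (al : R -> R) a' c', SM al -> t0 < a' -> c' < t1 ->
     (forall s, ~~ (a' <= s <= c') -> al s = 0) -> \int[mu]_s (al s * h s) = 0) ->
  t0 <= a -> a < c -> c <= t1 -> \int[mu]_(s in `]a, c[) h s = 0.
Proof.
move=> hI H t0a ac ct1; have mh : mfunT h by exact: measurable_L1 hI.
have [N _ HN] := near_window_supp ac.
pose u k := \int[mu]_s (window (k + N) a c s * h s).
have u0 k : u k = 0.
  have [n0 nac] := HN (k + N)%N (leq_addl _ _).
  have np : 0 < (k + N)%:R^-1 :> R by rewrite invr_gt0 ltr0n.
  apply: (H _ (a + (k + N)%:R^-1) (c - (k + N)%:R^-1)); first exact: SM_window.
  - by rewrite (le_lt_trans t0a)// ltrDl.
  - by rewrite (lt_le_trans _ ct1)// gtrBl.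
  - by move=> s; exact: window_supp.
have ul : u @ \oo --> \int[mu]_(s in `]a, c[) h s.
  rewrite Rintegral_mkcond; apply: (@Rdominated_cvg _ _ _ mu _ _ (fun s => `|h s|)).
  - by move=> k; exact: (measurable_funM (SM_measurable (SM_window _ _ _)) mh).
  - exact: (measurable_patch (measurable_itv _) mh).
  - exact: integrable_norm hI.
  - by move=> k s; rewrite normrM ler_piMl// window_norm.
  - apply: aeW => s; apply: cvg_near_cst.
    have [M _ HM] := near_window s ac; exists M => // k Mk.
    rewrite HM; last by rewrite /= (leq_trans Mk)// leq_addr.
    rewrite patchE; case: ifPn => [|]; rewrite ?inE ?notin_setE/= in_itv/=.
      by move=> ->; rewrite mul1r.
    by move=> /negP/negbTE ->; rewrite mul0r.
rewrite (_ : u = fun=> 0) in ul; last by apply/funext => k; exact: u0.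
exact: (cvg_unique (@norm_hausdorff _ _) ul (@cvg_cst _ _ _ _ _)).
Qed.

(** Windows give vanishing integrals over the intervals []t0, y[]. The primitive of [h] is therefore
    constant on []t0, t1[], and Lebesgue differentiation identifies its derivative with [h]. *)
Lemma test_ae0 (h : R -> R) t0 t1 : integrableT mu h ->
  (forall (al : R -> R) a c, SM al -> t0 < a -> c < t1 ->
     (forall s, ~~ (a <= s <= c) -> al s = 0) -> \int[mu]_s (al s * h s) = 0) ->
  {ae mu, forall s, t0 < s < t1 -> h s = 0}.
Proof.
move=> hI H.
have mh : mfunT h by exact: measurable_L1 hI.
have hS (D : set R) : measurable D -> mu.-integrable D (EFin \o h).
  move=> mD; exact: (@integrableS _ (measurableTypeR R) R mu setT D (EFin \o h) measurableT mD (fun _ _ => Logic.I) hI).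
have loch : locally_integrable [set: R] h.
  split => //; first exact: openT.
  move=> K _ /compact_measurable mK.
  have /integrableP[_] := hS _ mK.
  by [].
have := FTC1Ny (fun y => hS _ (measurable_itv _)) loch.
apply: ae_imply => s [_ <-] /andP[s0 s1].
rewrite derive1E; apply: derive_val.
apply: (isd_near (f := cst (\int[mu]_(t in `]-oo, t0]) h t))).
near=> y.
have [y0 y1] : t0 < y /\ y < t1.
  by split; near: y; [exact: lt_nbhsr|exact: lt_nbhsl].
have E := window_itv hI H (lexx t0) y0 (ltW y1).
rewrite /cst (@itv_bndbnd_setU _ _ -oo%O (BRight t0) (BRight y)) ?bnd_simp ?(ltW y0)//.
rewrite Rintegral_setU//=; last 2 first.
- by apply: hS; exact: measurableU.
- rewrite disj_set2E; apply/eqP; apply/seteqP; split => x //=; rewrite !in_itv/= => -[? /andP[? _]]; lra.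
rewrite -(@Rintegral_itv_bndo_bndc _ (BRight t0) y) ?E ?addr0//.
exact: hS.
Unshelve. all: by end_near. Qed.

End window.

(** * The product mollifier and its Lipschitz bound *)

Section mollifier.
Variables (R : realType) (n : nat).
Local Notation leb := (@lebesgue_rV R n).
Implicit Types (w x y : 'rV[R]_n) (q : R).

(** A product instead of a radial bump: its transform factorises, and differences of two scales
    telescope coordinate by coordinate. *)
Definition rho q w : R := \prod_(i < n) (q^-1 * bell (w ord0 i / q)).

Lemma rhoE q x y : rho q (y - x) = prof (fun=> @bell R) q y x.
Proof. by rewrite /rho /prof; apply: eq_bigr => i _; rewrite !mxE. Qed.

Lemma rhoN q w : rho q (- w) = rho q w.
Proof. by rewrite /rho; apply: eq_bigr => i _; rewrite !mxE mulNr bellN. Qed.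

Lemma rho_prof q w : rho q w = prof (fun=> @bell R) q 0 w.
Proof. by rewrite -rhoE sub0r rhoN. Qed.

Let bC (i : 'I_n) := @bell_Cc R.

Lemma rho_supp q w : 0 < q -> rho q w != 0 -> forall i, `|w ord0 i| <= q.
Proof.
move=> q0; rewrite rho_prof => /(prof_supp bC q0) h i.
by have := h i; rewrite mxE subr0 mulr1.
Qed.

Lemma rho_integrable q : 0 < q -> integrableT leb (rho q) /\ \int[leb]_w rho q w = 1.
Proof.
move=> q0; have [I E _] := prof_int bC 0 q0.
have -> : rho q = prof (fun=> @bell R) q 0 by apply/funext => w; exact: rho_prof.
by split => //; rewrite E; apply: big1 => i _; exact: Rintegral_bell.
Qed.

Lemma measurable_rho q : mfunT (rho q).
Proof.
rewrite /rho; apply: measurable_prod => i _; apply: measurable_funM => //.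
apply: (measurableT_comp (SM_measurable (@bell_Cc R).1)).
by apply: measurable_funM => //; exact: measurable_coord.
Qed.

Lemma rho_bound : exists2 C : R, 0 <= C & forall q w, 0 < q -> `|rho q w| <= C * q ^- n.
Proof.
have [C C0 HC] := Cc_bounded (@bell_Cc R).
exists (C ^+ n); first exact: exprn_ge0.
move=> q w q0; rewrite /rho normr_prod -exprVn -exprMn -[n in leRHS]card_ord -prodr_const.
apply: ler_prod => i _; rewrite normr_ge0/= normrM mulrC (gtr0_norm (_ : 0 < q^-1)) ?invr_gt0//.
by rewrite ler_wpM2r// invr_ge0 ltW.
Qed.

Lemma rho_majorant : exists2 C : R, 0 <= C & forall q w, 0 < q ->
  (`|rho q w|%:E <= (C * q ^- n)%:E * Psi (q^-1 *: w))%E.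
Proof.
have [C C0 HC] := rho_bound; exists C => // q w q0.
have qn : 0 <= q ^- n by rewrite invr_ge0 exprn_ge0// ltW.
have [->|r0] := eqVneq (rho q w) 0.
  by rewrite normr0 mule_ge0 ?Psi_ge0// lee_fin mulr_ge0.
have P1 : (1 <= Psi (q^-1 *: w))%E.
  apply: Psi_ge1 => i; rewrite mxE normrM normfV (gtr0_norm q0) ler_pdivrMl//.
  by rewrite (le_trans (rho_supp q0 r0 i))//; lra.
apply: le_trans (lee_wpmul2l _ P1); last by rewrite lee_fin mulr_ge0.
by rewrite mule1 lee_fin HC.
Qed.

Lemma bell_lip : exists2 C : R, 0 <= C & forall a c : R, `|bell a - bell c| <= C * `|a - c|.
Proof.
have [C C0 HC] := Cc_bounded (Cc_derive1 (@bell_Cc R)).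
exists C => // a c; wlog ac : a c / c <= a.
  by move=> W; have [/W//|/ltW/W] := leP c a; rewrite distrC [`|a - c|]distrC.
have [||z _ ->] := @MVT_segment R (@bell R) (derive1 (@bell R)) c a ac.
- by move=> x _; exact: SM_isd (@bell_Cc R).1.
- by apply: continuous_subspaceT => x; exact: SM_continuous (@bell_Cc R).1 x.
- by rewrite normrM ler_wpM2r.
Qed.

Lemma prod_lip m (a c : 'I_m -> R) (C : R) : 1 <= C -> (forall i, `|a i| <= C) -> (forall i, `|c i| <= C) ->
  `|\prod_(i < m) a i - \prod_(i < m) c i| <= C ^+ m * \sum_(i < m) `|a i - c i|.
Proof.
move=> C1; have C0 : 0 <= C by lra.
elim: m a c => [|m IH] a c aC cC; first by rewrite !big_ord0 subrr normr0 mulr0.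
rewrite !big_ord_recl/=.
set A := \prod_(i < m) a _; set D := \prod_(i < m) c _; set S := \sum_(i < m) _.
have -> : a ord0 * A - c ord0 * D = (a ord0 - c ord0) * A + c ord0 * (A - D) by ring.
rewrite (le_trans (ler_normD _ _))// !normrM mulrDr lerD//.
  rewrite mulrC ler_wpM2r// /A normr_prod.
  apply: (@le_trans _ _ (C ^+ m)); last by rewrite exprS ler_peMl// exprn_ge0.
  rewrite -[m in leRHS]card_ord -prodr_const; apply: ler_prod => i _.
  by rewrite normr_ge0 aC.
rewrite exprS -mulrA ler_pM//; exact: IH.
Qed.

Lemma rho_lip : exists2 C : R, 0 <= C & forall q u w, 0 < q ->
  `|rho q u - rho q w| <= C * q ^- n.+1 * \sum_(i < n) `|u ord0 i - w ord0 i|.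
Proof.
have [C C0 HC] := Cc_bounded (@bell_Cc R); have [L L0 HL] := bell_lip.
exists ((C + 1) ^+ n * L); first by rewrite mulr_ge0// exprn_ge0// addr_ge0.
move=> q u w q0; have C1 : 1 <= C + 1 by rewrite lerDr.
have bC1 (x : R) : `|bell x| <= C + 1 by rewrite (le_trans (HC x))// lerDl.
have E z : rho q z = q ^- n * \prod_(i < n) bell (z ord0 i / q).
  by rewrite /rho big_split prodr_const card_ord exprVn.
have qn : 0 <= q ^- n by rewrite invr_ge0 exprn_ge0// ltW.
have := prod_lip C1 (fun i => bC1 (u ord0 i / q)) (fun i => bC1 (w ord0 i / q)).
rewrite !E -mulrBr normrM (ger0_norm qn) => h.
rewrite (le_trans (ler_wpM2l qn h))//.
have -> : (C + 1) ^+ n * L * q ^- n.+1 * \sum_(i < n) `|u ord0 i - w ord0 i| =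
  q ^- n * ((C + 1) ^+ n * (\sum_(i < n) (L * (q^-1 * `|u ord0 i - w ord0 i|)))).
  rewrite -mulr_sumr -mulr_sumr exprS invfM; ring.
rewrite ler_wpM2l// ler_wpM2l ?exprn_ge0 ?addr_ge0//; apply: ler_sum => i _.
by rewrite (le_trans (HL _ _))// -mulrBl normrM normfV (gtr0_norm q0) [_ / q]mulrC.
Qed.

Definition moll q (h : 'rV[R]_n -> R) y := \int[leb]_x (rho q (y - x) * h x).

Lemma moll_modulus : exists2 C : R, 0 <= C & forall q (h : 'rV[R]_n -> R), 0 < q ->
  integrableT leb h ->
  (\int[leb]_y `|(moll q h y - h y)%:E| <= C%:E * modulus h q)%E.
Proof.
have [C C0 HC] := rho_majorant; have [B B0 HB] := rho_bound.
exists C => // q h q0 hI; have [I E] := rho_integrable q0.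
have := conv_modulus q0 C0 (measurable_rho q) (fun w => HB q w q0) (fun w => HC q w q0) I E hI.
by under eq_integral do rewrite mul1r.
Qed.

End mollifier.

(** * Littlewood-Paley blocks of the vector field *)

(** The integral of a nonnegative function is the supremum over simple functions below it, so
    monotonicity needs no measurability. *)
Lemma ge0_le_integral_lower d (T : measurableType d) (R : realType) (m : {measure set T -> \bar R})
    (D : set T) (f g : T -> \bar R) : (forall x, D x -> 0 <= f x)%E -> (forall x, D x -> f x <= g x)%E ->
  (\int[m]_(x in D) f x <= \int[m]_(x in D) g x)%E.
Proof.
move=> f0 fg; rewrite integral_mkcond [leRHS]integral_mkcond.
rewrite ge0_integralTE; last first.
  by move=> x; rewrite patchE; case: ifPn => //; rewrite inE; exact: f0.
rewrite ge0_integralTE; last first.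
  by move=> x; rewrite patchE; case: ifPn => //; rewrite inE => Dx; exact: le_trans (f0 _ Dx) (fg _ Dx).
apply: ereal_sup_le => _ [h hf <-]; exists h => // x.
apply: le_trans (hf x) _; rewrite !patchE; case: ifPn => //; rewrite inE; exact: fg.
Qed.

Section singular_time.
Variables (R : realType) (n : nat).
Local Notation C := R[i].
Local Notation leb := (@lebesgue_rV R n).
Variables (K : fundamental_kernel R n) (H : 'rV[R]_n -> C) (B : R) (v : 'I_n -> R -> R) (M : R).
Hypotheses (mH : re_im (mfunT) H) (H_le : forall x, normc (H x) <= B).
Hypothesis HK : {ae leb, forall x, H x = fk_hat K x}.
Hypotheses (vC : forall i, Cc M (v i)).
Implicit Types (w y xi : 'rV[R]_n) (g : 'rV[R]_n -> R).

Let uC q y i : 0 < q -> Cc (\sum_(i < n) `|y ord0 i| + q * M) (dil q (y ord0 i) (v i)).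
Proof.
move=> q0; apply: Cc_le (dil_Cc (y ord0 i) q0 (vC i)); rewrite lerD2r (bigD1 i)//= lerDl.
by apply: sumr_ge0.
Qed.

Lemma inv_fourier_scale q y (a : R) xi : 0 < q ->
  inv_fourier (fun x => Complex (a * prof v q y x) 0) xi =
  Complex a 0 * (cis (2 * pi * dotv y xi) * PP v q xi).
Proof.
move=> q0; rewrite -(prod_cFT_dil vC)// -(inv_fourier_prod xi (fun i => uC y i q0)).
have [pI _ _] := prof_int vC y q0.
have mp : mfunT (prof v q y) by exact: measurable_L1 pI.
rewrite /inv_fourier -Cintegral_scale; last first.
  apply: (le_Cintegrable _ (integrable_norm pI)).
    apply: re_im_measurableM; last by split; [exact: mp|exact: measurable_cst].
    apply: re_im_measurable_cis; apply: measurable_funM => //; apply: measurable_dotv => //.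
  by move=> x; rewrite ComplexField.Normc.normcM normc_cis mul1r /= expr0n addr0 sqrtr_sqr.
congr (Cintegral _ _ _); apply/funext => x; rewrite mulrCA; congr (_ * _).
by rewrite /prof; apply: Cext; rewrite ?cReM ?cImM/=; ring.
Qed.

Lemma measurable_fourier d (T : measurableType d) (G : T * 'rV[R]_n -> R) : mfunT G ->
  re_im (mfunT) (fun z : T * 'rV[R]_n => fourier (fun x => Complex (G (z.1, x)) 0 : C) z.2).
Proof.
move=> mG.
pose F (z : (T * 'rV[R]_n) * 'rV[R]_n) : C := cis (- (2 * pi * dotv z.2 z.1.2)) * Complex (G (z.1.1, z.2)) 0.
have m11 : mfunT (fun z : (T * 'rV[R]_n) * 'rV[R]_n => z.1.1).
  exact: (measurableT_comp measurable_fst measurable_fst).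
have m12 : mfunT (fun z : (T * 'rV[R]_n) * 'rV[R]_n => z.1.2).
  exact: (measurableT_comp measurable_snd measurable_fst).
have [mF1 mF2] : re_im (mfunT) F.
  apply: re_im_measurableM.
    apply: re_im_measurable_cis; apply: measurableT_comp => //.
    by apply: measurable_funM => //; apply: measurable_dotv => //; exact: measurable_snd.
  split; last exact: measurable_cst.
  by apply: (measurableT_comp mG); apply: measurable_fun_pair => //; exact: measurable_snd.
by split; [exact: (measurable_Rintegral leb mF1)|exact: (measurable_Rintegral leb mF2)].
Qed.

Lemma measurable_mode q y : re_im (mfunT) (fun xi => cis (2 * pi * dotv y xi) * PP v q xi).
Proof.
apply: re_im_measurableM; last exact: (measurable_PP vC).
by apply: re_im_measurable_cis; apply: measurable_funM => //; apply: measurable_dotv.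
Qed.

Lemma singular_op_scale g q y (a : R) : 0 < q -> integrableT leb g ->
  Re (singular_op K g (fun x => Complex (a * prof v q y x) 0)) =
  a * \int[leb]_x (kap H v q (y - x) * g x).
Proof.
move=> q0 gI; rewrite -(singular_op_kap mH H_le vC y HK q0 gI).
have mg : mfunT g by exact: measurable_L1 gI.
have mgc : re_im (mfunT) (fun x => Complex (g x) 0 : C) by split; [exact: mg|exact: measurable_cst].
pose fg := fourier (fun x => Complex (g x) 0 : C).
have mfg : re_im (mfunT) fg.
  have mg2 : mfunT (fun z : 'rV[R]_n * 'rV[R]_n => g z.2) by exact: (measurableT_comp mg measurable_snd).
  have md : mfunT (fun xi : 'rV[R]_n => (xi, xi)) by apply: measurable_fun_pair.
  exact: (re_im_measurable_comp (measurable_fourier mg2) md).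
have fgb xi : normc (fg xi) <= 2 * \int[leb]_x `|g x|.
  have nE (x : 'rV[R]_n) : normc (cis (- (2 * pi * dotv x xi)) * Complex (g x) 0) = `|g x|.
    by rewrite ComplexField.Normc.normcM normc_cis mul1r /= expr0n addr0 sqrtr_sqr.
  have I : Cintegrable leb (fun x => cis (- (2 * pi * dotv x xi)) * Complex (g x) 0).
    apply: (le_Cintegrable _ (integrable_norm gI)); last by move=> x; rewrite nE.
    apply: re_im_measurableM => //; apply: re_im_measurable_cis; apply: measurableT_comp => //.
    by apply: measurable_funM => //; apply: measurable_dotv.
  by apply: (le_trans (normc_Cintegral I)); under eq_Rintegral do rewrite nE.
pose Q xi := cis (2 * pi * dotv y xi) * PP v q xi.
have mQ : re_im (mfunT) Q by exact: measurable_mode.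
have [PI _] := PP_integrable vC q0.
have FI : Cintegrable leb (fun xi => H xi * fg xi * Q xi).
  apply: (le_Cintegrable (g := fun xi => B * (2 * \int[leb]_x `|g x|) * normc (PP v q xi))).
  - by apply: re_im_measurableM => //; exact: re_im_measurableM.
  - exact: (integrableZl measurableT _ (Cintegrable_normc PI)).
  - move=> xi; rewrite !ComplexField.Normc.normcM normc_cis mul1r ler_wpM2r ?normc_ge0//.
    by rewrite ler_pM ?normc_ge0.
have E (a' : R) : singular_op K g (fun x => Complex (a' * prof v q y x) 0) =
    Complex a' 0 * Cintegral leb setT (fun xi => H xi * fg xi * Q xi).
  rewrite -Cintegral_scale// /singular_op.
  apply: Cintegral_ae.
  - rewrite [X in re_im _ X](_ : _ = fun xi => fk_hat K xi * fg xi * (Complex a' 0 * Q xi)); last first.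
      by apply/funext => xi; rewrite inv_fourier_scale.
    apply: re_im_measurableM; first by apply: re_im_measurableM => //; exact: fk_hat_measurable.
    by apply: re_im_measurableM => //; exact: re_im_measurable_cst.
  - apply: re_im_measurableM; first exact: re_im_measurable_cst.
    by apply: re_im_measurableM => //; exact: re_im_measurableM.
  - by apply: ae_imply HK => xi ->; rewrite inv_fourier_scale// mulrCA.
have E1 := E 1; rewrite (_ : Complex 1 0 = 1)// mul1r in E1.
have ReZ (z : C) : Re (Complex a 0 * z) = a * Re z by case: z => z1 z2 /=; rewrite mul0r subr0.
rewrite E ReZ; congr (a * _).
rewrite -E1; congr (Re (singular_op _ _ _)).
by apply/funext => x; rewrite mul1r.
Qed.

(** The section of [G] at time [s] is integrable only for almost every [s]; the formula at fixed
    time is used at those times, under an integral in [s]. *)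
Lemma singular_op_time (G : spacetime R n -> R) (al : R -> R) (D : set R) q y :
  0 < q -> measurable D -> mfunT al -> integrableT (mu \x leb)%E G ->
  \int[mu]_(s in D) Re (singular_op K (fun x => G (s, x)) (fun x => Complex (al s * prof v q y x) 0)) =
  \int[mu]_(s in D) (al s * \int[leb]_x (kap H v q (y - x) * G (s, x))).
Proof.
move=> q0 mD mal GI; have mG : mfunT G by exact: measurable_L1 GI.
rewrite /Rintegral; congr fine; apply: ae_eq_integral => //.
- apply: measurable_funTS; apply/measurable_EFinP.
  pose F (z : spacetime R n) : C := fk_hat K z.2 * fourier (fun x => Complex (G (z.1, x)) 0 : C) z.2 *
    (Complex (al z.1) 0 * (cis (2 * pi * dotv y z.2) * PP v q z.2)).
  have [mF _] : re_im (mfunT) F.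
    apply: re_im_measurableM.
      apply: re_im_measurableM; first exact: (re_im_measurable_comp (fk_hat_measurable K) measurable_snd).
      exact: measurable_fourier.
    apply: re_im_measurableM; last exact: (re_im_measurable_comp (measurable_mode q y) measurable_snd).
    by split; [exact: (measurableT_comp mal measurable_fst)|exact: measurable_cst].
  have := measurable_Rintegral leb mF; congr (measurable_fun _ _); apply/funext => s.
  rewrite /singular_op /=; apply: eq_Rintegral => xi _.
  by rewrite inv_fourier_scale.
- apply: measurable_funTS; apply/measurable_EFinP; apply: measurable_funM => //.
  apply: (measurable_Rintegral leb (f := fun z : spacetime R n => kap H v q (y - z.2) * G z)).
  apply: measurable_funM => //.
  by apply: (measurableT_comp (measurableT_comp (measurable_kap mH vC q) (measurable_rV_subc y)) measurable_snd).
- apply: ae_imply (ae_integrable1 GI) => s GsI _.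
  by rewrite (singular_op_scale _ _ q0 GsI).
Qed.

End singular_time.

(** * The difference of two mollifiers as a divergence *)

Section telescoping.
Variables (R : realType) (n : nat).
Implicit Types (q : R).

(** The factors of [a] are replaced by those of [c] one at a time, from the left. The definition of
    [step] follows the same pattern. *)
Lemma telescope_prod m (a c : 'I_m -> R) :
  \sum_(j < m) \prod_(i < m) (if i == j then a i - c i else if (i < j)%N then c i else a i) =
  \prod_(i < m) a i - \prod_(i < m) c i.
Proof.
elim: m a c => [|m IH] a c; first by rewrite !big_ord0 subrr.
rewrite [LHS]big_ord_recl [X in X + _]big_ord_recl [X in _ = X - _]big_ord_recl [X in _ = _ - X]big_ord_recl/=.
rewrite [X in _ + X = _](eq_bigr (fun j : 'I_m => c ord0 * \prod_(i < m) (if i == j then a (lift ord0 i) - c (lift ord0 i)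
    else if (i < j)%N then c (lift ord0 i) else a (lift ord0 i)))); last first.
  move=> j _; rewrite big_ord_recl/=; congr (_ * _); apply: eq_bigr => i _.
rewrite -mulr_sumr IH; ring.
Qed.

(* [step j] is the profile whose [j]-th derivatives sum to [rho 1 - rho 2]. *)
Definition step (j i : 'I_n) : R -> R :=
  if i == j then @theta R else if (i < j)%N then (fun z : R => bell (z / 2) / 2) else @bell R.

Lemma half_Cc : @Cc R 2 (fun x : R => bell (x / 2) / 2).
Proof.
have [bS b0] := @bell_Cc R; split.
  rewrite (_ : (fun _ => _) = fun x : R => cst 2^-1 x * bell (2^-1 * x + 0)).
    by apply: SM_mul; [exact: SM_cst|apply: SM_comp].
  by apply/funext => x; rewrite /cst addr0 [x / 2]mulrC [LHS]mulrC.
move=> x x2; rewrite b0 ?mul0r// normrM (ger0_norm (_ : 0 <= 2^-1 :> R))//.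
by rewrite ltr_pdivlMr// mul1r.
Qed.

Lemma step_Cc j i : Cc 2 (step j i).
Proof.
rewrite /step; case: ifPn => _; first exact: theta_Cc.
case: ifPn => _; first exact: half_Cc.
by apply: Cc_le (@bell_Cc R); lra.
Qed.

Lemma step_int j : exists i, \int[@lebesgue_measure R]_x step j i x = 0.
Proof. by exists j; rewrite /step eqxx; exact: Rintegral_theta. Qed.

Lemma dil_derive q (y : R) (v : R -> R) x : 0 < q -> SM v ->
  derive1 (dil q y v) x = - q^-1 * (q^-1 * derive1 v ((y - x) / q)).
Proof.
move=> q0 vS; have qn : q != 0 by rewrite gt_eqF.
have E (z : R) : (y - z) / q = - q^-1 * z + y / q by field.
have d := @isd_comp R v (fun z => - q^-1 * z + y / q) x _ _ (SM_isd _ vS) (isd_affine (- q^-1) (y / q) x).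
have := isdM (is_derive_cst (q^-1) x (1 : R)) d.
rewrite mulr0 addr0 => h.
have -> : dil q y v = (fun z => cst q^-1 z * v (- q^-1 * z + y / q)).
  by apply/funext => z; rewrite /dil E.
by rewrite (isd_derive1 h) E /cst; ring.
Qed.

(** Differentiating the profile [step j] along coordinate [j] turns [theta] into the difference of
    the one-dimensional mollifiers of scales 1 and 2, and the sum over [j] telescopes. The sign and
    the factor [q^-1] come from the chain rule in [(y - x) / q]. *)
Lemma sum_step q (x y : 'rV[R]_n) : 0 < q ->
  - \sum_(j < n) \prod_(i < n) (if i == j then derive1 (dil q (y ord0 i) (step j i))
      else dil q (y ord0 i) (step j i)) (x ord0 i) =
  q^-1 * (rho q (y - x) - rho (2 * q) (y - x)).
Proof.
move=> q0; pose z i := (y ord0 i - x ord0 i) / q.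
pose a i : R := q^-1 * bell (z i); pose c i : R := q^-1 * (bell (z i / 2) / 2).
have -> : rho q (y - x) = \prod_(i < n) a i by apply: eq_bigr => i _; rewrite !mxE.
have -> : rho (2 * q) (y - x) = \prod_(i < n) c i.
  apply: eq_bigr => i _; rewrite !mxE.
  have -> : (y ord0 i - x ord0 i) / (2 * q) = z i / 2 by rewrite /z invfM mulrA mulrAC.
  by rewrite /c invfM; ring.
rewrite -telescope_prod mulr_sumr -sumrN; apply: eq_bigr => j _.
rewrite (bigD1 j)//= [in RHS](bigD1 j)//= !eqxx dil_derive//; last first.
  exact: (step_Cc j j).1.
rewrite (eq_bigr (fun i : 'I_n => if (i < j)%N then c i else a i)); last first.
  by move=> i ij; rewrite (negbTE ij) /step (negbTE ij); case: ifPn.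
rewrite [in RHS](eq_bigr (fun i : 'I_n => if (i < j)%N then c i else a i)); last first.
  by move=> i ij; rewrite (negbTE ij).
rewrite /step eqxx theta_derive1 -/(z j) /a /c; ring.
Qed.

End telescoping.

Section pairing.
Variables (R : realType) (n : nat).
Local Notation leb := (@lebesgue_rV R n).
Implicit Types (f : spacetime R n -> R) (P : 'rV[R]_n -> R) (al : R -> R).

Lemma bounded_integrable d (T : measurableType d) (m : {measure set T -> \bar R}) (f k : T -> R) (C : R) :
  mfunT k -> (forall z, `|k z| <= C) -> integrableT m f ->
  m.-integrable setT (fun z => (k z * f z)%:E).
Proof.
move=> mk kC fI; have mf : mfunT f by exact: measurable_L1 fI.
apply: (le_integrable measurableT _ _ (integrableZl measurableT C (integrable_norm fI))).
  by apply/measurable_EFinP; exact: measurable_funM.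
move=> z _ /=; rewrite lee_fin normrM (le_trans (ler_wpM2r _ (kC z)))//.
exact: ler_norm.
Qed.

Lemma Rintegral_sum d (T : measurableType d) (m : {measure set T -> \bar R}) (I : Type) (r : seq I)
    (f : I -> T -> R) : (forall i, integrableT m (f i)) ->
  integrableT m (fun x => \sum_(i <- r) f i x) /\
  \int[m]_x (\sum_(i <- r) f i x) = \sum_(i <- r) \int[m]_x f i x.
Proof.
move=> fI; elim: r => [|i r [rI IH]].
  split; last by rewrite big_nil; under eq_Rintegral do rewrite big_nil; rewrite /Rintegral integral0.
  rewrite (_ : _ \o _ = cst 0%E); first exact: integrable0.
  by apply/funext => x /=; rewrite big_nil.
split.
  rewrite (_ : _ \o _ = ((EFin \o f i) \+ (EFin \o (fun x => (\sum_(i <- r) f i x)%R)))%E).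
    exact: integrableD.
  by apply/funext => x /=; rewrite big_cons EFinD.
under eq_Rintegral do rewrite big_cons.
by rewrite big_cons RintegralD// IH.
Qed.

Lemma tens_bounded (u : 'I_n -> R -> R) M : (forall i, Cc M (u i)) ->
  exists2 C : R, 0 <= C & forall x : 'rV[R]_n, `|\prod_(i < n) u i (x ord0 i)| <= C.
Proof.
move=> uC; have /choice[C HC] : forall i, exists C, 0 <= C /\ forall z, `|u i z| <= C.
  by move=> i; have [C C0 HC] := Cc_bounded (uC i); exists C.
exists (\prod_(i < n) C i); first by apply: prodr_ge0 => i _; exact: (HC i).1.
move=> x; rewrite normr_prod; apply: ler_prod => i _; rewrite normr_ge0 /=; exact: (HC i).2.
Qed.

Lemma pairing_integrable f P (C : R) : mfunT P -> (forall x, `|P x| <= C) ->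
  integrableT leb2 f ->
  mu.-integrable setT (fun s => (\int[leb]_x (P x * f (s, x)))%:E).
Proof.
move=> mP PC fI.
have := bounded_integrable (k := fun z : spacetime R n => P z.2)
  (measurableT_comp mP measurable_snd) (fun z => PC z.2) fI.
exact: (@integrable_inner1 _ _ _ _ _ mu leb (fun z : spacetime R n => P z.2 * f z)).
Qed.

Lemma pairing_fubini f P al (C A : R) : mfunT P -> (forall x, `|P x| <= C) ->
  mfunT al -> (forall s, `|al s| <= A) ->
  integrableT leb2 f ->
  \int[leb2]_z (f z * (al z.1 * P z.2)) = \int[mu]_s (al s * \int[leb]_x (P x * f (s, x))).
Proof.
move=> mP PC mal alA fI.
have mal1 : mfunT (fun z : spacetime R n => al z.1).
  exact: (measurableT_comp mal measurable_fst).
have mP2 : mfunT (fun z : spacetime R n => P z.2).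
  exact: (measurableT_comp mP measurable_snd).
have mf : mfunT f by exact: measurable_L1 fI.
have kI : leb2.-integrable setT (fun z => (al z.1 * P z.2 * f z)%:E).
  apply: (bounded_integrable (C := A * C)) => //; first exact: measurable_funM.
  by move=> z; rewrite normrM ler_pM.
under eq_Rintegral do rewrite mulrC.
rewrite -(@Rfubini1 _ _ _ _ _ mu leb (fun z : spacetime R n => al z.1 * P z.2 * f z) kI).
rewrite /Rintegral; congr fine; apply: ae_eq_integral => //.
- apply/measurable_EFinP.
  exact: (measurable_Rintegral leb (f := fun z : spacetime R n => al z.1 * P z.2 * f z)
    (measurable_funM (measurable_funM mal1 mP2) mf)).
- apply/measurable_EFinP; apply: measurable_funM => //.
  exact: (measurable_Rintegral leb (f := fun z : spacetime R n => P z.2 * f z)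
    (measurable_funM mP2 mf)).
- apply: ae_imply (ae_integrable1 fI) => s fsI _ /=.
  have := RintegralZl (al s) measurableT (bounded_integrable mP PC fsI).
  by rewrite /Rintegral => <-; congr (fine _)%:E; apply: eq_integral => x _; rewrite mulrA.
Qed.

End pairing.

(** * Moduli of continuity integrated in time *)

Section modulus_time.
Variables (R : realType) (n : nat).
Local Notation leb := (@lebesgue_rV R n).
Implicit Types (G : spacetime R n -> R).
Local Open Scope ereal_scope.

Lemma measurable_modulus_time G (q : R) : mfunT G ->
  mfunT (fun s => modulus (fun x => G (s, x)) q).
Proof.
move=> mG.
pose t1 (z : (spacetime R n) * 'rV[R]_n) : 'rV[R]_n := (z.2 - q *: z.1.2)%R.
have mt1 : mfunT t1.
  apply: (measurableT_comp (@measurable_rV_sub R n) (g := fun z : (spacetime R n) * 'rV[R]_n => (z.2, (q *: z.1.2)%R))).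
  apply: measurable_fun_pair => //.
  exact: (measurableT_comp (measurable_rV_scale q) (measurableT_comp measurable_snd measurable_fst)).
have m11 : mfunT (fun z : (spacetime R n) * 'rV[R]_n => z.1.1).
  exact: (measurableT_comp measurable_fst measurable_fst).
have ma : mfunT (fun z : (spacetime R n) * 'rV[R]_n => G (z.1.1, t1 z)).
  by apply: (measurableT_comp mG); exact: measurable_fun_pair.
have mb : mfunT (fun z : (spacetime R n) * 'rV[R]_n => G (z.1.1, z.2)).
  by apply: (measurableT_comp mG); exact: measurable_fun_pair.
have mo : mfunT (fun z : spacetime R n => omega (fun x => G (z.1, x)) (q *: z.2)%R).
  exact: (ge0_measurable_integral leb (measurable_normB ma mb)).
apply: (ge0_measurable_integral leb (f := fun z : spacetime R n =>
  Psi z.2 * omega (fun x => G (z.1, x)) (q *: z.2)%R)).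
  by apply: emeasurable_funM => //; exact: (measurableT_comp (@measurable_Psi R n) measurable_snd).
by move=> z; rewrite mule_ge0 ?Psi_ge0 ?omega_ge0.
Qed.

Lemma integrable_L1n G : integrableT leb2 G ->
  mu.-integrable setT (fun s => L1n (fun x => G (s, x))).
Proof.
move=> GI; have mG : mfunT G by exact: measurable_L1 GI.
have mn : mfunT (fun z : spacetime R n => `|(G z)%:E|).
  by apply: measurableT_comp => //; apply/measurable_EFinP.
apply/integrableP; split; first exact: (ge0_measurable_integral leb mn).
under eq_integral do rewrite gee0_abs ?integral_ge0//.
rewrite /L1n; have := @fubini_tonelli1 _ _ _ _ _ mu leb _ mn (fun=> abse_ge0 _).
by move=> <-; have /integrableP[_] := GI.
Qed.

(** A second dominated convergence, now in time: the modulus at time [s] is at most twice the L^1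
    norm of that section times the integral of [Psi]. *)
Lemma modulus_time_cvg G : integrableT leb2 G ->
  \int[mu]_s modulus (fun x => G (s, x)) (2 ^- l)%R @[l --> \oo] --> 0.
Proof.
move=> GI; have mG : mfunT G by exact: measurable_L1 GI.
have mGs s : mfunT (fun x => G (s, x)) by exact: (measurableT_comp mG (pair1_measurable s)).
pose P := \int[leb]_u @Psi R n u.
have Pfin : P \is a fin_num.
  have /integrableP[_] := @Psi_integrable R n.
  rewrite ge0_fin_numE ?integral_ge0//; last by move=> u _; exact: Psi_ge0.
  by under eq_integral do rewrite gee0_abs ?Psi_ge0//.
apply: (@ge0_dominated_cvg0 R _ (measurableTypeR R) mu _ (fun s => (2 * fine P)%:E * L1n (fun x => G (s, x)))).
- by move=> k; exact: measurable_modulus_time.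
- by move=> k s; exact: modulus_ge0.
- by apply: integrableZl => //; exact: integrable_L1n.
- apply: aeW => s k; rewrite (le_trans (modulus_le _ (mGs s)))//.
  by rewrite EFinM fineK// -/P muleAC.
- by apply: ae_imply (ae_integrable1 GI) => s GsI; exact: modulus_cvg.
Qed.

End modulus_time.

(** * Blocks expressed and bounded through the singular operators *)

Section besov.
Variables (R : realType) (n m : nat) (T : R).
Local Notation C := R[i].
Local Notation leb := (@lebesgue_rV R n).
Implicit Types (q : R) (y : 'rV[R]_n).

(** The factors of the derivative along coordinate [j] of the dilated profile [step j] centred at
    [y]. *)
Definition dstep_fac (j : 'I_n) q y (i : 'I_n) : R -> R :=
  if i == j then derive1 (dil q (y ord0 i) (step j i)) else dil q (y ord0 i) (step j i).

Definition dstep (j : 'I_n) q y (x : 'rV[R]_n) : R := \prod_(i < n) dstep_fac j q y i (x ord0 i).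

Lemma dil_step_Cc j q y i : 0 < q -> Cc (\sum_(i < n) `|y ord0 i| + q * 2) (dil q (y ord0 i) (step j i)).
Proof.
move=> q0; apply: Cc_le (dil_Cc (y ord0 i) q0 (step_Cc R j i)).
by rewrite lerD2r (bigD1 i)//= lerDl; apply: sumr_ge0.
Qed.

Lemma dstep_fac_Cc j q y i : 0 < q -> Cc (\sum_(i < n) `|y ord0 i| + q * 2) (dstep_fac j q y i).
Proof.
by move=> q0; rewrite /dstep_fac; case: ifP => _; [apply: Cc_derive1|]; exact: dil_step_Cc.
Qed.

Lemma measurable_dstep j q y : 0 < q -> mfunT (dstep j q y).
Proof.
move=> q0; apply: measurable_prod => i _.
exact: (measurableT_comp (SM_measurable (dstep_fac_Cc j y i q0).1) (measurable_coord i)).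
Qed.

(* The Littlewood-Paley block [rho_q * h - rho_{2q} * h] *)
Definition block q (h : 'rV[R]_n -> R) y := \int[leb]_x ((rho q (y - x) - rho (2 * q) (y - x)) * h x).

Variables (h : spacetime R n -> R) (H : 'I_n -> 'I_m -> 'rV[R]_n -> C) (B : 'I_n -> 'I_m -> R)
  (G : 'I_n -> 'I_m -> spacetime R n -> R).
Hypotheses (hI : integrableT leb2 h) (GI : forall j k, integrableT leb2 (G j k)).
Hypotheses (B0 : forall j k, 0 <= B j k) (mH : forall j k, re_im (mfunT) (H j k))
  (H_le : forall j k x, normc (H j k x) <= B j k).

Let fI q y j k s := \int[leb]_x (kap (H j k) (step j) q (y - x) * G j k (s, x)).

Let mkap q y j k : mfunT (fun x : 'rV[R]_n => kap (H j k) (step j) q (y - x)).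
Proof. exact: (measurableT_comp (measurable_kap (mH j k) (step_Cc R j) q) (measurable_rV_subc y)). Qed.

Let kap_b q y j k (x : 'rV[R]_n) : 0 < q ->
  `|kap (H j k) (step j) q (y - x)| <= 2 * B j k * AA (step j) * q ^- n.
Proof. by move=> q0; apply: kap_le => //; exact: step_Cc. Qed.

Let mrho q y : mfunT (fun x : 'rV[R]_n => rho q (y - x)).
Proof. exact: (measurableT_comp (measurable_rho q) (measurable_rV_subc y)). Qed.

(** The hypothesis is the derivative identity of (R2) tested on a function of time multiplied by the
    profile [step j]. Summed over [j], its left-hand side is the block by [sum_step]; the function
    of time being arbitrary, the identity holds at almost every time, with a null set depending on
    [y]. *)
Lemma block_eq q y : 0 < q ->
  (forall j al a c, SM al -> 0 < a -> c < T -> (forall s, ~~ (a <= s <= c) -> al s = 0) ->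
    - (\int[leb2]_z (h z * (al z.1 * dstep j q y z.2))) =
    \sum_(k < m) \int[mu]_(s in `]0, T[) (al s * fI q y j k s)) ->
  {ae mu, forall s, 0 < s < T ->
    q^-1 * block q (fun x => h (s, x)) y = \sum_(j < n) \sum_(k < m) fI q y j k s}.
Proof.
move=> q0 W; have q20 : 0 < 2 * q by rewrite mulr_gt0.
have [C C0 HC] := rho_bound R n.
have mr : mfunT (fun x : 'rV[R]_n => q^-1 * (rho q (y - x) - rho (2 * q) (y - x))).
  by apply: measurable_funM => //; exact: measurable_funB.
have br (x : 'rV[R]_n) : `|q^-1 * (rho q (y - x) - rho (2 * q) (y - x))| <= q^-1 * (C * q ^- n + C * (2 * q) ^- n).
  rewrite normrM (ger0_norm (_ : 0 <= q^-1)) ?invr_ge0 ?(ltW q0)// ler_wpM2l ?invr_ge0 ?(ltW q0)//.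
  by rewrite (le_trans (ler_normB _ _))// lerD// HC.
pose bl (s : R) := \int[leb]_x (q^-1 * (rho q (y - x) - rho (2 * q) (y - x)) * h (s, x)).
have blI : integrableT mu bl by exact: pairing_integrable br hI.
have fII j k : integrableT mu (fI q y j k).
  by apply: pairing_integrable (GI j k) => // x; exact: kap_b.
have mfI j k : mfunT (fI q y j k) by exact: measurable_L1 (fII j k).
have sI : integrableT mu (fun s => \sum_(j < n) \sum_(k < m) fI q y j k s).
  exact: (Rintegral_sum (index_enum _) (fun j => (Rintegral_sum (index_enum _) (fII j)).1)).1.
have DI : integrableT mu (fun s => bl s - \sum_(j < n) \sum_(k < m) fI q y j k s).
  exact: (integrableB measurableT blI sI).
have := test_ae0 DI; move=> /(_ 0 T) E.
apply: ae_imply2 (E _) (ae_integrable1 hI) => [s Es hsI sT|al a c alS a0 cT als].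
  have rI : leb.-integrable setT (fun x => ((rho q (y - x) - rho (2 * q) (y - x)) * h (s, x))%:E).
    apply: (bounded_integrable (C := C * q ^- n + C * (2 * q) ^- n)) => //.
      exact: measurable_funB.
    by move=> x; rewrite (le_trans (ler_normB _ _))// lerD// HC.
  rewrite /block -RintegralZl//; rewrite -(subr0_eq (Es sT)).
  by apply: eq_Rintegral => x _; rewrite mulrA.
have alC : Cc (`|a| + `|c|) al.
  split => // s sac; apply: als; apply/negP => /andP[as_ sc].
  have ? := ler_norm c; have ? := normr_ge0 a.
  move: sac; rewrite ltNge => /negP; apply; rewrite ler_norml; apply/andP; split; lra.
have [A A0 HA] := Cc_bounded alC; have mal := SM_measurable alS.
have alI (g : R -> R) : integrableT mu g -> mu.-integrable setT (fun s => (al s * g s)%:E).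
  by move=> gI; apply: (@bounded_integrable _ _ (measurableTypeR R)) gI => //; exact: HA.
under eq_Rintegral do rewrite mulrBr.
rewrite RintegralB//; last 2 first.
- exact: alI blI.
- exact: alI sI.
rewrite -(pairing_fubini mr br mal HA hI).
apply/eqP; rewrite subr_eq0; apply/eqP.
have supp (g : R -> R) : \int[mu]_(s in `]0, T[) (al s * g s) = \int[mu]_s (al s * g s).
  rewrite Rintegral_mkcond; apply: eq_Rintegral => s _; rewrite patchE; case: ifPn => //.
  rewrite notin_setE/= in_itv/= => /negP sT; rewrite als ?mul0r//.
  by apply: contra sT => /andP[as_ sc]; apply/andP; split; lra.
have sumE j : \int[mu]_s (al s * \sum_(k < m) fI q y j k s) =
    - \int[leb2]_z (h z * (al z.1 * dstep j q y z.2)).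
  rewrite (W j al a c alS a0 cT als); under eq_Rintegral do rewrite mulr_sumr.
  rewrite (Rintegral_sum _ (fun k => alI _ (fII j k))).2.
  by apply: eq_bigr => k _; rewrite supp.
under [RHS]eq_Rintegral do rewrite mulr_sumr.
rewrite (Rintegral_sum _ (fun j => alI _ ((Rintegral_sum _ (fII j)).1))).2.
rewrite (eq_bigr _ (fun j _ => sumE j)).
have hdI j : leb2.-integrable setT (fun z => (h z * (al z.1 * dstep j q y z.2))%:E).
  have [D D0 HD] := tens_bounded (fun i => dstep_fac_Cc j y i q0).
  rewrite (_ : (fun z => _) = fun z : spacetime R n => (al z.1 * dstep j q y z.2 * h z)%:E); last first.
    by apply/funext => z; rewrite mulrC.
  apply: (bounded_integrable (C := A * D)) => //.
    apply: measurable_funM; first exact: (measurableT_comp mal measurable_fst).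
    exact: (measurableT_comp (measurable_dstep j y q0) measurable_snd).
  by move=> z; rewrite normrM ler_pM// HD.
rewrite sumrN -(Rintegral_sum _ hdI).2.
rewrite -[RHS]mulN1r -RintegralZl//; last exact: (Rintegral_sum _ hdI).1.
apply: eq_Rintegral => z _; rewrite -(sum_step z.2 y q0) mulN1r -mulr_sumr -mulr_sumr.
by rewrite mulrN mulrN.
Qed.

Let measurable_fI q : 0 < q -> forall j k,
  mfunT (fun z : spacetime R n => fI q z.2 j k z.1).
Proof.
move=> q0 j k.
have m1 : mfunT (fun z : (spacetime R n) * 'rV[R]_n => kap (H j k) (step j) q (z.1.2 - z.2)).
  apply: (measurableT_comp (measurable_kap (mH j k) (step_Cc R j) q)).
  apply: (measurableT_comp (@measurable_rV_sub R n) (g := fun z : (spacetime R n) * 'rV[R]_n => (z.1.2, z.2))).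
  by apply: measurable_fun_pair => //; exact: (measurableT_comp measurable_snd measurable_fst).
have mG : mfunT (G j k) by exact: measurable_L1 (GI j k).
have m2 : mfunT (fun z : (spacetime R n) * 'rV[R]_n => G j k (z.1.1, z.2)).
  apply: (measurableT_comp mG); apply: measurable_fun_pair => //.
  exact: (measurableT_comp measurable_fst measurable_fst).
exact: (measurable_Rintegral leb (measurable_funM m1 m2)).
Qed.

Lemma measurable_block q : mfunT
  (fun z : spacetime R n => block q (fun x => h (z.1, x)) z.2).
Proof.
have mh : mfunT h by exact: measurable_L1 hI.
have m0 : mfunT (fun z : (spacetime R n) * 'rV[R]_n => (z.1.2 - z.2 : 'rV[R]_n)).
  apply: (measurableT_comp (@measurable_rV_sub R n) (g := fun z : (spacetime R n) * 'rV[R]_n => (z.1.2, z.2))).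
  by apply: measurable_fun_pair => //; exact: (measurableT_comp measurable_snd measurable_fst).
have m2 : mfunT (fun z : (spacetime R n) * 'rV[R]_n => h (z.1.1, z.2)).
  apply: (measurableT_comp mh); apply: measurable_fun_pair => //.
  exact: (measurableT_comp measurable_fst measurable_fst).
apply: (measurable_Rintegral leb (f := fun z : (spacetime R n) * 'rV[R]_n =>
  (rho q (z.1.2 - z.2) - rho (2 * q) (z.1.2 - z.2)) * h (z.1.1, z.2))).
apply: measurable_funM => //; apply: measurable_funB.
  exact: (measurableT_comp (measurable_rho q) m0).
exact: (measurableT_comp (measurable_rho (2 * q)) m0).
Qed.

Local Open Scope ereal_scope.

(** The exceptional times of the identity depend on [y], so the time integral is moved inside before
    the block is replaced. It is moved out again to apply [conv_modulus] with [m = 0] at almost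
    every fixed time. *)
Lemma block_int_le (E : 'I_n -> 'I_m -> R) q (A : set 'rV[R]_n) : (0 < q)%R -> measurable A ->
  (forall j k, (0 <= E j k)%R) ->
  (forall j k w, `|kap (H j k) (step j) q w|%:E <= (E j k * q ^- n)%:E * Psi (q^-1 *: w)%R) ->
  (forall j k, integrableT leb (kap (H j k) (step j) q)) ->
  (forall j k, (\int[leb]_w kap (H j k) (step j) q w)%R = 0%R) ->
  (forall y, A y -> {ae mu, forall s, (0 < s < T)%R ->
    (q^-1 * block q (fun x => h (s, x)) y)%R = (\sum_(j < n) \sum_(k < m) fI q y j k s)%R}) ->
  \int[mu]_(s in `]0%R, T[) \int[leb]_(y in A) `|(q^-1 * block q (fun x => h (s, x)) y)%R%:E| <=
  \sum_(j < n) \sum_(k < m) ((E j k)%:E * \int[mu]_s modulus (fun x => G j k (s, x)) q).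
Proof.
move=> q0 mA E0 kE kI k0 W.
pose D : set (spacetime R n) := `]0%R, T[%classic `*` A.
pose F := (fun z : spacetime R n => `|(q^-1 * block q (fun x => h (z.1, x)) z.2)%R%:E|) \_ D.
have mD : measurable D by exact: measurableX.
have mF : mfunT F.
  apply: measurable_patch => //; apply: measurableT_comp => //; apply/measurable_EFinP.
  by apply: measurable_funM => //; exact: measurable_block.
have F0 z : 0 <= F z by rewrite /F patchE; case: ifP.
have -> : \int[mu]_(s in `]0%R, T[) \int[leb]_(y in A) `|(q^-1 * block q (fun x => h (s, x)) y)%R%:E| =
    \int[mu]_s \int[leb]_y F (s, y).
  rewrite integral_mkcond; apply: eq_integral => s _; rewrite patchE.
  case: ifPn => [|] sT; last first.
    rewrite integral0_eq// => y _; rewrite /F patchE ifF//; apply/negbTE; move: sT; rewrite !notin_setE /D /=.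
    by move=> sT [].
  rewrite integral_mkcond; apply: eq_integral => y _; rewrite /F !patchE.
  rewrite [(s, y) \in D](_ : _ = (y \in A))//; apply/idP/idP; rewrite !inE /D /=; first by case.
  by move=> yA; split => //; rewrite inE in sT.
rewrite (ge0_fubini leb mu mF F0).
have mfI := measurable_fI q0.
have mfn j k : mfunT (fun z : spacetime R n => `|(fI q z.2 j k z.1)%:E|).
  by apply: measurableT_comp => //; apply/measurable_EFinP.
have mS : mfunT (fun z : spacetime R n => \sum_(j < n) \sum_(k < m) `|(fI q z.2 j k z.1)%:E|).
  by apply: emeasurable_sum => j; apply: emeasurable_sum => k.
apply: (@le_trans _ _ (\int[leb]_y \int[mu]_s \sum_(j < n) \sum_(k < m) `|(fI q y j k s)%:E|)).
  apply: ge0_le_integral_lower => [y _|y _]; first by apply: integral_ge0 => s _; exact: F0.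
  have [yA|yA] := pselect (A y); last first.
    rewrite integral0_eq => [|s _]; first by apply: integral_ge0 => s _; do 2!apply: sume_ge0 => ? _.
    by rewrite /F patchE ifF//; apply/negbTE; rewrite notin_setE /D /= => -[].
  apply: (@ae_ge0_le_integral _ (measurableTypeR R)) => //.
  - exact: (measurableT_comp mF (pair2_measurable y)).
  - by move=> s _; do 2!apply: sume_ge0 => ? _.
  - exact: (measurableT_comp mS (pair2_measurable y)).
  apply: ae_imply (W y yA) => s Ws _; rewrite /F patchE; case: ifPn => [|_]; last first.
    by do 2!apply: sume_ge0 => ? _.
  rewrite inE /D /= in_itv/= => -[sT _]; rewrite Ws//.
  rewrite (eq_bigr (fun j => (\sum_(k < m) `|fI q y j k s|)%R%:E)); last by move=> j _; rewrite -sumEFin.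
  rewrite sumEFin lee_fin (le_trans (ler_norm_sum _ _ _))//; apply: ler_sum => j _.
  exact: ler_norm_sum.
rewrite -(ge0_fubini leb mu mS); last by move=> z; do 2!apply: sume_ge0 => ? _.
have mfs s j k : mfunT (fun y => `|(fI q y j k s)%:E|).
  exact: (measurableT_comp (mfn j k) (pair1_measurable s)).
have -> : \int[mu]_s \int[leb]_y \sum_(j < n) \sum_(k < m) `|(fI q y j k s)%:E| =
    \sum_(j < n) \sum_(k < m) \int[mu]_s \int[leb]_y `|(fI q y j k s)%:E|.
  transitivity (\int[mu]_s \sum_(j < n) \sum_(k < m) \int[leb]_y `|(fI q y j k s)%:E|).
    apply: eq_integral => s _; rewrite ge0_integral_sum//.
    - by apply: eq_bigr => j _; rewrite ge0_integral_sum.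
    - by move=> j; apply: emeasurable_sum => k.
    - by move=> j y _; apply: sume_ge0.
  have mi j k : mfunT (fun s => \int[leb]_y `|(fI q y j k s)%:E|).
    exact: (ge0_measurable_integral leb (mfn j k)).
  rewrite (@ge0_integral_sum _ (measurableTypeR R))//.
  - apply: eq_bigr => j _; rewrite (@ge0_integral_sum _ (measurableTypeR R))//.
    by move=> k s _; exact: integral_ge0.
  - by move=> j; apply: emeasurable_sum => k.
  - by move=> j s _; apply: sume_ge0 => k _; exact: integral_ge0.
apply: lee_sum => j _; apply: lee_sum => k _.
have mG : mfunT (G j k) by exact: measurable_L1 (GI j k).
have mm := measurable_modulus_time q mG.
rewrite -ge0_integralZl//; [|by move=> s _; exact: modulus_ge0|by rewrite lee_fin].
apply: (@ae_ge0_le_integral _ (measurableTypeR R)) => //.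
- by move=> s _; exact: integral_ge0.
- exact: (ge0_measurable_integral leb (mfn j k)).
- by move=> s _; rewrite mule_ge0 ?lee_fin ?modulus_ge0.
- by apply: measurable_funeM.
apply: ae_imply (ae_integrable1 (GI j k)) => s GsI _.
have := conv_modulus q0 (E0 j k) (measurable_kap (mH j k) (step_Cc R j) q)
  (fun w => kap_le (mH j k) (H_le j k) (step_Cc R j) w q0) (kE j k) (kI j k) (k0 j k) GsI.
by under eq_integral do rewrite mul0r subr0.
Qed.

End besov.

(** * Blocks of the vector field tend to zero *)

Section besov_limit.
Variables (R : realType) (n : nat) (T : R) (b : R -> 'rV[R]_n -> 'rV[R]_n) (i0 : 'I_n).
Local Notation C := R[i].
Local Notation leb := (@lebesgue_rV R n).

Lemma measurable_strip (a c : R) : measurable (strip a c : set (spacetime R n)).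
Proof. by apply: measurableX => //; exact: measurable_itv. Qed.

(** A component of the field made globally integrable by a sharp cut. The cut has no effect on test
    functions supported in the cube. *)
Definition trunc_field (r : R) (z : spacetime R n) : R :=
  ((fun z => b z.1 z.2 ord0 i0) \_ (`]0, T[%classic `*` cube r)) z.

Lemma dstep_supp j q (y x : 'rV[R]_n) : 0 < q -> dstep j q y x != 0 -> forall i, `|x ord0 i - y ord0 i| <= q * 2.
Proof.
move=> q0 xn i; rewrite leNgt; apply: contra xn => h.
rewrite /dstep (bigD1 i)//= [X in X * _](_ : _ = 0) ?mul0r//.
have dC : forall z, q * 2 < `|z - y ord0 i| -> dil q (y ord0 i) (step j i) z = 0.
  by move=> z; exact: (dil_supp (step_Cc R j)).
rewrite /dstep_fac; case: ifP => _; last exact: dC.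
apply: isd_derive1; apply: (isd_near (f := cst 0)).
near=> z; rewrite dC//; near: z.
have c : (fun z : R => `|z - y ord0 i|) z @[z --> x ord0 i] --> `|x ord0 i - y ord0 i|.
  by apply: cvg_norm; apply: cvgB; [exact: cvg_id|exact: cvg_cst].
exact: (cvgr_gt _ c _ h).
Unshelve. all: by end_near. Qed.

Lemma Re_sum (I : Type) (s : seq I) (f : I -> C) : Re (\sum_(k <- s) f k) = \sum_(k <- s) Re (f k).
Proof. by elim/big_rec2: _ => // k x y _ <-; rewrite cReD. Qed.

(** At scale 2^-l <= 1 the profiles have support radius [2 * 2 ^- l <= 2]. The margin 2 between the
    cubes thus makes the truncated field indistinguishable from [b] in (R2), for profiles centred in
    the smaller cube. *)
Lemma besov_limit (r r' : R) : R2 T b -> r + 2 <= r' ->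
  integrableT leb2 (trunc_field r') ->
  (\int[mu]_(s in `]0%R, T[) \int[leb]_(y in cube r)
     `|((2 ^- l)^-1 * block (2 ^- l) (fun x => trunc_field r' (s, x)) y)%:E|)%E @[l --> \oo] --> 0%E.
Proof.
move=> [m [K [g [gI gE]]]] rr hI.
pose G j k : spacetime R n -> R := (fun z => g i0 j k z.1 z.2) \_ (strip 0 T).
have GI j k : integrableT leb2 (G j k).
  have := gI i0 j k; rewrite (integrable_mkcond _ (measurable_strip 0 T)); congr (integrable _ _ _).
  by apply/funext => z; rewrite /G /= !patchE; case: ifP.
have /choice[HB HHB] : forall p : 'I_n * 'I_m, exists HB : ('rV[R]_n -> C) * R,
    [/\ 0 <= HB.2, re_im (mfunT) HB.1, forall x, normc (HB.1 x) <= HB.2 &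
    {ae leb, forall x, HB.1 x = fk_hat (K i0 p.1 p.2) x}].
  by move=> p; have [H [B HB]] := bounded_representative (K i0 p.1 p.2); exists (H, B).
pose H j k := (HB (j, k)).1; pose B j k := (HB (j, k)).2.
have B0 j k : 0 <= B j k by have [] := HHB (j, k).
have mH j k : re_im (mfunT) (H j k) by have [] := HHB (j, k).
have H_le j k x : normc (H j k x) <= B j k by have [_ _ h _] := HHB (j, k); exact: h.
have HK j k : {ae leb, forall x, H j k x = fk_hat (K i0 j k) x} by have [] := HHB (j, k).
have /choice[EE HEE] : forall p : 'I_n * 'I_m, exists E, 0 <= E /\ forall q w, 0 < q ->
    (`|kap (H p.1 p.2) (step p.1) q w|%:E <= (E * q ^- n)%:E * Psi (q^-1 *: w))%E.
  move=> p; have [E E0 HE] := kap_majorant (B0 p.1 p.2) (mH p.1 p.2) (H_le p.1 p.2) (HK p.1 p.2)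
    (step_Cc R p.1) (step_int R p.1).
  by exists E; split => // q w; exact: HE.
pose E j k := EE (j, k).
have weak l (y : 'rV[R]_n) : cube r y -> {ae mu, forall s, 0 < s < T ->
    (2 ^- l)^-1 * block (2 ^- l) (fun x => trunc_field r' (s, x)) y =
    \sum_(j < n) \sum_(k < m) \int[leb]_x (kap (H j k) (step j) (2 ^- l) (y - x) * G j k (s, x))}.
  move=> yr; have q0 : 0 < 2 ^- l :> R by rewrite invr_gt0 exprn_gt0.
  apply: (@block_eq _ _ _ T _ H B) => // j al a c alS a0 cT als.
  have q1 : 2 ^- l <= 1 :> R by rewrite invf_le1 ?exprn_gt0// exprn_ege1// ler1n.
  have mal := SM_measurable alS.
  pose u i := dil (2 ^- l) (y ord0 i) (step j i).
  pose phi (z : R * 'rV[R]_n) := al z.1 * \prod_(i < n) u i (z.2 ord0 i).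
  have uS i : SM (u i) := (dil_step_Cc j y i q0).1.
  have us i x : (2 ^- l) * 2 < `|x - y ord0 i| -> u i x = 0.
    exact: (dil_supp (step_Cc R j)).
  have := gE i0 j phi (test_prod_time alS als a0 cT uS us).
  move=> /(congr1 (@complex.Re R)) /=; rewrite Re_sum => W.
  transitivity (- \int[leb2]_(z in strip 0 T) (b z.1 z.2 ord0 i0 * 'D_(0, basis_rV R j) phi z)).
    congr (- _); rewrite [in RHS]Rintegral_mkcond; apply: eq_Rintegral => z _.
    rewrite /trunc_field !patchE /phi derive_space// -/(dstep j (2 ^- l) y z.2).
    have [->|dn] := eqVneq (dstep j (2 ^- l) y z.2) 0; first by rewrite !mulr0; case: ifP.
    have zc : cube r' z.2.
      move=> i; have := dstep_supp q0 dn i; have := yr i.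
      have := ler_normD (z.2 ord0 i - y ord0 i) (y ord0 i); rewrite subrK => ? ? ?; lra.
    rewrite (_ : (z \in `]0, T[%classic `*` cube r') = (z \in strip 0 T)); last first.
      by apply/idP/idP; rewrite !inE /strip /=; move=> [? _]; split.
    by case: ifP => _; rewrite ?mul0r.
  rewrite W; apply: eq_bigr => k _.
  have E1 := singular_op_time (D := `]0, T[%classic) (mH j k) (H_le j k) (HK j k) (step_Cc R j) y q0
    (measurable_itv _) mal (GI j k).
  apply: etrans E1.
  apply: eq_Rintegral => s; rewrite inE => sT.
  have -> // : g i0 j k s = (fun x => G j k (s, x)).
  by apply/funext => x; rewrite /G patchE ifT// inE; split.
pose F l := (\sum_(j < n) \sum_(k < m) ((E j k)%:E * \int[mu]_s modulus (fun x => G j k (s, x)) (2 ^- l)))%E.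
apply: (@squeeze_cvge0 _ _ F) => [l|].
  have q0 : 0 < 2 ^- l :> R by rewrite invr_gt0 exprn_gt0.
  apply/andP; split; first by apply: integral_ge0 => s _; exact: integral_ge0.
  apply: (@block_int_le _ _ _ _ _ H B) => //.
  - exact: measurable_cube.
  - by move=> j k; exact: (HEE (j, k)).1.
  - by move=> j k w; exact: (HEE (j, k)).2.
  - by move=> j k; apply: (kap_integrable (B0 j k) (mH j k) (H_le j k) (HK j k) (step_Cc R j) (step_int R j)).
  - by move=> j k; apply: (kap_mean0 (B0 j k) (mH j k) (H_le j k) (HK j k) (step_Cc R j) (step_int R j)).
  - by move=> y yr; exact: weak.
have -> : 0%E = (\sum_(j < n) \sum_(k < m) ((E j k)%:E * 0%E))%E :> \bar R.
  by rewrite big1// => j _; rewrite big1// => k _; rewrite mule0.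
apply: cvg_nnesum => [j _|j _]; first by apply: nearW => l; apply: sume_ge0 => k _; rewrite mule_ge0 ?lee_fin ?(HEE (j, k)).1// integral_ge0// => s _; exact: modulus_ge0.
apply: cvg_nnesum => [k _|k _]; first by apply: nearW => l; rewrite mule_ge0 ?lee_fin ?(HEE (j, k)).1// integral_ge0// => s _; exact: modulus_ge0.
by apply: cvgeZl => //; exact: modulus_time_cvg.
Qed.

End besov_limit.

(** * Increments bounded by blocks at dyadic scales *)

Section convolution.
Variables (R : realType) (n : nat).
Local Notation leb := (@lebesgue_rV R n).
Implicit Types (h f : 'rV[R]_n -> R) (q r : R) (x y w : 'rV[R]_n).

Local Notation L1on A h := (\int[leb]_(y in A) `|(h y)%:E|)%E.

(** A localised Young inequality: a kernel supported in a cube of radius [p] sees, from the cube of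
    radius [r], only the values of [g] in the cube of radius [r + p]. *)
Lemma ge0_conv_cube (k g : 'rV[R]_n -> \bar R) (r p : R) :
  mfunT k -> mfunT g -> (forall w, 0 <= k w)%E -> (forall x, 0 <= g x)%E ->
  (forall w, ~ cube p w -> k w = 0%E) ->
  (\int[leb]_(y in cube r) \int[leb]_x (k (y - x)%R * g x) <=
   \int[leb]_w k w * \int[leb]_(x in cube (r + p)) g x)%E.
Proof.
move=> mk mg k0 g0 kp; pose g' := (g \_ (cube (r + p)))%E.
have mg' : mfunT g' by apply: measurable_patch => //; exact: measurable_cube.
have g'0 x : (0 <= g' x)%E by rewrite /g' patchE; case: ifP.
have mky : mfunT (fun z : 'rV[R]_n * 'rV[R]_n => k (z.1 - z.2)).
  exact: (measurableT_comp mk (@measurable_rV_sub R n)).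
have mP : mfunT (fun z : 'rV[R]_n * 'rV[R]_n => k (z.1 - z.2)%R * g' z.2)%E.
  by apply: emeasurable_funM => //; exact: (measurableT_comp mg' measurable_snd).
have P0 z : (0 <= k (z.1 - z.2)%R * g' z.2)%E by exact: mule_ge0.
have mi := ge0_measurable_integral leb mP P0.
apply: (@le_trans _ _ (\int[leb]_y \int[leb]_x (k (y - x)%R * g' x))%E).
  rewrite integral_mkcond; apply: ge0_le_integral_lower => y _.
    by rewrite patchE; case: ifP => // _; apply: integral_ge0 => x _; exact: mule_ge0.
  rewrite patchE; case: ifPn => [|_]; last by apply: integral_ge0 => x _; exact: (P0 (y, x)).
  rewrite inE => yr; apply: ge0_le_integral_lower => x _; first exact: mule_ge0.
  rewrite /g' patchE; case: ifPn => // xr.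
  rewrite kp ?mul0e// => yx; move: xr; rewrite notin_setE; apply => i.
  have := yr i; have := yx i; rewrite !mxE => h1 h2.
  rewrite -(subKr (y ord0 i) (x ord0 i)) (le_trans (ler_normB _ _))// lerD//.
rewrite (ge0_fubini leb leb mP P0) /= [X in (_ * X)%E]integral_mkcond -/g'.
rewrite -ge0_integralZl//; last exact: integral_ge0.
apply: ge0_le_integral_lower => x _; first by apply: integral_ge0 => y _; exact: (P0 (y, x)).
rewrite ge0_integralZr//; last exact: (measurableT_comp mky (pair2_measurable x)).
by rewrite (ge0_integral_shift (- x) mk k0).
Qed.

Lemma measurable_moll q h : mfunT h -> mfunT (moll q h).
Proof.
move=> mh; apply: (measurable_Rintegral leb (f := fun z : 'rV[R]_n * 'rV[R]_n => rho q (z.1 - z.2) * h z.2)).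
apply: measurable_funM; first exact: (measurableT_comp (measurable_rho q) (@measurable_rV_sub R n)).
exact: (measurableT_comp mh measurable_snd).
Qed.

Lemma cube_mono r p : r <= p -> @cube R n r `<=` cube p.
Proof. by move=> rp x xr i; exact: le_trans (xr i) rp. Qed.

Lemma rho_out q w : 0 < q -> ~ cube q w -> rho q w = 0.
Proof. by move=> q0 h; apply/eqP; apply/negP => /negP /(rho_supp q0). Qed.

Lemma moll_L1on : exists2 C : R, 0 <= C & forall q h r, 0 < q -> mfunT h ->
  (L1on (cube r) (moll q h) <= C%:E * L1on (cube (r + q)) h)%E.
Proof.
have [C C0 HC] := @rho_majorant R n.
pose P := (\int[leb]_u @Psi R n u)%E.
have Pfin : P \is a fin_num.
  have /integrableP[_] := @Psi_integrable R n.
  rewrite ge0_fin_numE ?integral_ge0//; last by move=> u _; exact: Psi_ge0.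
  by under eq_integral do rewrite gee0_abs ?Psi_ge0//.
have fP0 : 0 <= fine P by rewrite fine_ge0// integral_ge0// => u _; exact: Psi_ge0.
exists (C * fine P); first exact: mulr_ge0.
move=> q h r q0 mh.
have mr : mfunT (fun w => `|(rho q w)%:E|)%E.
  by apply: measurableT_comp => //; apply/measurable_EFinP; exact: measurable_rho.
have mah : mfunT (fun w => `|(h w)%:E|)%E.
  by apply: measurableT_comp => //; apply/measurable_EFinP.
apply: (@le_trans _ _ (\int[leb]_(y in cube r) \int[leb]_x (`|(rho q (y - x))%:E| * `|(h x)%:E|))%E).
  apply: ge0_le_integral_lower => [//|y _].
  rewrite /moll /Rintegral (le_trans (abse_fine_le _))//.
  have mrh : mfunT (fun x => (rho q (y - x) * h x)%:E).
    apply/measurable_EFinP; apply: measurable_funM => //.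
    exact: (measurableT_comp (measurable_rho q) (measurable_rV_subc y)).
  rewrite (le_trans (le_abse_integral _ _ _))//.
  by apply: ge0_le_integral_lower => // x _; rewrite EFinM abseM.
apply: le_trans (ge0_conv_cube _ mr mah _ _ _) _ => //.
  by move=> w /(rho_out q0) ->; rewrite abse0.
apply: lee_wpmul2r; first exact: integral_ge0.
apply: (@le_trans _ _ (\int[leb]_w ((C * q ^- n)%:E * Psi (q^-1 *: w)%R))%E).
  by apply: ge0_le_integral_lower => // w _; exact: HC.
have mPs : mfunT (fun w : 'rV[R]_n => Psi (q^-1 *: w)).
  exact: (measurableT_comp (@measurable_Psi R n) (@measurable_rV_scale R n q^-1)).
have qn : 0 <= q ^- n by rewrite invr_ge0 exprn_ge0// ltW.
rewrite ge0_integralZl//; [|by move=> w _; exact: Psi_ge0|by rewrite lee_fin mulr_ge0].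
have := ge0_integral_scale (a := q^-1) _ (@measurable_Psi R n) (@Psi_ge0 R n).
rewrite invr_eq0 gt_eqF// => /(_ isT).
have -> : `|q^-1| = q^-1 by rewrite gtr0_norm// invr_gt0.
rewrite -/P [X in (_ <= X)%E]EFinM fineK// => <-.
by rewrite muleA -EFinM exprVn.
Qed.

Lemma moll_integrable q h : 0 < q -> integrableT leb h -> integrableT leb (moll q h).
Proof.
move=> q0 hI; have mh : mfunT h by exact: measurable_L1 hI.
have [C C0 HC] := @moll_modulus R n.
have mm := measurable_moll q mh.
have dI : integrableT leb (fun y => moll q h y - h y).
  apply/integrableP; split; first by apply/measurable_EFinP; exact: measurable_funB.
  have [C' C'0 HC'] := @rho_majorant R n.
  apply: le_lt_trans (HC q h q0 hI) _.
  rewrite lte_mul_pinfty//.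
  apply: le_lt_trans (modulus_le q mh) _.
  have /integrableP[_ hoo] := hI; have /integrableP[_ Poo] := @Psi_integrable R n.
  rewrite lte_mul_pinfty ?mule_ge0 ?integral_ge0//.
    by rewrite ge0_fin_numE ?mule_ge0 ?integral_ge0// lte_mul_pinfty.
  by move: Poo; under eq_integral do rewrite gee0_abs ?Psi_ge0//.
have := integrableD measurableT dI hI.
by congr (integrable _ _ _); apply/funext => y /=; rewrite -EFinD subrK.
Qed.

Lemma bounded_conv_integrable (k h : 'rV[R]_n -> R) (C : R) y : mfunT k -> (forall w, `|k w| <= C) ->
  integrableT leb h -> leb.-integrable setT (fun x => (k (y - x) * h x)%:E).
Proof.
move=> mk kC hI; apply: (bounded_integrable (k := fun x => k (y - x)) _ _ hI); last by move=> z; exact: kC.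
exact: (measurableT_comp mk (measurable_rV_subc y)).
Qed.

Lemma rho_conv_integrable q h y : 0 < q -> integrableT leb h ->
  leb.-integrable setT (fun x => (rho q (y - x) * h x)%:E).
Proof.
move=> q0 hI; have [C C0 HC] := @rho_bound R n.
by apply: (bounded_conv_integrable (k := rho q)) hI; [exact: measurable_rho|by move=> w; exact: HC].
Qed.

Lemma mollB q f h y : 0 < q -> integrableT leb f -> integrableT leb h ->
  moll q (fun x => f x - h x) y = moll q f y - moll q h y.
Proof.
move=> q0 fI hI; rewrite /moll -RintegralB//; try exact: rho_conv_integrable.
by apply: eq_Rintegral => x _; rewrite mulrBr.
Qed.

Lemma blockE q h y : 0 < q -> integrableT leb h ->
  block q h y = moll q h y - moll (2 * q) h y.
Proof.
move=> q0 hI; rewrite /moll -RintegralB//; try by apply: rho_conv_integrable => //; rewrite mulr_gt0.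
by apply: eq_Rintegral => x _; rewrite mulrBl.
Qed.

Lemma kernel_comp (a h : 'rV[R]_n -> R) (c : 'rV[R]_n * 'rV[R]_n -> R) (C : R) :
  mfunT c -> (forall z, `|c z| <= C) ->
  integrableT leb a -> integrableT leb h ->
  \int[leb]_x (a x * \int[leb]_z (c (x, z) * h z)) = \int[leb]_z (h z * \int[leb]_x (a x * c (x, z))).
Proof.
move=> mc cC aI hI.
have ma : mfunT a by exact: measurable_L1 aI.
have mh : mfunT h by exact: measurable_L1 hI.
pose F (z : 'rV[R]_n * 'rV[R]_n) := a z.1 * (c z * h z.2).
have FI : integrableT (leb \x leb)%E F.
  apply: (le_integrable_prod (a := fun x => C * `|a x|) (c := fun x => `|h x|)).
  - exact: (measurable_funM (measurableT_comp ma measurable_fst)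
      (measurable_funM mc (measurableT_comp mh measurable_snd))).
  - exact: (integrableZl measurableT C (integrable_norm aI)).
  - exact: integrable_norm hI.
  - move=> x z; rewrite /F /= !normrM mulrA ler_wpM2r// mulrC ler_wpM2r//.
transitivity (\int[leb]_x \int[leb]_z F (x, z)).
  apply: eq_Rintegral => x _; rewrite /F /= RintegralZl//.
  apply: (bounded_integrable (C := C) (k := fun z => c (x, z))) hI => [|z]; last exact: cC.
  exact: (measurableT_comp mc (pair1_measurable x)).
rewrite (@Rfubini _ _ _ _ _ leb leb F FI) /=.
apply: eq_Rintegral => z _; rewrite -RintegralZl//; last first.
  have := bounded_integrable (C := C) (k := fun x => c (x, z)) (measurableT_comp mc (pair2_measurable z)) _ aI.
  move=> /(_ (fun x => cC (x, z))); rewrite (_ : (fun x => _) = fun x => (a x * c (x, z))%:E)//.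
  by apply/funext => x; rewrite mulrC.
by apply: eq_Rintegral => x _; rewrite /F /= mulrA mulrC.
Qed.

(** Both compositions have kernels that are integrals over [x], and the reflection [x] to
    [y + z - x] exchanges them. *)
Lemma moll_comm q p h y : 0 < q -> 0 < p -> integrableT leb h ->
  moll q (moll p h) y = moll p (moll q h) y.
Proof.
move=> q0 p0 hI; have [C C0 HC] := @rho_bound R n.
have E u v : 0 < u -> 0 < v ->
    moll u (moll v h) y = \int[leb]_z (h z * \int[leb]_x (rho u (y - x) * rho v (x - z))).
  move=> u0 v0; have [rI _] := rho_integrable n u0.
  apply: (kernel_comp (a := fun x => rho u (y - x)) (c := fun z => rho v (z.1 - z.2)) (C := C * v ^- n)) hI.
  - exact: (measurableT_comp (measurable_rho v) (@measurable_rV_sub R n)).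
  - by move=> z; exact: HC.
  - have := integrable_leb_affine (a := -1) y _ rI; rewrite oppr_eq0 oner_eq0 => /(_ isT).
    have -> // : (fun x => (EFin \o rho u) (-1 *: x + y)) = EFin \o (fun x => rho u (y - x)).
    apply/funext => x; have -> : -1 *: x + y = y - x by rewrite scaleN1r addrC.
    by [].
rewrite (E q p q0 p0) (E p q p0 q0); apply: eq_Rintegral => z _.
pose F1 x := rho p (y - x) * rho q (x - z); pose F2 x := rho q (y - x) * rho p (x - z).
have m1 : mfunT F1.
  apply: measurable_funM; first exact: (measurableT_comp (measurable_rho p) (measurable_rV_subc y)).
  exact: (measurableT_comp (measurable_rho q) (measurable_rV_shift (- z))).
have E2 : F2 = fun x => F1 (y + z - x).
  apply/funext => x; rewrite /F1 /F2.
  have -> : y + z - x - z = y - x by apply/rowP => i; rewrite !mxE; ring.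
  have -> : y - (y + z - x) = x - z by apply/rowP => i; rewrite !mxE; ring.
  exact: mulrC.
have K : \int[leb]_x F2 x = \int[leb]_x F1 x by rewrite E2; exact: Rintegral_reflect.
exact: (congr1 (fun u => h z * u) K).
Qed.

End convolution.

Lemma le_RintegralB d (T : measurableType d) (R : realType) (m : {measure set T -> \bar R}) (a c g : T -> R) (K : R) :
  integrableT m a -> integrableT m c -> integrableT m g ->
  (forall x, `|a x - c x| <= K * g x) -> `|\int[m]_x a x - \int[m]_x c x| <= K * \int[m]_x g x.
Proof.
move=> aI cI gI h; rewrite -RintegralB// -RintegralZl//.
have dI := integrableB measurableT aI cI.
apply: (le_trans (le_normr_Rintegral measurableT dI)).
apply: le_Rintegral => //; first exact: integrable_norm dI.
exact: (integrableZl measurableT K gI).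
Qed.

#[local] Opaque rho moll block.

(** * A Lipschitz-type inequality at dyadic scales *)

Section lipschitz.
Variables (R : realType) (n : nat).
Local Notation leb := (@lebesgue_rV R n).
Implicit Types (h f : 'rV[R]_n -> R) (q r p : R) (x y z w : 'rV[R]_n).

Local Notation L1on A h := (\int[leb]_(y in A) `|(h y)%:E|)%E.

Definition dist1 y z := \sum_(i < n) `|y ord0 i - z ord0 i|.

Lemma dist1_ge0 y z : 0 <= dist1 y z.
Proof. exact: sumr_ge0. Qed.

Lemma coord_le_dist1 y z i : `|y ord0 i - z ord0 i| <= dist1 y z.
Proof. by rewrite /dist1 (bigD1 i)//= lerDl; apply: sumr_ge0. Qed.

(** An unnormalised local average at a single scale. Tonelli bounds its local L^1 norm by that of
    [f], an estimate in L^1 that a supremum over all scales would not satisfy. *)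
Definition mass p f y := \int[leb]_x (\1_(cube p) (y - x) * `|f x|).

Lemma measurable_indic_cube p : mfunT (\1_(cube p) : 'rV[R]_n -> R).
Proof. by apply: measurable_indic; exact: measurable_cube. Qed.

Lemma mass_integrable p f y : integrableT leb f ->
  leb.-integrable setT (fun x => (\1_(cube p) (y - x) * `|f x|)%:E).
Proof.
move=> fI; apply: (bounded_conv_integrable (k := \1_(cube p)) (C := 1)).
- exact: measurable_indic_cube.
- by move=> w; rewrite indicE; case: (_ \in _); rewrite ?normr1// normr0.
- exact: integrable_norm fI.
Qed.

Lemma mass_ge0 p f y : 0 <= mass p f y.
Proof. by apply: Rintegral_ge0 => x _; rewrite mulr_ge0// indicE. Qed.

Lemma measurable_mass p f : mfunT f -> mfunT (mass p f).
Proof.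
move=> mf; apply: (measurable_Rintegral leb (f := fun z : 'rV[R]_n * 'rV[R]_n => \1_(cube p) (z.1 - z.2) * `|f z.2|)).
apply: measurable_funM; first exact: (measurableT_comp (measurable_indic_cube p) (@measurable_rV_sub R n)).
exact: (measurableT_comp (measurableT_comp (@normr_measurable R setT) mf) measurable_snd).
Qed.

Lemma mass_L1on p f r : 0 <= p -> integrableT leb f ->
  (\int[leb]_(y in cube r) (mass p f y)%:E <= ((2 * p) ^+ n)%:E * L1on (cube (r + p)) f)%E.
Proof.
move=> p0 fI; have mf : mfunT f by exact: measurable_L1 fI.
rewrite -(lebesgue_cube n p0).
have mi : mfunT (fun w : 'rV[R]_n => (\1_(cube p) w)%:E : \bar R).
  by apply/measurable_EFinP; exact: measurable_indic_cube.
have -> : leb (cube p) = (\int[leb]_w (\1_(cube p) w)%:E)%E.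
  by rewrite integral_indic//= ?setIT//; exact: measurable_cube.
have mah : mfunT (fun w => `|(f w)%:E|)%E.
  by apply: measurableT_comp => //; apply/measurable_EFinP.
apply: le_trans (ge0_conv_cube r mi mah _ _ _).
- rewrite le_eqVlt; apply/orP; left; apply/eqP; apply: eq_integral => y _.
  rewrite /mass /Rintegral fineK; last exact: integrable_fin_num (mass_integrable p y fI).
  by apply: eq_integral => x _; rewrite EFinM.
- by move=> w; rewrite lee_fin indicE.
- by move=> w.
- by move=> w pw; rewrite indicE memNset.
Qed.

(** The cube of radius [p] around [y] contains the supports of both translated mollifiers, so the
    mass around [y] alone controls the increment. *)
Lemma moll_lip : exists2 C : R, 0 <= C & forall q p f y z, 0 < q ->
  integrableT leb f -> dist1 y z + q <= p ->
  `|moll q f y - moll q f z| <= C * q ^- n.+1 * dist1 y z * mass p f y.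
Proof.
have [C C0 HC] := @rho_lip R n; exists C => // q p f y z q0 fI pq.
apply: (le_RintegralB (rho_conv_integrable y q0 fI) (rho_conv_integrable z q0 fI) (mass_integrable p y fI)) => x.
rewrite -mulrBl normrM mulrA ler_wpM2r//.
have d0 : 0 <= C * q ^- n.+1 * dist1 y z.
  by rewrite mulr_ge0 ?dist1_ge0// mulr_ge0// invr_ge0 exprn_ge0// ltW.
rewrite indicE; case: (boolP (_ \in _)) => [_|]; rewrite ?mulr1.
  rewrite (le_trans (HC q _ _ q0))// ler_wpM2l//; last first.
    by apply: ler_sum => i _; rewrite !mxE opprB addrA subrK.
  by rewrite mulr_ge0// invr_ge0 exprn_ge0// ltW.
rewrite notin_setE mulr0 => yx.
have ry : rho q (y - x) = 0.
  apply: rho_out => // h; apply: yx; apply: cube_mono h; have := dist1_ge0 y z; lra.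
have rz : rho q (z - x) = 0.
  apply: rho_out => // h; apply: yx => i; have := h i; have := coord_le_dist1 y z i.
  rewrite !mxE => h1 h2.
  have -> : y ord0 i - x ord0 i = (y ord0 i - z ord0 i) + (z ord0 i - x ord0 i) by ring.
  by rewrite (le_trans (ler_normD _ _))// (le_trans _ pq)// lerD.
by rewrite ry rz subrr normr0.
Qed.

(** Two mollifications, because the difference between the scales q and 2q is then (rho_q + rho_2q)
    convolved with the block. This is Lipschitz with a constant proportional to the local mass of
    the block, whereas the block itself comes with no such estimate. *)
Definition moll2 q h := moll q (moll q h).

Lemma pow2V_gt0 k : 0 < 2 ^- k :> R.
Proof. by rewrite invr_gt0 exprn_gt0. Qed.

Lemma pow2VS k : 2 * 2 ^- k.+1 = 2 ^- k :> R.
Proof. by rewrite exprS invfM mulrA divff ?mul1r. Qed.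

Lemma block_fun q h : 0 < q -> integrableT leb h ->
  block q h = fun y => moll q h y - moll (2 * q) h y.
Proof. by move=> q0 hI; apply/funext => y; exact: blockE. Qed.

Lemma block_integrable q h : 0 < q -> integrableT leb h ->
  integrableT leb (block q h).
Proof.
move=> q0 hI; rewrite block_fun//.
have q20 : 0 < 2 * q by rewrite mulr_gt0.
exact: (integrableB measurableT (moll_integrable q0 hI) (moll_integrable q20 hI)).
Qed.

(** The difference of two squares, for commuting operators. *)
Lemma moll2B q p h y : 0 < q -> 0 < p -> integrableT leb h ->
  moll2 q h y = moll2 p h y +
    (moll q (fun x => moll q h x - moll p h x) y + moll p (fun x => moll q h x - moll p h x) y).
Proof.
move=> q0 p0 hI.
have I1 := moll_integrable q0 hI; have I2 := moll_integrable p0 hI.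
have arith (a c x u z w : R) : a = x - u -> c = z - w -> z = u -> x = w + (a + c).
  by move=> -> -> ->; ring.
exact: (arith _ _ _ _ _ _ (mollB y q0 I1 I2) (mollB y p0 I1 I2) (moll_comm y p0 q0 hI)).
Qed.

Lemma moll2_half q h y : 0 < q -> integrableT leb h ->
  moll2 q h y = moll2 (2 * q) h y + (moll q (block q h) y + moll (2 * q) (block q h) y).
Proof.
move=> q0 hI; have q20 : 0 < 2 * q by rewrite mulr_gt0.
by rewrite (block_fun q0 hI); exact: moll2B.
Qed.

(** Up to a constant, a Lipschitz constant near [y] for [moll2] at scale 2^-m. In the factor with
    exponent [n.+1], the power [n] normalises the average and the last one is the cost of a
    derivative. *)
Definition mass_sum m h y := mass 2 (moll 1 h) y +
  \sum_(l < m) (2 ^- l.+1) ^- n.+1 * mass (4 * 2 ^- l.+1) (block (2 ^- l.+1) h) y.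

Lemma mass_term_ge0 q p h y : 0 < q -> 0 <= q ^- n.+1 * mass p h y.
Proof. by move=> q0; rewrite mulr_ge0 ?mass_ge0// invr_ge0 exprn_ge0// ltW. Qed.

Lemma mass_sum_ge0 m h y : 0 <= mass_sum m h y.
Proof.
by rewrite addr_ge0 ?mass_ge0// sumr_ge0// => l _; exact: mass_term_ge0 (pow2V_gt0 _).
Qed.

Lemma le_mass_sum k m h y : (k <= m)%N -> mass_sum k h y <= mass_sum m h y.
Proof.
move=> km; rewrite lerD2l -(subnKC km) big_split_ord/= lerDl sumr_ge0// => l _.
exact: mass_term_ge0 (pow2V_gt0 _).
Qed.

Lemma moll2_lip_step (C q : R) h y z (M D : R) : 0 <= C -> 0 < q ->
  (forall q p f, 0 < q -> integrableT leb f -> dist1 y z + q <= p ->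
    `|moll q f y - moll q f z| <= C * q ^- n.+1 * dist1 y z * mass p f y) ->
  integrableT leb h -> dist1 y z <= q ->
  `|moll2 (2 * q) h y - moll2 (2 * q) h z| <= 2 * C * dist1 y z * M ->
  `|moll2 q h y - moll2 q h z| <= 2 * C * dist1 y z * (M + q ^- n.+1 * mass (4 * q) (block q h) y).
Proof.
move=> C0 q0 HC hI Dq IH; have D0 := dist1_ge0 y z.
have bI := block_integrable q0 hI; have q20 : 0 < 2 * q by rewrite mulr_gt0.
have q2 : q <= 2 * q by lra.
have pq : dist1 y z + 2 * q <= 4 * q by lra.
have pq' : dist1 y z + q <= 4 * q by lra.
have L1 := HC _ _ _ q0 bI pq'; have L2 := HC _ _ _ q20 bI pq.
rewrite (moll2_half y q0 hI) (moll2_half z q0 hI).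
have M0 := mass_ge0 (4 * q) (block q h) y.
have {}L2 : `|moll (2 * q) (block q h) y - moll (2 * q) (block q h) z| <=
    C * q ^- n.+1 * dist1 y z * mass (4 * q) (block q h) y.
  apply: (le_trans L2); rewrite ler_wpM2r// ler_wpM2r// ler_wpM2l// lef_pV2 ?posrE ?exprn_gt0//.
  by apply: lerXn2r => //; rewrite nnegrE ltW.
move: (moll2 _ _ y) (moll2 _ _ z) (moll q _ y) (moll q _ z) (moll (2 * q) _ y) (moll (2 * q) _ z) IH L1 L2.
move: (mass _ _ _) (q ^- _) (dist1 y z) => W Q D' a b c d e f IH L1 L2.
have -> : a + (c + e) - (b + (d + f)) = (a - b) + ((c - d) + (e - f)) by ring.
rewrite (le_trans (ler_normD _ _))// mulrDr lerD// (le_trans (ler_normD _ _))//.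
rewrite (le_trans (lerD L1 L2))//.
by rewrite le_eqVlt; apply/orP; left; apply/eqP; ring.
Qed.

(** From scale 1 downwards, each halving adds the increments of one block mollified at two scales,
    whence the factor 2 in the constant. The condition on [dist1] at the finest scale implies those
    at all the coarser ones. *)
Lemma moll2_lip : exists2 C : R, 0 <= C & forall k h y z,
  integrableT leb h -> dist1 y z <= 2 ^- k ->
  `|moll2 (2 ^- k) h y - moll2 (2 ^- k) h z| <= C * dist1 y z * mass_sum k h y.
Proof.
have [C C0 HC] := moll_lip; exists (2 * C); first exact: mulr_ge0.
move=> k h y z hI; have D0 := dist1_ge0 y z.
elim: k => [|k IH] Dk.
  rewrite expr0 invr1 in Dk *; rewrite /moll2 /mass_sum big_ord0 addr0.
  have D2 : dist1 y z + 1 <= 2 by lra.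
  apply: le_trans (HC 1 2 (moll 1 h) y z ltr01 (moll_integrable ltr01 hI) D2) _.
  rewrite expr1n invr1 mulr1 ler_wpM2r ?mass_ge0// ler_wpM2r// ler_peMl// ler1n//.
rewrite /mass_sum big_ord_recr/= addrA.
have q0 := pow2V_gt0 k.+1; rewrite -pow2VS in IH.
apply: moll2_lip_step => //; first by move=> q p f; exact: HC.
apply: IH; apply: (le_trans Dk); rewrite ler_peMl ?ler1n// ltW//.
Qed.

(** The weight [2 ^+ k] makes the error of [moll2] at scale 2^-k at most 2^-k times the defect, for
    every [k <= m] at once. A sum takes the place of a maximum so that it can be integrated term by
    term. *)
Definition defect m h y := \sum_(k < m.+1) 2 ^+ k * `|h y - moll2 (2 ^- k) h y|.

Lemma defect_ge0 m h y : 0 <= defect m h y.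
Proof. by apply: sumr_ge0 => k _; rewrite mulr_ge0// exprn_ge0. Qed.

(** Selects the scale at which two points at distance [D] are compared: not smaller than [D], and
    comparable to [D] unless [D] is below the finest scale 2^-m. *)
Lemma dyadic_scale m (D : R) : 0 <= D <= 1 -> exists2 k : nat, (k <= m)%N &
  D <= 2 ^- k /\ 2 ^- k <= 2 * (2 ^- m + D).
Proof.
move=> /andP[D0 D1]; have q0 := pow2V_gt0 m.
suff [k km [Dk kD]] : exists2 k : nat, (k <= m)%N & D <= 2 ^- k /\ (k = m \/ 2 ^- k <= 2 * D).
  by exists k => //; split => //; case: kD => [->|]; lra.
elim: m {q0} => [|m [k km [Dk kD]]]; first by exists 0%N; rewrite // expr0 invr1; split; [lra|left].
have q2 := pow2VS m.
have [Dm|Dm] := leP D (2 ^- m.+1); first by exists m.+1 => //; split => //; left.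
have [Dm'|Dm'] := leP D (2 ^- m); first by exists m => //; split => //; right; lra.
exists k; first exact: leq_trans km _.
by split=> //; case: kD => [E|]; [move: Dk; rewrite E; lra|right].
Qed.

Lemma le_defect k m h y : (k <= m)%N -> `|h y - moll2 (2 ^- k) h y| <= 2 ^- k * defect m h y.
Proof.
move=> km; rewrite -(@ler_pM2l _ (2 ^+ k)) ?exprn_gt0// mulVKf ?expf_neq0//.
have k' : (k < m.+1)%N by [].
by rewrite /defect (bigD1 (Ordinal k'))//= lerDl; apply: sumr_ge0 => j _; rewrite mulr_ge0// exprn_ge0.
Qed.

Lemma key_ineq_arith (a c a' c' D d q Y Z S : R) : 0 <= D -> 0 < d -> 0 <= Y -> 0 <= Z -> 0 <= S ->
  q <= 2 * (d + D) -> `|a - a'| <= q * Y -> `|c - c'| <= q * Z -> `|a' - c'| <= D * S ->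
  `|a - c| <= (d + D) * (`|a| + `|c| + 2 * (Y + Z) + S).
Proof.
move=> D0 d0 Y0 Z0 S0 qd h1 h2 h3.
have -> : a - c = (a - a') + (a' - c') - (c - c') by ring.
rewrite (le_trans (ler_normB _ _))// (le_trans (lerD (ler_normD _ _) h2))//.
rewrite (le_trans (lerD (lerD h1 h3) (lexx _)))//.
have s1 : D * S <= (d + D) * S by rewrite ler_wpM2r// lerDr ltW.
have s2 : q * (Y + Z) <= 2 * (d + D) * (Y + Z) by rewrite ler_wpM2r// addr_ge0.
have s3 : 0 <= (d + D) * (`|a| + `|c|) by rewrite mulr_ge0// addr_ge0// ltW.
lra.
Qed.

(** At the scale given by [dyadic_scale], [h] is compared with [moll2] at both points, and [moll2]
    at one point with [moll2] at the other. For points at distance more than 1 the triangle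
    inequality is enough, which is why [|h|] enters the weight. *)
Lemma key_ineq : exists2 C : R, 0 <= C & forall m h y z, integrableT leb h ->
  `|h y - h z| <= (2 ^- m + dist1 y z) *
    (`|h y| + `|h z| + 2 * (defect m h y + defect m h z) + C * mass_sum m h y).
Proof.
have [C C0 HC] := moll2_lip; exists C => // m h y z hI.
have D0 := dist1_ge0 y z.
have Hy := defect_ge0 m h y; have Hz := defect_ge0 m h z; have qm := pow2V_gt0 m.
have S0 : 0 <= C * mass_sum m h y by rewrite mulr_ge0 ?mass_sum_ge0.
have [D1|D1] := ltP 1 (dist1 y z).
  rewrite (le_trans (ler_normB _ _))// -[leLHS]mul1r; apply: ler_pM => //.
  - by rewrite (le_trans (ltW D1))// lerDr ltW.
  - by rewrite -addrA lerDl addr_ge0// mulr_ge0// addr_ge0.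
have D01 : 0 <= dist1 y z <= 1 by rewrite D0.
have [k km [Dk kD]] := dyadic_scale m D01.
apply: (key_ineq_arith D0 qm Hy Hz S0 kD (le_defect h y km) (le_defect h z km)).
apply: (le_trans (HC k h y z hI Dk)); rewrite [C * _]mulrC -mulrA ler_wpM2l// ler_wpM2l//.
exact: le_mass_sum.
Qed.

End lipschitz.

(** * Integrals of the weight at a fixed time *)

Section weight.
Variables (R : realType) (n : nat).
Local Notation leb := (@lebesgue_rV R n).
Implicit Types (h f : 'rV[R]_n -> R) (q r p : R) (x y z w : 'rV[R]_n).

Local Notation L1on A h := (\int[leb]_(y in A) `|(h y)%:E|)%E.

Definition weight (C : R) m h y := `|h y| + 2 * defect m h y + C * mass_sum m h y.

Lemma L1on_le (A B : set 'rV[R]_n) h : measurable A -> measurable B -> mfunT h ->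
  A `<=` B -> (L1on A h <= L1on B h)%E.
Proof.
move=> mA mB mh AB; apply: ge0_subset_integral => //.
by apply: measurable_funTS; apply: measurableT_comp => //; apply/measurable_EFinP.
Qed.

Lemma L1on_D (A : set 'rV[R]_n) (f g h : 'rV[R]_n -> R) : measurable A -> mfunT f -> mfunT g ->
  mfunT h -> (forall y, `|h y| <= `|f y| + `|g y|) -> (L1on A h <= L1on A f + L1on A g)%E.
Proof.
move=> mA mf mg mh H.
have ma k : mfunT k -> measurable_fun A (fun y : 'rV[R]_n => `|(k y : R)%:E|)%E.
  by move=> mk; apply: measurable_funTS; apply: measurableT_comp => //; apply/measurable_EFinP.
rewrite -ge0_integralD//; [|exact: ma|exact: ma].
by apply: ge0_le_integral_lower => // y _; rewrite /= -EFinD lee_fin.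
Qed.

Lemma L1onZ (A : set 'rV[R]_n) (c : R) (f : 'rV[R]_n -> R) : measurable A -> 0 <= c -> mfunT f ->
  (L1on A (fun y => c * f y)%R = c%:E * L1on A f)%E.
Proof.
move=> mA c0 mf; rewrite -ge0_integralZl//.
  by apply: eq_integral => y _ /=; rewrite normrM (ger0_norm c0) EFinM.
by apply: measurable_funTS; apply: measurableT_comp => //; apply/measurable_EFinP.
Qed.

Lemma measurable_mollB q h : mfunT h -> mfunT (fun y => h y - moll q h y).
Proof. by move=> mh; apply: measurable_funB => //; exact: measurable_moll. Qed.

Lemma measurable_moll2B q h : mfunT h -> mfunT (fun y => h y - moll2 q h y).
Proof. by move=> mh; apply: measurable_funB => //; do 2!apply: measurable_moll. Qed.

(** [h - moll2 q h] is [h - moll q h] plus its own mollification, so twofold mollification costs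
    only a constant and a slightly larger cube. *)
Lemma moll2_L1on : exists2 C : R, 0 <= C & forall q h r, 0 < q <= 1 -> integrableT leb h ->
  (L1on (cube r) (fun y => h y - moll2 q h y) <= C%:E * L1on (cube (r + 1)) (fun y => h y - moll q h y))%E.
Proof.
have [C C0 HC] := @moll_L1on R n; exists (1 + C); first by rewrite addr_ge0.
move=> q h r /andP[q0 q1] hI; have mh : mfunT h by exact: measurable_L1 hI.
have mI := moll_integrable q0 hI; have mm := measurable_moll q mh; have mmm := measurable_moll q mm.
have mB : mfunT (fun y => h y - moll q h y) by exact: measurable_funB.
have cr s : measurable (@cube R n s) by exact: measurable_cube.
apply: (@le_trans _ _ (L1on (cube r) (fun y => h y - moll q h y) + L1on (cube r) (moll q (fun y => h y - moll q h y)))%E).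
  apply: L1on_D => //; [exact: measurable_moll|exact: measurable_funB|].
  move=> y; rewrite (mollB y q0 hI mI) /moll2.
  by rewrite -[X in `|X| <= _](subrKA (moll q h y)) ler_normD.
rewrite EFinD ge0_muleDl// mul1e leeD//.
  by apply: L1on_le => //; apply: cube_mono; lra.
apply: (le_trans (HC q _ r q0 mB)); apply: lee_wpmul2l; first by rewrite lee_fin.
by apply: L1on_le => //; apply: cube_mono; lra.
Qed.

Lemma measurable_defect m h : mfunT h -> mfunT (defect m h).
Proof.
move=> mh; apply: measurable_sum => k; apply: measurable_funM => //.
apply: (measurableT_comp (@normr_measurable R setT)); apply: measurable_funB => //.
by do 2!apply: measurable_moll.
Qed.

Lemma measurable_block1 q h : mfunT h -> mfunT (block q h).
Proof.
move=> mh; apply: (measurable_Rintegral leb (f := fun z : 'rV[R]_n * 'rV[R]_n => (rho q (z.1 - z.2) - rho (2 * q) (z.1 - z.2)) * h z.2)).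
apply: measurable_funM; last exact: (measurableT_comp mh measurable_snd).
by apply: measurable_funB; exact: (measurableT_comp (measurable_rho _) (@measurable_rV_sub R n)).
Qed.

(** The powers of the scale q = 2^-l balance: integrating the mass over a cube of radius 4q gives
    (8q)^n, and [q ^- n.+1] times this is 8^n / q. Every scale is thus counted with 2^l times the
    L^1 norm of its block, the quantity that tends to zero. *)
Lemma weight_integral (C : R) : 0 <= C -> exists2 K : R, 0 <= K & forall m h r, 0 <= r ->
  integrableT leb h ->
  (\int[leb]_(y in cube r) (weight C m h y)%:E <= K%:E * (L1n h +
    \sum_(k < m.+1) (L1on (cube (r + 1)) (fun y => 2 ^+ k * (h y - moll (2 ^- k) h y))%R +
      L1on (cube (r + 4)) (fun y => (2 ^- k)^-1 * block (2 ^- k) h y)%R)))%E.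
Proof.
move=> C0; have [C1 C10 HC1] := moll2_L1on; have [C2 C20 HC2] := @moll_L1on R n.
exists (1 + 2 * C1 + C * (4 ^+ n * C2 + 8 ^+ n)).
  by rewrite !addr_ge0 ?mulr_ge0 ?addr_ge0 ?mulr_ge0 ?exprn_ge0.
move=> m h r r0 hI; have mh : mfunT h by exact: measurable_L1 hI.
have mA : measurable (@cube R n r) by exact: measurable_cube.
have cr s : measurable (@cube R n s) by exact: measurable_cube.
pose P k := L1on (cube (r + 1)) (fun y => 2 ^+ k * (h y - moll (2 ^- k) h y)).
pose Q k := L1on (cube (r + 4)) (fun y => (2 ^- k)^-1 * block (2 ^- k) h y).
have P0 k : (0 <= P k)%E by exact: integral_ge0.
have Q0 k : (0 <= Q k)%E by exact: integral_ge0.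
rewrite -/(P _) -/(Q _); pose S := (\sum_(k < m.+1) (P k + Q k))%E.
have L0 : (0 <= L1n h)%E by exact: integral_ge0.
have S0 : (0 <= S)%E by apply: sume_ge0 => k _; exact: adde_ge0.
rewrite -/S; pose X := (L1n h + S)%E.
have X0 : (0 <= X)%E by exact: adde_ge0.
have LX : (L1n h <= X)%E by rewrite leeDl.
have PX : (\sum_(k < m.+1) P k <= X)%E.
  by apply: (@le_trans _ _ S); [apply: lee_sum => k _; rewrite leeDl|rewrite leeDr].
have QX : (\sum_(l < m) Q l.+1 <= X)%E.
  apply: (@le_trans _ _ S); last by rewrite leeDr.
  apply: (@le_trans _ _ (\sum_(k < m.+1) Q k)%E); first by rewrite big_ord_recl/= leeDr.
  by apply: lee_sum => k _; rewrite leeDr.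
have mfa (f : 'rV[R]_n -> R) : mfunT f -> measurable_fun (cube r) (fun y => (f y)%:E).
  by move=> mf; apply: measurable_funTS; apply/measurable_EFinP.
have m1 : mfunT (fun y => `|h y|) by exact: (measurableT_comp (@normr_measurable R setT) mh).
have m2 := measurable_defect m mh.
have mm1 := measurable_moll 1 mh.
have m3 := measurable_mass 2 mm1.
have m4 l := measurable_mass (4 * 2 ^- l.+1) (measurable_block1 (2 ^- l.+1) mh).
have m5 : mfunT (fun y => \sum_(l < m) (2 ^- l.+1) ^- n.+1 * mass (4 * 2 ^- l.+1) (block (2 ^- l.+1) h) y).
  by apply: measurable_sum => l; exact: (measurable_funM (measurable_cst _) (m4 l)).
have m6 : mfunT (mass_sum m h) by exact: measurable_funD m3 m5.
have q0 k : 0 < 2 ^- k :> R := pow2V_gt0 R k.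
have q1 k : 2 ^- k <= 1 :> R by rewrite invf_le1 ?exprn_gt0// exprn_ege1// ler1n.
have s0 y : 0 <= \sum_(l < m) (2 ^- l.+1) ^- n.+1 * mass (4 * 2 ^- l.+1) (block (2 ^- l.+1) h) y.
  by apply: sumr_ge0 => l _; exact: mass_term_ge0.
have -> : (\int[leb]_(y in cube r) (weight C m h y)%:E = \int[leb]_(y in cube r) `|(h y)%:E| +
    2%:E * \int[leb]_(y in cube r) (defect m h y)%:E + C%:E * \int[leb]_(y in cube r) (mass_sum m h y)%:E)%E.
  rewrite -ge0_integralZl//; [|exact: mfa|by move=> y _; rewrite lee_fin defect_ge0].
  rewrite -ge0_integralD//; [|exact: mfa|by move=> y _; rewrite -EFinM lee_fin mulr_ge0 ?defect_ge0|by apply: measurable_funeM; exact: mfa].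
  rewrite -ge0_integralZl//; [|exact: mfa|by move=> y _; rewrite lee_fin mass_sum_ge0].
  rewrite -ge0_integralD//.
  - by move=> y _; rewrite -EFinM -EFinD lee_fin addr_ge0 ?mulr_ge0 ?defect_ge0.
  - by apply: emeasurable_funD; [exact: mfa|apply: measurable_funeM; exact: mfa].
  - by move=> y _; rewrite -EFinM lee_fin mulr_ge0 ?mass_sum_ge0.
  - by apply: measurable_funeM; exact: mfa.
have B1 : (\int[leb]_(y in cube r) `|(h y)%:E| <= 1%:E * X)%E.
  rewrite mul1e (le_trans _ LX)//; apply: ge0_subset_integral => //.
  by apply: measurableT_comp => //; apply/measurable_EFinP.
have B2 : (2%:E * \int[leb]_(y in cube r) (defect m h y)%:E <= (2 * C1)%:E * X)%E.
  rewrite EFinM -muleA lee_wpmul2l// /defect.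
  under eq_integral do rewrite -sumEFin.
  rewrite ge0_integral_sum//; last first.
    move=> k; apply: mfa; apply: measurable_funM => //.
    apply: (measurableT_comp (@normr_measurable R setT)); apply: measurable_funB => //.
    by do 2!apply: measurable_moll.
  apply: (@le_trans _ _ (C1%:E * \sum_(k < m.+1) P k)%E); last by rewrite lee_wpmul2l ?lee_fin.
  rewrite ge0_sume_distrr//; apply: lee_sum => k _.
  under eq_integral do rewrite EFinM.
  have mk := measurable_mollB (2 ^- k) mh; have mk2 := measurable_moll2B (2 ^- k) mh.
  have p0 : 0 <= 2 ^+ k :> R by exact: exprn_ge0.
  rewrite /P (L1onZ (cr _) p0 mk).
  rewrite ge0_integralZl//; last exact: (mfa _ (measurableT_comp (@normr_measurable R setT) mk2)).
  rewrite muleCA lee_wpmul2l ?lee_fin ?exprn_ge0//; apply: HC1 => //.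
  by rewrite q0 q1.
have B3 : (\int[leb]_(y in cube r) (mass_sum m h y)%:E <= (4 ^+ n * C2)%:E * X + (8 ^+ n)%:E * X)%E.
  under eq_integral do rewrite EFinD.
  rewrite ge0_integralD//; [|by move=> y _; rewrite lee_fin mass_ge0|exact: mfa|by move=> y _; rewrite lee_fin|exact: mfa].
  apply: leeD.
    have t0 : 0 <= 2 :> R by [].
    apply: (le_trans (mass_L1on r t0 (moll_integrable ltr01 hI))).
    have -> : (2 * 2 = 4 :> R) by ring.
    rewrite EFinM -muleA lee_wpmul2l ?lee_fin ?exprn_ge0//.
    apply: (le_trans (HC2 1 h _ ltr01 mh)); rewrite lee_wpmul2l ?lee_fin// (le_trans _ LX)//.
    apply: ge0_subset_integral => //.
    by apply: measurableT_comp => //; apply/measurable_EFinP.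
  under eq_integral do rewrite -sumEFin.
  rewrite ge0_integral_sum//; last 2 first.
  - by move=> l; apply: (mfa _ (measurable_funM (measurable_cst _) (m4 l))).
  - by move=> l y _; rewrite lee_fin; exact: mass_term_ge0.
  apply: (@le_trans _ _ ((8 ^+ n)%:E * \sum_(l < m) Q l.+1)%E); last by rewrite lee_wpmul2l ?lee_fin ?exprn_ge0.
  rewrite ge0_sume_distrr//; apply: lee_sum => l _.
  under eq_integral do rewrite EFinM.
  rewrite ge0_integralZl//; last 2 first.
  - by apply: mfa; exact: m4.
  - by move=> y _; rewrite lee_fin mass_ge0.
  have p0 : 0 <= 4 * 2 ^- l.+1 :> R by rewrite mulr_ge0// ltW.
  have bI := block_integrable (q0 l.+1) hI.
  have mb := measurable_block1 (2 ^- l.+1) mh.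
  have M1 := mass_L1on r p0 bI.
  have M2 : (L1on (cube (r + 4 * 2 ^- l.+1)) (block (2 ^- l.+1) h) <= L1on (cube (r + 4)) (block (2 ^- l.+1) h))%E.
    apply: L1on_le => //; apply: cube_mono; rewrite lerD2l -[leRHS]mulr1 ler_wpM2l//.
  have -> : Q l.+1 = (((2 ^- l.+1)^-1)%:E * L1on (cube (r + 4)) (block (2 ^- l.+1) h))%E.
    by rewrite /Q (L1onZ (cr _) _ mb)// invr_ge0 ltW.
  apply: (@le_trans _ _ (((2 ^- l.+1) ^- n.+1)%:E * (((2 * (4 * 2 ^- l.+1)) ^+ n)%:E * L1on (cube (r + 4)) (block (2 ^- l.+1) h)))%E).
    rewrite lee_wpmul2l ?lee_fin ?invr_ge0 ?exprn_ge0 ?(ltW (q0 _))//.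
    by apply: (le_trans M1); rewrite lee_wpmul2l// lee_fin exprn_ge0// mulr_ge0.
  rewrite !muleA -!EFinM le_eqVlt; apply/orP; left; apply/eqP; congr ((_)%:E * _)%E.
  have := q0 l.+1; move: (2 ^- l.+1) => q /gt_eqF/negbT qn.
  have -> : 2 * (4 * q) = 8 * q by ring.
  by rewrite exprMn exprS invfM mulrA [_ * 8 ^+ n]mulrC -!mulrA; congr (_ * _); rewrite mulVf ?mulr1// expf_neq0.
have -> : ((1 + 2 * C1 + C * (4 ^+ n * C2 + 8 ^+ n))%:E * X =
    1%:E * X + (2 * C1)%:E * X + C%:E * ((4 ^+ n * C2)%:E * X + (8 ^+ n)%:E * X))%E.
  have c1 : 0 <= 2 * C1 by rewrite mulr_ge0.
  have c2 : 0 <= 4 ^+ n * C2 by rewrite mulr_ge0 ?exprn_ge0.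
  have c3 : 0 <= 8 ^+ n :> R by rewrite exprn_ge0.
  have mD a c : 0 <= a -> 0 <= c -> ((a + c)%:E * X = a%:E * X + c%:E * X)%E.
    by move=> a0 c0; rewrite EFinD ge0_muleDl.
  by rewrite mD ?addr_ge0 ?mulr_ge0 ?addr_ge0// mD// [(C * _)%:E]EFinM -muleA mD.
by rewrite leeD ?leeD// lee_wpmul2l ?lee_fin.
Qed.

End weight.

(** * Integrals of the weight over time *)

Section weight_time.
Variables (R : realType) (n : nat) (T : R).
Local Notation leb := (@lebesgue_rV R n).
Variable h : spacetime R n -> R.
Hypothesis hI : integrableT leb2 h.
Local Notation L1on A h := (\int[leb]_(y in A) `|(h y)%:E|)%E.
Local Notation tint f := (\int[mu]_(s in `]0%R, T[) f s)%E.

Let mh : mfunT h.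
Proof. by exact: measurable_L1 hI. Qed.

Lemma measurable_L1on_time (f : spacetime R n -> R) (A : set 'rV[R]_n) : measurable A ->
  mfunT f -> mfunT (fun s => L1on A (fun y => f (s, y))).
Proof.
move=> mA mf.
have mF : mfunT ((fun z => `|(f z)%:E|) \_ (setT `*` A))%E.
  by apply: measurable_patch; [exact: measurableX|apply: measurableT_comp => //; apply/measurable_EFinP].
have := ge0_measurable_integral leb mF; move=> /(_ _)/wrap[z|].
  by rewrite patchE; case: ifP.
congr (measurable_fun _ _); apply/funext => s; rewrite [RHS]integral_mkcond; apply: eq_integral => y _.
rewrite !patchE; congr (if _ then _ else _); apply/idP/idP; rewrite !inE; first by case.
by [].
Qed.

Section joint.
Variable f : spacetime R n -> R.
Hypothesis mf : mfunT f.

Let TV := ((spacetime R n) * 'rV[R]_n)%type.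

Let mdiff : mfunT (fun z : TV => (z.1.2 - z.2 : 'rV[R]_n)).
Proof.
apply: (measurableT_comp (@measurable_rV_sub R n) (g := fun z : TV => (z.1.2, z.2))).
by apply: measurable_fun_pair => //; exact: (measurableT_comp measurable_snd measurable_fst).
Qed.

Let mf3 : mfunT (fun z : TV => f (z.1.1, z.2)).
Proof.
apply: (measurableT_comp mf); apply: measurable_fun_pair => //.
exact: (measurableT_comp measurable_fst measurable_fst).
Qed.

Lemma measurable_moll_time q : mfunT
  (fun z : spacetime R n => moll q (fun x => f (z.1, x)) z.2).
Proof.
exact: (measurable_Rintegral leb (f := fun z : TV => rho q (z.1.2 - z.2) * f (z.1.1, z.2))
  (measurable_funM (measurableT_comp (measurable_rho q) mdiff) mf3)).
Qed.

Lemma measurable_block_time q : mfunT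
  (fun z : spacetime R n => block q (fun x => f (z.1, x)) z.2).
Proof.
exact: (measurable_Rintegral leb (f := fun z : TV => (rho q (z.1.2 - z.2) - rho (2 * q) (z.1.2 - z.2)) * f (z.1.1, z.2))
  (measurable_funM (measurable_funB (measurableT_comp (measurable_rho q) mdiff)
     (measurableT_comp (measurable_rho (2 * q)) mdiff)) mf3)).
Qed.

Lemma measurable_mass_time p : mfunT
  (fun z : spacetime R n => mass p (fun x => f (z.1, x)) z.2).
Proof.
apply: (measurable_Rintegral leb (f := fun z : TV => \1_(cube p) (z.1.2 - z.2) * `|f (z.1.1, z.2)|)).
apply: measurable_funM.
  have mi : mfunT (\1_(cube p) : 'rV[R]_n -> R) by exact: measurable_indic_cube.
  exact: (measurableT_comp mi mdiff).
exact: (measurableT_comp (@normr_measurable R setT) mf3).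
Qed.

End joint.

Lemma measurable_moll2_time q : mfunT
  (fun z : spacetime R n => moll2 q (fun x => h (z.1, x)) z.2).
Proof. exact: measurable_moll_time (measurable_moll_time mh q) q. Qed.

Lemma measurable_weight_time (C : R) m : mfunT
  (fun z : spacetime R n => weight C m (fun x => h (z.1, x)) z.2).
Proof.
have mn (f : spacetime R n -> R) : mfunT f -> mfunT (fun z => `|f z|).
  by move=> mf; exact: (measurableT_comp (@normr_measurable R setT) mf).
have mhz : mfunT (fun z : spacetime R n => h (z.1, z.2)).
  by rewrite (_ : (fun z => _) = h)//; apply/funext => -[].
have mdef : mfunT (fun z : spacetime R n => defect m (fun x => h (z.1, x)) z.2).
  apply: measurable_sum => k; apply: (measurable_funM (measurable_cst _)); apply: mn.
  exact: (measurable_funB mhz (measurable_moll2_time (2 ^- k))).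
have mms : mfunT (fun z : spacetime R n => mass_sum m (fun x => h (z.1, x)) z.2).
  apply: measurable_funD; first exact: measurable_mass_time (measurable_moll_time mh 1) 2.
  apply: measurable_sum => l; apply: (measurable_funM (measurable_cst _)).
  exact: measurable_mass_time (measurable_block_time mh (2 ^- l.+1)) _.
exact: (measurable_funD (measurable_funD (mn _ mhz) (measurable_funM (measurable_cst _) mdef))
  (measurable_funM (measurable_cst _) mms)).
Qed.

Lemma ereal_telescope (a c : nat -> \bar R) d : (forall l, a l <= a l.+1 + c l)%E ->
  (a 0%N <= a d + \sum_(l < d) c l)%E.
Proof.
move=> H; elim: d => [|d IH]; first by rewrite big_ord0 adde0.
apply: (le_trans IH); rewrite big_ord_recr/= [X in (_ <= _ + X)%E]addeC addeA leeD2r//.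
Qed.

Lemma moll_telescope (A : set 'rV[R]_n) k d (g : 'rV[R]_n -> R) : measurable A -> integrableT leb g ->
  (L1on A (fun y => g y - moll (2 ^- k) g y)%R <=
   L1on A (fun y => g y - moll (2 ^- (k + d)) g y)%R + \sum_(l < d) L1on A (block (2 ^- (k + l).+1) g))%E.
Proof.
move=> mA gI; have mg : mfunT g by exact: measurable_L1 gI.
have := @ereal_telescope (fun l => L1on A (fun y => g y - moll (2 ^- (k + l)) g y)%R)
  (fun l => L1on A (block (2 ^- (k + l).+1) g)) d.
rewrite addn0; apply => l; rewrite addnS.
have q0 := pow2V_gt0 R (k + l).+1.
apply: L1on_D => //; [exact: measurable_mollB|exact: measurable_block1|exact: measurable_mollB|].
move=> y; rewrite (blockE y q0 gI) pow2VS.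
by rewrite -[X in `|X| <= _](subrKA (moll (2 ^- (k + l).+1) g y)) ler_normD.
Qed.

Definition osc (r : R) k := tint (fun s => L1on (cube r) (fun y => 2 ^+ k * (h (s, y) - moll (2 ^- k) (fun x => h (s, x)) y))%R).

Definition freq (r : R) k := tint (fun s => L1on (cube r) (fun y => (2 ^- k)^-1 * block (2 ^- k) (fun x => h (s, x)) y)%R).

Let mc (r : R) : measurable (@cube R n r).
Proof. exact: measurable_cube. Qed.

Let mhz : mfunT (fun z : spacetime R n => h (z.1, z.2)).
Proof. by rewrite (_ : (fun z => _) = h)//; apply/funext => -[]. Qed.

Let mosc r k : mfunT (fun s => L1on (cube r) (fun y => 2 ^+ k * (h (s, y) - moll (2 ^- k) (fun x => h (s, x)) y))%R).
Proof.
apply: (@measurable_L1on_time (fun z => 2 ^+ k * (h (z.1, z.2) - moll (2 ^- k) (fun x => h (z.1, x)) z.2))) => //.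
exact: (measurable_funM (measurable_cst _) (measurable_funB mhz (measurable_moll_time mh _))).
Qed.

Let mfreq r k : mfunT (fun s => L1on (cube r) (fun y => (2 ^- k)^-1 * block (2 ^- k) (fun x => h (s, x)) y)%R).
Proof.
apply: (@measurable_L1on_time (fun z => (2 ^- k)^-1 * block (2 ^- k) (fun x => h (z.1, x)) z.2)) => //.
exact: (measurable_funM (measurable_cst _) (measurable_block_time mh _)).
Qed.

Let mL1n : mfunT (fun s => L1n (fun x => h (s, x))).
Proof. exact: measurable_int (integrable_L1n hI). Qed.

Lemma osc_ge0 r k : (0 <= osc r k)%E.
Proof. by apply: integral_ge0 => s _; exact: integral_ge0. Qed.

Lemma freq_ge0 r k : (0 <= freq r k)%E.
Proof. by apply: integral_ge0 => s _; exact: integral_ge0. Qed.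

Let ae_le (f g : R -> \bar R) : mfunT f -> mfunT g ->
  (forall s, 0 <= f s)%E -> (forall s, 0 <= g s)%E ->
  (forall s, leb.-integrable setT (fun x => (h (s, x))%:E) -> f s <= g s)%E -> (tint f <= tint g)%E.
Proof.
move=> mf mg f0 g0 fg; apply: (@ae_ge0_le_integral _ (measurableTypeR R)) => //.
- exact: (@measurable_funTS _ _ (measurableTypeR R)).
- exact: (@measurable_funTS _ _ (measurableTypeR R)).
by apply: ae_imply (ae_integrable1 hI) => s hs _; exact: fg.
Qed.

Lemma weight_time_le (C : R) : (0 <= C)%R -> exists2 K : R, (0 <= K)%R & forall m r, (0 <= r)%R ->
  (tint (fun s => \int[leb]_(y in cube r) (weight C m (fun x => h (s, x)) y)%:E) <=
   K%:E * (tint (fun s => L1n (fun x => h (s, x))) + \sum_(k < m.+1) (osc (r + 1)%R k + freq (r + 4)%R k)))%E.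
Proof.
move=> C0; have [K K0 HK] := weight_integral n C0; exists K => // m r r0.
have mD : measurable (`]0, T[%classic : set (measurableTypeR R)) by exact: measurable_itv.
have mS (f : R -> \bar R) : mfunT f -> measurable_fun (`]0, T[%classic : set (measurableTypeR R)) f.
  by move=> mf; exact: measurable_funTS.
pose f1 s := L1n (fun x => h (s, x)).
pose f2 k s := L1on (cube (r + 1)) (fun y => 2 ^+ k * (h (s, y) - moll (2 ^- k) (fun x => h (s, x)) y))%R.
pose f3 k s := L1on (cube (r + 4)) (fun y => (2 ^- k)^-1 * block (2 ^- k) (fun x => h (s, x)) y)%R.
pose u s := (f1 s + \sum_(k < m.+1) (f2 k s + f3 k s))%E.
have f10 s : (0 <= f1 s)%E by exact: integral_ge0.
have f20 k s : (0 <= f2 k s)%E by exact: integral_ge0.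
have f30 k s : (0 <= f3 k s)%E by exact: integral_ge0.
have mf1 : mfunT f1 by exact: mL1n.
have mf2 k : mfunT (f2 k) by exact: mosc.
have mf3 k : mfunT (f3 k) by exact: mfreq.
have mk k := emeasurable_funD (mf2 k) (mf3 k).
have ms : mfunT (fun s => \sum_(k < m.+1) (f2 k s + f3 k s))%E by apply: emeasurable_sum => k; exact: mk.
have mu_ : mfunT u by exact: emeasurable_funD.
have s0 s : (0 <= \sum_(k < m.+1) (f2 k s + f3 k s))%E by apply: sume_ge0 => k _; exact: adde_ge0.
have u0 s : (0 <= u s)%E by exact: adde_ge0.
have -> : (tint (fun s => L1n (fun x => h (s, x))) + \sum_(k < m.+1) (osc (r + 1)%R k + freq (r + 4)%R k) = tint u)%E.
  rewrite (@ge0_integralD _ (measurableTypeR R) R mu _ mD f1 _ (fun s _ => f10 s) (mS _ mf1) (fun s _ => s0 s) (mS _ ms)).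
  congr (_ + _)%E.
  rewrite (@ge0_integral_sum _ (measurableTypeR R) R mu _ mD _ (fun (k : 'I_m.+1) s => (f2 k s + f3 k s)%E)
    (fun k => mS _ (mk k)) (fun k s _ => adde_ge0 (f20 k s) (f30 k s))).
  apply: eq_bigr => k _.
  by rewrite (@ge0_integralD _ (measurableTypeR R) R mu _ mD (f2 k) (f3 k) (fun s _ => f20 k s) (mS _ (mf2 k))
    (fun s _ => f30 k s) (mS _ (mf3 k))).
rewrite -ge0_integralZl//; [|exact: mS].
apply: ae_le.
- have := @measurable_L1on_time (fun z => weight C m (fun x => h (z.1, x)) z.2) _ (mc r) (measurable_weight_time C m).
  congr (measurable_fun _ _); apply/funext => s; apply: eq_integral => y _; rewrite gee0_abs// lee_fin.
  by rewrite !addr_ge0 ?mulr_ge0 ?defect_ge0 ?mass_sum_ge0.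
- exact: measurable_funeM.
- by move=> s; apply: integral_ge0 => y _; rewrite lee_fin !addr_ge0 ?mulr_ge0 ?defect_ge0 ?mass_sum_ge0.
- by move=> s; apply: mule_ge0 => //; rewrite lee_fin.
- by move=> s hs; exact: HK.
Qed.

Lemma freq_lty r k : (freq r k < +oo)%E.
Proof.
have [C C0 HC] := @moll_L1on R n; have q0 := pow2V_gt0 R k.
have q20 : 0 < 2 * 2 ^- k :> R by rewrite mulr_gt0.
have i0 : 0 <= (2 ^- k)^-1 :> R by rewrite invr_ge0 ltW.
apply: (@le_lt_trans _ _ (tint (fun s => ((2 ^- k)^-1 * (2 * C))%:E * L1n (fun x => h (s, x))))%E).
  apply: ae_le.
  - exact: mfreq.
  - exact: measurable_funeM.
  - by move=> s; exact: integral_ge0.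
  - by move=> s; apply: mule_ge0; [rewrite lee_fin mulr_ge0// mulr_ge0|exact: integral_ge0].
  move=> s hs; have mhs : mfunT (fun x => h (s, x)) by exact: measurable_L1 hs.
  rewrite (L1onZ (mc r) i0 (measurable_block1 _ mhs)) EFinM -muleA lee_wpmul2l ?lee_fin//.
  have L q : 0 < q -> (L1on (cube r) (moll q (fun x => h (s, x))) <= C%:E * L1n (fun x => h (s, x)))%E.
    move=> qq; apply: (le_trans (HC q _ r qq mhs)); rewrite lee_wpmul2l ?lee_fin//.
    by apply: ge0_subset_integral => //; apply: measurableT_comp => //; apply/measurable_EFinP.
  apply: (@le_trans _ _ (L1on (cube r) (moll (2 ^- k) (fun x => h (s, x))) + L1on (cube r) (moll (2 * 2 ^- k) (fun x => h (s, x))))%E).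
    apply: (L1on_D (mc r) (measurable_moll _ mhs) (measurable_moll _ mhs) (measurable_block1 _ mhs)).
    by move=> y; rewrite (blockE y q0 hs) ler_normB.
  have -> : ((2 * C)%:E * L1n (fun x => h (s, x)) = C%:E * L1n (fun x => h (s, x)) + C%:E * L1n (fun x => h (s, x)))%E.
    by rewrite -ge0_muleDl ?lee_fin// -EFinD; congr (_%:E * _)%E; ring.
  by apply: leeD; exact: L.
rewrite ge0_integralZl//; last 3 first.
- exact: (@measurable_funTS _ _ (measurableTypeR R)).
- by move=> s _; exact: integral_ge0.
- by rewrite lee_fin mulr_ge0// mulr_ge0.
have /integrableP[_] := integrable_L1n hI => Loo.
rewrite lte_mul_pinfty ?lee_fin ?mulr_ge0//; apply: le_lt_trans Loo.
under [leRHS]eq_integral do rewrite gee0_abs ?integral_ge0//.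
by apply: ge0_subset_integral => // s _; exact: integral_ge0.
Qed.

(** Telescoping from scale 2^-k down to 2^-(k+d) leaves a remainder measured by the modulus. Each
    block carries the factor 2^k = 2^-(l+1) 2^(k+l+1), hence geometric coefficients in front of
    [freq]. *)
Lemma osc_le : exists2 C : R, (0 <= C)%R & forall r k d,
  (osc r k <= (2 ^+ k * C)%:E * \int[mu]_s modulus (fun x => h (s, x)) (2 ^- (k + d))%R +
    \sum_(l < d) (2 ^- l.+1)%:E * freq r (k + l).+1)%E.
Proof.
have [C C0 HC] := @moll_modulus R n; exists C => // r k d.
have p0 : 0 <= 2 ^+ k :> R by exact: exprn_ge0.
have mD : measurable (`]0, T[%classic : set (measurableTypeR R)) by exact: measurable_itv.
have mS (f : R -> \bar R) : mfunT f -> measurable_fun (`]0, T[%classic : set (measurableTypeR R)) f.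
  by move=> mf; exact: measurable_funTS.
pose f1 s := ((2 ^+ k * C)%:E * modulus (fun x => h (s, x)) (2 ^- (k + d)))%E.
pose f2 l s := ((2 ^- l.+1)%:E * L1on (cube r) (fun y => (2 ^- (k + l).+1)^-1 * block (2 ^- (k + l).+1) (fun x => h (s, x)) y)%R)%E.
have mm := measurable_modulus_time (2 ^- (k + d)) mh.
have mf1 : mfunT f1 by exact: measurable_funeM.
have mf2 l : mfunT (f2 l) by apply: measurable_funeM; exact: mfreq.
have c0 : 0 <= 2 ^+ k * C by rewrite mulr_ge0.
have l0 l : 0 <= 2 ^- l.+1 :> R by rewrite ltW// pow2V_gt0.
have f10 s : (0 <= f1 s)%E by apply: mule_ge0; [rewrite lee_fin|exact: modulus_ge0].
have f20 l s : (0 <= f2 l s)%E by apply: mule_ge0; [rewrite lee_fin|exact: integral_ge0].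
have ms : mfunT (fun s => \sum_(l < d) f2 l s)%E by apply: emeasurable_sum => l; exact: mf2.
have s0 s : (0 <= \sum_(l < d) f2 l s)%E by apply: sume_ge0 => l _.
apply: (@le_trans _ _ (tint (fun s => f1 s + \sum_(l < d) f2 l s))%E).
  apply: ae_le.
  - exact: mosc.
  - exact: emeasurable_funD.
  - by move=> s; exact: integral_ge0.
  - by move=> s; exact: adde_ge0.
  move=> s hs; have mhs : mfunT (fun x => h (s, x)) by exact: measurable_L1 hs.
  rewrite (L1onZ (mc r) p0 (measurable_mollB _ mhs)).
  have := moll_telescope k d (mc r) hs.
  move=> /(lee_wpmul2l (_ : (0 <= (2 ^+ k)%:E)%E)) => /(_ _)/wrap[|]; first by rewrite lee_fin.
  move=> H; apply: (le_trans H); rewrite ge0_muleDr ?integral_ge0//; last by apply: sume_ge0 => l _; exact: integral_ge0.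
  apply: leeD.
    rewrite /f1 EFinM -muleA lee_wpmul2l ?lee_fin//.
    apply: (@le_trans _ _ (\int[leb]_y `|(h (s, y) - moll (2 ^- (k + d)) (fun x => h (s, x)) y)%:E|)%E).
      apply: ge0_subset_integral => //; apply: measurableT_comp => //; apply/measurable_EFinP.
      exact: measurable_mollB.
    have -> : (\int[leb]_y `|(h (s, y) - moll (2 ^- (k + d)) (fun x => h (s, x)) y)%:E| =
        \int[leb]_y `|(moll (2 ^- (k + d)) (fun x => h (s, x)) y - h (s, y))%:E|)%E.
      by apply: eq_integral => y _; rewrite /= distrC.
    exact: HC (pow2V_gt0 _ _) hs.
  rewrite ge0_sume_distrr; last by move=> l _; exact: integral_ge0.
  apply: lee_sum => l _; rewrite /f2 L1onZ//; last exact: measurable_block1.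
  rewrite muleA -EFinM lee_wpmul2r ?integral_ge0// lee_fin.
  rewrite invrK -addnS exprD mulrCA mulVf ?mulr1// expf_neq0//.
rewrite (@ge0_integralD _ (measurableTypeR R) R mu _ mD f1 _ (fun s _ => f10 s) (mS _ mf1) (fun s _ => s0 s) (mS _ ms)).
apply: leeD.
  rewrite /f1 ge0_integralZl//; [|exact: mS|by move=> s _; exact: modulus_ge0].
  rewrite lee_wpmul2l ?lee_fin//; apply: ge0_subset_integral => // s _; exact: modulus_ge0.
rewrite (@ge0_integral_sum _ (measurableTypeR R) R mu _ mD _ (fun (l : 'I_d) s => f2 l s)
  (fun l => mS _ (mf2 l)) (fun l s _ => f20 l s)).
apply: lee_sum => l _; rewrite /f2 (@ge0_integralZl _ (measurableTypeR R))//; last 2 first.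
- by apply: mS; exact: mfreq.
- by move=> s _; exact: integral_ge0.
Qed.

Lemma osc_lty r k : (osc r k < +oo)%E.
Proof.
have [C C0 HC] := osc_le; apply: le_lt_trans (HC r k 0%N) _; rewrite big_ord0 adde0.
rewrite lte_mul_pinfty ?lee_fin ?mulr_ge0 ?exprn_ge0//.
have mL : mfunT (fun s => L1n (fun x => h (s, x))) := mL1n.
pose P := (\int[leb]_u @Psi R n u)%E.
have /integrableP[_ Poo] := @Psi_integrable R n; have /integrableP[_ Loo] := integrable_L1n hI.
have P0 : (0 <= P)%E by apply: integral_ge0 => u _; exact: Psi_ge0.
have Pf : P \is a fin_num.
  by rewrite ge0_fin_numE//; move: Poo; under eq_integral do rewrite gee0_abs ?Psi_ge0//.
apply: (@le_lt_trans _ _ (\int[mu]_s ((2 * fine P)%:E * L1n (fun x => h (s, x))))%E).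
  apply: ge0_le_integral_lower => s _; first exact: modulus_ge0.
  apply: (le_trans (modulus_le _ (measurableT_comp mh (pair1_measurable s)))).
  by rewrite EFinM fineK// muleAC.
rewrite ge0_integralZl//; last 2 first.
- by move=> s _; exact: integral_ge0.
- by rewrite lee_fin mulr_ge0// fine_ge0.
rewrite lte_mul_pinfty ?lee_fin ?mulr_ge0 ?fine_ge0//.
apply: le_lt_trans Loo; rewrite le_eqVlt; apply/orP; left; apply/eqP.
by apply: eq_integral => s _; rewrite gee0_abs// integral_ge0.
Qed.

(** For fixed [k] the depth of the telescoping is taken so large that the remainder is below [e] in
    spite of its factor [2 ^+ k]; no rate for the modulus is required. The geometric sum of the
    blocks costs at most another [e]. *)
Lemma osc_small r k (e : R) : 0 < e -> (forall l, (k < l)%N -> (freq r l <= e%:E)%E) -> (osc r k <= (2 * e)%:E)%E.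
Proof.
move=> e0 He; have [C C0 HC] := osc_le.
have mc0 := modulus_time_cvg hI.
have C1 : 0 < 2 ^+ k * C + 1 by rewrite ltr_wpDl// mulr_ge0// exprn_ge0.
have [N _ HN] := cvge0_lt mc0 (divr_gt0 e0 C1).
have {}HN := ltW (HN (k + N)%N (leq_addl _ _)).
apply: (le_trans (HC r k N)); have -> : (2 * e = e + e)%R by ring.
rewrite EFinD; apply: leeD.
  apply: (@le_trans _ _ ((2 ^+ k * C)%:E * (e / (2 ^+ k * C + 1))%:E)%E).
    by rewrite lee_wpmul2l// lee_fin mulr_ge0// exprn_ge0.
  rewrite -EFinM lee_fin mulrCA ger_pMr// ler_pdivrMr// mul1r; lra.
apply: (@le_trans _ _ (\sum_(l < N) (2 ^- l.+1 * e)%:E)%E).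
  apply: lee_sum => l _; rewrite EFinM lee_wpmul2l//.
  by apply: He; rewrite ltnS leq_addr.
rewrite sumEFin lee_fin -mulr_suml ger_pMl//.
suff -> : \sum_(l < N) 2 ^- l.+1 = 1 - 2 ^- N :> R by rewrite gerBl// ltW// pow2V_gt0.
elim: N {HN} => [|N IH]; first by rewrite big_ord0 expr0 invr1 subrr.
by rewrite big_ord_recr/= IH -(pow2VS R N); ring.
Qed.

End weight_time.

Section cesaro_bound.
Variable R : realType.

(** Beyond some [k0] the terms are below [e1], chosen with [K * e1 <= e / 4]. The first [k0] terms
    and [X] form a constant, absorbed by [e * m%:R] for large [m]. *)
Lemma cesaro_bound (c : nat -> \bar R) (X : \bar R) (K : R) : (0 <= K)%R -> (0 <= X)%E -> (X < +oo)%E ->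
  (forall k, 0 <= c k)%E -> (forall k, c k < +oo)%E ->
  (forall e : R, (0 < e)%R -> exists k0, forall k, (k0 <= k)%N -> (c k <= e%:E)%E) ->
  forall e : R, (0 < e)%R -> exists m0 : nat, forall m, (m0 <= m)%N ->
    (K%:E * (X + \sum_(k < m.+1) c k) <= (e * m%:R)%:E)%E.
Proof.
move=> K0 X0 Xoo c0 coo ce e e0.
have cf k : c k = (fine (c k))%:E by rewrite fineK// ge0_fin_numE.
have Xf : X = (fine X)%:E by rewrite fineK// ge0_fin_numE.
have K1 : 0 < 4 * (K + 1) by rewrite mulr_gt0// ltr_wpDl.
have [k0 Hk0] := ce _ (divr_gt0 e0 K1).
pose e1 := e / (4 * (K + 1)).
pose M := \sum_(k < k0) fine (c k).
have fc0 k : 0 <= fine (c k) by rewrite fine_ge0.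
have e10 : 0 < e1 by exact: divr_gt0.
have Ke1 : K * e1 <= e / 4.
  rewrite /e1 invfM mulrA [K * _]mulrC -!mulrA ler_wpM2l ?(ltW e0)//.
  rewrite mulrC -mulrA ger_pMr// mulrC ler_pdivrMr ?mul1r ?lerDl//; by rewrite ltr_wpDl.
have sumM m : \sum_(k < m) fine (c k) <= M + e1 * m%:R.
  elim: m => [|m IH]; first by rewrite big_ord0 mulr0 addr0 sumr_ge0.
  have [mk|km] := ltnP m k0.
    apply: (@le_trans _ _ M); last by rewrite lerDl mulr_ge0// ltW.
    rewrite /M -(subnKC mk) big_split_ord/= lerDl; apply: sumr_ge0 => j _; exact: fc0.
  rewrite big_ord_recr/= -natr1 mulrDr mulr1 addrA lerD//.
  by rewrite -lee_fin -cf; exact: Hk0.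
have [m1 Hm1] : exists m1 : nat, 2 * (K * (fine X + M) + e / 4) / e <= m1%:R.
  by exists (Num.truncn (2 * (K * (fine X + M) + e / 4) / e)).+1; rewrite ltW// truncnS_gt.
exists m1 => m mm.
have {}Hm1 : 2 * (K * (fine X + M) + e / 4) <= e * m%:R.
  by rewrite -ler_pdivrMl// mulrC (le_trans Hm1)// ler_nat.
under eq_bigr do rewrite cf.
rewrite sumEFin Xf -EFinD -EFinM lee_fin.
have S1 := sumM m.+1.
have : K * (fine X + \sum_(i < m.+1) fine (c i)) <= K * (fine X + M + e1 * m.+1%:R).
  by rewrite ler_wpM2l// -addrA lerD2l.
have E : K * (fine X + M + e1 * m.+1%:R) = K * (fine X + M) + K * e1 * m%:R + K * e1.
  by rewrite -natr1; ring.
have := ler_wpM2r (ler0n R m) Ke1.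
have := mulr_ge0 (ltW e0) (ler0n R m).
rewrite E; lra.
Qed.

End cesaro_bound.

Section weight_conclusion.
Variables (R : realType) (n : nat) (T : R).
Local Notation leb := (@lebesgue_rV R n).
Variable h : spacetime R n -> R.
Hypothesis hI : integrableT leb2 h.

Lemma freq_mono r r' k : r <= r' -> (freq T h r k <= freq T h r' k)%E.
Proof.
have mh : mfunT h by exact: measurable_L1 hI.
move=> rr; apply: ge0_le_integral_lower => s _; first exact: integral_ge0.
apply: L1on_le; [exact: measurable_cube|exact: measurable_cube| |exact: cube_mono].
apply: (measurable_funM (measurable_cst _)); apply: measurable_block1.
exact: (measurableT_comp mh (pair1_measurable s)).
Qed.

Lemma weight_time_small (C r : R) : 0 <= C -> 0 <= r -> freq T h (r + 4) k @[k --> \oo] --> 0%E ->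
  forall e : R, 0 < e -> exists m0 : nat, forall m, (m0 <= m)%N ->
  (\int[mu]_(s in `]0%R, T[) \int[leb]_(y in cube r) (weight C m (fun x => h (s, x)) y)%:E <= (e * m%:R)%:E)%E.
Proof.
move=> C0 r0 fc e e0; have [K K0 HK] := weight_time_le T hI C0.
have fr k : (freq T h (r + 1) k <= freq T h (r + 4) k)%E by apply: freq_mono; lra.
have X0 : (0 <= \int[mu]_(s in `]0%R, T[) L1n (fun x => h (s, x)))%E.
  by apply: integral_ge0 => s _; exact: integral_ge0.
have Xoo : (\int[mu]_(s in `]0%R, T[) L1n (fun x => h (s, x)) < +oo)%E.
  have /integrableP[mL Loo] := integrable_L1n hI.
  apply: le_lt_trans Loo.
  rewrite [leRHS](_ : _ = \int[mu]_s L1n (fun x => h (s, x)))%E; last first.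
    by apply: eq_integral => s _; rewrite gee0_abs// integral_ge0.
  by apply: ge0_subset_integral => // s _; exact: integral_ge0.
have [k|k|e' e'0|m0 Hm0] := cesaro_bound (c := fun k => (osc T h (r + 1) k + freq T h (r + 4) k)%E) K0 X0 Xoo _ _ _ e0.
- by apply: adde_ge0; [exact: osc_ge0|exact: freq_ge0].
- by apply: lte_add_pinfty; [exact: osc_lty|exact: freq_lty].
(* [osc_small] doubles the bound on the blocks, and [freq] itself takes the remaining third. *)
- have e3 : 0 < e' / 3 by rewrite divr_gt0.
  have [k0 _ Hk0] := cvge0_lt fc e3; exists k0 => k kk.
  have -> : e' = 2 * (e' / 3) + e' / 3 by field.
  rewrite EFinD; apply: leeD; last exact: ltW (Hk0 k kk).
  apply: (osc_small hI e3) => l kl; apply: (le_trans (fr l)); apply: ltW.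
  by apply: Hk0; rewrite /= (leq_trans kk)// ltnW.
by exists m0 => m mm; exact: le_trans (HK m r r0) (Hm0 m mm).
Qed.

End weight_conclusion.

(** * Growth conditions along a compressible map *)

Section measure_tools.
Context d (T : measurableType d) (R : realType).
Implicit Types (m : {measure set T -> \bar R}) (f : T -> \bar R).
Local Open Scope ereal_scope.

Lemma ge0_integral_le_measure m1 m2 f : (forall A, measurable A -> m1 A <= m2 A) ->
  (forall x, 0 <= f x) -> \int[m1]_x f x <= \int[m2]_x f x.
Proof.
move=> m12 f0; rewrite !ge0_integralTE//; apply: ge_ereal_sup => _ [h hf <-].
pose h' : T -> R := HBNNSimple.NonNegSimpleFun.sort h.
have E : sintegral m1 h' <= sintegral m2 h'.
  rewrite !sintegralE; apply: lee_fsum => [|y [x _ <-]]; first exact: (fimfunP h).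
  by rewrite lee_wpmul2l ?lee_fin// m12.
by apply: (le_trans E); apply: ereal_sup_ubound; exists h.
Qed.

Lemma ge0_integral_ae0 m f : mfunT f -> (forall x, 0 <= f x) -> \int[m]_x f x = 0 ->
  {ae m, forall x, f x = 0}.
Proof.
move=> mf f0 I0; have /(ae_eq_integral_abs m measurableT mf) : \int[m]_x `|f x| = 0.
  by under eq_integral do rewrite gee0_abs//.
by apply: ae_imply => x /(_ Logic.I).
Qed.

Lemma ae_pullback m (Y : T -> T) (L : R) (P : T -> Prop) : mfunT Y ->
  (forall A, measurable A -> m (Y @^-1` A) <= L%:E * m A) -> {ae m, forall y, P y} -> {ae m, forall x, P (Y x)}.
Proof.
move=> mY YL [A [mA A0 PA]]; exists (Y @^-1` A); split.
- by rewrite -[X in measurable X]setTI; exact: mY.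
- by apply/eqP; rewrite eq_le measure_ge0 andbT (le_trans (YL A mA))// A0 mule0.
- by move=> x; exact: PA.
Qed.

Lemma ge0_integral_compress m (Y : T -> T) (L : R) f : mfunT Y -> (0 <= L)%R ->
  (forall A, measurable A -> m (Y @^-1` A) <= L%:E * m A) -> mfunT f -> (forall x, 0 <= f x) ->
  \int[m]_x f (Y x) <= L%:E * \int[m]_x f x.
Proof.
move=> mY L0 YL mf f0.
have := ge0_integral_pushforward mY m measurableT mf (fun y _ => f0 y).
rewrite preimage_setT => <-.
have := ge0_integral_mscale m measurableT (NngNum L0) mf (fun y _ => f0 y).
move=> <-; exact: ge0_integral_le_measure.
Qed.

End measure_tools.

Section product_ae.
Variables (R : realType) (n : nat).
Local Notation leb := (@lebesgue_rV R n).

Lemma ae_section (P : spacetime R n -> Prop) : {ae leb2, forall z, P z} ->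
  {ae mu, forall s, {ae leb, forall y, P (s, y)}}.
Proof.
move=> [A [mA A0 PA]].
have ms s : measurable (xsection A s) by exact: measurable_xsection.
have := @ge0_integral_ae0 _ (measurableTypeR R) R mu (leb \o xsection A) (measurable_fun_xsection leb mA)
  (fun s => measure_ge0 _ _) A0.
apply: ae_imply => s As; exists (xsection A s); split => // y /= nP.
by rewrite /xsection/= inE; apply: PA.
Qed.

(** Two quantifiers over almost every point do not commute for arbitrary predicates. Encoding the
    property as the vanishing of a nonnegative measurable function on the product allows the
    exchange by Tonelli. *)
Lemma ge0_ae_swap (F : spacetime R n -> \bar R) : mfunT F -> (forall z, 0 <= F z)%E ->
  {ae mu, forall s, {ae leb, forall x, F (s, x) = 0%E}} -> {ae leb, forall x, {ae mu, forall s, F (s, x) = 0%E}}.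
Proof.
move=> mF F0 H.
have I0 : (\int[mu]_s \int[leb]_x F (s, x) = 0)%E.
  rewrite -(integral0 mu setT); apply: ae_eq_integral => //.
  - exact: (ge0_measurable_integral leb mF).
  apply: ae_imply H => s Hs _; rewrite -(integral0 leb setT); apply: ae_eq_integral => //.
    exact: (measurableT_comp mF (pair1_measurable s)).
  by apply: ae_imply Hs => x.
rewrite (ge0_fubini leb mu mF F0) in I0.
have mi : mfunT (fun x => \int[mu]_s F (s, x))%E by exact: measurable_fun_fubini_tonelli_G.
have := ge0_integral_ae0 mi (fun x => integral_ge0 _ (fun s _ => F0 (s, x))) I0.
apply: ae_imply => x; apply: (@ge0_integral_ae0 _ (measurableTypeR R)).
  exact: (measurableT_comp mF (pair2_measurable x)).
by move=> s; exact: F0.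
Qed.

Lemma measurable_enorm : mfunT (@enorm R n).
Proof.
apply: measurableT_comp; last by apply: measurable_dotv.
exact: continuous_measurable_fun (@sqrt_continuous R).
Qed.

End product_ae.

Section growth.
Variables (R : realType) (n : nat) (T : R) (b : R -> 'rV[R]_n -> 'rV[R]_n).
Hypothesis mb : measurable_field T b.
Hypothesis hR1 : R1 T b.
Local Notation leb := (@lebesgue_rV R n).

Definition field0 i (z : spacetime R n) : R := ((fun z => b z.1 z.2 ord0 i) \_ (strip 0 T)) z.

Lemma measurable_stripE (a c : R) : measurable (strip a c : set (spacetime R n)).
Proof. by apply: measurableX => //; exact: measurable_itv. Qed.

Lemma measurable_field0 i : mfunT (field0 i).
Proof.
have := measurable_restrictT (fun z => b z.1 z.2 ord0 i) (measurable_stripE 0 T).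
move=> [H _]; apply: H.
exact: (measurableT_comp (measurable_coord i) mb).
Qed.

Lemma field0E i s y : 0 < s < T -> field0 i (s, y) = b s y ord0 i.
Proof. by move=> sT; rewrite /field0 patchE ifT// inE; split. Qed.

Lemma field0_out i s y : ~~ (0 < s < T) -> field0 i (s, y) = 0.
Proof.
move=> sT; rewrite /field0 patchE ifF//; apply/negbTE; rewrite notin_setE => -[] /= h _.
by move: sT; rewrite in_itv/= in h; rewrite h.
Qed.

Variables (Z : spacetime R n -> 'rV[R]_n) (L : R).
Hypotheses (mZ : mfunT Z) (L0 : 0 <= L)
  (ZL : forall s A, measurable A -> (leb ((fun x => Z (s, x)) @^-1` A) <= L%:E * leb A)%E).

Let mZs s : mfunT (fun x => Z (s, x)).
Proof. exact: (measurableT_comp mZ (pair1_measurable s)). Qed.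

(** The rate |b_i| / (1 + |x|) along the map [Z]. For [Z] the flow it bounds the growth of
    trajectories; for [Z] the identity it gives the local integrability of the field. *)
Definition drift i z := `|field0 i (z.1, Z z)| / (1 + enorm (Z z)).

Lemma measurable_field_flow i : mfunT (fun z => field0 i (z.1, Z z)).
Proof. by apply: (measurableT_comp (measurable_field0 i)); apply: measurable_fun_pair. Qed.

Lemma measurable_inv_enorm : mfunT (fun y : 'rV[R]_n => (1 + enorm y)^-1).
Proof.
pose g (x : R) := (1 + `|x|)^-1.
have gc : continuous g.
  move=> x; rewrite /continuous_at /g; apply: cvgV.
    by rewrite gt_eqF// ltr_wpDr.
  by apply: cvgD; [exact: cvg_cst|apply: cvg_norm; exact: cvg_id].
rewrite (_ : (fun y => _) = g \o @enorm R n); last by apply/funext => y; rewrite /g /= ger0_norm// enorm_ge0.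
exact: (measurableT_comp (continuous_measurable_fun gc) (@measurable_enorm R n)).
Qed.

Lemma drift_ge0 i z : 0 <= drift i z.
Proof. by rewrite /drift divr_ge0// addr_ge0// enorm_ge0. Qed.

Lemma measurable_drift i : mfunT (drift i).
Proof.
apply: measurable_funM; last exact: (measurableT_comp measurable_inv_enorm mZ).
exact: (measurableT_comp (@normr_measurable R setT) (measurable_field_flow i)).
Qed.

(** The part of the field in L^1 is carried over by bounded compression. The part in L^oo is bounded
    along [Z] outside the preimage of a null set, which is null, at the cost of the volume of the
    cube. *)
Lemma drift_lty i r : (\int[mu]_s \int[leb]_(x in cube r) (drift i (s, x))%:E < +oo)%E.
Proof.
have [b1 [b2 [[mb1 b1oo] [mb2 b2oo] bE]]] := hR1.
pose c1 z := (fun z => enorm (b1 z.1 z.2)) \_ (strip 0 T) z.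
have mc1 : mfunT c1.
  have := measurable_restrictT (fun z => enorm (b1 z.1 z.2)) (measurable_stripE 0 T).
  by move=> [H _]; apply: H; exact: (measurableT_comp (@measurable_enorm R n) mb1).
have c10 z : 0 <= c1 z by rewrite /c1 patchE; case: ifP => // _; exact: enorm_ge0.
pose n2 s := Lnorm leb +oo (fun x => (enorm (b2 s x))%:E).
pose u s := (L%:E * \int[leb]_y (c1 (s, y))%:E)%E.
pose f s := (\int[leb]_(x in cube r) (drift i (s, x))%:E)%E.
have mcub : measurable (@cube R n r) by exact: measurable_cube.
have mf : mfunT f.
  have mF : mfunT ((fun z => (drift i z)%:E) \_ (setT `*` cube r))%E.
    by apply: measurable_patch; [exact: measurableX|apply/measurable_EFinP; exact: measurable_drift].
  have := ge0_measurable_integral leb mF; move=> /(_ _)/wrap[z|].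
    by rewrite patchE; case: ifP => // _; rewrite lee_fin drift_ge0.
  congr (measurable_fun _ _); apply/funext => s; rewrite [RHS]integral_mkcond; apply: eq_integral => y _.
  rewrite !patchE; congr (if _ then _ else _); apply/idP/idP; rewrite !inE; first by case.
  by [].
have mu1 : mfunT (fun s => \int[leb]_y (c1 (s, y))%:E)%E.
  by apply: (ge0_measurable_integral leb (f := fun z => (c1 z)%:E)); [apply/measurable_EFinP|move=> z; rewrite lee_fin].
have mu_ : mfunT u by exact: measurable_funeM.
have u0 s : (0 <= u s)%E by apply: mule_ge0; [rewrite lee_fin|apply: integral_ge0 => y _; rewrite lee_fin].
have f0 s : (0 <= f s)%E by apply: integral_ge0 => x _; rewrite lee_fin drift_ge0.
have uoo : (\int[mu]_s u s < +oo)%E.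
  rewrite ge0_integralZl//; last by move=> s _; apply: integral_ge0 => y _; rewrite lee_fin.
  rewrite lte_mul_pinfty ?lee_fin//; apply: le_lt_trans b1oo.
  rewrite [leRHS]integral_mkcond le_eqVlt; apply/orP; left; apply/eqP; apply: eq_integral => s _.
  rewrite patchE; case: ifPn => sT.
    rewrite Lnorm1; apply: eq_integral => y _; rewrite gee0_abs ?lee_fin ?enorm_ge0//.
    by rewrite /c1 patchE ifT// inE; split => //; rewrite inE in sT.
  rewrite integral0_eq// => y _; rewrite /c1 patchE ifF//; apply/negbTE.
  by move: sT; rewrite !notin_setE => sT [].
pose c := fine (leb (cube r)).
have cE : leb (cube r) = c%:E.
  rewrite /c fineK// ge0_fin_numE//; have [r0|r0] := leP 0 r; first by rewrite lebesgue_cube ?ltry.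
  apply: (@le_lt_trans _ _ (leb (cube 0))); last by rewrite lebesgue_cube ?ltry.
  by apply: le_measure; rewrite ?inE//; [exact: measurable_cube|move=> x xr j; exact: le_trans (xr j) (ltW r0)].
have c0 : 0 <= c by exact: fine_ge0.
(* The factor is [c + 1] instead of [c] so that it is positive and the bound remains trivial at
   times where [n2 s] is infinite. *)
have key : {ae mu, forall s, 0 < s < T -> (f s <= u s + (c + 1)%:E * n2 s)%E}.
  apply: ae_imply (ae_section bE) => s bEs sT.
  have n20 : (0 <= n2 s)%E by exact: Lnorm_ge0.
  have us0 := u0 s.
  have [n2oo|n2f] := eqVneq (n2 s) +oo%E.
    rewrite n2oo gt0_muley ?lte_fin ?ltr_wpDl// addey ?leey// gt_eqF// (lt_le_trans _ us0)//.
  have n2r : n2 s = (fine (n2 s))%:E.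
    by rewrite fineK// ge0_fin_numE// lt_neqAle n2f leey.
  have aeb : {ae leb, forall y, `|field0 i (s, y)| / (1 + enorm y) <= c1 (s, y) + fine (n2 s)}.
    apply: ae_imply2 bEs (ae_le_Lnormy leb (fun x => (enorm (b2 s x))%:E)) => y Ey.
    rewrite -/(n2 s) n2r /= lee_fin (ger0_norm (enorm_ge0 _)) => b2y.
    have sy : strip 0 T (s, y) by split.
    have := congr1 (fun v : 'rV[R]_n => v ord0 i) (Ey sy); rewrite !mxE /= => Eyi.
    rewrite field0E// /c1 patchE ifT ?inE//=.
    have e0 : 0 <= (1 + enorm y)^-1 by rewrite invr_ge0 addr_ge0// enorm_ge0.
    rewrite -[X in _ * X <= _](ger0_norm e0) -normrM mulrC Eyi (le_trans (ler_normD _ _))// lerD ?coord_le_enorm//.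
    exact: le_trans (coord_le_enorm _ _) b2y.
  have := ae_pullback (mZs s) (ZL s) aeb => {}aeb.
  have mcZ : mfunT (fun x => (c1 (s, Z (s, x)))%:E).
    apply/measurable_EFinP.
    exact: (measurableT_comp (measurableT_comp mc1 (pair1_measurable s)) (mZs s)).
  apply: (@le_trans _ _ (\int[leb]_(x in cube r) ((c1 (s, Z (s, x)))%:E + (fine (n2 s))%:E))%E).
    apply: ae_ge0_le_integral => //.
    - by move=> x _; rewrite lee_fin drift_ge0.
    - apply: measurable_funTS; apply/measurable_EFinP.
      exact: (measurableT_comp (measurable_drift i) (pair1_measurable s)).
    - by move=> x _; rewrite -EFinD lee_fin addr_ge0// fine_ge0.
    - by apply: measurable_funTS; apply: emeasurable_funD.
    - by apply: ae_imply aeb => x h _; rewrite -EFinD lee_fin.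
  rewrite ge0_integralD//; last 3 first.
  - by move=> x _; rewrite lee_fin.
  - exact: measurable_funTS.
  - by move=> x _; rewrite lee_fin fine_ge0.
  apply: leeD.
    apply: (@le_trans _ _ (\int[leb]_x (c1 (s, Z (s, x)))%:E)%E).
      by apply: ge0_subset_integral => // x _; rewrite lee_fin.
    apply: (ge0_integral_compress (f := fun y => (c1 (s, y))%:E) (mZs s) L0 (ZL s)).
      by apply/measurable_EFinP; exact: (measurableT_comp mc1 (pair1_measurable s)).
    by move=> x; rewrite lee_fin.
  rewrite integral_cst// [X in (_ * X)%E]cE n2r -!EFinM lee_fin mulrC ler_wpM2r ?fine_ge0//.
  + by rewrite lee_fin fine_ge0.
  + by rewrite lerDl.
have [B [mB B0 HB]] := key.
have c1p : 0 < c + 1 by rewrite ltr_wpDl.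
(* The norm [n2] comes without measurability in [s]. The measurable excess of [f] over [u], divided
   by [c + 1], lies below it at almost every time, and its integral is compared with that of [n2] by
   monotonicity alone. *)
pose g s := ((c + 1)^-1%:E * maxe (f s - u s) 0)%E.
have mg : mfunT g.
  apply: measurable_funeM; apply: measurable_maxe => //; exact: emeasurable_funB.
have g0 s : (0 <= g s)%E by apply: mule_ge0; [rewrite lee_fin invr_ge0 ltW|rewrite le_max lexx orbT].
have goo : (\int[mu]_s g s < +oo)%E.
  apply: le_lt_trans b2oo.
  rewrite (@ge0_negligible_integral _ (measurableTypeR R) R mu setT B g mB measurableT mg (fun s _ => g0 s) B0).
  rewrite [leLHS]integral_mkcond [leRHS]integral_mkcond.
  apply: ge0_le_integral_lower => s _; first by rewrite patchE; case: ifP.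
  rewrite !patchE; case: ifPn => [|_]; last by case: ifP => // _; exact: Lnorm_ge0.
  rewrite inE => -[_ nB]; case: ifPn => [|]; rewrite ?inE ?notin_setE /= in_itv/=.
    move=> sT; have fs : (f s <= u s + (c + 1)%:E * n2 s)%E by apply: contrapT => h; apply: nB; apply: HB => /= /(_ sT).
    have n20 : (0 <= n2 s)%E by exact: Lnorm_ge0.
    rewrite /g lee_pdivrMl// ge_max mule_ge0 ?lee_fin ?(ltW c1p)// andbT.
    have [uf|] := boolP (u s \is a fin_num); first by rewrite leeBlDl.
    rewrite ge0_fin_numE// -leNgt leye_eq => /eqP ->.
    by rewrite addeNy leNye.
  move=> /negP sT; rewrite /g (_ : f s = 0%E) ?sub0e; last first.
    by apply: integral0_eq => x _; rewrite /drift field0_out ?normr0 ?mul0r.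
  by rewrite (_ : maxe _ _ = 0%E) ?mule0//; apply/max_idPr; rewrite oppe_le0.
have cg0 s : (0 <= (c + 1)%:E * g s)%E by rewrite mule_ge0// lee_fin ltW.
have ug0 s : (0 <= u s + (c + 1)%:E * g s)%E by rewrite adde_ge0.
have mug : mfunT (fun s => u s + (c + 1)%:E * g s)%E.
  by apply: emeasurable_funD => //; exact: measurable_funeM.
have uI : mu.-integrable setT u.
  by apply/integrableP; split => //; under eq_integral do rewrite gee0_abs//.
apply: (@le_lt_trans _ _ (\int[mu]_s (u s + (c + 1)%:E * g s))%E).
  apply: (@ae_ge0_le_integral _ (measurableTypeR R)).
  - exact: measurableT.
  - by move=> s _; exact: f0.
  - exact: mf.
  - by move=> s _; exact: ug0.
  - exact: mug.
  have := @integrable_ae _ (measurableTypeR R) R mu setT measurableT u uI.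
  apply: ae_imply => s /(_ Logic.I) uf _.
  rewrite /g muleA -EFinM mulfV ?gt_eqF// mul1e -leeBlDl// le_max lexx//.
rewrite ge0_integralD//; last exact: measurable_funeM.
by rewrite lte_add_pinfty// ge0_integralZl// ?lee_fin ?ltW// lte_mul_pinfty ?lee_fin ?ltW.
Qed.

End growth.

(** * Primitives and a logarithmic Gronwall estimate *)

Section log_growth.
Variable R : realType.
Implicit Types (f g : R -> R) (s r : R).

Lemma integrable_sub (D : set R) f : measurable D -> integrableT mu f -> mu.-integrable D (EFin \o f).
Proof.
move=> mD fI; exact: (@integrableS _ (measurableTypeR R) R mu setT D (EFin \o f) measurableT mD (fun _ _ => Logic.I) fI).
Qed.

Definition primitive t f s := \int[mu]_(r in `[t, s]) f r.

Lemma primitive_chasles t f s1 s2 : integrableT mu f -> t <= s1 -> s1 <= s2 ->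
  primitive t f s2 = primitive t f s1 + primitive s1 f s2.
Proof.
move=> fI ts1 s12; have hI (D : set R) : measurable D -> mu.-integrable D (EFin \o f) by move=> mD; exact: integrable_sub.
have := @Rintegral_itvB _ f (BLeft t) (BRight s2) s1 (hI _ (measurable_itv _)).
rewrite !bnd_simp => /(_ ts1 s12) /eqP; rewrite subr_eq => /eqP E.
rewrite /primitive E addrC (@Rintegral_itv_obnd_cbnd _ s1 (BRight s2) f)//; exact: hI.
Qed.

Lemma primitive_continuous t f T : t <= T -> integrableT mu f ->
  {within `[t, T], continuous (primitive t f)}.
Proof. by move=> tT fI; exact: parameterized_integral_continuous tT (integrable_sub (measurable_itv `[t, T]) fI). Qed.

Lemma primitive_open t f s : integrableT mu f -> primitive t f s = \int[mu]_(r in `]t, s[) f r.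
Proof.
move=> fI; have hI (D : set R) : measurable D -> mu.-integrable D (EFin \o f) by move=> mD; exact: integrable_sub.
have [ts|st] := leP t s; last by rewrite /primitive !set_itv_ge// bnd_simp -?leNgt -?ltNge// ltW.
rewrite (@Rintegral_itv_bndo_bndc _ (BRight t) s f); last exact: hI.
rewrite (@Rintegral_itv_obnd_cbnd _ t (BRight s) f)//; exact: hI.
Qed.

Lemma within_continuous_dist t T (F : R -> R) x (e : R) : {within `[t, T], continuous F} -> t <= x <= T -> 0 < e ->
  exists2 d, 0 < d & forall y, t <= y <= T -> `|y - x| < d -> `|F y - F x| < e.
Proof.
move=> /subspace_continuousP Fc xT e0.
have xI : `[t, T]%classic x by rewrite /= in_itv.
have /cvgrPdist_lt/(_ _ e0) := Fc x xI.
rewrite near_withinE => /nbhs_ballP[d d0 H]; exists d => // y yT yx.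
rewrite distrC; apply: H; last by rewrite /= in_itv.
by rewrite /ball/= distrC.
Qed.

Lemma primitive_ge0 t f s : (forall r, 0 <= f r) -> 0 <= primitive t f s.
Proof. by move=> f0; apply: Rintegral_ge0. Qed.

(** The supremum of the points where [F] does not exceed its initial value is again such a point by
    continuity; the local hypothesis would carry it further to the right. *)
Lemma real_induction t T (F : R -> R) : t <= T -> {within `[t, T], continuous F} ->
  (forall s, t <= s < T -> exists2 d, 0 < d & forall r, s <= r -> r < s + d -> r <= T -> F r <= F s) ->
  forall s, t <= s <= T -> F s <= F t.
Proof.
move=> tT Fc H s1 /andP[ts1 s1T]; rewrite leNgt; apply/negP => Fs1.
pose E := [set s | t <= s <= s1 /\ F s <= F t].
have Et : E t by split; rewrite ?lexx.
have Eub : has_ubound E by exists s1 => s [/andP[]].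
have Esup : has_sup E by split => //; exists t.
pose s0 := sup E.
have ts0 : t <= s0 by exact: ub_le_sup.
have s01 : s0 <= s1 by apply: ge_sup; [exists t|move=> s [/andP[]]].
have s0T : t <= s0 <= T by rewrite ts0 (le_trans s01).
have Fs0 : F s0 <= F t.
  rewrite leNgt; apply/negP => h.
  have h0 : 0 < F s0 - F t by rewrite subr_gt0.
  have [d d0 Hd] := within_continuous_dist Fc s0T h0.
  have [s [/andP[ts ss1] Fs] ss0] := sup_adherent d0 Esup.
  have ss0' : s <= s0 by apply: ub_le_sup => //; split => //; rewrite ts.
  have := Hd s; rewrite ts (le_trans ss1) // => /(_ isT).
  rewrite distrC ger0_norm ?subr_ge0// -/s0 in ss0 *.
  have sd : s0 - s < d by rewrite -/s0 in ss0; lra.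
  by move=> /(_ sd); rewrite ltr_norml => /andP[? _]; lra.
have s0lt : s0 < s1 by rewrite lt_neqAle s01 andbT; apply: contraTneq Fs1 => <-; rewrite -leNgt.
have [|d d0 Hd] := H s0; first by rewrite ts0 (lt_le_trans s0lt).
pose s := Num.min s1 (s0 + d / 2).
have s0s : s0 < s by rewrite /s lt_min s0lt ltrDl divr_gt0.
have ss1 : s <= s1 by rewrite /s ge_min lexx.
have sd : s < s0 + d by rewrite /s gt_min; apply/orP; right; lra.
have : s <= s0.
  apply: ub_le_sup => //; split; first by rewrite ss1 (le_trans ts0)// ltW.
  by apply: le_trans Fs0; apply: Hd; [exact: ltW|exact: sd|exact: le_trans s1T].
by rewrite leNgt s0s.
Qed.

(** Formally [D' <= w (del + D)], divided and integrated. [D] is only continuous with increments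
    bounded by integrals of [a], so [real_induction] is applied to the logarithm minus [1 + eta]
    times the primitive of [w]; [eta] absorbs the variation of [D] over a short interval and is
    sized so that its total effect is below [e]. *)
Lemma log_growth (D a w : R -> R) (del t T : R) : t <= T -> 0 < del ->
  {within `[t, T], continuous D} -> (forall s, 0 <= D s) -> D t = 0 ->
  integrableT mu a -> integrableT mu w -> (forall r, 0 <= w r) ->
  (forall r, a r = w r * (del + D r)) ->
  (forall r s, t <= r -> r <= s -> s <= T -> D s - D r <= primitive r a s) ->
  forall s, t <= s <= T -> ln (1 + D s / del) <= primitive t w s.
Proof.
move=> tT del0 Dc D0 Dt aI wI w0 aw Da s sT.
have prt f : primitive t f t = 0.
  by rewrite /primitive set_itv1 /Rintegral integral_set1.
have dD r : 0 < del + D r by rewrite ltr_wpDr.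
have lnE : ln (1 + D s / del) = ln (del + D s) - ln del.
  have dn : del != 0 by rewrite gt_eqF.
  by rewrite -[X in X + _](divff dn) -mulrDl ln_div ?posrE.
have pw0 : 0 <= primitive t w s by exact: primitive_ge0.
apply/ler_addgt0Pr => e e0.
pose eta := e / (primitive t w s + 1).
have eta0 : 0 < eta by rewrite divr_gt0// ltr_wpDl.
pose F r := ln (del + D r) - (1 + eta) * primitive t w r.
suff : F s <= F t.
  rewrite /F prt mulr0 subr0 Dt addr0 lnE => h.
  have : eta * primitive t w s <= e.
    rewrite /eta mulrAC ler_pdivrMr ?ltr_wpDl// ler_wpM2l ?(ltW e0)//; lra.
  lra.
apply: (real_induction tT) => //.
  move=> x; apply: cvgB.
    apply: continuous_comp; last exact: continuous_ln.
    by apply: cvgD; [exact: cvg_cst|exact: Dc].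
  by apply: cvgM; [exact: cvg_cst|exact: primitive_continuous tT wI x].
move=> r /andP[tr rT].
have rT' : t <= r <= T by rewrite tr ltW.
have ed : 0 < eta * (del + D r) by rewrite mulr_gt0.
have [d d0 Hd] := within_continuous_dist Dc rT' ed.
exists d => // r' rr' r'd r'T.
have aw' : primitive r a r' <= (1 + eta) * (del + D r) * primitive r w r'.
  rewrite /primitive -RintegralZl//; last exact: integrable_sub.
  apply: le_Rintegral => //; first exact: integrable_sub.
    apply: (@integrableZl _ (measurableTypeR R) R mu `[r, r']%classic _ ((1 + eta) * (del + D r)) (EFin \o w)) => //.
    exact: integrable_sub.
  move=> x; rewrite /= in_itv/= => /andP[rx xr']; rewrite aw mulrC ler_wpM2r//.
  have xT : t <= x <= T by rewrite (le_trans tr)// (le_trans xr').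
  have := Hd x xT; rewrite ger0_norm ?subr_ge0// => /(_ ltac:(lra)).
  rewrite ltr_norml => /andP[_]; lra.
rewrite /F (primitive_chasles wI tr rr').
have h1 := Da r r' tr rr' r'T.
have lnI : ln (del + D r') - ln (del + D r) <= (D r' - D r) / (del + D r).
  rewrite -ln_div ?posrE//.
  have -> : (del + D r') / (del + D r) = 1 + (D r' - D r) / (del + D r).
    have dn : del + D r != 0 by rewrite gt_eqF.
    by rewrite -[1 in RHS](divff dn) -mulrDl; congr (_ / _); ring.
  apply: le_ln1Dx; rewrite ltr_pdivlMr// mulN1r; have := dD r'; lra.
have h2 : (D r' - D r) / (del + D r) <= (1 + eta) * primitive r w r'.
  by rewrite ler_pdivrMr// (le_trans h1)// (le_trans aw')// mulrAC.
lra.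
Qed.

End log_growth.

(** * From the distributional equation in time to an integral equation *)

Section window_limit.
Variable R : realType.
Implicit Types (f g : R -> R).

Lemma window_derive1 n (a c s : R) :
  derive1 (window n a c) s = n%:R * bell (n%:R * (s - a) - 2) - n%:R * bell (n%:R * (s - c) + 2).
Proof.
have aff (x k : R) : is_derive s 1 (fun y => n%:R * (y - x) + k) n%:R.
  rewrite (_ : (fun y => _) = fun y => n%:R * y + (k - n%:R * x)); last by apply/funext => y; ring.
  exact: isd_affine.
have d (x k : R) : is_derive s 1 (fun y => smoothstep (n%:R * (y - x) + k)) (bell (n%:R * (s - x) + k) * n%:R).
  have := @isd_comp R (@smoothstep R) (fun y => n%:R * (y - x) + k) s _ _ (SM_isd _ (SM_smoothstep R)) (aff x k).
  by [].
apply: isd_derive1; rewrite /window.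
have h1 := d a (-2); have h2 := d c 2.
have := @is_deriveB _ _ _ _ _ _ _ _ _ h1 h2.
by rewrite ![_ * n%:R]mulrC.
Qed.

(** An approximate identity centred at a - ka/(k+1). The offset [ka] matches the position of the
    steps of a window, so that the limit sees [f] on one side of [a] only. *)
Lemma bell_limit f (a ka l B : R) : mfunT f -> (forall x, `|f x| <= B) ->
  (forall u, `|u| <= 1 -> f (a + (u - ka) / k.+1%:R) @[k --> \oo] --> l) ->
  \int[mu]_s (k.+1%:R * bell (k.+1%:R * (s - a) + ka) * f s) @[k --> \oo] --> l.
Proof.
move=> mf fB fl; have [bS b0] := @bell_Cc R.
have E k : \int[mu]_s (k.+1%:R * bell (k.+1%:R * (s - a) + ka) * f s) =
    \int[mu]_u (bell u * f (a + (u - ka) / k.+1%:R)).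
  have kn : k.+1%:R != 0 :> R by rewrite pnatr_eq0.
  have := @Rintegral_affine1 R (k.+1%:R^-1) (a - ka / k.+1%:R) (fun s => k.+1%:R * bell (k.+1%:R * (s - a) + ka) * f s).
  rewrite invr_eq0 => /(_ kn) <-; last first.
    apply: measurable_funM => //; apply: measurable_funM => //.
    apply: (measurableT_comp (SM_measurable bS)); apply: measurable_funD => //.
    by apply: measurable_funM => //; exact: measurable_funB.
  rewrite ger0_norm ?invr_ge0//.
  transitivity (k.+1%:R^-1 * \int[mu]_u (k.+1%:R * (bell u * f (a + (u - ka) / k.+1%:R)))).
    congr (_ * _); apply: eq_Rintegral => u _.
    have -> : k.+1%:R * (k.+1%:R^-1 * u + (a - ka / k.+1%:R) - a) + ka = u by field.
    have -> : k.+1%:R^-1 * u + (a - ka / k.+1%:R) = a + (u - ka) / k.+1%:R by field.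
    by rewrite mulrA.
  rewrite RintegralZl// ?mulrA ?mulVf// ?mul1r//.
  have mfa : mfunT (fun u : R => f (a + (u - ka) / k.+1%:R)).
    apply: (measurableT_comp mf); apply: measurable_funD => //; apply: measurable_funM => //; exact: measurable_funB.
  have := @bounded_integrable R _ (measurableTypeR R) mu _ _ B mfa (fun u => fB _) (Cc_integrable (@bell_Cc R)).
  by rewrite (_ : (fun u => _) = EFin \o (fun u => bell u * f (a + (u - ka) / k.+1%:R)))//; apply/funext => u /=; rewrite mulrC.
under eq_cvg do rewrite E.
have -> : l = \int[mu]_u (bell u * l).
  rewrite RintegralZr//; last exact: Cc_integrable (@bell_Cc R).
  by rewrite Rintegral_bell mul1r.
have B0 : 0 <= B by exact: le_trans (normr_ge0 _) (fB 0).
apply: (@Rdominated_cvg _ _ (measurableTypeR R) mu _ _ (fun u => B * `|bell u|)).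
- move=> k; apply: measurable_funM; first exact: SM_measurable bS.
  apply: (measurableT_comp mf); apply: measurable_funD => //; apply: measurable_funM => //; exact: measurable_funB.
- apply: measurable_funM => //; exact: SM_measurable bS.
- exact: (integrableZl measurableT B (integrable_norm (Cc_integrable (@bell_Cc R)))).
- by move=> k u; rewrite normrM mulrC ler_wpM2r.
- apply: aeW => u; have [u1|u1] := leP `|u| 1.
    by apply: cvgM; [exact: cvg_cst|exact: fl].
  by rewrite b0// mul0r; under eq_cvg do rewrite mul0r; exact: cvg_cst.
Qed.

Lemma bell_shift_integrable f k (a ka B : R) : mfunT f -> (forall x, `|f x| <= B) ->
  mu.-integrable setT (fun s => (k.+1%:R * bell (k.+1%:R * (s - a) + ka) * f s)%:E).
Proof.
move=> mf fB; have [bS b0] := @bell_Cc R.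
have uC : Cc (`|a| + 1 + `|ka|) (fun s : R => bell (k.+1%:R * (s - a) + ka)).
  split.
    rewrite (_ : (fun s => _) = fun s => bell (k.+1%:R * s + (ka - k.+1%:R * a))); last by apply/funext => s; congr bell; ring.
    exact: SM_comp.
  move=> s sM; apply: b0.
  have h1 := ler_normB (k.+1%:R * (s - a) + ka) ka; rewrite addrK normrM in h1.
  have h2 := ler_normD (s - a) a; rewrite subrK in h2.
  have h3 : `|s - a| <= `|k.+1%:R : R| * `|s - a| by rewrite ler_peMl// ger0_norm// ler1n.
  lra.
have := @bounded_integrable R _ (measurableTypeR R) mu _ _ B mf fB
  (integrableZl measurableT (k.+1%:R : R) (Cc_integrable uC)).
rewrite (_ : (fun s => _) = (fun s => (k.+1%:R * bell (k.+1%:R * (s - a) + ka) * f s)%:E))//.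
by apply/funext => s /=; rewrite mulrC.
Qed.

(** Tested on windows: the derivative of a window is the difference of two approximate identities,
    one concentrating at [t] from the right and one at [s] from the left. One-sided continuity at
    the two ends is all that the limit needs. *)
Lemma window_weak f g (t s B : R) : t < s -> mfunT f -> (forall x, `|f x| <= B) ->
  integrableT mu g ->
  (forall e, 0 < e -> exists2 d, 0 < d & forall r, t < r -> r < t + d -> `|f r - f t| <= e) ->
  (forall e, 0 < e -> exists2 d, 0 < d & forall r, s - d < r -> r < s -> `|f r - f s| <= e) ->
  (forall (al : R -> R) a c, SM al -> t < a -> c < s -> (forall r, ~~ (a <= r <= c) -> al r = 0) ->
    \int[mu]_r (derive1 al r * f r) = - \int[mu]_r (al r * g r)) ->
  f s - f t = \int[mu]_(r in `]t, s[) g r.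
Proof.
move=> ts mf fB gI ft fs W.
have mg : mfunT g by exact: measurable_L1 gI.
have lt_ : \int[mu]_r (k.+1%:R * bell (k.+1%:R * (r - t) + -2) * f r) @[k --> \oo] --> f t.
  apply: bell_limit fB _ => // u; rewrite ler_norml => /andP[u1 u2].
  apply/cvgrPdist_le => e e0; have [d d0 Hd] := ft e e0.
  near=> k; rewrite distrC; have k0 : 0 < k.+1%:R :> R by [].
  have kd : 3 < k.+1%:R * d.
    have : 3 / d < k%:R by near: k; exact: nbhs_infty_gtr.
    rewrite ltr_pdivrMr// -natr1; have := d0; nra.
  apply: Hd; first by rewrite ltrDl divr_gt0//; lra.
  by rewrite ltrD2l ltr_pdivrMr//; lra.
have ls_ : \int[mu]_r (k.+1%:R * bell (k.+1%:R * (r - s) + 2) * f r) @[k --> \oo] --> f s.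
  apply: bell_limit fB _ => // u; rewrite ler_norml => /andP[u1 u2].
  apply/cvgrPdist_le => e e0; have [d d0 Hd] := fs e e0.
  near=> k; rewrite distrC; have k0 : 0 < k.+1%:R :> R by [].
  have kd : 3 < k.+1%:R * d.
    have : 3 / d < k%:R by near: k; exact: nbhs_infty_gtr.
    rewrite ltr_pdivrMr// -natr1; have := d0; nra.
  apply: Hd; last by rewrite gtrDl pmulr_llt0 ?invr_gt0//; lra.
  by rewrite ltrD2l ltr_pdivlMr//; lra.
have lg : \int[mu]_r (window k.+1 t s r * g r) @[k --> \oo] --> \int[mu]_(r in `]t, s[) g r.
  rewrite Rintegral_mkcond; apply: (@Rdominated_cvg _ _ (measurableTypeR R) mu _ _ (fun s => `|g s|)).
  - by move=> k; exact: (measurable_funM (SM_measurable (SM_window _ _ _)) mg).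
  - exact: (measurable_patch (measurable_itv _) mg).
  - exact: integrable_norm gI.
  - by move=> k r; rewrite normrM ler_piMl// window_norm.
  - apply: aeW => r; apply: cvg_near_cst.
    have [M _ HM] := near_window r ts; exists M => // k Mk.
    rewrite HM; last by rewrite /= (leq_trans Mk).
    rewrite patchE; case: ifPn => [|]; rewrite ?inE ?notin_setE/= in_itv/=.
      by move=> ->; rewrite mul1r.
    by move=> /negP/negbTE ->; rewrite mul0r.
have lD : \int[mu]_r (k.+1%:R * bell (k.+1%:R * (r - t) + -2) * f r) -
   \int[mu]_r (k.+1%:R * bell (k.+1%:R * (r - s) + 2) * f r) @[k --> \oo] --> f t - f s.
  by apply: cvgB.
have lN : - (\int[mu]_r (window k.+1 t s r * g r)) @[k --> \oo] --> - (\int[mu]_(r in `]t, s[) g r).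
  by apply: cvgN.
suff E : \forall k \near \oo, \int[mu]_r (k.+1%:R * bell (k.+1%:R * (r - t) + -2) * f r) -
   \int[mu]_r (k.+1%:R * bell (k.+1%:R * (r - s) + 2) * f r) = - \int[mu]_r (window k.+1 t s r * g r).
  have h : - (\int[mu]_r (window k.+1 t s r * g r)) @[k --> \oo] --> f t - f s by exact: (cvg_trans (near_eq_cvg E) lD).
  have E2 := cvg_unique (@norm_hausdorff _ _) lN h.
  by rewrite -[RHS]opprK E2 opprB.
have [N _ HN] := near_window_supp ts.
exists N => // k /= Nk; have [n0 nts] := HN k.+1 (leqW Nk).
have np : 0 < k.+1%:R^-1 :> R by rewrite invr_gt0.
rewrite -(W (window k.+1 t s) (t + k.+1%:R^-1) (s - k.+1%:R^-1)).
- rewrite -RintegralB//; try exact: bell_shift_integrable fB.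
  by apply: eq_Rintegral => r _; rewrite window_derive1 mulrBl.
- exact: SM_window.
- by rewrite ltrDl.
- by rewrite gtrBl.
- by move=> r; exact: window_supp.
Unshelve. all: by end_near. Qed.

End window_limit.

(** * The flow equation for bounded renormalizations *)

Section strip_cube.
Variables (R : realType) (n : nat).
Local Notation leb := (@lebesgue_rV R n).

Lemma cube_ex (x : 'rV[R]_n) : exists r : nat, cube r%:R x.
Proof.
exists (Num.truncn (\sum_(i < n) `|x ord0 i|)).+1 => i.
by rewrite (le_trans _ (ltW (truncnS_gt _)))// (bigD1 i)//= lerDl sumr_ge0.
Qed.

Lemma measurable_stripcube r : measurable (setT `*` @cube R n r : set (spacetime R n)).
Proof. by apply: measurableX => //; exact: measurable_cube. Qed.

Lemma stripcube_integrable (d : spacetime R n -> R) r : mfunT d -> (forall z, 0 <= d z) ->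
  (\int[mu]_s \int[leb]_(x in cube r) (d (s, x))%:E < +oo)%E ->
  integrableT leb2 (d \_ (setT `*` cube r)).
Proof.
move=> md d0 doo; have mn : mfunT (EFin \o (d \_ (setT `*` cube r))).
  by apply/measurable_EFinP; apply: measurable_patch => //; exact: measurable_stripcube.
apply/integrableP; split => //.
have p0 z : 0 <= (d \_ (setT `*` cube r)) z by rewrite patchE; case: ifP.
under eq_integral do rewrite /= ger0_norm//.
have := @fubini_tonelli1 _ _ _ _ _ mu leb _ mn; move=> -> //.
apply: le_lt_trans doo; rewrite le_eqVlt; apply/orP; left; apply/eqP.
apply: eq_integral => s _; rewrite /fubini_F [RHS]integral_mkcond; apply: eq_integral => x _ /=.
rewrite !patchE.
have -> : ((s, x) \in setT `*` cube r) = (x \in cube r) by apply/idP/idP; rewrite !inE; [case|].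
by case: ifP.
Qed.

End strip_cube.

Section flow.
Variables (R : realType) (n : nat) (T t : R) (b X : R -> 'rV[R]_n -> 'rV[R]_n).
Hypotheses (t0 : 0 <= t) (tT : t < T) (mb : measurable_field T b) (hR1 : R1 T b).
Hypothesis hX : regular_lagrangian_flow T b t X.
Local Notation leb := (@lebesgue_rV R n).
Implicit Types (beta : 'rV[R]_n -> R).

(** Extended by the identity outside [[t, T]]: the map is then measurable on the whole of space-time
    and compresses with constant at most [L + 1] at every time. *)
Definition flow (z : spacetime R n) : 'rV[R]_n := if t <= z.1 <= T then X z.1 z.2 else z.2.

Lemma flowE s x : t <= s <= T -> flow (s, x) = X s x.
Proof. by rewrite /flow /= => ->. Qed.

Lemma measurable_flow : mfunT flow.
Proof.
apply: measurable_fun_rVP => i.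
pose A : set (spacetime R n) := `[t, T]%classic `*` setT.
have mA : measurable A by apply: measurableX => //; exact: measurable_itv.
rewrite (_ : (fun z => _) = (fun z => X z.1 z.2 ord0 i) \_ A \+ (fun z => z.2 ord0 i) \_ (~` A)); last first.
  apply/funext => z; rewrite /= !patchE in_setC /flow.
  have -> : (z \in A) = (t <= z.1 <= T).
    by apply/idP/idP; rewrite !inE /A /= in_itv//= => -[].
  by case: ifP => _; rewrite /= ?addr0 ?add0r.
apply: measurable_funD.
  have := measurable_restrictT (fun z => X z.1 z.2 ord0 i) mA; move=> [H _]; apply: H.
  exact: (measurableT_comp (measurable_coord i) (rlf_measurable hX)).
apply: measurable_patch; first exact: measurableC.
exact: (measurableT_comp (measurable_coord i) measurable_snd).
Qed.

Lemma flow_compression : exists2 L : R, 0 <= L & forall s A, measurable A ->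
  (leb ((fun x => flow (s, x)) @^-1` A) <= L%:E * leb A)%E.
Proof.
have [L L0 HL] := rlf_compression hX; exists (L + 1); first by rewrite addr_ge0.
move=> s A mA; have A0 := measure_ge0 leb A; rewrite EFinD ge0_muleDl// mul1e.
have [sT|sT] := boolP (t <= s <= T).
  rewrite (_ : _ @^-1` _ = X s @^-1` A); last by apply/funext => x /=; rewrite flowE.
  by rewrite (le_trans (HL s _ A mA))// ?leeDl//= in_itv.
rewrite (_ : _ @^-1` _ = A); last by apply/funext => x; rewrite /= /flow /= (negbTE sT).
by rewrite leeDr// mule_ge0.
Qed.

Let mflow_s s : mfunT (fun x => flow (s, x)).
Proof. exact: (measurableT_comp measurable_flow (pair1_measurable s)). Qed.

Definition velocity i z := field0 T b i (z.1, flow z).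

Lemma measurable_velocity i : mfunT (velocity i).
Proof. exact: (measurable_field_flow mb measurable_flow i). Qed.

Lemma flow_drift_lty i r : (\int[mu]_s \int[leb]_(x in cube r) (drift T b flow i (s, x))%:E < +oo)%E.
Proof.
have [L L0 HL] := flow_compression.
exact: (drift_lty mb hR1 measurable_flow L0 HL).
Qed.

Lemma log_C1_lip beta : log_C1 beta -> exists2 C : R, 0 <= C & forall u w, `|beta u - beta w| <= C * enorm (u - w).
Proof.
move=> [bC1 [C HC]]; have C0 : 0 <= C.
  have := (HC 0).2; rewrite -[X in _ <= X]mulr1 => /(le_trans (enorm_ge0 _)).
  by rewrite mulr1 pmulr_lge0// invr_gt0 ltr_wpDr// enorm_ge0.
have gC z : enorm (gradient beta z) <= C.
  apply: (le_trans (HC z).2); rewrite ler_pdivrMr ?ltr_wpDr ?enorm_ge0//.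
  by rewrite ler_peMr// lerDl enorm_ge0.
exists (C *+ n); first exact: mulrn_wge0.
move=> u w; apply: rV_MVT => h _.
have [d _] := bC1 (w + h *: (u - w)) Logic.I; split => //.
rewrite derive_basis// (le_trans (ler_norm_sum _ _ _))//.
apply: (@le_trans _ _ (\sum_(j < n) C * enorm (u - w))); last by rewrite sumr_const card_ord mulrnAl.
apply: ler_sum => j _; rewrite normrM mulrC ler_pM//.
  apply: le_trans (gC (w + h *: (u - w))); apply: le_trans (coord_le_enorm _ j).
  by rewrite mxE.
exact: coord_le_enorm.
Qed.

Lemma rV_continuous_measurable (f : 'rV[R]_n -> R) : continuous f -> mfunT f.
Proof.
move=> fc; have h := punctured_continuous_measurable (c := 0) (fun x _ => fc x).
rewrite (_ : f = fun x => f x * \1_(~` [set 0]) x + f 0 * \1_[set 0] x).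
  apply: measurable_funD => //; apply: measurable_funM => //; apply: measurable_indic; exact: measurable_set1_rV.
apply/funext => x; rewrite !indicE in_setC; have [->|x0] := eqVneq x 0.
  by rewrite mem_set//= mulr0 add0r mulr1.
by rewrite memNset//= ?mulr1 ?mulr0 ?addr0//; exact/eqP.
Qed.

Definition transport beta z := \sum_(j < n) gradient beta (flow z) ord0 j * velocity j z.

Lemma measurable_transport beta : log_C1 beta -> mfunT (transport beta).
Proof.
move=> [bC1 _]; apply: measurable_sum => j; apply: measurable_funM; last exact: measurable_velocity.
rewrite (_ : (fun z => _) = (fun y => 'D_(basis_rV R j) beta y) \o flow); last first.
  by apply/funext => z; rewrite /= mxE.
apply: measurableT_comp measurable_flow; apply: rV_continuous_measurable => y.
exact: (bC1 y Logic.I).2.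
Qed.

Lemma transport_le beta C : (forall z, enorm (gradient beta z) <= C / (1 + enorm z)) ->
  forall z, `|transport beta z| <= C * \sum_(j < n) drift T b flow j z.
Proof.
move=> gC z; rewrite (le_trans (ler_norm_sum _ _ _))// mulr_sumr; apply: ler_sum => j _.
rewrite normrM /drift -/(velocity j z) [X in _ <= C * X]mulrC mulrA ler_wpM2r//.
exact: le_trans (coord_le_enorm _ j) (gC _).
Qed.

Lemma drift_integrable i r : integrableT leb2 ((fun z => drift T b flow i z) \_ (setT `*` cube r)).
Proof.
by apply: stripcube_integrable (flow_drift_lty i r) => [|z]; [exact: (measurable_drift mb measurable_flow)|exact: drift_ge0].
Qed.

Lemma transport_integrable beta r : log_C1 beta ->
  integrableT leb2 ((transport beta) \_ (setT `*` cube r)).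
Proof.
move=> bl; have [_ [C HC]] := bl.
have C0 : 0 <= C.
  have := (HC 0).2; rewrite -[X in _ <= X]mulr1 => /(le_trans (enorm_ge0 _)).
  by rewrite mulr1 pmulr_lge0// invr_gt0 ltr_wpDr// enorm_ge0.
have dI := (Rintegral_sum (index_enum 'I_n) (fun i => drift_integrable i r)).1.
apply: (le_integrable measurableT _ _ (integrableZl measurableT C dI)).
  by apply/measurable_EFinP; apply: measurable_patch; [exact: measurable_stripcube|exact: measurable_transport].
move=> z _ /=; rewrite lee_fin (le_trans _ (ler_norm _))//.
rewrite patchE; case: ifPn => zr.
  apply: (le_trans (transport_le (fun z => (HC z).2) z)); rewrite ler_wpM2l//.
  by apply: ler_sum => j _; rewrite patchE zr.
rewrite normr0 mulr_ge0// sumr_ge0// => j _; rewrite patchE; case: ifP => // _; exact: drift_ge0.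
Qed.

Lemma pairing_fubini2 (f : spacetime R n -> R) (P : 'rV[R]_n -> R) (al : R -> R) (C A : R) :
  mfunT P -> (forall x, `|P x| <= C) ->
  mfunT al -> (forall s, `|al s| <= A) ->
  integrableT leb2 f ->
  \int[leb2]_z (f z * (al z.1 * P z.2)) = \int[leb]_x (P x * \int[mu]_s (al s * f (s, x))).
Proof.
move=> mP PC mal alA fI.
have mal1 : mfunT (fun z : spacetime R n => al z.1).
  exact: (measurableT_comp mal measurable_fst).
have mP2 : mfunT (fun z : spacetime R n => P z.2).
  exact: (measurableT_comp mP measurable_snd).
have mf : mfunT f by exact: measurable_L1 fI.
have kI : leb2.-integrable setT (fun z => (al z.1 * P z.2 * f z)%:E).
  apply: (bounded_integrable (C := A * C)) => //; first exact: measurable_funM.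
  by move=> z; rewrite normrM ler_pM.
under eq_Rintegral do rewrite mulrC.
rewrite -(@Rfubini2 _ _ _ _ _ mu leb (fun z : spacetime R n => al z.1 * P z.2 * f z) kI).
rewrite /Rintegral; congr fine; apply: ae_eq_integral => //.
- apply/measurable_EFinP.
  exact: (measurable_Rintegral2 mu (f := fun z : spacetime R n => al z.1 * P z.2 * f z)
    (measurable_funM (measurable_funM mal1 mP2) mf)).
- apply/measurable_EFinP; apply: measurable_funM => //.
  exact: (measurable_Rintegral2 mu (f := fun z : spacetime R n => al z.1 * f z)
    (measurable_funM mal1 mf)).
- apply: ae_imply (ae_integrable2 fI) => x fxI _ /=.
  have afI := @bounded_integrable R _ (measurableTypeR R) mu _ _ A mal alA fxI.
  have := RintegralZl (P x) measurableT afI.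
  by rewrite /Rintegral => <-; congr (fine _)%:E; apply: eq_integral => s _ /=; congr (_%:E); ring.
Qed.

Lemma integrable_Rintegral2 (f : spacetime R n -> R) :
  integrableT leb2 f -> integrableT leb (fun x => \int[mu]_u f (u, x)).
Proof.
move=> fI; have mf : mfunT f by exact: measurable_L1 fI.
have mJ := measurable_Rintegral2 mu mf.
apply/integrableP; split; first exact/measurable_EFinP.
have mn : mfunT (fun z => `|(f z)%:E|%E) by apply: measurableT_comp => //; exact/measurable_EFinP.
have [_] := integrableP _ _ _ fI; apply: le_lt_trans.
have := @fubini_tonelli2 _ _ _ _ _ mu leb _ mn => /(_ (fun z => abse_ge0 _)) ->.
apply: ge0_le_integral_lower => //.
move=> x _ /=; rewrite /Rintegral.
have mfx : mfunT (fun u => (f (u, x))%:E).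
  by apply/measurable_EFinP; exact: (measurableT_comp mf (pair2_measurable x)).
apply: le_trans (le_abse_integral mu measurableT mfx).
by case: (\int[_]_(_ in _) _)%E => [v||] /=; rewrite ?normr0 ?leey.
Qed.

Section equation.
Variables (beta : 'rV[R]_n -> R) (B : R).
Hypotheses (bl : log_C1 beta) (bB : forall z, `|beta z| <= B).

Let mbeta : mfunT beta.
Proof.
apply: rV_continuous_measurable => z; apply: differentiable_continuous.
by have [] := bl.1 z Logic.I.
Qed.

Let B0 : 0 <= B. Proof. exact: le_trans (normr_ge0 _) (bB 0). Qed.

(** Cutting to a cube makes both sides of the equation integrable over space-time. A mollifier of
    scale [q <= 1] centred in the cube of radius [r] does not see the cut at [r + 1]. *)
Let F r (z : spacetime R n) := beta (flow z) * (\1_(`[t, T]%classic) z.1 * \1_(cube r) z.2).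
Let G r (z : spacetime R n) := ((transport beta) \_ (setT `*` cube r)) z.

Let indic_cube_integrable r : integrableT leb (\1_(cube r) : 'rV[R]_n -> R).
Proof.
suff fin : (leb (cube r) < +oo)%E by apply: integrable_indic_lty => //; exact: measurable_cube.
have [r0|r0] := leP 0 r; first by rewrite lebesgue_cube ?ltry.
apply: (@le_lt_trans _ _ (leb (cube 0))); last by rewrite lebesgue_cube ?ltry.
by apply: le_measure; rewrite ?inE; [exact: measurable_cube|exact: measurable_cube|apply: cube_mono; exact: ltW].
Qed.

Let indic_itv_integrable : integrableT mu (\1_(`[t, T]%classic) : R -> R).
Proof. by apply: (@integrable_indic_lty _ (measurableTypeR R)) => //; exact: lebesgue_itv_lty. Qed.

Let FI r : integrableT leb2 (F r).
Proof.
apply: (bounded_integrable (C := B) (k := fun z => beta (flow z))) => //.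
  exact: (measurableT_comp mbeta measurable_flow).
exact: (@integrable_prod _ _ _ _ _ mu leb (\1_(`[t, T]%classic)) (\1_(cube r)) indic_itv_integrable (indic_cube_integrable r)).
Qed.

Let GI r : integrableT leb2 (G r).
Proof. exact: transport_integrable. Qed.

Let indic1 d (U : measurableType d) (A : set U) (u : U) : `|\1_A u| <= 1 :> R.
Proof. by rewrite indicE; case: (u \in A); rewrite ?normr1// normr0. Qed.

Let FsI r s : integrableT leb (fun x => F r (s, x)).
Proof.
have mb' : mfunT (fun x => beta (flow (s, x)) * \1_(`[t, T]%classic) s).
  by apply: measurable_funM => //; exact: (measurableT_comp mbeta (mflow_s s)).
have bd x : `|beta (flow (s, x)) * \1_(`[t, T]%classic) s| <= B.
  by rewrite normrM (le_trans (ler_piMr (normr_ge0 _) (indic1 _ _))).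
have := bounded_integrable (C := B) mb' bd (indic_cube_integrable r).
by apply: eq_integrable => // x _; rewrite /F /= mulrA.
Qed.

Section pairing.
Variables (q r : R) (y : 'rV[R]_n).
Hypotheses (r0 : 0 <= r) (q0 : 0 < q) (q1 : q <= 1) (yr : cube r y).
Let P (x : 'rV[R]_n) := rho q (y - x).

Let mP : mfunT P.
Proof. exact: (measurableT_comp (measurable_rho q) (measurable_rV_subc y)). Qed.

Let Pout x : ~ cube (r + 1) x -> P x = 0.
Proof.
move=> xr; apply: rho_out => // yx; apply: xr => i; have := yr i; have := yx i; rewrite !mxE => h1 h2.
rewrite -(subKr (y ord0 i) (x ord0 i)) (le_trans (ler_normB _ _))// lerD//.
exact: le_trans h1 q1.
Qed.

(** The flow equation tested on [al] times the mollifier centred at [y], which is a product of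
    functions of one variable and hence a test function. *)
Lemma transport_weak (al : R -> R) (a c : R) : SM al -> t < a -> c < T -> (forall s, ~~ (a <= s <= c) -> al s = 0) ->
  \int[mu]_s (derive1 al s * \int[leb]_x (P x * F (r + 1) (s, x))) =
  - \int[mu]_s (al s * \int[leb]_x (P x * G (r + 1) (s, x))).
Proof.
move=> alS ta cT als; have [C C0 HC] := @rho_bound R n.
have PC x : `|P x| <= C * q ^- n by exact: HC.
have alC : Cc (`|a| + `|c|) al.
  split => // s sac; apply: als; apply/negP => /andP[as_ sc].
  have ? := ler_norm c; have ? := normr_ge0 a; have a0 : 0 < a := le_lt_trans t0 ta.
  move: sac; rewrite ltNge => /negP; apply; rewrite ler_norml; apply/andP; split; lra.
have [A A0 HA] := Cc_bounded alC; have mal := SM_measurable alS.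
have [A' A'0 HA'] := Cc_bounded (Cc_derive1 alC); have mal' := SM_measurable (Cc_derive1 alC).1.
rewrite -(pairing_fubini mP PC mal' HA' (FI _)) -(pairing_fubini mP PC mal HA (GI _)).
have bC (i : 'I_n) : Cc 1 (@bell R) := @bell_Cc R.
pose u i := dil q (y ord0 i) (@bell R).
pose phi (z : R * 'rV[R]_n) := al z.1 * \prod_(i < n) u i (z.2 ord0 i).
have uS i : SM (u i) := (dil_Cc (y ord0 i) q0 (bC i)).1.
have us i x : q * 1 < `|x - y ord0 i| -> u i x = 0 by exact: (dil_supp bC).
have phiE z : phi z = al z.1 * P z.2 by rewrite /phi /P rhoE.
have := rlf_equation hX bl (test_prod_time alS als ta cT uS us).
rewrite -/phi => /eqP; rewrite eqr_oppLR => /eqP W.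
have al'0 s : ~~ (a <= s <= c) -> derive1 al s = 0.
  move=> sac; apply: isd_derive1; apply: (isd_near (f := cst 0)).
  have [sa|sa] := ltP s a.
    near=> x; rewrite als// negb_and -ltNge; apply/orP; left; near: x; exact: lt_nbhsl.
  have cs : c < s by rewrite ltNge; apply: contra sac; rewrite sa.
  near=> x; rewrite als// negb_and -!ltNge; apply/orP; right; near: x; exact: lt_nbhsr.
transitivity (\int[leb2]_(z in strip t T) (beta (X z.1 z.2) * 'D_(1, 0) phi z)).
  rewrite [RHS]Rintegral_mkcond; apply: eq_Rintegral => -[s x] _; rewrite patchE.
  have -> : 'D_(1, 0) phi (s, x) = derive1 al s * P x.
    rewrite /phi (derive_time (fun x : 'rV[R]_n => \prod_(i < n) u i (x ord0 i)) (s, x) alS).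
    by rewrite /P rhoE.
  have [sT|sT] := boolP ((s, x) \in strip t T); last first.
    rewrite al'0 ?mul0r ?mulr0//; apply: contra sT => /andP[as_ sc]; rewrite inE; split => //=.
    by rewrite in_itv /= (lt_le_trans ta as_) (le_lt_trans sc cT).
  move: sT; rewrite inE => -[/= sT _]; rewrite in_itv/= in sT; have /andP[ts sT'] := sT.
  have [xr|xr] := pselect (cube (r + 1) x); last by rewrite (Pout xr) !mulr0.
  rewrite /F flowE ?(ltW ts) ?(ltW sT')// !indicE !mem_set ?mulr1//=.
  by rewrite in_itv/= (ltW ts) (ltW sT').
rewrite W; apply: (congr1 -%R); rewrite Rintegral_mkcond; apply: eq_Rintegral => -[s x] _; rewrite patchE.
have phis : al (s, x).1 * \prod_(i < n) u i ((s, x).2 ord0 i) = al s * P x := phiE (s, x).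
rewrite phis /=.
have [sT|sT] := boolP ((s, x) \in strip t T); last first.
  rewrite als ?mul0r ?mulr0//; apply: contra sT => /andP[as_ sc]; rewrite inE; split => //=.
  by rewrite in_itv /= (lt_le_trans ta as_) (le_lt_trans sc cT).
move: sT; rewrite inE => -[/= sT _]; rewrite in_itv/= in sT; have /andP[ts sT'] := sT.
have [xr|xr] := pselect (cube (r + 1) x); last by rewrite (Pout xr) !mulr0.
rewrite /G patchE ifT; last by rewrite inE.
congr (_ * _); apply: eq_bigr => j _; rewrite /velocity flowE ?(ltW ts) ?(ltW sT')//= field0E//.
by rewrite (le_lt_trans t0 ts).
Unshelve. all: by end_near. Qed.

(** [beta] is bounded and Lipschitz. Where the two positions differ by at most [gam], the increment
    is at most [K * gam]; elsewhere it is at most [2 * B], on a set made small by convergence in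
    measure. Each contribution is given half of [e]. *)
Lemma pairing_cvg s0 e : t <= s0 <= T -> 0 < e -> exists2 d, 0 < d & forall s, t <= s <= T -> `|s - s0| < d ->
  `|\int[leb]_x (P x * F (r + 1) (s, x)) - \int[leb]_x (P x * F (r + 1) (s0, x))| <= e.
Proof.
move=> s0T e0; have [C C0 HC] := @rho_bound R n; have [K K0 HK] := log_C1_lip bl.
pose M := C * q ^- n; have PM x : `|P x| <= M by exact: HC.
have M0 : 0 <= M by exact: le_trans (normr_ge0 _) (PM 0).
pose rad := (r + 1) *+ n + 1; have r10 : 0 <= r + 1 by rewrite addr_ge0.
have rad0 : 0 < rad by rewrite ltr_wpDl// mulrn_wge0.
have cb (x : 'rV[R]_n) : cube (r + 1) x -> eball rad x.
  move=> xr; rewrite /eball /=; apply: (le_lt_trans (enorm_le_sum x)).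
  apply: (@le_lt_trans _ _ (\sum_(i < n) (r + 1))); first by apply: ler_sum => i _; exact: xr.
  by rewrite sumr_const card_ord ltrDl.
pose V := fine (leb (cube (r + 1))).
have VE : leb (cube (r + 1)) = V%:E.
  by rewrite /V fineK// ge0_fin_numE// lebesgue_cube ?ltry.
have V0 : 0 <= V by exact: fine_ge0.
have KMV : 0 < K * M * V + 1 := ltr_wpDl (mulr_ge0 (mulr_ge0 K0 M0) V0) ltr01.
have BM : 0 < 2 * B * M + 1 := ltr_wpDl (mulr_ge0 (mulr_ge0 (ler0n _ 2) B0) M0) ltr01.
pose gam := e / 2 / (K * M * V + 1).
have gam0 : 0 < gam by rewrite !divr_gt0.
have s0I : `[t, T]%classic s0 by rewrite /= in_itv.
have cvX := rlf_continuous hX s0I gam0 rad0.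
have e2 : 0 < e / 2 / (2 * B * M + 1) by rewrite !divr_gt0.
have : \forall s \near within `[t, T]%classic (nbhs s0),
    (leb [set x | eball rad x /\ (gam < enorm (X s x - X s0 x))%R] < (e / 2 / (2 * B * M + 1))%:E)%E.
  have U0 : [set y : \bar R | (y < (e / 2 / (2 * B * M + 1))%:E)%E] 0%E by rewrite /= lte_fin.
  exact: (cvX _ (open_nbhs_nbhs (conj (@open_ereal_lt_ereal _ _) U0))).
rewrite near_withinE => /nbhs_ballP[d d0 Hd]; exists d => // s sT sd.
have sI : `[t, T]%classic s by rewrite /= in_itv.
have := Hd s; rewrite /ball /= distrC => /(_ sd sI); set E := [set x | _] => lE.
have mdX : mfunT (fun x => flow (s, x) - flow (s0, x)).
  apply: measurable_fun_rVP => i.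
  rewrite (_ : (fun x => _) = fun x => flow (s, x) ord0 i - flow (s0, x) ord0 i); last by apply/funext => x; rewrite !mxE.
  by apply: measurable_funB; exact: (measurableT_comp (measurable_coord i) (mflow_s _)).
have mE : measurable E.
  rewrite (_ : E = (@enorm R n @^-1` `]-oo, rad[%classic) `&` ((fun x => enorm (flow (s, x) - flow (s0, x))) @^-1` `]gam, +oo[%classic)).
    apply: measurableI; rewrite -[X in measurable X]setTI.
      exact: (@measurable_enorm R n measurableT _ (measurable_itv _)).
    exact: (measurableT_comp (@measurable_enorm R n) mdX measurableT (measurable_itv _)).
  by apply/seteqP; split => x; rewrite /E /eball /= !in_itv/= !flowE// andbT.
have Eoo : (leb E < +oo)%E by exact: lt_trans lE (ltry _).
have EI : integrableT leb (\1_E : 'rV[R]_n -> R) by exact: integrable_indic_lty.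
have CI := indic_cube_integrable (r + 1).
have PFI s' : leb.-integrable setT (fun x => (P x * F (r + 1) (s', x))%:E).
  exact: (bounded_integrable mP PM (FsI _ s')).
pose g x := K * gam * \1_(cube (r + 1)) x + 2 * B * \1_E x.
have g1I := integrableZl measurableT (K * gam) CI; have g2I := integrableZl measurableT (2 * B) EI.
have gI : integrableT leb g by exact: (integrableD measurableT g1I g2I).
have gE : \int[leb]_x g x = K * gam * V + 2 * B * fine (leb E).
  rewrite /g RintegralD// !RintegralZl//; congr (_ * _ + _ * _).
    by rewrite /Rintegral integral_indic ?setIT//; exact: measurable_cube.
  by rewrite /Rintegral integral_indic ?setIT.
have Ef : leb E = (fine (leb E))%:E by rewrite fineK// ge0_fin_numE.
apply: (@le_trans _ _ (M * \int[leb]_x g x)).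
  apply: (le_RintegralB (PFI s) (PFI s0) gI) => x; rewrite -mulrBr normrM ler_pM//.
  have FE u : t <= u <= T -> F (r + 1) (u, x) = beta (X u x) * \1_(cube (r + 1)) x.
    by move=> uT; rewrite /F flowE//= [X in _ * (X * _)]indicE mem_set ?mul1r//= in_itv.
  rewrite !FE// -mulrBl normrM /g !indicE.
  have [xr|xr] := pselect (cube (r + 1) x); last by rewrite (memNset xr) normr0 !mulr0 add0r mulr_ge0 ?mulr_ge0.
  rewrite mem_set//= normr1 !mulr1.
  have [g0|g0] := ltP gam (enorm (X s x - X s0 x)).
    rewrite (_ : x \in E) ?mulr1; last by rewrite inE; split => //; exact: cb.
    rewrite (le_trans (ler_normB _ _))// (le_trans (lerD (bB _) (bB _)))//.
    have : 0 <= K * gam by rewrite mulr_ge0// ltW.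
    lra.
  rewrite (le_trans (HK _ _))// (le_trans (ler_wpM2l K0 g0))// lerDl.
  by rewrite mulr_ge0 ?mulr_ge0.
rewrite gE mulrDr.
have h1 : M * (K * gam * V) <= e / 2.
  have -> : M * (K * gam * V) = (K * M * V) * (e / 2) / (K * M * V + 1) by rewrite /gam; ring.
  rewrite ler_pdivrMr// mulrC ler_wpM2l ?divr_ge0 ?(ltW e0)//; lra.
have h2 : M * (2 * B * fine (leb E)) <= e / 2.
  have lEr : fine (leb E) <= e / 2 / (2 * B * M + 1) by rewrite -lee_fin -Ef ltW.
  have -> : M * (2 * B * fine (leb E)) = 2 * B * M * fine (leb E) by ring.
  have BM0 : 0 <= 2 * B * M := mulr_ge0 (mulr_ge0 (ler0n _ 2) B0) M0.
  rewrite (le_trans (ler_wpM2l BM0 lEr))// mulrA ler_pdivrMr// mulrC ler_wpM2l ?divr_ge0 ?(ltW e0)//; lra.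
lra.
Qed.

Lemma pairing_eq s : t < s <= T ->
  \int[leb]_x (P x * F (r + 1) (s, x)) - \int[leb]_x (P x * F (r + 1) (t, x)) =
  \int[leb]_x (P x * \int[mu]_u (\1_(`]t, s[%classic) u * G (r + 1) (u, x))).
Proof.
move=> /andP[ts sT]; have [C C0 HC] := @rho_bound R n.
have PC x : `|P x| <= C * q ^- n by exact: HC.
pose f s := \int[leb]_x (P x * F (r + 1) (s, x)).
pose g s := \int[leb]_x (P x * G (r + 1) (s, x)).
have mF : mfunT (F (r + 1)) by exact: measurable_L1 (FI _).
have mPF : mfunT (fun z : spacetime R n => P z.2 * F (r + 1) z).
  exact: (measurable_funM (measurableT_comp mP measurable_snd) mF).
have mf : mfunT f by exact: (measurable_Rintegral leb mPF).
have CI := indic_cube_integrable (r + 1).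
have PFle s' x : `|P x * F (r + 1) (s', x)| <= (C * q ^- n * B) * \1_(cube (r + 1)) x.
  rewrite normrM /F /= !normrM -mulrA; apply: ler_pM => //; apply: ler_pM => //.
  rewrite [X in _ * X <= _]ger0_norm ?indicE// ler_piMl ?indicE//.
  by have := indic1 `[t, T]%classic s'; rewrite indicE.
have fB s' : `|f s'| <= C * q ^- n * B * \int[leb]_x \1_(cube (r + 1)) x.
  have zI : integrableT leb (fun=> 0 : R) by exact: integrable0.
  have Z0 : \int[leb]_(x in setT) (0 : R) = 0 by rewrite /Rintegral integral0.
  have I1 : integrableT leb (fun x => P x * F (r + 1) (s', x)).
    exact: (bounded_integrable mP PC (FsI _ s')).
  have := le_RintegralB I1 zI CI (K := C * q ^- n * B).
  rewrite Z0 subr0; apply => x; rewrite subr0; exact: PFle.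
have gI : integrableT mu g by exact: pairing_integrable PC (GI _).
have tT' : t <= t <= T by rewrite lexx (le_trans (ltW ts)).
have sT' : t <= s <= T by rewrite (ltW ts).
have E : f s - f t = \int[mu]_(u in `]t, s[) g u.
  apply: (window_weak ts mf fB gI).
  - move=> e e0; have [d d0 Hd] := pairing_cvg tT' e0; exists (Num.min d (s - t)); first by rewrite lt_min d0 subr_gt0.
    move=> u tu; rewrite -ltrBlDl lt_min => /andP[ud us]; apply: Hd; first by apply/andP; split; lra.
    by rewrite gtr0_norm ?subr_gt0.
  - move=> e e0; have [d d0 Hd] := pairing_cvg sT' e0; exists (Num.min d (s - t)); first by rewrite lt_min d0 subr_gt0.
    move=> u; rewrite ltrBlDr -ltrBlDl lt_min => /andP[ud us] us'; apply: Hd; first by apply/andP; split; lra.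
    by rewrite ltr0_norm ?subr_lt0// opprB.
  - move=> al a c alS ta cs als; apply: (transport_weak alS ta _ als); exact: lt_le_trans cs sT.
have mi : mfunT (\1_(`]t, s[%classic) : R -> R) by apply: measurable_indic; exact: measurable_itv.
rewrite -/(f s) -/(f t) E -(pairing_fubini2 mP PC mi (indic1 _) (GI _)).
rewrite (pairing_fubini mP PC mi (indic1 _) (GI _)) Rintegral_mkcond.
apply: eq_Rintegral => u _; rewrite patchE indicE; case: ifP => _; by rewrite ?mul1r ?mul0r.
Qed.

End pairing.

Let G1I r s : leb2.-integrable setT
  (EFin \o (fun z : spacetime R n => \1_(`]t, s[%classic) z.1 * G r z)).
Proof.
have mi : mfunT (\1_(`]t, s[%classic) : measurableTypeR R -> R).
  by apply: measurable_indic; exact: measurable_itv.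
exact: (bounded_integrable (C := 1) (k := fun z : spacetime R n => \1_(`]t, s[%classic) z.1)
  (measurableT_comp mi measurable_fst) (fun z => indic1 _ _) (GI r)).
Qed.

#[local] Transparent moll.

(** By [pairing_eq] all mollifications of the defect [H] at scales at most 1 vanish on a cube. They
    converge to it in L^1, so it vanishes almost everywhere there, and countably many cubes exhaust
    the space. *)
Lemma transport_eq s : t <= s <= T ->
  {ae leb, forall x, beta (X s x) = beta x + \int[mu]_(u in `]t, s[) transport beta (u, x)}.
Proof.
move=> sT'; have /andP[] := sT'; rewrite le_eqVlt => /predU1P[<- _|ts sT].
  by apply: ae_imply (rlf_initial hX) => x ->; rewrite set_itvoo0 ?Rintegral_set0 ?addr0.
have tT' : t <= t <= T by rewrite lexx ltW.
pose J r x := \int[mu]_u (\1_(`]t, s[%classic) u * G r (u, x)).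
pose H r x := F r (s, x) - F r (t, x) - J r x.
have JI r : integrableT leb (J r) by exact: (integrable_Rintegral2 (G1I r s)).
have DI r : integrableT leb (fun x => F r (s, x) - F r (t, x)).
  exact: (integrableB measurableT (FsI r s) (FsI r t)).
have HI r : integrableT leb (H r) by exact: (integrableB measurableT (DI r) (JI r)).
have [C C0 HC] := @moll_modulus R n.
have H0 (r : nat) : {ae leb, forall x, cube r%:R x -> H (r%:R + 1) x = 0}.
  set h := H (r%:R + 1).
  have m0 k y : cube r%:R y -> moll (2 ^- k) h y = 0.
    move=> yr; have q0 : 0 < 2 ^- k :> R by exact: pow2V_gt0.
    have q1 : 2 ^- k <= 1 :> R by rewrite invf_le1 ?exprn_gt0// exprn_ege1// ler1n.
    have [A A0 HA] := @rho_bound R n.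
    have mP : mfunT (fun x : 'rV[R]_n => rho (2 ^- k) (y - x)).
      exact: (measurableT_comp (measurable_rho _) (measurable_rV_subc y)).
    have PI f : integrableT leb f ->
        integrableT leb (fun x => rho (2 ^- k) (y - x) * f x).
      by move=> fI; apply: (bounded_integrable mP _ fI) => x; exact: HA.
    have := pairing_eq (ler0n _ r) q0 q1 yr (s := s); rewrite ts sT => /(_ isT) E.
    rewrite /moll /h /H.
    under eq_Rintegral do rewrite mulrBr mulrBr.
    rewrite (RintegralB measurableT _ (PI _ (JI _))); last first.
      exact: (integrableB measurableT (PI _ (FsI _ s)) (PI _ (FsI _ t))).
    by rewrite (RintegralB measurableT (PI _ (FsI _ s)) (PI _ (FsI _ t))) E subrr.
  have mh : mfunT h by exact: measurable_L1 (HI _).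
  have mc := @measurable_cube R n r%:R.
  have I0 : (\int[leb]_x `|(h \_ (cube r%:R) x)%:E| = 0)%E.
    apply/eqP; rewrite eq_le; apply/andP; split; last exact: integral_ge0.
    have L : (C%:E * modulus h (2 ^- k))%E @[k --> \oo] --> 0%E.
      by rewrite -[X in _ --> X](mule0 C%:E); exact: (cvgeZl _ (modulus_cvg (HI (r%:R + 1)))).
    rewrite -(cvg_lim _ L)//; apply: lime_ge; first by apply/cvg_ex; exists 0%E.
    apply: nearW => k; apply: le_trans (HC _ _ (pow2V_gt0 R k) (HI (r%:R + 1))).
    apply: ge0_le_integral_lower => //.
    move=> x _; rewrite /= lee_fin patchE; case: ifPn => [|_]; last by rewrite normr0.
    by rewrite inE => xr; rewrite -/h m0// sub0r normrN.
  have mn : mfunT (fun x => `|(h \_ (cube r%:R) x)%:E|)%E.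
    apply: measurableT_comp => //; apply/measurable_EFinP; exact: measurable_patch.
  apply: ae_imply (ge0_integral_ae0 mn (fun x => abse_ge0 _) I0) => x + xr.
  by rewrite patchE mem_set//= => -[/eqP]; rewrite normr_eq0 => /eqP.
have Hn := ae_foralln H0.
apply: filterS2 (rlf_initial hX) Hn => x Xt Hx.
have [r xr] := cube_ex x.
have xr1 : cube (r%:R + 1) x by move: xr; apply: cube_mono; rewrite lerDl.
have := Hx r xr; rewrite /H => /eqP; rewrite subr_eq0 => /eqP.
have FE u : t <= u <= T -> F (r%:R + 1) (u, x) = beta (X u x).
  by move=> uT; rewrite /F flowE//= !indicE !mem_set ?mulr1//= in_itv.
rewrite !FE// Xt => /eqP; rewrite subr_eq addrC => /eqP ->; congr (_ + _).
rewrite Rintegral_mkcond; apply: eq_Rintegral => u _; rewrite /G !patchE indicE.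
have -> : ((u, x) \in setT `*` cube (r%:R + 1)) by rewrite inE.
by case: (u \in _); rewrite ?mul1r ?mul0r.
Qed.

End equation.

End flow.

(** * Truncated logarithm and truncated coordinates *)

Section radial.
Variables (R : realType) (n : nat).
Local Notation V := 'rV[R]_n.
Implicit Types (z v : V).

Lemma differentiable_dotv z : differentiable (fun x : V => dotv x x) z.
Proof.
rewrite (_ : (fun x => _) = \sum_(i < n) (fun x : V => x ord0 i) * (fun x : V => x ord0 i)); last first.
  by apply/funext => x; rewrite fct_sumE.
by apply: differentiable_sum => i; apply: differentiableM; exact: differentiable_coord.
Qed.

Lemma isd_dotv z v : is_derive (0 : R) 1 (fun h : R => dotv (h *: v + z) (h *: v + z)) (2 * dotv z v).
Proof.
have d := isdD (isdM (isd_affine (dotv v v) (2 * dotv z v) (0 : R)) (isd_affine 1 0 (0 : R)))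
  (is_derive_cst (dotv z z) (0 : R) 1).
have E : (fun y => (dotv v v * y + 2 * dotv z v) * (1 * y + 0) + cst (dotv z z) y) =
  (fun h : R => dotv (h *: v + z) (h *: v + z)).
  apply/funext => h; rewrite /dotv /= mulrDl -mulrA [X in _ + X * _]mulr_sumr !mulr_suml -!big_split /=.
  by apply: eq_bigr => i _; rewrite !mxE; ring.
rewrite -E; apply: is_derive_eq d _.
by ring.
Qed.

Lemma differentiable_dotvl v z : differentiable (fun z : V => dotv z v) z.
Proof.
rewrite (_ : (fun x => _) = \sum_(i < n) (fun x : V => x ord0 i) * cst (v ord0 i)); last first.
  by apply/funext => x; rewrite fct_sumE.
by apply: differentiable_sum => i; apply: differentiableM; [exact: differentiable_coord|exact: differentiable_cst].
Qed.

Lemma radial_derive (G : R -> R) z g : is_derive (dotv z z) 1 G g ->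
  differentiable (fun x : V => G (dotv x x)) z /\
  forall v, is_derive (0 : R) 1 (fun h : R => G (dotv (h *: v + z) (h *: v + z))) (g * (2 * dotv z v)).
Proof.
move=> dG; split => [|v].
  apply: (differentiable_comp (f := fun x : V => dotv x x) (g := G)); first exact: differentiable_dotv.
  by apply/derivable1_diffP; case: dG.
have := isd_dotv z v.
apply: (isd_comp (f := G) (g := fun h : R => dotv (h *: v + z) (h *: v + z))).
by rewrite scale0r add0r.
Qed.

Lemma dotv_basis z j : dotv z (basis_rV R j) = z ord0 j.
Proof.
rewrite /dotv (bigD1 j)//= big1 ?addr0; last by move=> i ij; rewrite mxE eqxx/= (negbTE ij) mulr0.
by rewrite mxE !eqxx mulr1.
Qed.

Lemma dotv_enorm z : dotv z z = enorm z ^+ 2.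
Proof. by rewrite sqr_sqrtr// dotvv_ge0. Qed.

Variable ep : R.
Hypotheses (ep0 : 0 < ep) (ep1 : ep <= 1).

Let S0 z : 0 <= dotv z z. Proof. exact: dotvv_ge0. Qed.
Let eS0 z : 0 <= ep * dotv z z. Proof. by rewrite mulr_ge0// ltW. Qed.
Let eS1 z : 0 < 1 + ep * dotv z z. Proof. exact: ltr_pwDl ltr01 (eS0 z). Qed.
Let S1 z : 0 < 1 + dotv z z. Proof. exact: ltr_pwDl ltr01 (S0 z). Qed.
Let eS_le z : ep * dotv z z <= dotv z z. Proof. by rewrite ler_piMl. Qed.

(* [log (1 + |z|^2) / 2] truncated to a bounded function *)
Definition log_trunc z : R := 2^-1 * (ln (1 + dotv z z) - ln (1 + ep * dotv z z)).

Let slope z := (1 + dotv z z)^-1 - ep / (1 + ep * dotv z z).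

Let log_trunc_isd z : is_derive (dotv z z) 1 (fun s : R => 2^-1 * (ln (1 + s) - ln (1 + ep * s))) (2^-1 * slope z).
Proof.
have d1' : is_derive (dotv z z) 1 (fun s : R => 1 + s) 1.
  by have := isd_affine 1 1 (dotv z z); congr is_derive; apply/funext => s; rewrite mul1r addrC.
have d2' : is_derive (dotv z z) 1 (fun s : R => 1 + ep * s) ep.
  by have := isd_affine ep 1 (dotv z z); congr is_derive; apply/funext => s; rewrite addrC.
have d1 := isd_comp (f := @ln R) (g := fun s : R => 1 + s) (is_derive1_ln (S1 z)) d1'.
have d2 := isd_comp (f := @ln R) (g := fun s : R => 1 + ep * s) (is_derive1_ln (eS1 z)) d2'.
have := isdM (is_derive_cst (2^-1 : R) (dotv z z) 1) (isdD d1 (isdM (is_derive_cst (-1 : R) (dotv z z) 1) d2)).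
rewrite (_ : (fun y => _) = (fun s : R => 2^-1 * (ln (1 + s) - ln (1 + ep * s)))); last first.
  by apply/funext => s /=; rewrite mulN1r.
by move=> d; apply: is_derive_eq d _; rewrite /= /slope; ring.
Qed.

Let log_trunc_D v z : 'D_v log_trunc z = slope z * dotv z v.
Proof.
apply: derive_line.
have [_ /(_ v) d] := radial_derive (log_trunc_isd z).
by apply: is_derive_eq d _; rewrite mulrACA mulVf ?mul1r// pnatr_eq0.
Qed.

Let diff_inv (c : R) z : 1 + c * dotv z z != 0 -> differentiable (fun z : V => (1 + c * dotv z z)^-1) z.
Proof.
move=> h; apply: (differentiableV (f := fun z : V => 1 + c * dotv z z)) => //.
have cd a : differentiable (cst a : V -> R) z by exact: differentiable_cst.
have d : differentiable (cst 1 + cst c * (fun z : V => dotv z z)) z.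
  apply: differentiableD; first exact: cd.
  by apply: differentiableM; [exact: cd|exact: differentiable_dotv].
exact: d.
Qed.

Lemma log_trunc_gradient z j : gradient log_trunc z ord0 j = slope z * z ord0 j.
Proof. by rewrite /gradient mxE log_trunc_D dotv_basis. Qed.

Lemma log_trunc_bound z : `|log_trunc z| <= 2^-1 * ln ep^-1.
Proof.
rewrite /log_trunc -ln_div ?posrE// normrM gtr0_norm ?invr_gt0// ler_wpM2l ?invr_ge0//.
have le1 : 1 <= (1 + dotv z z) / (1 + ep * dotv z z).
  by rewrite ler_pdivlMr// mul1r lerD2l.
rewrite ger0_norm ?ln_ge0// ler_ln ?posrE ?invr_gt0//; last exact: lt_le_trans ltr01 le1.
rewrite ler_pdivrMr// mulrDr mulr1 mulKf ?gt_eqF// lerD2r.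
by rewrite invf_ge1.
Qed.

Let slope_le z : `|slope z| <= (1 + dotv z z)^-1.
Proof.
have h1 : ep / (1 + ep * dotv z z) <= (1 + dotv z z)^-1.
  rewrite ler_pdivrMr// mulrC ler_pdivlMr// mulrDr mulr1 lerD2r//.
have h2 : 0 <= ep / (1 + ep * dotv z z) by rewrite divr_ge0// ltW.
by rewrite /slope ger0_norm ?subr_ge0// lerBlDr lerDl.
Qed.

Let sum_coord_le z : \sum_(j < n) `|z ord0 j| <= n%:R * enorm z.
Proof.
apply: (@le_trans _ _ (\sum_(j < n) enorm z)); first by apply: ler_sum => j _; exact: coord_le_enorm.
by rewrite sumr_const card_ord mulr_natl.
Qed.

Let enorm1 z : 0 < 1 + enorm z.
Proof. exact: ltr_pwDl ltr01 (enorm_ge0 z). Qed.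

(** The constant does not depend on [ep], so the bound derived along the flow survives the removal
    of the truncation. It comes from [\sum |z_j| <= n |z|] and [|z| (1 + |z|) <= 2 (1 + |z|^2)]. *)
Lemma log_trunc_gradient_le z : enorm (gradient log_trunc z) <= (2 * n%:R) / (1 + enorm z).
Proof.
rewrite (le_trans (enorm_le_sum _))//.
under eq_bigr do rewrite log_trunc_gradient normrM.
rewrite -mulr_sumr (le_trans (ler_pM _ _ (slope_le z) (sum_coord_le z)))// ?sumr_ge0//.
rewrite mulrC ler_pdivrMr// mulrAC ler_pdivlMr//.
have := dotv_enorm z; have := enorm_ge0 z; set a := enorm z => a0 ->.
rewrite -mulrA [X in _ <= X * _]mulrC -mulrA ler_wpM2l//.
have : 0 <= (a - 1) ^+ 2 by exact: sqr_ge0.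
rewrite !expr2; nra.
Qed.

Let ln1_ge0 z : 0 <= ln (1 + enorm z).
Proof. by rewrite ln_ge0// lerDl enorm_ge0. Qed.

Let log_C1I beta B C : C1_on setT beta -> (forall z, `|beta z| <= B) ->
  (forall z, enorm (gradient beta z) <= C / (1 + enorm z)) -> log_C1 beta.
Proof.
move=> h bB gC; split => //; exists (`|B| + `|C|) => z; split.
  rewrite (le_trans (bB z))// (le_trans (ler_norm _))// (@le_trans _ _ (`|B| + `|C|)) ?lerDl//.
  by rewrite ler_peMr ?addr_ge0// lerDl.
rewrite (le_trans (gC z))// ler_pM2r ?invr_gt0// (le_trans (ler_norm _))// lerDr//.
Qed.

Lemma log_trunc_C1 : log_C1 log_trunc.
Proof.
apply: (log_C1I _ log_trunc_bound log_trunc_gradient_le) => z _; split.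
  by have [] := radial_derive (log_trunc_isd z).
move=> v; rewrite (_ : 'D_v log_trunc = (fun z => slope z * dotv z v)); last by apply/funext => x; exact: log_trunc_D.
 apply: differentiable_continuous.
apply: (differentiableM (f := slope) (g := fun z : V => dotv z v)); last exact: differentiable_dotvl.
have h1 : 1 + 1 * dotv z z != 0 by rewrite mul1r gt_eqF.
have h2 : 1 + ep * dotv z z != 0 by rewrite gt_eqF.
have d1 := diff_inv h1; have d2 := diff_inv h2.
rewrite (_ : slope = (fun z : V => (1 + 1 * dotv z z)^-1) - cst ep * (fun z : V => (1 + ep * dotv z z)^-1)); last first.
  by apply/funext => x; rewrite /slope /= !fctE mul1r.
by apply: differentiableB => //; apply: differentiableM; [exact: differentiable_cst|].
Qed.

Lemma log_trunc_le z : log_trunc z <= 2^-1 * ln (1 + dotv z z).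
Proof. by rewrite /log_trunc ler_wpM2l ?invr_ge0// lerBlDr lerDl ln_ge0// lerDl. Qed.

Let damp z := (1 + ep * dotv z z)^-1.

(** The coordinate divided by [1 + ep |z|^2], a bounded admissible renormalization. Its gradient
    bound degenerates with [ep], but on bounded sets the function and its gradient approach those of
    the coordinate at rate [ep], which suffices once trajectories are known to be bounded. *)
Definition coord_trunc (i : 'I_n) z : R := z ord0 i * damp z.

Let damp_isd z : is_derive (dotv z z) 1 (fun s : R => (1 + ep * s)^-1) (- ep * damp z ^+ 2).
Proof.
have d : is_derive (dotv z z) 1 (fun s : R => 1 + ep * s) ep.
  by have := isd_affine ep 1 (dotv z z); congr is_derive; apply/funext => s; rewrite addrC.
have := isdV (f := fun s : R => 1 + ep * s) (lt0r_neq0 (eS1 z)) d => {}d.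
by apply: is_derive_eq d _; rewrite /damp -exprVn; ring.
Qed.

Let coord_trunc_D i v z : 'D_v (coord_trunc i) z =
  damp z * v ord0 i - 2 * ep * z ord0 i * dotv z v * damp z ^+ 2.
Proof.
apply: derive_line.
have [_ /(_ v) d] := radial_derive (damp_isd z).
have {}d := isdM (isd_affine (v ord0 i) (z ord0 i) 0) d.
have -> : (fun h : R => coord_trunc i (h *: v + z)) =
    (fun h : R => (v ord0 i * h + z ord0 i) * (1 + ep * dotv (h *: v + z) (h *: v + z))^-1).
  by apply/funext => h; rewrite /coord_trunc /damp !mxE (mulrC h).
by apply: is_derive_eq d _; rewrite scale0r add0r /damp; ring.
Qed.

Let damp0 z : 0 < damp z. Proof. by rewrite invr_gt0. Qed.
Let damp_le1 z : damp z <= 1. Proof. by rewrite invf_le1// lerDl. Qed.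
Let damp_S z : 1 - damp z = ep * dotv z z * damp z.
Proof. by rewrite -[X in X - _](mulfV (lt0r_neq0 (eS1 z))) /damp; ring. Qed.

Let coord2 z i j : `|z ord0 i * z ord0 j| <= dotv z z.
Proof. by rewrite normrM dotv_enorm expr2 ler_pM// coord_le_enorm. Qed.

Lemma coord_trunc_gradient i z j :
  `|gradient (coord_trunc i) z ord0 j - (i == j)%:R| <= 3 * ep * dotv z z.
Proof.
rewrite /gradient mxE coord_trunc_D dotv_basis mxE eqxx /=.
have -> : damp z * (i == j)%:R - 2 * ep * z ord0 i * z ord0 j * damp z ^+ 2 - (i == j)%:R =
  - (ep * dotv z z * damp z) * (i == j)%:R - 2 * ep * (z ord0 i * z ord0 j) * damp z ^+ 2.
  by rewrite -damp_S; ring.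
have e0 : 0 <= ep by exact: ltW.
have d0 : 0 <= damp z by exact: ltW.
rewrite (le_trans (ler_normB _ _))//.
have h1 : `|- (ep * dotv z z * damp z) * (i == j)%:R| <= ep * dotv z z.
  rewrite normrM normrN (ger0_norm (mulr_ge0 (eS0 z) d0)).
  rewrite -[leRHS]mulr1 ler_pM ?mulr_ge0//; first by rewrite ler_piMr.
  by case: (i == j); rewrite ?normr1 ?normr0.
have h2 : `|2 * ep * (z ord0 i * z ord0 j) * damp z ^+ 2| <= 2 * ep * dotv z z.
  have p0 : 0 <= 2 * ep by rewrite mulr_ge0.
  have q0 : 0 <= damp z ^+ 2 := exprn_ge0 2 d0.
  have q1 : damp z ^+ 2 <= 1 := exprn_ile1 2 d0 (damp_le1 z).
  have cc : `|2 * ep * (z ord0 i * z ord0 j)| <= 2 * ep * dotv z z.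
    by rewrite normrM (ger0_norm p0); apply: ler_wpM2l p0 _ _ (coord2 z i j).
  by rewrite normrM (ger0_norm q0) -[leRHS]mulr1 ler_pM.
rewrite (le_trans (lerD h1 h2))// le_eqVlt; apply/orP; left; apply/eqP; ring.
Qed.

Let enorm_damp z : (1 + enorm z) * damp z <= 2 / ep.
Proof.
rewrite /damp ler_pdivrMr// mulrAC ler_pdivlMr//.
have := dotv_enorm z; have := enorm_ge0 z; set a := enorm z => a0 ->.
have : 0 <= (a - 1) ^+ 2 by exact: sqr_ge0.
have -> : (a - 1) ^+ 2 = 1 + a ^+ 2 - 2 * a by ring.
move=> h; have h1 : ep * a <= ep * (2^-1 * (1 + a ^+ 2)) by rewrite ler_wpM2l ?(ltW ep0)//; lra.
have h2 : 0 <= ep * a ^+ 2 by rewrite mulr_ge0 ?exprn_ge0 ?(ltW ep0).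
have {}h1 : ep * a <= 2^-1 * ep + 2^-1 * (ep * a ^+ 2) by apply: le_trans h1 _; rewrite le_eqVlt; apply/orP; left; apply/eqP; ring.
have -> : (1 + a) * ep = ep + ep * a by ring.
by move: h1 h2 (ep1); lra.
Qed.

Lemma coord_trunc_bound i z : `|coord_trunc i z| <= 2 / ep.
Proof.
rewrite normrM (gtr0_norm (damp0 z)) (le_trans _ (enorm_damp z))// ler_wpM2r ?(ltW (damp0 z))//.
by rewrite (le_trans (coord_le_enorm z i))// lerDr.
Qed.

Lemma coord_trunc_gradient_le i z :
  enorm (gradient (coord_trunc i) z) <= (n%:R * (6 / ep)) / (1 + enorm z).
Proof.
rewrite (le_trans (enorm_le_sum _))//.
apply: (@le_trans _ _ (\sum_(j < n) 6 / ep / (1 + enorm z))); last first.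
  by rewrite sumr_const card_ord -[leRHS]mulrA -[leLHS]mulr_natl.
apply: ler_sum => j _; rewrite /gradient mxE coord_trunc_D dotv_basis mxE eqxx /=.
have d0 : 0 <= damp z by exact: ltW.
have h : `|damp z * (i == j)%:R - 2 * ep * z ord0 i * z ord0 j * damp z ^+ 2| <= 3 * damp z.
  rewrite (le_trans (ler_normB _ _))//.
  have h1 : `|damp z * (i == j)%:R| <= damp z.
    by rewrite normrM (ger0_norm d0) ler_piMr//; case: (i == j); rewrite ?normr1 ?normr0.
  have h2 : `|2 * ep * z ord0 i * z ord0 j * damp z ^+ 2| <= 2 * damp z.
    have -> : 2 * ep * z ord0 i * z ord0 j * damp z ^+ 2 = 2 * damp z * (ep * damp z * (z ord0 i * z ord0 j)) by ring.
    have p0 : 0 <= 2 * damp z by rewrite mulr_ge0.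
    have q0 : 0 <= ep * damp z by rewrite mulr_ge0// ltW.
    rewrite normrM (ger0_norm p0) ler_piMr// normrM (ger0_norm q0).
    rewrite (le_trans (ler_wpM2l q0 (coord2 z i j)))// mulrAC -damp_S lerBlDr lerDl//.
  rewrite (le_trans (lerD h1 h2))// le_eqVlt; apply/orP; left; apply/eqP; ring.
rewrite (le_trans h)// ler_pdivlMr//.
have -> : 3 * damp z * (1 + enorm z) = 3 * ((1 + enorm z) * damp z) by ring.
have -> : 6 / ep = 3 * (2 / ep) by ring.
exact: ler_wpM2l (ler0n _ 3) _ _ (enorm_damp z).
Qed.

Lemma coord_trunc_C1 i : log_C1 (coord_trunc i).
Proof.
have c1 z : differentiable damp z.
  by apply: diff_inv; rewrite gt_eqF.
have cc j z : differentiable (fun z : V => z ord0 j) z by exact: differentiable_coord.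
apply: (log_C1I _ (coord_trunc_bound i) (coord_trunc_gradient_le i)) => z _; split.
  apply: differentiableM; first exact: differentiable_coord.
  by have [] := radial_derive (damp_isd z).
move=> v; apply: differentiable_continuous.
rewrite (_ : 'D_v (coord_trunc i) = damp * cst (v ord0 i) -
  cst (2 * ep) * (fun z : V => z ord0 i) * (fun z : V => dotv z v) * (damp * damp)).
  have cd c : differentiable (cst c : V -> R) z by exact: differentiable_cst.
  have dd : differentiable (fun z : V => dotv z v) z by exact: differentiable_dotvl.
  by apply: differentiableB; do ?apply: differentiableM.
by apply/funext => x; rewrite coord_trunc_D !fctE /= expr2.
Qed.

Lemma coord_trunc_near i z : `|coord_trunc i z - z ord0 i| <= ep * (dotv z z * `|z ord0 i|).
Proof.
have -> : coord_trunc i z - z ord0 i = - (z ord0 i * (1 - damp z)) by rewrite /coord_trunc; ring.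
have p0 : 0 <= ep * dotv z z * damp z by rewrite mulr_ge0// ltW.
rewrite normrN normrM damp_S (ger0_norm p0) mulrC mulrA ler_wpM2r//.
by rewrite ler_piMr.
Qed.

End radial.

(** * Integral trajectories *)

Lemma Rintegral_dom (R : realType) (f g : R -> R) : let mu := @lebesgue_measure R in
  mfunT f -> integrableT mu g -> (forall u, 0 <= g u) ->
  {ae mu, forall u, `|f u| <= g u} ->
  integrableT mu f /\
  forall D : set R, measurable D -> `|\int[mu]_(u in D) f u| <= \int[mu]_u g u.
Proof.
move=> mu mf gI g0 fg; have mg : mfunT g by exact: measurable_L1 gI.
have mf' : mfunT (EFin \o f) by exact/measurable_EFinP.
have le1 : (\int[mu]_u `|(f u)%:E| <= \int[mu]_u (g u)%:E)%E.
  apply: (@ae_ge0_le_integral _ (measurableTypeR R)).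
  - exact: measurableT.
  - by move=> u _; exact: abse_ge0.
  - by apply: measurableT_comp.
  - by move=> u _; rewrite lee_fin.
  - exact/measurable_EFinP.
  - by apply: ae_imply fg => u fgu _; rewrite lee_fin.
have gE : (\int[mu]_u (g u)%:E = (\int[mu]_u g u)%:E)%E.
  by rewrite /Rintegral fineK//; exact: (@integrable_fin_num _ (measurableTypeR R)).
split; first by apply/integrableP; split => //; apply: le_lt_trans le1 _; rewrite gE ltry.
move=> D mD; rewrite -lee_fin -gE; apply: le_trans le1.
apply: (@le_trans _ _ `|\int[mu]_(u in D) (f u)%:E|%E).
  by rewrite /Rintegral; case: (\int[_]_(_ in _) _)%E => [v||] /=; rewrite ?normr0 ?leey.
apply: (@le_trans _ _ (\int[mu]_(u in D) `|(f u)%:E|)%E).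
  by apply: le_abse_integral => //; exact: measurable_funTS mf'.
apply: (@ge0_subset_integral _ (measurableTypeR R)) => //.
by apply: measurableT_comp.
Qed.

Section flow_path.
Variables (R : realType) (n : nat) (T t : R) (b X : R -> 'rV[R]_n -> 'rV[R]_n).
Hypotheses (t0 : 0 <= t) (tT : t < T) (mb : measurable_field T b) (hR1 : R1 T b).
Hypothesis hX : regular_lagrangian_flow T b t X.
Local Notation leb := (@lebesgue_rV R n).
Local Notation flow := (flow T t X).
Local Notation vel := (velocity T t b X).
Local Notation drf := (drift T b flow).

Let mflow := measurable_flow hX.

Lemma drift_ae_integrable : {ae leb, forall x j, integrableT mu (fun s => drf j (s, x))}.
Proof.
have H (r : nat) : {ae leb, forall x j, cube r%:R x -> integrableT mu (fun s => drf j (s, x))}.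
  apply: filter_forall => j; apply: ae_imply (ae_integrable2 (drift_integrable mb hR1 hX j r%:R)) => x xI xr.
  apply: eq_integrable xI => // s _ /=; rewrite patchE.
  by have -> : ((s, x) \in setT `*` cube r%:R) by rewrite inE.
apply: ae_imply (ae_foralln H) => x Hx j; have [r xr] := cube_ex x; exact: Hx r j xr.
Qed.

Let dsum z := \sum_(j < n) drf j z.

Let dsum_ge0 z : 0 <= dsum z. Proof. by apply: sumr_ge0 => j _; exact: drift_ge0. Qed.

Let mdsum : mfunT dsum.
Proof. by apply: measurable_sum => j; exact: (measurable_drift mb mflow j). Qed.

Let dsum_integrable x : (forall j, integrableT mu (fun s => drf j (s, x))) ->
  integrableT mu (fun s => dsum (s, x)).
Proof. by move=> H; exact: (@Rintegral_sum _ _ (measurableTypeR R) mu _ (index_enum 'I_n) _ (fun j => H j)).1. Qed.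

Let level x := 2^-1 * ln (1 + dotv x x) + 2 * n%:R * \int[mu]_s dsum (s, x).

(* a bound on [|X(s, x)|^2] that does not depend on [s] *)
Definition envelope (x : 'rV[R]_n) : R := expR (2 * level x + 1).

Let S1 (z : 'rV[R]_n) : 0 < 1 + dotv z z. Proof. exact: ltr_pwDl ltr01 (dotvv_ge0 z). Qed.

Let mdotv : mfunT (fun x : 'rV[R]_n => dotv x x).
Proof.
by apply: measurable_sum => j; apply: measurable_funM; exact: measurable_coord.
Qed.

Lemma measurable_envelope : mfunT envelope.
Proof.
apply: measurableT_comp; first exact: measurable_expR.
apply: measurable_funD => //; apply: measurable_funM => //; apply: measurable_funD.
  apply: measurable_funM => //; apply: measurableT_comp; first exact: measurable_ln.
  exact: measurable_funD.
apply: measurable_funM => //; exact: (measurable_Rintegral2 mu mdsum).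
Qed.

Let level_ge x : 2^-1 * ln (1 + dotv x x) <= level x.
Proof. by rewrite lerDl mulr_ge0 ?mulr_ge0//; apply: Rintegral_ge0. Qed.

Let envelope_of x (w : 'rV[R]_n) : ln (1 + dotv w w) <= 2 * level x + 1 -> dotv w w <= envelope x.
Proof.
move=> h; rewrite -[dotv w w]addr0 (@le_trans _ _ (1 + dotv w w)) ?[1 + _]addrC ?lerD2l//.
by rewrite [_ + 1]addrC -[leLHS]lnK ?posrE// ler_expR.
Qed.

Let inv1 k : 0 < k.+1%:R^-1 :> R. Proof. by rewrite invr_gt0. Qed.
Let inv_le1 k : k.+1%:R^-1 <= 1 :> R. Proof. by rewrite invf_le1// ler1n. Qed.

(** The equation holds outside one null set for all truncations 1/(k+1) at once, so [k] may be
    chosen from the position [w] itself with [ep |w|^2 <= 1]. The truncation then costs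
    [ln (1 + ep |w|^2) <= 1], the last term in [envelope]. *)
Lemma flow_envelope s : {ae leb, forall x, dotv (flow (s, x)) (flow (s, x)) <= envelope x}.
Proof.
have [sT|sT] := boolP (t <= s <= T); last first.
  apply: aeW => x; rewrite /flow /= (negbTE sT); apply: envelope_of.
  by have := level_ge x; lra.
have E k := transport_eq t0 tT mb hR1 hX (log_trunc_C1 n (inv1 k) (inv_le1 k)) (log_trunc_bound (inv1 k) (inv_le1 k)) sT.
apply: filterS2 (ae_foralln E) drift_ae_integrable => x Ex xI.
rewrite flowE//; set w := X s x in Ex *; apply: envelope_of.
pose k := Num.truncn (dotv w w).
have wk : k.+1%:R^-1 * dotv w w <= 1 by rewrite mulrC ler_pdivrMr// mul1r ltW// truncnS_gt.
have mtr : mfunT (fun u => transport T t b X (log_trunc k.+1%:R^-1) (u, x)).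
  apply: (measurableT_comp _ (pair2_measurable x)); exact: (measurable_transport mb hX (log_trunc_C1 n (inv1 k) (inv_le1 k))).
have gI := integrableZl measurableT (2 * n%:R) (dsum_integrable xI).
have tr_le u : `|transport T t b X (log_trunc k.+1%:R^-1) (u, x)| <= 2 * n%:R * dsum (u, x).
  rewrite /dsum; exact: (transport_le T t b X (log_trunc_gradient_le (inv1 k) (inv_le1 k)) (u, x)).
have g0 u : 0 <= 2 * n%:R * dsum (u, x) by exact: le_trans (normr_ge0 _) (tr_le u).
have [_ /(_ `]t, s[%classic (measurable_itv _))] := Rintegral_dom mtr gI g0 (aeW _ tr_le).
rewrite RintegralZl//; last exact: dsum_integrable.
move=> /(le_trans (ler_norm _)) h1; have h2 := Ex k.
have h3 := log_trunc_le (inv1 k) x.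
have h4 : ln (1 + k.+1%:R^-1 * dotv w w) <= 1.
  rewrite (le_trans (le_ln1Dx _))//; apply: lt_le_trans (_ : 0 <= _); rewrite ?ltrN10//.
  by rewrite mulr_ge0 ?dotvv_ge0// ltW.
move: h2; rewrite {1}/log_trunc => h2; rewrite /level.
set L := ln (1 + dotv w w) in h2 *; set L' := ln (1 + k.+1%:R^-1 * dotv w w) in h2 h4.
move: h1 h2 h3 h4; lra.
Qed.

(** The null set of [flow_envelope] depends on [s]; the positive part of the excess over the
    envelope is the function to which the exchange of quantifiers applies. *)
Lemma flow_envelope_ae : {ae leb, forall x, {ae mu, forall s, dotv (flow (s, x)) (flow (s, x)) <= envelope x}}.
Proof.
pose F (z : spacetime R n) := (Num.max 0 (dotv (flow z) (flow z) - envelope z.2))%:E.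
have mF : mfunT F.
  apply/measurable_EFinP; apply: measurable_maxr => //; apply: measurable_funB.
    exact: (measurableT_comp mdotv mflow).
  exact: (measurableT_comp measurable_envelope measurable_snd).
have FP s x : F (s, x) = 0%E <-> dotv (flow (s, x)) (flow (s, x)) <= envelope x.
  by rewrite /F /= -subr_le0; split => [[/max_idPl]|/max_idPl ->].
have F0 z : (0 <= F z)%E by rewrite lee_fin le_max lexx.
have := ge0_ae_swap mF F0; case=> [|A [mA A0 HA]].
  by apply: aeW => s; apply: ae_imply (flow_envelope s) => x /FP.
exists A; split => // x Nx; apply: HA => H; apply: Nx.
by apply: ae_imply H => s /FP.
Qed.

Let mvel i x : mfunT (fun s => vel i (s, x)).
Proof. exact: (measurableT_comp (measurable_velocity mb hX i) (pair2_measurable x)). Qed.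

Let vsum z := \sum_(j < n) `|vel j z|.

(** Along a bounded trajectory the factor [1 + |X|] lost in [drift] is at most [2 + envelope x], by
    [1 + a <= 2 + a^2]. *)
Lemma velocity_ae_integrable : {ae leb, forall x j, integrableT mu (fun s => vel j (s, x))}.
Proof.
apply: filterS2 drift_ae_integrable flow_envelope_ae => x xI xe j.
have e0 : 0 <= 2 + envelope x by rewrite addr_ge0// expR_ge0.
have gI := integrableZl measurableT (2 + envelope x) (xI j).
apply: (Rintegral_dom (mvel j x) gI _ _).1 => [u|]; first by rewrite mulr_ge0// drift_ge0.
apply: ae_imply xe => u ue; have w1 : 0 < 1 + enorm (flow (u, x)) := ltr_pwDl ltr01 (enorm_ge0 _).
have -> : `|vel j (u, x)| = (1 + enorm (flow (u, x))) * drf j (u, x).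
  by rewrite /drift mulrC divfK ?gt_eqF.
rewrite ler_wpM2r ?drift_ge0//; move: ue; rewrite dotv_enorm; set a := enorm _; move: (envelope x) => e.
have : 0 <= (a - 1) ^+ 2 by exact: sqr_ge0.
have -> : (a - 1) ^+ 2 = 1 + a ^+ 2 - 2 * a by ring.
have : 0 <= a ^+ 2 by exact: sqr_ge0.
lra.
Qed.

(** The truncated coordinates satisfy the equation for every [k]. All their errors are at most
    1/(k+1) times a quantity [K] that depends on [x] but not on [k]. *)
Lemma flow_integral s i : t <= s <= T ->
  {ae leb, forall x, X s x ord0 i = x ord0 i + \int[mu]_(u in `]t, s[) vel i (u, x)}.
Proof.
move=> sT.
have E k := transport_eq t0 tT mb hR1 hX (coord_trunc_C1 (inv1 k) (inv_le1 k) i) (coord_trunc_bound (inv1 k) (inv_le1 k) i) sT.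
have EA := ae_foralln E.
apply: filterS3 EA velocity_ae_integrable flow_envelope_ae => x Ex vI xe.
set w := X s x in Ex *; set I := \int[mu]_(u in _) _.
have vsI : integrableT mu (fun u => vsum (u, x)).
  have vnI j : integrableT mu (fun u => `|vel j (u, x)|).
    exact: (integrable_norm (vI j)).
  exact: (@Rintegral_sum _ _ (measurableTypeR R) mu _ (index_enum 'I_n) _ (fun j => vnI j)).1.
pose K := dotv w w * `|w ord0 i| + dotv x x * `|x ord0 i| + 3 * envelope x * \int[mu]_u vsum (u, x).
suff Kk k : `|w ord0 i - (x ord0 i + I)| <= k.+1%:R^-1 * K.
  apply/eqP; rewrite -subr_eq0 -normr_le0 leNgt; apply/negP => d0.
  have := Kk (Num.truncn (K / `|w ord0 i - (x ord0 i + I)|)); set k := Num.truncn _.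
  rewrite mulrC ler_pdivlMr// leNgt => /negP; apply.
  by rewrite mulrC -ltr_pdivrMr// truncnS_gt.
set ep := k.+1%:R^-1; have ep0 : 0 < ep by exact: inv1.
have ep1 : ep <= 1 by exact: inv_le1.
pose f u := transport T t b X (coord_trunc ep i) (u, x) - vel i (u, x).
have mtr : mfunT (fun u => transport T t b X (coord_trunc ep i) (u, x)).
  apply: (measurableT_comp _ (pair2_measurable x)); exact: (measurable_transport mb hX (coord_trunc_C1 ep0 ep1 i)).
have mf : mfunT f by exact: (measurable_funB mtr (mvel i x)).
have c0 : 0 <= 3 * ep * envelope x by rewrite !mulr_ge0 ?expR_ge0 ?ltW.
have gI := integrableZl measurableT (3 * ep * envelope x) vsI.
have g0 u : 0 <= 3 * ep * envelope x * vsum (u, x) by rewrite mulr_ge0// sumr_ge0.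
have fg : {ae mu, forall u, `|f u| <= 3 * ep * envelope x * vsum (u, x)}.
  apply: ae_imply xe => u ue.
  have -> : f u = \sum_(j < n) (gradient (coord_trunc ep i) (flow (u, x)) ord0 j - (i == j)%:R) * vel j (u, x).
    rewrite /f /transport; under [RHS]eq_bigr do rewrite mulrBl.
    rewrite sumrB; congr (_ - _); rewrite (bigD1 i)//= eqxx mul1r big1 ?addr0// => j ji.
    by rewrite eq_sym (negbTE ji) mul0r.
  rewrite (le_trans (ler_norm_sum _ _ _))// mulr_sumr; apply: ler_sum => j _.
  rewrite normrM ler_wpM2r//; have := coord_trunc_gradient ep0 i (flow (u, x)) j => /le_trans; apply.
  by rewrite ler_wpM2l// mulr_ge0// ltW.
have [fI /(_ `]t, s[%classic (measurable_itv _)) fle] := Rintegral_dom mf gI g0 fg.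
have hE : \int[mu]_(u in `]t, s[) transport T t b X (coord_trunc ep i) (u, x) = \int[mu]_(u in `]t, s[) f u + I.
  have mi : measurable (`]t, s[%classic : set R) by exact: measurable_itv.
  rewrite -(@RintegralD _ (measurableTypeR R) R mu _ f (fun u => vel i (u, x)) mi (integrable_sub mi fI) (integrable_sub mi (vI i))).
  by apply: eq_Rintegral => u _; rewrite /f subrK.
have := Ex k; rewrite -/ep hE => {}hE.
have h1 := coord_trunc_near ep0 i w; have h2 := coord_trunc_near ep0 i x.
have -> : w ord0 i - (x ord0 i + I) = - (coord_trunc ep i w - w ord0 i) + (coord_trunc ep i x - x ord0 i) + \int[mu]_(u in `]t, s[) f u.
  by rewrite hE; ring.
move: fle; rewrite RintegralZl// => fle.
rewrite (le_trans (ler_normD _ _))// (le_trans (lerD (ler_normD _ _) (lexx _)))// normrN.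
rewrite (le_trans (lerD (lerD h1 h2) fle))// le_eqVlt; apply/orP; left; apply/eqP; rewrite /K; ring.
Qed.

End flow_path.

(** * Uniqueness *)

Section trunc_field_integrable.
Variables (R : realType) (n : nat) (T : R) (b : R -> 'rV[R]_n -> 'rV[R]_n).
Hypotheses (mb : measurable_field T b) (hR1 : R1 T b).
Local Notation leb := (@lebesgue_rV R n).

(** The drift estimate for the identity map, whose compression constant is 1; on the cube the weight
    [1 + |x|] is bounded. *)
Lemma trunc_field_integrable i r : integrableT leb2 (trunc_field T b i r).
Proof.
have ZL (s : measurableTypeR R) A : measurable A ->
    (leb ((fun x : 'rV[R]_n => snd (s, x)) @^-1` A) <= 1%:E * leb A)%E by move=> _; rewrite mul1e.
have dI := stripcube_integrable (measurable_drift mb measurable_snd i) (fun z => drift_ge0 _ _ _ _ z)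
  (drift_lty mb hR1 measurable_snd ler01 ZL i r).
have mS : measurable (`]0, T[%classic `*` @cube R n r : set (spacetime R n)).
  by apply: measurableX; [exact: measurable_itv|exact: measurable_cube].
have mt : mfunT (trunc_field T b i r).
  rewrite /trunc_field; apply: (measurable_restrictT (fun z => b z.1 z.2 ord0 i) mS).1.
  apply: (measurableT_comp (measurable_coord i)); apply: measurable_funS mb; first exact: measurable_stripE.
  by move=> z [zT _]; split.
have r0 : 0 <= 1 + `|r| *+ n by rewrite addr_ge0// mulrn_wge0.
apply: (le_integrable measurableT _ _ (integrableZl measurableT (1 + `|r| *+ n) dI)); first exact/measurable_EFinP.
move=> [s x] _ /=; rewrite lee_fin (le_trans _ (ler_norm _))// /trunc_field patchE.
case: ifPn => [|_]; last by rewrite normr0 mulr_ge0// patchE; case: ifP => // _; exact: drift_ge0.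
rewrite inE => -[/= sT xr]; rewrite in_itv/= in sT.
rewrite patchE ifT; last by rewrite inE.
rewrite /drift field0E//= mulrA ler_pdivlMr ?ltr_pwDl ?enorm_ge0// mulrC ler_wpM2r//.
rewrite lerD2l (le_trans (enorm_le_sum x))//.
have -> : `|r| *+ n = \sum_(j < n) `|r| by rewrite sumr_const card_ord.
by apply: ler_sum => j _; rewrite (le_trans (xr j))// ler_norm.
Qed.

End trunc_field_integrable.

(** * Comparison of two flows *)

Section uniqueness.
Variables (R : realType) (n : nat) (T t : R) (b X Y : R -> 'rV[R]_n -> 'rV[R]_n).
Hypotheses (t0 : 0 <= t) (tT : t < T) (mb : measurable_field T b) (hR1 : R1 T b) (hR2 : R2 T b).
Hypotheses (hX : regular_lagrangian_flow T b t X) (hY : regular_lagrangian_flow T b t Y).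
Local Notation leb := (@lebesgue_rV R n).
Local Notation fX := (flow T t X).
Local Notation fY := (flow T t Y).

Let dv i z := velocity T t b X i z - velocity T t b Y i z.

Let mdv i : mfunT (dv i).
Proof. exact: (measurable_funB (measurable_velocity mb hX i) (measurable_velocity mb hY i)). Qed.

(* the distance of the two trajectories, as a function that is continuous in time *)
Let gap (z : spacetime R n) :=
  \sum_(i < n) `|\int[mu]_u (\1_(`[t, z.1]%classic) u * dv i (u, z.2))|.

Let gapE s x : gap (s, x) = \sum_(i < n) `|primitive t (fun u => dv i (u, x)) s|.
Proof.
apply: eq_bigr => i _; congr `|_|; rewrite /primitive [RHS]Rintegral_mkcond.
by apply: eq_Rintegral => u _; rewrite patchE indicE; case: (u \in _); rewrite ?mul1r ?mul0r.
Qed.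

Let gap_ge0 z : 0 <= gap z. Proof. exact: sumr_ge0. Qed.

Let measurable_gap : mfunT gap.
Proof.
apply: measurable_sum => i; apply: measurableT_comp => //.
pose A : set (measurableTypeR R * (spacetime R n)) := [set w | t <= w.1 <= w.2.1].
have m1 : mfunT (fun w : measurableTypeR R * (spacetime R n) => w.1) by exact: measurable_fst.
have m21 : mfunT (fun w : measurableTypeR R * (spacetime R n) => w.2.1).
  exact: (measurableT_comp measurable_fst measurable_snd).
have m22 : mfunT (fun w : measurableTypeR R * (spacetime R n) => w.2.2).
  exact: (measurableT_comp measurable_snd measurable_snd).
have mA : measurable A.
  rewrite (_ : A = (fun w => w.1) @^-1` `[t, +oo[%classic `&` (fun w => w.2.1 - w.1) @^-1` `[0, +oo[%classic).
    apply: measurableI; rewrite -[X in measurable X]setTI; first exact: (m1 measurableT _ (measurable_itv _)).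
    exact: (measurable_funB m21 m1 measurableT (measurable_itv _)).
  by apply/seteqP; split => w; rewrite /A /= !in_itv/= !andbT subr_ge0 => /andP.
have mf : mfunT (fun w : measurableTypeR R * (spacetime R n) => \1_A w * dv i (w.1, w.2.2)).
  apply: measurable_funM; first exact: measurable_indic.
  by apply: (measurableT_comp (mdv i)); apply: measurable_fun_pair.
have := measurable_Rintegral2 mu mf; congr measurable_fun; apply/funext => z.
Qed.

Let dv_ae_integrable : {ae leb, forall x i, integrableT mu (fun u => dv i (u, x))}.
Proof.
apply: filterS2 (velocity_ae_integrable t0 tT mb hR1 hX) (velocity_ae_integrable t0 tT mb hR1 hY) => x HX HY i.
exact: (integrableB measurableT (HX i) (HY i)).
Qed.

Let gap_dist s : t <= s <= T -> {ae leb, forall x, gap (s, x) = dist1 (X s x) (Y s x)}.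
Proof.
move=> sT.
have IX : {ae leb, forall x i, X s x ord0 i = x ord0 i + \int[mu]_(u in `]t, s[) velocity T t b X i (u, x)}.
  by apply: filter_forall => i; exact: flow_integral.
have IY : {ae leb, forall x i, Y s x ord0 i = x ord0 i + \int[mu]_(u in `]t, s[) velocity T t b Y i (u, x)}.
  by apply: filter_forall => i; exact: flow_integral.
have IXY : {ae leb, forall x i, X s x ord0 i - Y s x ord0 i =
    \int[mu]_(u in `]t, s[) velocity T t b X i (u, x) - \int[mu]_(u in `]t, s[) velocity T t b Y i (u, x)}.
  by apply: filterS2 IX IY => x HX HY i; rewrite HX HY; ring.
apply: filterS3 IXY (velocity_ae_integrable t0 tT mb hR1 hX) (velocity_ae_integrable t0 tT mb hR1 hY) => x HXY vX vY.
rewrite gapE; apply: eq_bigr => i _; congr `|_|.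
rewrite primitive_open; last exact: (integrableB measurableT (vX i) (vY i)).
have mi : measurable (`]t, s[%classic : set R) by exact: measurable_itv.
have := @RintegralB _ (measurableTypeR R) R mu _ (fun u => velocity T t b X i (u, x)) (fun u => velocity T t b Y i (u, x))
  mi (integrable_sub mi (vX i)) (integrable_sub mi (vY i)).
by move=> ->; rewrite HXY.
Qed.

Let measurable_dist1 : mfunT (fun z => dist1 (fX z) (fY z)).
Proof.
apply: measurable_sum => i; apply: measurableT_comp => //.
exact: (measurable_funB (measurableT_comp (measurable_coord i) (measurable_flow hX))
  (measurableT_comp (measurable_coord i) (measurable_flow hY))).
Qed.

Let gap_dist_ae : {ae leb, forall x, {ae mu, forall u, t <= u <= T -> gap (u, x) = dist1 (fX (u, x)) (fY (u, x))}}.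
Proof.
pose F (z : spacetime R n) := (\1_(`[t, T]%classic) z.1 * `|gap z - dist1 (fX z) (fY z)|)%:E.
have mi : mfunT (\1_(`[t, T]%classic) : measurableTypeR R -> R).
  by apply: measurable_indic; exact: measurable_itv.
have mF : mfunT F.
  apply/measurable_EFinP; apply: measurable_funM; first exact: (measurableT_comp mi measurable_fst).
  by apply: measurableT_comp => //; exact: (measurable_funB measurable_gap measurable_dist1).
have F0 z : (0 <= F z)%E by rewrite lee_fin mulr_ge0// indicE.
have FP s x : F (s, x) = 0%E <-> (t <= s <= T -> gap (s, x) = dist1 (fX (s, x)) (fY (s, x))).
  rewrite /F /= indicE.
  have -> : (s \in `[t, T]%classic) = (t <= s <= T) by apply/idP/idP; rewrite inE /= in_itv.
  case: (boolP (t <= s <= T)) => sT; last by split => // _; rewrite mul0r.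
  rewrite mul1r; split => [[/eqP]|/(_ isT) ->]; last by rewrite subrr normr0.
  by rewrite normr_eq0 subr_eq0 => /eqP.
have := ge0_ae_swap mF F0; case=> [|A [mA A0 HA]].
  apply: aeW => s; have [sT|sT] := boolP (t <= s <= T).
    by apply: ae_imply (gap_dist sT) => x gx; apply/FP => _; rewrite !flowE.
  by apply: aeW => x; apply/FP; rewrite (negbTE sT).
exists A; split => // x Nx; apply: HA => H; apply: Nx.
by apply: ae_imply H => s /FP.
Qed.

Let adv u x := \sum_(i < n) `|dv i (u, x)|.
Let rate m u x := adv u x / (2 ^- m + gap (u, x)).

Let den_gt0 m z : 0 < 2 ^- m + gap z.
Proof. exact: ltr_pwDl (pow2V_gt0 R m) (gap_ge0 z). Qed.

Let rate_ge0 m u x : 0 <= rate m u x.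
Proof. by rewrite divr_ge0 ?sumr_ge0// ltW. Qed.

Let minv m x : mfunT (fun u => (2 ^- m + gap (u, x))^-1).
Proof.
have mgx : mfunT (fun u => gap (u, x)) by exact: (measurableT_comp measurable_gap (pair2_measurable x)).
pose g (v : R) := (2 ^- m + `|v|)^-1.
have gc : continuous g.
  move=> v; rewrite /continuous_at /g; apply: cvgV; first by rewrite gt_eqF// ltr_pwDl// pow2V_gt0.
  by apply: cvgD; [exact: cvg_cst|apply: cvg_norm; exact: cvg_id].
rewrite (_ : (fun u => _) = g \o (fun u => gap (u, x))); last by apply/funext => u; rewrite /g /= ger0_norm.
exact: (measurableT_comp (continuous_measurable_fun gc) mgx).
Qed.

Let mrate m x : mfunT (fun u => rate m u x).
Proof.
apply: (measurable_funM _ (minv m x)); apply: measurable_sum => i; apply: measurableT_comp => //.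
exact: (measurableT_comp (mdv i) (pair2_measurable x)).
Qed.

(** [log_growth] requires a function continuous in time for the given [x] and vanishing at [t]. The
    distance of the representatives [X], [Y] has this only up to null sets of times, so [gap] stands
    in for it. *)
Let growth m s : t <= s <= T ->
  {ae leb, forall x, ln (1 + gap (s, x) / 2 ^- m) <= \int[mu]_(u in `]t, s[) rate m u x}.
Proof.
move=> sT; apply: ae_imply dv_ae_integrable => x dI.
have d0 := pow2V_gt0 R m.
have aI : integrableT mu (fun u => adv u x).
  have nI i : integrableT mu (fun u => `|dv i (u, x)|) by exact: (integrable_norm (dI i)).
  exact: (@Rintegral_sum _ _ (measurableTypeR R) mu _ (index_enum 'I_n) _ (fun i => nI i)).1.
have mg := minv m x.
have wI : integrableT mu (fun u => rate m u x).
  have gle u : `|(2 ^- m + gap (u, x))^-1| <= (2 ^- m)^-1.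
    by rewrite ger0_norm ?invr_ge0 ?(ltW (den_gt0 _ _))// lef_pV2 ?posrE// lerDl.
  have := bounded_integrable mg gle aI.
  by apply: eq_integrable => // u _; rewrite /rate /= mulrC.
rewrite -primitive_open//; apply: (log_growth (ltW tT) d0 (D := fun u => gap (u, x)) (a := fun u => adv u x)) => //.
- rewrite (_ : (fun u => gap (u, x)) = fun u => \sum_(i < n) `|primitive t (fun u => dv i (u, x)) u|); last first.
    by apply/funext => u; rewrite gapE.
  elim: (index_enum _) => [|i l IH].
    by rewrite (_ : (fun u => _) = cst 0) => [v|]; [exact: cvg_cst|apply/funext => u; rewrite big_nil].
  rewrite (_ : (fun u => _) = (fun u => `|primitive t (fun v => dv i (v, x)) u|) +
    (fun u => \sum_(j <- l) `|primitive t (fun v => dv j (v, x)) u|)); last by apply/funext => u; rewrite big_cons.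
  apply/subspace_continuousP => v vT; have /subspace_continuousP/(_ v vT) h2 := IH.
  have /subspace_continuousP/(_ v vT) h1 := primitive_continuous (ltW tT) (dI i).
  exact: (cvgD (cvg_norm h1) h2).
- rewrite gapE big1// => i _; rewrite /primitive set_itv1 Rintegral_set1 normr0//.
- by move=> u; rewrite /rate divfK// gt_eqF.
- move=> s1 s2 ts1 s12 s2T; rewrite !gapE -sumrB.
  have mi : measurable (`[s1, s2]%classic : set R) by exact: measurable_itv.
  have m1 : mfunT (\1_(`[s1, s2]%classic) : measurableTypeR R -> R) by exact: measurable_indic.
  have E f : primitive s1 f s2 = \int[mu]_u (\1_(`[s1, s2]%classic) u * f u).
    rewrite /primitive [LHS]Rintegral_mkcond; apply: eq_Rintegral => u _.
    by rewrite patchE indicE; case: (u \in _); rewrite ?mul1r ?mul0r.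
  have i1 (u : measurableTypeR R) : `|\1_(`[s1, s2]%classic) u| <= 1 :> R.
    by rewrite indicE; case: (u \in _); rewrite ?normr1 ?normr0.
  have nI i := bounded_integrable (C := 1) m1 i1 (integrable_norm (dI i)).
  have -> : primitive s1 (fun u => adv u x) s2 = \sum_(i < n) primitive s1 (fun u => `|dv i (u, x)|) s2.
    under [RHS]eq_bigr do rewrite E.
    rewrite -(@Rintegral_sum _ _ (measurableTypeR R) mu _ (index_enum 'I_n) _ (fun i => nI i)).2 E.
    by apply: eq_Rintegral => u _; rewrite /adv mulr_sumr.
  apply: ler_sum => i _; rewrite (primitive_chasles (dI i) ts1 s12).
  rewrite lerBlDl (le_trans (ler_normD _ _))// lerD2l.
  exact: (@le_normr_Rintegral _ (measurableTypeR R) R mu _ _ mi (integrable_sub mi (dI i))).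
Qed.

(** Starting points from which both trajectories remain, at almost every time, in the cube of radius
    [k]; only the weight on that cube is then needed. *)
Let G (k : nat) := [set x | envelope T t b X x <= k%:R ^+ 2 /\ envelope T t b Y x <= k%:R ^+ 2].

Let mG k : measurable (G k).
Proof.
have mle (f : 'rV[R]_n -> R) c : mfunT f -> measurable [set x | f x <= c].
  move=> mf; rewrite (_ : [set x | f x <= c] = f @^-1` `]-oo, c]); last by apply/seteqP; split => x; rewrite /= in_itv.
  by rewrite -[X in measurable X]setTI; exact: (mf measurableT _ (measurable_itv _)).
exact: (measurableI _ _ (mle _ _ (measurable_envelope mb hX)) (mle _ _ (measurable_envelope mb hY))).
Qed.

Let cube_of k (w : 'rV[R]_n) e : dotv w w <= e -> e <= k%:R ^+ 2 -> cube k%:R w.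
Proof.
move=> we ek j; apply: le_trans (coord_le_enorm w j) _.
rewrite /enorm -[leRHS]ger0_norm ?ler0n// -sqrtr_sqr ler_wsqrtr//; exact: le_trans ek.
Qed.

Let weight_arith (a1 a2 a3 a4 a5 a6 : R) : 0 <= a6 ->
  a1 + a2 + 2 * (a3 + a4) + a5 <= a1 + 2 * a3 + a5 + (a2 + 2 * a4 + a6).
Proof. by lra. Qed.

(** For [x] in [G k] the rate is bounded by the weights at the two positions: by [key_ineq], the
    denominator cancels the factor 2^-m plus distance. Integrating over [x], compression replaces
    the two flows by Lebesgue measure on the cube, where the weight is o(m). *)
Let gap_log_small s k : t <= s <= T -> exists2 K : R, 0 <= K & forall e, 0 < e ->
  exists m0 : nat, forall m, (m0 <= m)%N ->
  (\int[leb]_(x in G k) (ln (1 + gap (s, x) / 2 ^- m))%:E <= (K * (e * m%:R))%:E)%E.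
Proof.
move=> sT; have [C C0 HC] := key_ineq R n.
have [LX LX0 HLX] := flow_compression hX; have [LY LY0 HLY] := flow_compression hY.
(* The weight estimate uses blocks on the cube of radius [lam + 4], and the estimate on blocks
   requires a further margin of 2. *)
pose lam : R := k%:R; pose h i := trunc_field T b i (lam + 6).
have hI i := trunc_field_integrable mb hR1 i (lam + 6).
exists ((LX + LY) * n%:R); first by rewrite mulr_ge0// addr_ge0.
move=> e e0.
have small i : exists m0 : nat, forall m, (m0 <= m)%N ->
    (\int[mu]_(s in `]0%R, T[) \int[leb]_(y in cube lam) (weight C m (fun x => h i (s, x)) y)%:E <= (e * m%:R)%:E)%E.
  apply: (weight_time_small (hI i) C0 (ler0n _ k) _ e0).
  by apply: (besov_limit hR2 _ (hI i)); rewrite -addrA lerD2l; lra.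
have [m0 Hm0] := fin_all_exists small.
exists (\max_i m0 i) => m mm.
have Hm i := Hm0 i m (leq_trans (leq_bigmax i) mm).
pose Wt i (z : spacetime R n) := weight C m (fun x => h i (z.1, x)) z.2 * \1_(cube lam) z.2.
have mcl : measurable (@cube R n lam) by exact: measurable_cube.
have mW i : mfunT (Wt i).
  have mi : mfunT (\1_(cube lam) : 'rV[R]_n -> R) by exact: measurable_indic.
  exact: (measurable_funM (measurable_weight_time (hI i) C m) (measurableT_comp mi measurable_snd)).
have w0 i u y : 0 <= weight C m (fun x => h i (u, x)) y.
  by rewrite /weight !addr_ge0// mulr_ge0// ?defect_ge0 ?mass_sum_ge0.
have W0 i z : 0 <= Wt i z by rewrite mulr_ge0// indicE.
have mWX i : mfunT (fun z : spacetime R n => Wt i (z.1, fX z)).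
  by apply: (measurableT_comp (mW i)); apply: measurable_fun_pair => //; exact: (measurable_flow hX).
have mWY i : mfunT (fun z : spacetime R n => Wt i (z.1, fY z)).
  by apply: (measurableT_comp (mW i)); apply: measurable_fun_pair => //; exact: (measurable_flow hY).
pose on (u : measurableTypeR R) : R := \1_(`]0, T[%classic) u.
have mon : mfunT on by apply: measurable_indic; exact: measurable_itv.
have on0 u : 0 <= on u by rewrite /on indicE.
pose H z := on z.1 * \sum_(i < n) (Wt i (z.1, fX z) + Wt i (z.1, fY z)).
have mH : mfunT H.
  apply: measurable_funM; first exact: (measurableT_comp mon measurable_fst).
  by apply: measurable_sum => i; exact: (measurable_funD (mWX i) (mWY i)).
have H0 z : 0 <= H z by rewrite mulr_ge0// sumr_ge0// => i _; rewrite addr_ge0.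
have secI : {ae mu, forall u i, integrableT leb (fun x => h i (u, x))}.
  by apply: filter_forall => i; exact: (ae_integrable1 (hI i)).
have envXY : {ae leb, forall x, {ae mu, forall u, dotv (fX (u, x)) (fX (u, x)) <= envelope T t b X x /\
    dotv (fY (u, x)) (fY (u, x)) <= envelope T t b Y x}}.
  apply: filterS2 (flow_envelope_ae t0 tT mb hR1 hX) (flow_envelope_ae t0 tT mb hR1 hY) => x HX HY.
  by apply: filterS2 HX HY => u; split.
have le1 : {ae leb, forall x, G k x -> ((ln (1 + gap (s, x) / 2 ^- m))%:E <= \int[mu]_u (H (u, x))%:E)%E}.
  apply: filterS3 (growth m sT) envXY gap_dist_ae => x gx ex gd [GX GY].
  apply: (@le_trans _ _ (\int[mu]_(u in `]t, s[) rate m u x)%:E); first by rewrite lee_fin.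
  have mi : measurable (`]t, s[%classic : set R) by exact: measurable_itv.
  apply: (@le_trans _ _ (\int[mu]_(u in `]t, s[) (rate m u x)%:E)%E).
    have : (0 <= \int[mu]_(u in `]t, s[) (rate m u x)%:E)%E.
      by apply: integral_ge0 => u _; rewrite lee_fin.
    by rewrite /Rintegral; case: (\int[_]_(_ in _) _)%E => [v||] //= _; rewrite leey.
  have mHx : mfunT (fun u => (H (u, x))%:E).
    by apply/measurable_EFinP; exact: (measurableT_comp mH (pair2_measurable x)).
  apply: (@le_trans _ _ (\int[mu]_(u in `]t, s[) (H (u, x))%:E)%E); last first.
    by apply: (@ge0_subset_integral _ (measurableTypeR R)) => // u _; rewrite lee_fin.
  apply: (@ae_ge0_le_integral _ (measurableTypeR R)).
  - exact: mi.
  - by move=> u _; rewrite lee_fin.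
  - by apply/measurable_EFinP; exact: measurable_funTS (mrate m x).
  - by move=> u _; rewrite lee_fin.
  - exact: measurable_funTS mHx.
  apply: filterS3 ex gd secI => u [eX eY] gu sI; rewrite /= in_itv/= => /andP[tu us].
  have /andP[_ sT'] := sT.
  have uT : u < T := lt_le_trans us sT'.
  have u0 : 0 < u := le_lt_trans t0 tu.
  have uT0 : 0 < u < T by rewrite u0.
  have cX : cube lam (fX (u, x)) by exact: cube_of eX GX.
  have cY : cube lam (fY (u, x)) by exact: cube_of eY GY.
  have on1 : on u = 1 by rewrite /on indicE mem_set//= in_itv.
  rewrite lee_fin /H /= on1 mul1r /rate ler_pdivrMr// gu ?(ltW tu) ?(ltW uT)// mulr_suml.
  apply: ler_sum => i _.
  have hE w : cube lam w -> h i (u, w) = field0 T b i (u, w).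
    move=> wl; rewrite field0E// /h /trunc_field patchE mem_set//; split; first by rewrite /= in_itv.
    by apply: cube_mono wl; rewrite lerDl.
  rewrite /dv /velocity /= -!hE//.
  apply: (le_trans (HC m (fun w => h i (u, w)) (fX (u, x)) (fY (u, x)) (sI i))).
  rewrite mulrC ler_wpM2r ?addr_ge0 ?dist1_ge0 ?(ltW (pow2V_gt0 R m))//.
  rewrite /Wt /= !indicE !mem_set// !mulr1 /weight.
  (* [key_ineq] has the mass sum at the first point only; adding the one at the second completes
     both weights. *)
  exact: weight_arith (mulr_ge0 C0 (mass_sum_ge0 m (fun w => h i (u, w)) (fY (u, x)))).
pose A i u := (\int[leb]_y (Wt i (u, y))%:E)%E.
have mA i : mfunT (A i).
  apply: (measurable_fun_fubini_tonelli_F (fun z => (Wt i z)%:E)); first exact/measurable_EFinP.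
  by move=> z; rewrite lee_fin.
have A0 i u : (0 <= A i u)%E by apply: integral_ge0 => y _; rewrite lee_fin.
have mWu i u : mfunT (fun y => (Wt i (u, y))%:E).
  by apply/measurable_EFinP; exact: (measurableT_comp (mW i) (pair1_measurable u)).
have mFX u : mfunT (fun x => fX (u, x)) by exact: (measurableT_comp (measurable_flow hX) (pair1_measurable u)).
have mFY u : mfunT (fun x => fY (u, x)) by exact: (measurableT_comp (measurable_flow hY) (pair1_measurable u)).
have W0E i z : (0 <= (Wt i z)%:E)%E by rewrite lee_fin.
have inner u : (\int[leb]_x (H (u, x))%:E <= \sum_(i < n) ((LX + LY)%:E * ((on u)%:E * A i u)))%E.
  have HE x : ((H (u, x))%:E = \sum_(i < n) ((on u)%:E * ((Wt i (u, fX (u, x)))%:E + (Wt i (u, fY (u, x)))%:E)))%E.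
    by rewrite /H /= mulr_sumr -sumEFin; apply: eq_bigr => i _; rewrite EFinM EFinD.
  under eq_integral do rewrite HE.
  have mS i : mfunT (fun x => (Wt i (u, fX (u, x)))%:E + (Wt i (u, fY (u, x)))%:E)%E.
    by apply: emeasurable_funD; [exact: (measurableT_comp (mWu i u) (mFX u))|exact: (measurableT_comp (mWu i u) (mFY u))].
  have on0E : (0 <= (on u)%:E)%E by rewrite lee_fin.
  have S0 i x : (0 <= (Wt i (u, fX (u, x)))%:E + (Wt i (u, fY (u, x)))%:E)%E by rewrite adde_ge0.
  rewrite ge0_integral_sum//; last 2 first.
  - by move=> i; apply: emeasurable_funM => //.
  - by move=> i x _; rewrite mule_ge0.
  apply: lee_sum => i _; rewrite ge0_integralZl// ge0_integralD//; last 2 first.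
  - exact: (measurableT_comp (mWu i u) (mFX u)).
  - exact: (measurableT_comp (mWu i u) (mFY u)).
  have h1 := ge0_integral_compress (mFX u) LX0 (HLX u) (mWu i u) (fun y => W0E i (u, y)).
  have h2 := ge0_integral_compress (mFY u) LY0 (HLY u) (mWu i u) (fun y => W0E i (u, y)).
  apply: (le_trans (lee_wpmul2l on0E (leeD h1 h2))).
  by rewrite [leRHS]muleCA EFinD [X in (_ <= _ * X)%E]ge0_muleDl ?lee_fin.
have mHE : mfunT (fun z => (H z)%:E) by exact/measurable_EFinP.
have H0E z : (0 <= (H z)%:E)%E by rewrite lee_fin.
apply: (@le_trans _ _ (\int[leb]_x \int[mu]_u (H (u, x))%:E)%E).
  rewrite integral_mkcond; apply: ae_ge0_le_integral => //.
  - by move=> x _; rewrite restrict_EFin lee_fin patchE; case: ifP => // _; rewrite ln_ge0// lerDl divr_ge0// ltW// pow2V_gt0.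
  - rewrite restrict_EFin; apply/measurable_EFinP; apply: measurable_patch; first exact: mG.
    apply: measurableT_comp; first exact: measurable_ln.
    apply: measurable_funD => //; apply: measurable_funM => //.
    exact: (measurableT_comp measurable_gap (pair1_measurable s)).
  - by move=> x _; apply: integral_ge0.
  - exact: (measurable_fun_fubini_tonelli_G (m1 := mu) (fun z => (H z)%:E) mHE H0E).
  apply: ae_imply le1 => x lx _; rewrite patchE; case: ifPn => [|_]; last by apply: integral_ge0.
  by rewrite inE; exact: lx.
rewrite -(@fubini_tonelli _ _ _ _ _ mu leb (fun z => (H z)%:E) mHE H0E).
apply: (@le_trans _ _ (\int[mu]_u \sum_(i < n) ((LX + LY)%:E * ((on u)%:E * A i u)))%E).
  by apply: ge0_le_integral_lower => u _; [exact: integral_ge0|exact: inner].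
have L0 : (0 <= (LX + LY)%:E)%E by rewrite lee_fin addr_ge0.
have onA0 i u : (0 <= (on u)%:E * A i u)%E by rewrite mule_ge0// lee_fin.
have monA i : mfunT (fun u => (on u)%:E * A i u)%E.
  by apply: emeasurable_funM; [exact/measurable_EFinP|exact: mA].
rewrite (@ge0_integral_sum _ (measurableTypeR R))//; last 2 first.
- by move=> i; exact: (emeasurable_funM (measurable_cst _) (monA i)).
- by move=> i u _; rewrite mule_ge0.
apply: (@le_trans _ _ (\sum_(i < n) ((LX + LY) * (e * m%:R))%:E)%E); last first.
  by rewrite sumEFin lee_fin sumr_const card_ord -[leLHS]mulr_natr mulrAC.
apply: lee_sum => i _.
rewrite (@ge0_integralZl _ (measurableTypeR R))// EFinM; apply: lee_wpmul2l => //.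
apply: le_trans (Hm i); rewrite [leRHS]integral_mkcond.
apply: ge0_le_integral_lower => u _ //; rewrite patchE /on indicE.
case: ifPn => _; last by rewrite mul0e.
rewrite mul1e /A [leRHS]integral_mkcond; apply: ge0_le_integral_lower => y _ //.
by rewrite patchE /Wt /= indicE; case: ifPn => _; rewrite ?mulr1 ?mulr0.
Qed.

(** Chebyshev's inequality: where the gap is at least 2^-p the logarithm is at least (m - p) ln 2,
    of order m, while its integral over [G k] is o(m). The measure of that set is therefore below
    any positive number. *)
Let gap_lt s k p : t <= s <= T -> {ae leb, forall x, G k x -> gap (s, x) < 2 ^- p}.
Proof.
move=> sT; have [K K0 HK] := gap_log_small k sT.
pose A := G k `&` [set x | 2 ^- p <= gap (s, x)].
have mgs : mfunT (fun x => gap (s, x)) by exact: (measurableT_comp measurable_gap (pair1_measurable s)).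
have mA : measurable A.
  apply: measurableI; first exact: mG.
  rewrite (_ : [set x | _] = (fun x => gap (s, x)) @^-1` `[2 ^- p, +oo[%classic); last first.
    by apply/seteqP; split => x /=; rewrite in_itv/= andbT.
  by rewrite -[X in measurable X]setTI; exact: (mgs measurableT _ (measurable_itv _)).
exists A; split => //; last first.
  move=> x /= /not_implyP[Gx] /negP; rewrite -leNgt => gx; by split.
have l2 : 0 < ln 2 :> R by rewrite ln_gt0// ltr1n.
apply/eqP; rewrite eq_le measure_ge0 andbT; apply/lee_addgt0Pr => e e0; rewrite add0e.
have K1 : 0 < K + 1 by rewrite ltr_wpDl.
(* With this choice the final bound on the measure is [e * (K / (K + 1))], at most [e], also when
   [K = 0]. *)
have [|m0 Hm] := HK (e * (ln 2 / 2) / (K + 1)); first by rewrite divr_gt0// mulr_gt0// divr_gt0.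
(* [m >= 2 * p] leaves [m - p >= m / 2]; the successor keeps [m] positive when [p = 0]. *)
pose m := maxn m0 (2 * p).+1.
have m1 : (0 : R) < m%:R by rewrite ltr0n (leq_trans _ (leq_maxr _ _)).
pose c : R := ln 2 / 2 * m%:R; have c0 : 0 < c by rewrite mulr_gt0// divr_gt0.
have mp : (2 * p <= m)%N by apply: leq_trans (leq_maxr m0 _); exact: leqnSn.
have cA x : A x -> c <= ln (1 + gap (s, x) / 2 ^- m).
  move=> [_ gx]; have pm : (p <= m)%N by apply: leq_trans mp; rewrite leq_pmull.
  have h : 2 ^+ (m - p) <= 1 + gap (s, x) / 2 ^- m.
    rewrite (@le_trans _ _ (gap (s, x) / 2 ^- m)) ?lerDr//.
    rewrite invrK expfB_cond ?pnatr_eq0// mulrC ler_pM2r ?exprn_gt0//.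
  apply: (@le_trans _ _ (ln (2 ^+ (m - p)))); last first.
    rewrite ler_ln ?posrE ?exprn_gt0//; exact: lt_le_trans h; rewrite exprn_gt0.
  have -> : c = ln 2 * (2^-1 * m%:R) by rewrite /c mulrA.
  rewrite lnXn// -[leRHS]mulr_natr ler_pM2l// natrB//.
  have : (2 * p)%:R <= m%:R :> R by rewrite ler_nat.
  rewrite natrM; lra.
have I1 : (c%:E * leb A <= (K * (e * (ln 2 / 2) / (K + 1) * m%:R))%:E)%E.
  apply: le_trans (Hm m (leq_maxl _ _)).
  rewrite -integral_cst//; apply: (@le_trans _ _ (\int[leb]_(x in A) (ln (1 + gap (s, x) / 2 ^- m))%:E)%E).
    by apply: ge0_le_integral_lower => x Ax; rewrite lee_fin ?cA// ltW.
  apply: ge0_subset_integral => //; last by move=> x [].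
    apply: measurable_funTS; apply/measurable_EFinP; apply: measurableT_comp; first exact: measurable_ln.
    by apply: measurable_funD => //; apply: measurable_funM.
  by move=> x _; rewrite lee_fin ln_ge0// lerDl divr_ge0// ltW// pow2V_gt0.
rewrite -lee_pdivlMl// in I1; apply: (le_trans I1); rewrite -EFinM lee_fin /c.
have -> : (ln 2 / 2 * m%:R)^-1 * (K * (e * (ln 2 / 2) / (K + 1) * m%:R)) = e * (K / (K + 1)).
  by field; rewrite !gt_eqF.
by rewrite ler_piMr ?(ltW e0)// ler_pdivrMr// mul1r lerDl.
Qed.

Let add_le (a c d : R) : 0 <= a -> 0 <= c -> a + c <= d -> a <= d /\ c <= d.
Proof. by move=> a0 c0 h; split; lra. Qed.

(** Every [x] lies in some [G k] because its two envelopes are finite, and the null sets for the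
    countably many pairs [k], [p] are discarded together. *)
Lemma flow_unique s : t <= s <= T -> {ae leb, forall x, X s x = Y s x}.
Proof.
move=> sT.
have lt : {ae leb, forall x k p, G k x -> gap (s, x) < 2 ^- p}.
  by apply: ae_foralln => k; apply: ae_foralln => p; exact: gap_lt.
apply: filterS2 lt (gap_dist sT) => x gx gd.
pose k := (Num.truncn (envelope T t b X x + envelope T t b Y x)).+1.
have eX : 0 <= envelope T t b X x by exact: expR_ge0.
have eY : 0 <= envelope T t b Y x by exact: expR_ge0.
have Gx : G k x.
  have k0 : (0 < k)%N by [].
  have h : envelope T t b X x + envelope T t b Y x <= k%:R ^+ 2.
    rewrite (le_trans (ltW (truncnS_gt _)))// -/k -natrX ler_nat -mulnn leq_pmulr ?k0//.
  exact: add_le eX eY h.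
have g0 : gap (s, x) = 0.
  apply/eqP; rewrite eq_le gap_ge0 andbT leNgt; apply/negP => g0.
  pose p := (Num.truncn (gap (s, x))^-1).+1.
  have := gx k p Gx; rewrite ltNge => /negP; apply.
  rewrite invf_ple ?posrE ?exprn_gt0// (le_trans (ltW (truncnS_gt _)))// -/p -natrX ler_nat ltnW// ltn_expl//.
apply/rowP => i; apply/eqP; rewrite -subr_eq0 -normr_le0.
by rewrite (le_trans (coord_le_dist1 _ _ i))// -gd g0.
Qed.

End uniqueness.

Theorem theorem6p1 (R : realType) (N : nat) (hN : (0 < N)%N)
    (T : R) (hT : 0 < T) (b : R -> 'rV[R]_N -> 'rV[R]_N)
    (mb : measurable_field T b) (hR1 : R1 T b) (hR2 : R2 T b) (hR3 : R3 T b)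
    (t : R) (ht : 0 <= t < T)
    (X Xbar : R -> 'rV[R]_N -> 'rV[R]_N)
    (hX : regular_lagrangian_flow T b t X)
    (hXbar : regular_lagrangian_flow T b t Xbar)
    (s : R) (hs : t <= s <= T) :
  {ae lebesgue_rV R N, forall x, X s x = Xbar s x}.
Proof. by have /andP[t0 tT] := ht; exact: (flow_unique t0 tT mb hR1 hR2 hX hXbar hs). Qed.
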